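(* Let $\Phi$ be an irreducible crystallographic root system in $V=\mathbb{R}^\ell$ with exponents $e_1,\dots,e_\ell$, Coxeter number $h$, and a fixed positive system $\Phi^+$. Then: (1) for every integer $m\ge0$ the cone $\mathbf{c}\mathcal{A}(\Phi^+)^{[-m,m]}$ is free with exponents $(1,e_1+mh,e_2+mh,\dots,e_\ell+mh)$; (2) for every integer $m\ge1$ the cone $\mathbf{c}\mathcal{A}(\Phi^+)^{[1-m,m]}$ is free with exponents $(1,mh,mh,\dots,mh)$.
   Context: For $\alpha\in\Phi^+$ and $k\in\mathbb{Z}$, $H_{\alpha,k}=\{v\in V:\alpha(v)=k\}$. For integers $p\le q$, $[p,q]=\{p,p+1,\dots,q\}$, and $\mathcal{A}(\Phi^+)^{[p,q]}=\{H_{\alpha,k}:\alpha\in\Phi^+,k\in[p,q]\}$ is an affine arrangement in $V$. Its cone $\mathbf{c}\mathcal{A}(\Phi^+)^{[p,q]}$ is the central arrangement in $\mathbb{R}\times V$ (coordinates $(x_0,x_1,\dots,x_\ell)$) consisting of the hyperplanes $\{\alpha-kx_0=0\}$ for $\alpha\in\Phi^+$, $k\in[p,q]$, together with $H_\infty=\{x_0=0\}$. A central arrangement $\mathcal{B}$ in $\mathbb{R}^{n}$ is free with exponents $(d_1,\dots,d_n)$ if $D(\mathcal{B})=\{\delta\in\mathrm{Der}:\delta(\alpha_H)\in\alpha_HS\ \forall H\in\mathcal{B}\}$ ($S$ the polynomial ring, $\alpha_H$ a defining form of $H$) is a free $S$-module with homogeneous basis of polynomial degrees $d_1,\dots,d_n$.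 *)

(* Defs.v *)
From mathcomp Require Import all_boot all_algebra.
From mathcomp Require Import all_classical all_reals all_analysis.
From mathcomp Require Import complex.
From mathcomp Require mpoly.
Import (canonicals, coercions) mpoly.

Set Implicit Arguments.
Unset Strict Implicit.
Unset Printing Implicit Defensive.

Import GRing.Theory Num.Theory.
Local Open Scope ring_scope.

Section RootSystems.
Variable R : realType.
Variable l : nat.
Local Notation V := 'rV[R]_l.

Definition dotp (u v : V) : R := (u *m v^T) 0 0.

(* the orthogonal reflection s_a, acting on row vectors by v |-> v *m refl a,
   i.e. v |-> v - (2 (v,a)/(a,a)) a *)
Definition refl (a : V) : 'M[R]_l := 1%:M - (2 / dotp a a) *: (a^T *m a).

Definition is_root_system (Phi : seq V) : Prop :=
  [/\ uniq Phi /\ 0 \notin Phi,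
      (forall v : V, exists c : 'I_(size Phi) -> R,
           v = \sum_(i < size Phi) c i *: Phi`_i),
      (forall a, a \in Phi -> forall c : R, c *: a \in Phi -> (c = 1 \/ c = -1)),
      (forall a b, a \in Phi -> b \in Phi -> b *m refl a \in Phi) &
      (forall a b, a \in Phi -> b \in Phi ->
           exists z : int, 2 * dotp b a / dotp a a = z%:~R)].

Definition irreducible_rs (Phi : seq V) : Prop :=
  Phi != [::] /\
  forall P : pred V,
    (forall a b, a \in Phi -> b \in Phi -> P a -> ~~ P b -> dotp a b = 0) ->
    all P Phi \/ all (predC P) Phi.

Definition regular_vec (Phi : seq V) (v : V) : Prop :=
  forall a, a \in Phi -> dotp v a != 0.
Definition pos_system (Phi : seq V) (v : V) : seq V :=
  [seq a <- Phi | 0 < dotp v a].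

Definition simple_system_of (Pos : seq V) (s : seq V) : Prop :=
  [/\ uniq s, size s = l, {subset s <= Pos} &
      forall b, b \in Pos -> exists n : 'I_(size s) -> nat,
          b = \sum_(i < size s) (n i)%:R *: s`_i].

Definition coxeter_elt (s : seq V) : 'M[R]_l := foldr (fun a M => refl a *m M) 1%:M s.

Definition mxpow (c : 'M[R]_l) (k : nat) : 'M[R]_l := iter k (mulmx c) 1%:M.

Definition is_order (c : 'M[R]_l) (h : nat) : Prop :=
  [/\ (0 < h)%N, mxpow c h = 1%:M &
      forall k, (0 < k < h)%N -> mxpow c k != 1%:M].

Definition expi (t : R) : R[i] := (cos t +i* sin t)%C.

Definition are_exponents (c : 'M[R]_l) (h : nat) (e : 'I_l -> nat) : Prop :=
  (forall j, (e j < h)%N) /\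
  map_poly (real_complex R) (char_poly c) =
    \prod_(j < l) ('X - (expi (2 * pi * (e j)%:R / h%:R))%:P).

End RootSystems.

Section Arrangements.
Variable R : realType.

Local Notation Spoly n := (mpoly.mpoly n R).

Definition var (n : nat) (i : 'I_n) : Spoly n := mpoly.mpolyX R (mpoly.mnm1 i).

Definition homog (n : nat) (d : nat) (p : Spoly n) : bool :=
  p \is @mpoly.ishomog1 n R d (mpoly.mpoly_mdeg__canonical__mpoly_Measure n).

(* a central arrangement in R^n is given by the list of coefficient vectors
   a of its defining linear forms alpha_H = sum_i a_i x_i *)
Definition linform (n : nat) (a : 'rV[R]_n) : Spoly n := \sum_(i < n) a 0 i *: var i.

(* a derivation theta = sum_i theta_i d/dx_i is the function i |-> theta_i;
   for a linear form, theta(alpha_H) = sum_i a_i theta_i *)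
Definition der_apply (n : nat) (theta : 'I_n -> Spoly n) (a : 'rV[R]_n) : Spoly n :=
  \sum_(i < n) a 0 i *: theta i.

Definition in_D (n : nat) (A : seq 'rV[R]_n) (theta : 'I_n -> Spoly n) : Prop :=
  forall a, a \in A -> exists q : Spoly n, der_apply theta a = linform a * q.

Definition free_with_exponents (n : nat) (A : seq 'rV[R]_n) (d : seq nat) : Prop :=
  size d = n /\
  exists B : 'I_n -> 'I_n -> Spoly n,
    [/\ (forall k, in_D A (B k)),
        (forall k i : 'I_n, homog (nth 0%N d k) (B k i)),
        (forall theta, in_D A theta ->
           exists f : 'I_n -> Spoly n, forall i, theta i = \sum_(k < n) f k * B k i) &
        (forall f g : 'I_n -> Spoly n,
           (forall i, \sum_(k < n) f k * B k i = \sum_(k < n) g k * B k i) ->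
           forall k, f k = g k)].

(* [p, q] as a list of integers (p <= q) *)
Definition zrange (p q : int) : seq int := [seq p + (i%:Z) | i <- iota 0 (absz (q - p + 1))].

(* the cone c A(Pos)^[p,q] in R x V, coordinates (x_0, x_1, ..., x_l):
   hyperplanes  alpha - k x_0 = 0  (alpha in Pos, k in [p,q])  and  x_0 = 0 *)
Definition cone_form (l : nat) (a : 'rV[R]_l) (k : int) : 'rV[R]_l.+1 :=
  \row_(i < l.+1) (if unlift ord0 i is Some j then a 0 j else - k%:~R).

Definition H_infty (l : nat) : 'rV[R]_l.+1 := \row_(i < l.+1) (i == ord0)%:R.

Definition cone_arr (l : nat) (Pos : seq 'rV[R]_l) (p q : int) : seq 'rV[R]_l.+1 :=
  H_infty l :: [seq cone_form a k | a <- Pos, k <- zrange p q].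

End Arrangements.

(* Main.v *)
(** Reduce to a tower of arrangements. Starting from the hyperplane at infinity, the cones of the
    Catalan arrangements (levels [-m, m]) and of the Shi arrangements (levels [1 - m, m]) are reached
    by adding, height by height, all hyperplanes a = -m with a of height i (i = 1, 2, ...), and then
    all hyperplanes a = m + 1 with a of height h - t (t = 1, 2, ...). Each step is a multiple addition:
    a basis of the derivation module with exponents d_j stays a basis after the columns of degree d are
    multiplied by the new forms, provided every new hyperplane meets the old ones in exactly (number of
    old hyperplanes) - d traces and a certain matrix of constants has independent rows.

    The traces on a new hyperplane are counted plane by plane: all roots in a rank two subsystem
    through a, where a finite table suffices; the sums over planes are evaluated by
    [sum_b (a, b)^2 / (b, b) = h (a, a)] and by [ht a = sum_(g > 0) (g, a) / (g, g)].

    In the first kind of step the independence follows by evaluating the basis at a real point lying on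
    the new hyperplanes only; it exists because positive roots in the span of the roots of height i have
    height at least i. In the second kind of step a relation would give, after restriction to the
    hyperplane at infinity, a derivation of low degree for the multiarrangement with multiplicities
    2m + 1 and 2m + 2. Terao's basis of the derivations for the constant multiplicity 2m + 2 is
    equivariant, so that the inverse of its matrix pairs such a derivation with a basis for the roots
    of height below h - t into polynomials of negative degree, hence to zero.

    Terao's bases are built from basic invariants and Saito's flat pairing; their degrees are matched
    with the eigenvalues of the Coxeter element by means of an eigenvector on the Coxeter plane that lies
    on no reflecting hyperplane. *)

Require Import Defs.
From HB Require Import structures.
From mathcomp Require all_boot all_order all_algebra perm fraction spectral sesquilinear.
From mathcomp Require all_classical all_reals all_analysis.
From mathcomp Require boolp reals complex mpoly ring lra zify.

(** The two kinds of step need different independence arguments because [d] is the largest degree,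
    Euler's apart, in the first kind and the smallest in the second. In the first kind a new form
    takes values divisible by itself on every column of degree below [d], so evaluation of the basis
    at a point sees the constants alone. In the second kind columns of degree above [d] have
    polynomial coefficients, which evaluation does not separate from the constants. There the
    columns of degree exactly [d] are as many as the new hyperplanes, by the symmetry e -> h - e of
    the exponents and the duality between exponents and numbers of roots of each height; the matrix
    of constants is then square, and a vector in its kernel yields the derivation of low degree. No
    classification above rank two enters. The degrees d_j of the invariants are pinned by opposite
    bounds: the sum of the d_j - 1 is at most the number N of positive roots, by divisibility; 2N is
    at most h l, by counting sign changes along orbits of the Coxeter element; its eigenvalues give
    the reverse bound. Equality forces a single sign change in each orbit, and this identifies the
    eigenvalue. *)

Module RootsOfUnity.
Import all_boot all_order all_algebra all_classical all_reals all_analysis complex ring lra.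
Set Implicit Arguments. Unset Strict Implicit. Unset Printing Implicit Defensive.
Import Order.TTheory GRing.Theory Num.Theory.
Local Open Scope ring_scope.

(** * Roots of unity and sequences with one sign change *)

Section Trig.
Variable R : realType.
Local Notation C := R[i].
Lemma expiD (x y : R) : expi (x + y) = expi x * expi y.
Proof. by apply/eqP; rewrite eq_complex /= cosD sinD eqxx /= addrC. Qed.
Lemma expi0 : expi (0 : R) = 1. Proof. by rewrite /expi cos0 sin0. Qed.
Lemma expiMn (x : R) k : expi (x *+ k) = expi x ^+ k.
Proof. by elim: k => [|k IH]; rewrite ?expi0 // mulrS expiD IH exprS. Qed.
Lemma expi_conj (x : R) : conjc (expi x) = expi (- x).
Proof. by rewrite /expi cosN sinN. Qed.
Lemma expi_norm (x : R) : expi x * conjc (expi x) = 1.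
Proof. by rewrite expi_conj -expiD subrr expi0. Qed.
Lemma expi_neq1 (t : R) : 0 < t -> t < 2 * pi -> expi t != 1.
Proof.
move=> t0 t1; apply/negP => /eqP/(congr1 (@complex.Re R)) /= c1.
have : 0 < sin (t / 2) by apply: sin_gt0_pi; apply/andP; split; lra.
have := cosD (t / 2) (t / 2); rewrite -splitr c1.
have := cos2Dsin2 (t / 2); nra.
Qed.
Definition om (h : nat) : C := expi (2 * pi / h%:R).
Lemma om_exp h k : expi (2 * pi * k%:R / h%:R) = om h ^+ k :> C.
Proof. by rewrite /om -expiMn; congr expi; rewrite -[RHS]mulr_natr; move: (h%:R^-1) => y; ring. Qed.
Lemma om_h h : (0 < h)%N -> om h ^+ h = 1.
Proof.
move=> h0; rewrite -om_exp mulfK ?pnatr_eq0 -?lt0n // mulr_natl /expi cos2pi sin2pi //.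
Qed.
Lemma om_neq1 h k : (0 < k < h)%N -> om h ^+ k != 1.
Proof.
move=> /andP[k0 kh]; have h0 : 0 < h%:R :> R by rewrite ltr0n (leq_trans _ kh).
rewrite -om_exp; apply: expi_neq1; first by rewrite divr_gt0 // !mulr_gt0 ?pi_gt0 ?ltr0n.
by rewrite ltr_pdivrMr // ltr_pM2l ?ltr_nat // mulr_gt0 ?pi_gt0.
Qed.
Lemma om_inj h : {in [pred k | (k < h)%N] &, injective (fun k => om h ^+ k)}.
Proof.
move=> i j; rewrite !inE; wlog le : i j / (i <= j)%N => [H hi hj E|hi hj E].
  by have [le|le] := leqP i j; [apply: H | apply/esym; apply: H => //; exact: ltnW].
have om0 : om h != 0.
  apply/negP => /eqP E0; have := om_h (leq_ltn_trans (leq0n _) hi); rewrite E0 expr0n.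
  by rewrite eqn0Ngt (leq_ltn_trans (leq0n _) hi) => /eqP; rewrite eq_sym oner_eq0.
have : om h ^+ (j - i) = 1.
  apply: (@mulfI _ (om h ^+ i)); first by rewrite expf_neq0.
  by rewrite -exprD subnKC // mulr1.
have [lt E1|] := ltnP i j; last by move=> ge _; apply/eqP; rewrite eqn_leq le.
have := @om_neq1 h (j - i); rewrite E1 eqxx subn_gt0 lt /=; case/(_ _)/negP => //.
by apply: leq_ltn_trans hj; exact: leq_subr.
Qed.
Lemma geom0 (x : C) h : x ^+ h = 1 -> x != 1 -> \sum_(j < h) x ^+ j = 0.
Proof.
move=> xh x1; apply/eqP; have := subrX1 x h; rewrite xh subrr => /esym/eqP.
by rewrite mulf_eq0 subr_eq0 (negbTE x1).
Qed.
Lemma Re_sum' (I : Type) (r : seq I) (F : I -> C) : complex.Re (\sum_(i <- r) F i) = \sum_(i <- r) complex.Re (F i).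
Proof. by apply: (big_morph (@complex.Re R)) => // -[a b] [c d]. Qed.
Lemma Re_mul_conj (a b : C) : complex.Re a * complex.Re b = 2^-1 * complex.Re (a * b + a * conjc b).
Proof. by case: a b => a a' [b b'] /=; field. Qed.

(* test the sign sequence against [sin (pi (j + 1/2) / h) * sin (pi (j + 1/2 - L) / h)],
   which has the same signs and only the frequencies 0 and 1 *)
Lemma one_sign_change h L (lam u : C) : (0 < h)%N -> (L <= h)%N -> lam ^+ h = 1 -> lam != 1 ->
  (forall j, (j < L)%N -> complex.Re (u * lam ^+ j) < 0) ->
  (forall j, (L <= j < h)%N -> 0 < complex.Re (u * lam ^+ j)) ->
  lam = om h \/ lam * om h = 1.
Proof.
move=> h0 Lh lamh lam1 neg pos; apply: contrapT => /not_orP[n1 n2].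
have hR : 0 < h%:R :> R by rewrite ltr0n.
pose A (j : nat) : R := pi * (j%:R + 2^-1) / h%:R; pose B (j : nat) : R := pi * (j%:R + 2^-1 - L%:R) / h%:R.
have Apos j : (j < h)%N -> 0 < sin (A j).
  move=> jh; have j1 : j%:R + 1 <= h%:R :> R by rewrite natr1 ler_nat.
  have j0 : 0 <= j%:R :> R by [].
  apply: sin_gt0_pi; apply/andP; split; first by rewrite /A divr_gt0 // mulr_gt0 ?pi_gt0 //; lra.
  by rewrite /A ltr_pdivrMr // ltr_pM2l ?pi_gt0 //; lra.
have Bpos j : (L <= j < h)%N -> 0 < sin (B j).
  move=> /andP[Lj jh]; have j1 : j%:R + 1 <= h%:R :> R by rewrite natr1 ler_nat.
  have j0 : L%:R <= j%:R :> R by rewrite ler_nat.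
  have L0 : 0 <= L%:R :> R by [].
  apply: sin_gt0_pi; apply/andP; split; first by rewrite /B divr_gt0 // mulr_gt0 ?pi_gt0 //; lra.
  by rewrite /B ltr_pdivrMr // ltr_pM2l ?pi_gt0 //; lra.
have Bneg j : (j < L)%N -> sin (B j) < 0.
  move=> jL; have j1 : j%:R + 1 <= L%:R :> R by rewrite natr1 ler_nat.
  have L1 : L%:R <= h%:R :> R by rewrite ler_nat.
  have j0 : 0 <= j%:R :> R by [].
  rewrite -oppr_gt0 -sinN; apply: sin_gt0_pi; apply/andP; split.
    by rewrite /B -mulNr -mulrN divr_gt0 // mulr_gt0 ?pi_gt0 //; lra.
  by rewrite /B -mulNr -mulrN ltr_pdivrMr // ltr_pM2l ?pi_gt0 //; lra.
pose rho : C := expi (pi * (1 - L%:R) / h%:R); pose c0 : R := cos (pi * L%:R / h%:R).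
have yE j : sin (A j) * sin (B j) = 2^-1 * (c0 - complex.Re (rho * om h ^+ j)).
  rewrite /rho -om_exp -expiD /=.
  have -> : c0 = cos (A j - B j).
    by rewrite /c0; congr cos; rewrite /A /B; field; exact: lt0r_neq0.
  have -> : pi * (1 - L%:R) / h%:R + 2 * pi * j%:R / h%:R = A j + B j.
    by rewrite /A /B; field; exact: lt0r_neq0.
  by rewrite cosB cosD; field.
(* Under the negated conclusion [lam], [lam * om h] and [lam * conjc (om h)] are h-th roots of unity
   other than 1, so the three geometric sums vanish. Termwise positivity [P] then contradicts the
   zero sum. *)
have S0 : \sum_(j < h) complex.Re (u * lam ^+ j) * (sin (A j) * sin (B j)) = 0.
  under eq_bigr do rewrite yE mulrCA mulrBr Re_mul_conj.
  rewrite -mulr_sumr sumrB -mulr_suml -Re_sum' -mulr_sumr geom0 // mulr0 /= mul0r sub0r.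
  rewrite -mulr_sumr -Re_sum' big_split /=.
  have -> : \sum_(i < h) u * lam ^+ i * (rho * om h ^+ i) = 0.
    under eq_bigr do rewrite mulrACA -exprMn.
    by rewrite -mulr_sumr geom0 ?mulr0 ?exprMn ?lamh ?om_h ?mul1r //; apply/eqP.
  have -> : \sum_(i < h) u * lam ^+ i * conjc (rho * om h ^+ i) = 0.
    under eq_bigr do rewrite rmorphM rmorphXn mulrACA -exprMn.
    rewrite -mulr_sumr geom0 ?mulr0 // ?exprMn ?lamh -?rmorphXn ?om_h ?rmorph1 ?mulr1 //.
    apply/eqP => E; apply: n1; rewrite -[lam]mulr1 -(expi_norm (2 * pi / h%:R)) -/(om h).
    by rewrite [om h * _]mulrC mulrA E mul1r.
  by rewrite addr0 /= mulr0 oppr0 mulr0.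
have P j : (j < h)%N -> 0 < complex.Re (u * lam ^+ j) * (sin (A j) * sin (B j)).
  move=> jh; have [jL|jL] := ltnP j L.
    by rewrite nmulr_rgt0 ?neg // pmulr_rlt0 ?Apos // Bneg.
  by rewrite mulr_gt0 ?pos ?jL //= mulr_gt0 ?Apos ?Bpos ?jL.
move/eqP: S0; rewrite psumr_eq0; last by move=> j _; apply/ltW/P.
by move=> /allP /(_ (Ordinal h0) (mem_index_enum _)); rewrite /= gt_eqF // P.
Qed.
End Trig.

End RootsOfUnity.

(** * Trace counts in the root systems of rank two *)

Module RankTwoTables.
Import all_boot all_order all_algebra zify.
Set Implicit Arguments. Unset Strict Implicit. Unset Printing Implicit Defensive.
Import Order.TTheory GRing.Theory Num.Theory.
Local Open Scope ring_scope.

Lemma size_zrange p q : size (zrange p q) = absz (q - p + 1).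
Proof. by rewrite size_map size_iota. Qed.
Lemma mem_zrange p q k : (p <= q + 1)%R -> (k \in zrange p q) = (p <= k <= q)%R.
Proof.
move=> pq; apply/mapP/idP => [[i]|h]; first by rewrite mem_iota => hi ->; lia.
by exists (absz (k - p)); [rewrite mem_iota; lia | lia].
Qed.
Lemma zrange_uniq p q : uniq (zrange p q).
Proof. by rewrite map_inj_uniq ?iota_uniq // => i j; lia. Qed.

(* residues mod 6 suffice: adjacent rank 2 determinants are 1, 2 or 3 *)
Definition zseg (r lo hi : int) : seq int := [seq 6 * (lo + i%:Z) + r | i <- iota 0 (absz (hi - lo))].
Lemma mem_zseg r lo hi x : (exists q : int, x = 6 * q + r /\ (lo <= q < hi)%R) -> x \in zseg r lo hi.
Proof.
move=> [q [-> /andP[h1 h2]]]; apply/mapP; exists (absz (q - lo)); last by lia.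
by rewrite mem_iota /=; lia.
Qed.
(** Distinct keys are bounded by the lengths of four progressions covering them; the residues 1 and
    5 modulo 6 do not occur in the tables. The summands [y], [w] and the bound [t] are carried along
    so that each table entry ends in one goal of linear arithmetic. *)
Lemma cover_count (L : seq int) l0 u0 l2 u2 l3 u3 l4 u4 (y w t : nat) :
  (forall x, x \in L -> exists q : int, (x = 6 * q /\ l0 <= q /\ q < u0) \/ (x = 6 * q + 2 /\ l2 <= q /\ q < u2) \/
     (x = 6 * q + 3 /\ l3 <= q /\ q < u3) \/ (x = 6 * q + 4 /\ l4 <= q /\ q < u4)) ->
  (absz (u0 - l0)%R + absz (u2 - l2)%R + absz (u3 - l3)%R + absz (u4 - l4)%R + y + w <= t)%N ->
  (size (undup L) + y + w <= t)%N.
Proof.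
move=> H; apply: leq_trans; rewrite !leq_add2r.
pose C := zseg 0 l0 u0 ++ zseg 2 l2 u2 ++ zseg 3 l3 u3 ++ zseg 4 l4 u4.
have -> : (absz (u0 - l0)%R + absz (u2 - l2)%R + absz (u3 - l3)%R + absz (u4 - l4)%R = size C)%N.
  by rewrite /C !size_cat !size_map !size_iota !addnA.
apply: uniq_leq_size (undup_uniq _) _ => x; rewrite mem_undup => /H[q [|[|[|]]] [E [h1 h2]]]; rewrite /C !mem_cat.
- by rewrite (@mem_zseg 0) //; exists q; rewrite addr0 h1.
- by rewrite (@mem_zseg 2) ?orbT //; exists q; rewrite h1.
- by rewrite (@mem_zseg 3) ?orbT //; exists q; rewrite h1.
- by rewrite (@mem_zseg 4) ?orbT //; exists q; rewrite h1.
Qed.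

(** [h1] and [h2] stand for the heights, in the ambient system, of the two simple roots of the
    plane. They stay arbitrary, so one table serves every position of the plane. *)
Definition wt (h1 h2 : nat) (g : nat * nat) := (g.1 * h1 + g.2 * h2)%N.
(* an entry ((x, y), (c1, c2)): the line of the root with coordinates (x, y) at level k meets
   the line of a at level k0 in the point with parameter (c1 * k0 + c2 * k) / 6 *)
Notation entry := ((nat * nat) * (int * int))%type.
(** Levels present when [a = -m] is added: roots lower than [a] already have the level [-m]. *)
Definition rng1 (a : nat * nat) (m h1 h2 : nat) (b : nat * nat) : seq int :=
  zrange (if (wt h1 h2 b < wt h1 h2 a)%N then - m%:Z else 1 - m%:Z) m%:Z.
(** Levels present when [a = m + 1] is added: this filling descends in height, so roots higher than
    [a] already have the level [m + 1]. *)
Definition rng2 (a : nat * nat) (m h1 h2 : nat) (b : nat * nat) : seq int :=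
  zrange (- m%:Z) (if (wt h1 h2 a < wt h1 h2 b)%N then m.+1%:Z else m%:Z).
Definition keys (cf : seq entry) (rng : nat * nat -> seq int) (k0 : int) : seq int :=
  flatten [seq [seq x.2.1 * k0 + x.2.2 * k | k <- rng x.1] | x <- cf].
(** The excess of lines over traces is split into [m] times the number of other roots less one, and
    the height of [a] inside the plane less one. Summed over all planes through [a], the parts
    become m (h - 2) and the ambient height of [a] less one. *)
Definition cnt1 (cf : seq entry) (a : nat * nat) := forall m h1 h2 : nat, (0 < h1)%N -> (0 < h2)%N ->
  (size (undup (keys cf (rng1 a m h1 h2) (- m%:Z))) + m * (size cf - 1) + (a.1 + a.2 - 1)
   <= size (keys cf (rng1 a m h1 h2) (- m%:Z)))%N.
(** With s = [size cf] the excess equals (m + 1) (s - 1) minus the local height less one: the same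
    two parts as in [cnt1], with [m + 1] for [m] and the height term negated. *)
Definition cnt2 (cf : seq entry) (a : nat * nat) := forall m h1 h2 : nat, (0 < h1)%N -> (0 < h2)%N ->
  (size (undup (keys cf (rng2 a m h1 h2) m.+1%:Z)) + m * (size cf - 1) + (size cf - (a.1 + a.2))
   <= size (keys cf (rng2 a m h1 h2) m.+1%:Z))%N.
Ltac keysplit := rewrite /keys /rng1 /rng2 /wt /=; repeat match goal with
  | |- context [if leq ?x ?y then _ else _] => let H := fresh in have [H|H] := boolP (leq x y); try (exfalso; lia)
  end.
Lemma size_mapz (f : int -> int) p q : size (map f (zrange p q)) = absz (q - p + 1).
Proof. by rewrite size_map size_zrange. Qed.
Ltac keysize := rewrite !size_cat !size_mapz /=; lia.
Ltac keymem := let x := fresh "x" in let k := fresh "k" in let E := fresh "E" in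
  move=> x; rewrite !mem_cat ?in_nil ?orbF; repeat (case/orP);
  (move=> /mapP[k]; rewrite mem_zrange; [move=> /andP[? ?] E; exists (x %/ 6)%Z; lia | lia]).

Definition cf_A1A1_10 : seq entry := [:: ((0, 1)%N, ((0), (6)))].
Lemma cnt1_A1A1_10 : cnt1 cf_A1A1_10 (1, 0)%N.
Proof.
move=> m h1 h2 p1 p2; keysplit.
(* The arguments are the ends of the progressions for the residues 0, 2, 3, 4, affine in [m]; the
   two alternatives answer the two outcomes of the height comparison. All entries below follow this
   pattern. *)
all: first [by (apply: (@cover_count _ (-1 * m%:Z + (1)) (1 * m%:Z + (1)) (0 * m%:Z + (0)) (0 * m%:Z + (0)) (0 * m%:Z + (0)) (0 * m%:Z + (0)) (0 * m%:Z + (0)) (0 * m%:Z + (0))); [keymem | keysize]) | by (apply: (@cover_count _ (-1 * m%:Z + (0)) (1 * m%:Z + (1)) (0 * m%:Z + (0)) (0 * m%:Z + (0)) (0 * m%:Z + (0)) (0 * m%:Z + (0)) (0 * m%:Z + (0)) (0 * m%:Z + (0))); [keymem | keysize])].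
Qed.
Lemma cnt2_A1A1_10 : cnt2 cf_A1A1_10 (1, 0)%N.
Proof.
move=> m h1 h2 p1 p2; keysplit.
all: first [by (apply: (@cover_count _ (-1 * m%:Z + (0)) (1 * m%:Z + (1)) (0 * m%:Z + (0)) (0 * m%:Z + (0)) (0 * m%:Z + (0)) (0 * m%:Z + (0)) (0 * m%:Z + (0)) (0 * m%:Z + (0))); [keymem | keysize]) | by (apply: (@cover_count _ (-1 * m%:Z + (0)) (1 * m%:Z + (2)) (0 * m%:Z + (0)) (0 * m%:Z + (0)) (0 * m%:Z + (0)) (0 * m%:Z + (0)) (0 * m%:Z + (0)) (0 * m%:Z + (0))); [keymem | keysize])].
Qed.
Definition cf_A1A1_01 : seq entry := [:: ((1, 0)%N, ((0), (6)))].
Lemma cnt1_A1A1_01 : cnt1 cf_A1A1_01 (0, 1)%N.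
Proof.
move=> m h1 h2 p1 p2; keysplit.
all: first [by (apply: (@cover_count _ (-1 * m%:Z + (1)) (1 * m%:Z + (1)) (0 * m%:Z + (0)) (0 * m%:Z + (0)) (0 * m%:Z + (0)) (0 * m%:Z + (0)) (0 * m%:Z + (0)) (0 * m%:Z + (0))); [keymem | keysize]) | by (apply: (@cover_count _ (-1 * m%:Z + (0)) (1 * m%:Z + (1)) (0 * m%:Z + (0)) (0 * m%:Z + (0)) (0 * m%:Z + (0)) (0 * m%:Z + (0)) (0 * m%:Z + (0)) (0 * m%:Z + (0))); [keymem | keysize])].
Qed.
Lemma cnt2_A1A1_01 : cnt2 cf_A1A1_01 (0, 1)%N.
Proof.
move=> m h1 h2 p1 p2; keysplit.
all: first [by (apply: (@cover_count _ (-1 * m%:Z + (0)) (1 * m%:Z + (1)) (0 * m%:Z + (0)) (0 * m%:Z + (0)) (0 * m%:Z + (0)) (0 * m%:Z + (0)) (0 * m%:Z + (0)) (0 * m%:Z + (0))); [keymem | keysize]) | by (apply: (@cover_count _ (-1 * m%:Z + (0)) (1 * m%:Z + (2)) (0 * m%:Z + (0)) (0 * m%:Z + (0)) (0 * m%:Z + (0)) (0 * m%:Z + (0)) (0 * m%:Z + (0)) (0 * m%:Z + (0))); [keymem | keysize])].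
Qed.
Definition cf_A2_10 : seq entry := [:: ((0, 1)%N, ((0), (6))); ((1, 1)%N, ((-6), (6)))].
Lemma cnt1_A2_10 : cnt1 cf_A2_10 (1, 0)%N.
Proof.
move=> m h1 h2 p1 p2; keysplit.
all: first [by (apply: (@cover_count _ (-1 * m%:Z + (1)) (2 * m%:Z + (1)) (0 * m%:Z + (0)) (0 * m%:Z + (0)) (0 * m%:Z + (0)) (0 * m%:Z + (0)) (0 * m%:Z + (0)) (0 * m%:Z + (0))); [keymem | keysize]) | by (apply: (@cover_count _ (-1 * m%:Z + (0)) (2 * m%:Z + (1)) (0 * m%:Z + (0)) (0 * m%:Z + (0)) (0 * m%:Z + (0)) (0 * m%:Z + (0)) (0 * m%:Z + (0)) (0 * m%:Z + (0))); [keymem | keysize])].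
Qed.
Lemma cnt2_A2_10 : cnt2 cf_A2_10 (1, 0)%N.
Proof.
move=> m h1 h2 p1 p2; keysplit.
all: first [by (apply: (@cover_count _ (-2 * m%:Z + (-1)) (1 * m%:Z + (1)) (0 * m%:Z + (0)) (0 * m%:Z + (0)) (0 * m%:Z + (0)) (0 * m%:Z + (0)) (0 * m%:Z + (0)) (0 * m%:Z + (0))); [keymem | keysize]) | by (apply: (@cover_count _ (-2 * m%:Z + (-1)) (1 * m%:Z + (2)) (0 * m%:Z + (0)) (0 * m%:Z + (0)) (0 * m%:Z + (0)) (0 * m%:Z + (0)) (0 * m%:Z + (0)) (0 * m%:Z + (0))); [keymem | keysize])].
Qed.
Definition cf_A2_01 : seq entry := [:: ((1, 0)%N, ((0), (6))); ((1, 1)%N, ((-6), (6)))].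
Lemma cnt1_A2_01 : cnt1 cf_A2_01 (0, 1)%N.
Proof.
move=> m h1 h2 p1 p2; keysplit.
all: first [by (apply: (@cover_count _ (-1 * m%:Z + (1)) (2 * m%:Z + (1)) (0 * m%:Z + (0)) (0 * m%:Z + (0)) (0 * m%:Z + (0)) (0 * m%:Z + (0)) (0 * m%:Z + (0)) (0 * m%:Z + (0))); [keymem | keysize]) | by (apply: (@cover_count _ (-1 * m%:Z + (0)) (2 * m%:Z + (1)) (0 * m%:Z + (0)) (0 * m%:Z + (0)) (0 * m%:Z + (0)) (0 * m%:Z + (0)) (0 * m%:Z + (0)) (0 * m%:Z + (0))); [keymem | keysize])].
Qed.
Lemma cnt2_A2_01 : cnt2 cf_A2_01 (0, 1)%N.
Proof.
move=> m h1 h2 p1 p2; keysplit.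
all: first [by (apply: (@cover_count _ (-2 * m%:Z + (-1)) (1 * m%:Z + (1)) (0 * m%:Z + (0)) (0 * m%:Z + (0)) (0 * m%:Z + (0)) (0 * m%:Z + (0)) (0 * m%:Z + (0)) (0 * m%:Z + (0))); [keymem | keysize]) | by (apply: (@cover_count _ (-2 * m%:Z + (-1)) (1 * m%:Z + (2)) (0 * m%:Z + (0)) (0 * m%:Z + (0)) (0 * m%:Z + (0)) (0 * m%:Z + (0)) (0 * m%:Z + (0)) (0 * m%:Z + (0))); [keymem | keysize])].
Qed.
Definition cf_A2_11 : seq entry := [:: ((1, 0)%N, ((6), (-6))); ((0, 1)%N, ((0), (6)))].
Lemma cnt1_A2_11 : cnt1 cf_A2_11 (1, 1)%N.
Proof.
move=> m h1 h2 p1 p2; keysplit.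
all: (apply: (@cover_count _ (-2 * m%:Z + (0)) (1 * m%:Z + (1)) (0 * m%:Z + (0)) (0 * m%:Z + (0)) (0 * m%:Z + (0)) (0 * m%:Z + (0)) (0 * m%:Z + (0)) (0 * m%:Z + (0))); [keymem | keysize]).
Qed.
Lemma cnt2_A2_11 : cnt2 cf_A2_11 (1, 1)%N.
Proof.
move=> m h1 h2 p1 p2; keysplit.
all: (apply: (@cover_count _ (-1 * m%:Z + (0)) (2 * m%:Z + (2)) (0 * m%:Z + (0)) (0 * m%:Z + (0)) (0 * m%:Z + (0)) (0 * m%:Z + (0)) (0 * m%:Z + (0)) (0 * m%:Z + (0))); [keymem | keysize]).
Qed.
Definition cf_B2_10 : seq entry := [:: ((0, 1)%N, ((0), (6))); ((1, 1)%N, ((-6), (6))); ((1, 2)%N, ((-3), (3)))].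
Lemma cnt1_B2_10 : cnt1 cf_B2_10 (1, 0)%N.
Proof.
move=> m h1 h2 p1 p2; keysplit.
all: first [by (apply: (@cover_count _ (-1 * m%:Z + (1)) (2 * m%:Z + (1)) (0 * m%:Z + (0)) (0 * m%:Z + (0)) (0 * m%:Z + (0)) (1 * m%:Z + (0)) (0 * m%:Z + (0)) (0 * m%:Z + (0))); [keymem | keysize]) | by (apply: (@cover_count _ (-1 * m%:Z + (0)) (2 * m%:Z + (1)) (0 * m%:Z + (0)) (0 * m%:Z + (0)) (0 * m%:Z + (0)) (1 * m%:Z + (0)) (0 * m%:Z + (0)) (0 * m%:Z + (0))); [keymem | keysize])].
Qed.
Lemma cnt2_B2_10 : cnt2 cf_B2_10 (1, 0)%N.
Proof.
move=> m h1 h2 p1 p2; keysplit.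
all: first [by (apply: (@cover_count _ (-2 * m%:Z + (-1)) (1 * m%:Z + (1)) (0 * m%:Z + (0)) (0 * m%:Z + (0)) (-1 * m%:Z + (-1)) (0 * m%:Z + (0)) (0 * m%:Z + (0)) (0 * m%:Z + (0))); [keymem | keysize]) | by (apply: (@cover_count _ (-2 * m%:Z + (-1)) (1 * m%:Z + (2)) (0 * m%:Z + (0)) (0 * m%:Z + (0)) (-1 * m%:Z + (-1)) (0 * m%:Z + (0)) (0 * m%:Z + (0)) (0 * m%:Z + (0))); [keymem | keysize])].
Qed.
Definition cf_B2_01 : seq entry := [:: ((1, 0)%N, ((0), (6))); ((1, 1)%N, ((-6), (6))); ((1, 2)%N, ((-12), (6)))].
Lemma cnt1_B2_01 : cnt1 cf_B2_01 (0, 1)%N.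
Proof.
move=> m h1 h2 p1 p2; keysplit.
all: first [by (apply: (@cover_count _ (-1 * m%:Z + (1)) (3 * m%:Z + (1)) (0 * m%:Z + (0)) (0 * m%:Z + (0)) (0 * m%:Z + (0)) (0 * m%:Z + (0)) (0 * m%:Z + (0)) (0 * m%:Z + (0))); [keymem | keysize]) | by (apply: (@cover_count _ (-1 * m%:Z + (0)) (3 * m%:Z + (1)) (0 * m%:Z + (0)) (0 * m%:Z + (0)) (0 * m%:Z + (0)) (0 * m%:Z + (0)) (0 * m%:Z + (0)) (0 * m%:Z + (0))); [keymem | keysize])].
Qed.
Lemma cnt2_B2_01 : cnt2 cf_B2_01 (0, 1)%N.
Proof.
move=> m h1 h2 p1 p2; keysplit.
all: first [by (apply: (@cover_count _ (-3 * m%:Z + (-2)) (1 * m%:Z + (1)) (0 * m%:Z + (0)) (0 * m%:Z + (0)) (0 * m%:Z + (0)) (0 * m%:Z + (0)) (0 * m%:Z + (0)) (0 * m%:Z + (0))); [keymem | keysize]) | by (apply: (@cover_count _ (-3 * m%:Z + (-2)) (1 * m%:Z + (2)) (0 * m%:Z + (0)) (0 * m%:Z + (0)) (0 * m%:Z + (0)) (0 * m%:Z + (0)) (0 * m%:Z + (0)) (0 * m%:Z + (0))); [keymem | keysize])].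
Qed.
Definition cf_B2_11 : seq entry := [:: ((1, 0)%N, ((6), (-6))); ((0, 1)%N, ((0), (6))); ((1, 2)%N, ((-6), (6)))].
Lemma cnt1_B2_11 : cnt1 cf_B2_11 (1, 1)%N.
Proof.
move=> m h1 h2 p1 p2; keysplit.
all: (apply: (@cover_count _ (-2 * m%:Z + (0)) (2 * m%:Z + (1)) (0 * m%:Z + (0)) (0 * m%:Z + (0)) (0 * m%:Z + (0)) (0 * m%:Z + (0)) (0 * m%:Z + (0)) (0 * m%:Z + (0))); [keymem | keysize]).
Qed.
Lemma cnt2_B2_11 : cnt2 cf_B2_11 (1, 1)%N.
Proof.
move=> m h1 h2 p1 p2; keysplit.
all: (apply: (@cover_count _ (-2 * m%:Z + (-1)) (2 * m%:Z + (2)) (0 * m%:Z + (0)) (0 * m%:Z + (0)) (0 * m%:Z + (0)) (0 * m%:Z + (0)) (0 * m%:Z + (0)) (0 * m%:Z + (0))); [keymem | keysize]).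
Qed.
Definition cf_B2_12 : seq entry := [:: ((1, 0)%N, ((3), (-3))); ((0, 1)%N, ((0), (6))); ((1, 1)%N, ((6), (-6)))].
Lemma cnt1_B2_12 : cnt1 cf_B2_12 (1, 2)%N.
Proof.
move=> m h1 h2 p1 p2; keysplit.
all: (apply: (@cover_count _ (-2 * m%:Z + (0)) (1 * m%:Z + (1)) (0 * m%:Z + (0)) (0 * m%:Z + (0)) (-1 * m%:Z + (0)) (0 * m%:Z + (0)) (0 * m%:Z + (0)) (0 * m%:Z + (0))); [keymem | keysize]).
Qed.
Lemma cnt2_B2_12 : cnt2 cf_B2_12 (1, 2)%N.
Proof.
move=> m h1 h2 p1 p2; keysplit.
all: (apply: (@cover_count _ (-1 * m%:Z + (0)) (2 * m%:Z + (2)) (0 * m%:Z + (0)) (0 * m%:Z + (0)) (0 * m%:Z + (0)) (1 * m%:Z + (1)) (0 * m%:Z + (0)) (0 * m%:Z + (0))); [keymem | keysize]).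
Qed.
Definition cf_G2_10 : seq entry := [:: ((0, 1)%N, ((0), (6))); ((1, 1)%N, ((-6), (6))); ((1, 2)%N, ((-3), (3))); ((1, 3)%N, ((-2), (2))); ((2, 3)%N, ((-4), (2)))].
Lemma cnt1_G2_10 : cnt1 cf_G2_10 (1, 0)%N.
Proof.
move=> m h1 h2 p1 p2; keysplit.
all: first [by (apply: (@cover_count _ (-1 * m%:Z + (1)) (2 * m%:Z + (1)) (0 * m%:Z + (0)) (1 * m%:Z + (0)) (0 * m%:Z + (0)) (1 * m%:Z + (0)) (0 * m%:Z + (0)) (1 * m%:Z + (0))); [keymem | keysize]) | by (apply: (@cover_count _ (-1 * m%:Z + (0)) (2 * m%:Z + (1)) (0 * m%:Z + (0)) (1 * m%:Z + (0)) (0 * m%:Z + (0)) (1 * m%:Z + (0)) (0 * m%:Z + (0)) (1 * m%:Z + (0))); [keymem | keysize])].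
Qed.
Lemma cnt2_G2_10 : cnt2 cf_G2_10 (1, 0)%N.
Proof.
move=> m h1 h2 p1 p2; keysplit.
all: first [by (apply: (@cover_count _ (-2 * m%:Z + (-1)) (1 * m%:Z + (1)) (-1 * m%:Z + (-1)) (0 * m%:Z + (0)) (-1 * m%:Z + (-1)) (0 * m%:Z + (0)) (-1 * m%:Z + (-1)) (0 * m%:Z + (0))); [keymem | keysize]) | by (apply: (@cover_count _ (-2 * m%:Z + (-1)) (1 * m%:Z + (2)) (-1 * m%:Z + (-1)) (0 * m%:Z + (0)) (-1 * m%:Z + (-1)) (0 * m%:Z + (0)) (-1 * m%:Z + (-1)) (0 * m%:Z + (0))); [keymem | keysize])].
Qed.
Definition cf_G2_01 : seq entry := [:: ((1, 0)%N, ((0), (6))); ((1, 1)%N, ((-6), (6))); ((1, 2)%N, ((-12), (6))); ((1, 3)%N, ((-18), (6))); ((2, 3)%N, ((-9), (3)))].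
Lemma cnt1_G2_01 : cnt1 cf_G2_01 (0, 1)%N.
Proof.
move=> m h1 h2 p1 p2; keysplit.
all: first [by (apply: (@cover_count _ (-1 * m%:Z + (1)) (4 * m%:Z + (1)) (0 * m%:Z + (0)) (0 * m%:Z + (0)) (1 * m%:Z + (0)) (2 * m%:Z + (0)) (0 * m%:Z + (0)) (0 * m%:Z + (0))); [keymem | keysize]) | by (apply: (@cover_count _ (-1 * m%:Z + (0)) (4 * m%:Z + (1)) (0 * m%:Z + (0)) (0 * m%:Z + (0)) (1 * m%:Z + (0)) (2 * m%:Z + (0)) (0 * m%:Z + (0)) (0 * m%:Z + (0))); [keymem | keysize])].
Qed.
Lemma cnt2_G2_01 : cnt2 cf_G2_01 (0, 1)%N.
Proof.
move=> m h1 h2 p1 p2; keysplit.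
all: first [by (apply: (@cover_count _ (-4 * m%:Z + (-3)) (1 * m%:Z + (1)) (0 * m%:Z + (0)) (0 * m%:Z + (0)) (-2 * m%:Z + (-2)) (-1 * m%:Z + (-1)) (0 * m%:Z + (0)) (0 * m%:Z + (0))); [keymem | keysize]) | by (apply: (@cover_count _ (-4 * m%:Z + (-3)) (1 * m%:Z + (2)) (0 * m%:Z + (0)) (0 * m%:Z + (0)) (-2 * m%:Z + (-2)) (-1 * m%:Z + (-1)) (0 * m%:Z + (0)) (0 * m%:Z + (0))); [keymem | keysize])].
Qed.
Definition cf_G2_11 : seq entry := [:: ((1, 0)%N, ((6), (-6))); ((0, 1)%N, ((0), (6))); ((1, 2)%N, ((-6), (6))); ((1, 3)%N, ((-3), (3))); ((2, 3)%N, ((-12), (6)))].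
Lemma cnt1_G2_11 : cnt1 cf_G2_11 (1, 1)%N.
Proof.
move=> m h1 h2 p1 p2; keysplit.
all: (apply: (@cover_count _ (-2 * m%:Z + (0)) (3 * m%:Z + (1)) (0 * m%:Z + (0)) (0 * m%:Z + (0)) (0 * m%:Z + (0)) (1 * m%:Z + (0)) (0 * m%:Z + (0)) (0 * m%:Z + (0))); [keymem | keysize]).
Qed.
Lemma cnt2_G2_11 : cnt2 cf_G2_11 (1, 1)%N.
Proof.
move=> m h1 h2 p1 p2; keysplit.
all: (apply: (@cover_count _ (-3 * m%:Z + (-2)) (2 * m%:Z + (2)) (0 * m%:Z + (0)) (0 * m%:Z + (0)) (-1 * m%:Z + (-1)) (0 * m%:Z + (0)) (0 * m%:Z + (0)) (0 * m%:Z + (0))); [keymem | keysize]).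
Qed.
Definition cf_G2_12 : seq entry := [:: ((1, 0)%N, ((3), (-3))); ((0, 1)%N, ((0), (6))); ((1, 1)%N, ((6), (-6))); ((1, 3)%N, ((-6), (6))); ((2, 3)%N, ((12), (-6)))].
Lemma cnt1_G2_12 : cnt1 cf_G2_12 (1, 2)%N.
Proof.
move=> m h1 h2 p1 p2; keysplit.
all: (apply: (@cover_count _ (-3 * m%:Z + (0)) (2 * m%:Z + (1)) (0 * m%:Z + (0)) (0 * m%:Z + (0)) (-1 * m%:Z + (0)) (0 * m%:Z + (0)) (0 * m%:Z + (0)) (0 * m%:Z + (0))); [keymem | keysize]).
Qed.
Lemma cnt2_G2_12 : cnt2 cf_G2_12 (1, 2)%N.
Proof.
move=> m h1 h2 p1 p2; keysplit.
all: (apply: (@cover_count _ (-2 * m%:Z + (-1)) (3 * m%:Z + (3)) (0 * m%:Z + (0)) (0 * m%:Z + (0)) (0 * m%:Z + (0)) (1 * m%:Z + (1)) (0 * m%:Z + (0)) (0 * m%:Z + (0))); [keymem | keysize]).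
Qed.
Definition cf_G2_13 : seq entry := [:: ((1, 0)%N, ((2), (-2))); ((0, 1)%N, ((0), (6))); ((1, 1)%N, ((3), (-3))); ((1, 2)%N, ((6), (-6))); ((2, 3)%N, ((4), (-2)))].
Lemma cnt1_G2_13 : cnt1 cf_G2_13 (1, 3)%N.
Proof.
move=> m h1 h2 p1 p2; keysplit.
all: (apply: (@cover_count _ (-2 * m%:Z + (0)) (1 * m%:Z + (1)) (-1 * m%:Z + (0)) (0 * m%:Z + (0)) (-1 * m%:Z + (0)) (0 * m%:Z + (0)) (-1 * m%:Z + (0)) (0 * m%:Z + (0))); [keymem | keysize]).
Qed.
Lemma cnt2_G2_13 : cnt2 cf_G2_13 (1, 3)%N.
Proof.
move=> m h1 h2 p1 p2; keysplit.
all: (apply: (@cover_count _ (-1 * m%:Z + (0)) (2 * m%:Z + (2)) (0 * m%:Z + (0)) (1 * m%:Z + (1)) (0 * m%:Z + (0)) (1 * m%:Z + (1)) (0 * m%:Z + (0)) (1 * m%:Z + (1))); [keymem | keysize]).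
Qed.
Definition cf_G2_23 : seq entry := [:: ((1, 0)%N, ((2), (2))); ((0, 1)%N, ((3), (-3))); ((1, 1)%N, ((0), (6))); ((1, 2)%N, ((6), (-6))); ((1, 3)%N, ((4), (-2)))].
Lemma cnt1_G2_23 : cnt1 cf_G2_23 (2, 3)%N.
Proof.
move=> m h1 h2 p1 p2; keysplit.
all: (apply: (@cover_count _ (-2 * m%:Z + (0)) (1 * m%:Z + (1)) (-1 * m%:Z + (0)) (0 * m%:Z + (0)) (-1 * m%:Z + (0)) (0 * m%:Z + (0)) (-1 * m%:Z + (0)) (0 * m%:Z + (0))); [keymem | keysize]).
Qed.
Lemma cnt2_G2_23 : cnt2 cf_G2_23 (2, 3)%N.
Proof.
move=> m h1 h2 p1 p2; keysplit.
all: (apply: (@cover_count _ (-1 * m%:Z + (0)) (2 * m%:Z + (2)) (0 * m%:Z + (0)) (1 * m%:Z + (1)) (0 * m%:Z + (0)) (1 * m%:Z + (1)) (0 * m%:Z + (0)) (1 * m%:Z + (1))); [keymem | keysize]).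
Qed.
Definition det2 (a b : nat * nat) : int := a.1%:Z * b.2%:Z - a.2%:Z * b.1%:Z.
Definition G_A1A1 : seq (nat * nat) := [:: (1, 0)%N; (0, 1)%N].
Definition G_A2 : seq (nat * nat) := [:: (1, 0)%N; (0, 1)%N; (1, 1)%N].
Definition G_B2 : seq (nat * nat) := [:: (1, 0)%N; (0, 1)%N; (1, 1)%N; (1, 2)%N].
Definition G_G2 : seq (nat * nat) := [:: (1, 0)%N; (0, 1)%N; (1, 1)%N; (1, 2)%N; (1, 3)%N; (2, 3)%N].
Definition types2 := [:: G_A1A1; G_A2; G_B2; G_G2].
(** Cramer's rule, det(a, b) c = det(c, b) a + det(a, c) b, gives the value of the reference root
    [c] at the point where [a = k0] and [b = k]. The last clause makes the key six times this value.
    The tables choose [c] with determinant 1 or -1 against [a]. *)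
Definition good_cf (G : seq (nat * nat)) (a c : nat * nat) (cf : seq entry) :=
  [&& c \in G, det2 a c != 0, [seq x.1 | x <- cf] == rem a G &
      all (fun x => [&& det2 a x.1 != 0, det2 a x.1 * x.2.1 == 6 * det2 c x.1 & det2 a x.1 * x.2.2 == 6 * det2 a c]) cf].
Theorem rank2_table G a : G \in types2 -> a \in G -> exists c cf, [/\ good_cf G a c cf, cnt1 cf a & cnt2 cf a].
Proof.
rewrite !inE => /or4P[] /eqP ->; rewrite ?inE.
- repeat (case/orP); move=> /eqP ->.
  + by exists (0, 1)%N, cf_A1A1_10; split; [vm_compute | exact: cnt1_A1A1_10 | exact: cnt2_A1A1_10].
  + by exists (1, 0)%N, cf_A1A1_01; split; [vm_compute | exact: cnt1_A1A1_01 | exact: cnt2_A1A1_01].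
- repeat (case/orP); move=> /eqP ->.
  + by exists (0, 1)%N, cf_A2_10; split; [vm_compute | exact: cnt1_A2_10 | exact: cnt2_A2_10].
  + by exists (1, 0)%N, cf_A2_01; split; [vm_compute | exact: cnt1_A2_01 | exact: cnt2_A2_01].
  + by exists (0, 1)%N, cf_A2_11; split; [vm_compute | exact: cnt1_A2_11 | exact: cnt2_A2_11].
- repeat (case/orP); move=> /eqP ->.
  + by exists (0, 1)%N, cf_B2_10; split; [vm_compute | exact: cnt1_B2_10 | exact: cnt2_B2_10].
  + by exists (1, 0)%N, cf_B2_01; split; [vm_compute | exact: cnt1_B2_01 | exact: cnt2_B2_01].
  + by exists (0, 1)%N, cf_B2_11; split; [vm_compute | exact: cnt1_B2_11 | exact: cnt2_B2_11].
  + by exists (0, 1)%N, cf_B2_12; split; [vm_compute | exact: cnt1_B2_12 | exact: cnt2_B2_12].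
- repeat (case/orP); move=> /eqP ->.
  + by exists (0, 1)%N, cf_G2_10; split; [vm_compute | exact: cnt1_G2_10 | exact: cnt2_G2_10].
  + by exists (1, 0)%N, cf_G2_01; split; [vm_compute | exact: cnt1_G2_01 | exact: cnt2_G2_01].
  + by exists (0, 1)%N, cf_G2_11; split; [vm_compute | exact: cnt1_G2_11 | exact: cnt2_G2_11].
  + by exists (0, 1)%N, cf_G2_12; split; [vm_compute | exact: cnt1_G2_12 | exact: cnt2_G2_12].
  + by exists (0, 1)%N, cf_G2_13; split; [vm_compute | exact: cnt1_G2_13 | exact: cnt2_G2_13].
  + by exists (1, 1)%N, cf_G2_23; split; [vm_compute | exact: cnt1_G2_23 | exact: cnt2_G2_23].
Qed.

End RankTwoTables.

Module ShiCatalan.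
Import all_boot all_order all_algebra perm reals boolp complex mpoly ring lra zify.
Set Implicit Arguments. Unset Strict Implicit. Unset Printing Implicit Defensive.
Import Order.TTheory GRing.Theory Num.Theory.
Local Open Scope ring_scope.

(** * Divisibility by linear forms *)

Module LinearFormDivisibility.

Section RingInd.
Variables (K : nzRingType) (n : nat).
Lemma mpoly_ring_ind (P : {mpoly K[n]} -> Prop) :
  (forall c, P c%:MP) -> (forall i, P 'X_i) ->
  (forall p q, P p -> P q -> P (p + q)) ->
  (forall p q, P p -> P q -> P (p * q)) -> forall p, P p.
Proof.
move=> hC hX hD hM p.
have hXm m : P 'X_[m].
  rewrite mpolyXE_id; elim/big_ind: _ => //; first exact: (hC 1).
  move=> i _; elim: (m i) => [|k IH]; first by rewrite expr0; exact: (hC 1).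
  by rewrite exprS; apply: hM.
rewrite (mpolyE p); elim/big_ind: _ => //; first by rewrite -mpolyC0; apply: hC.
by move=> m _; rewrite -mul_mpolyC; apply: hM.
Qed.
End RingInd.

Section MorphExt.
Variables (K : nzRingType) (n : nat) (A : nzRingType).
Lemma mpoly_morph_ext (f g : {rmorphism {mpoly K[n]} -> A}) :
  (forall c, f c%:MP = g c%:MP) -> (forall i, f 'X_i = g 'X_i) -> f =1 g.
Proof.
move=> hC hX; apply: mpoly_ring_ind => //.
- by move=> p q hp hq; rewrite !rmorphD hp hq.
- by move=> p q hp hq; rewrite !rmorphM hp hq.
Qed.
End MorphExt.

Section Dvd.
Variable S : comNzRingType.
Definition mdvd (a p : S) := exists q, p = a * q.
Lemma mdvd0 a : mdvd a 0. Proof. by exists 0; rewrite mulr0. Qed.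
Lemma mdvd_refl a : mdvd a a. Proof. by exists 1; rewrite mulr1. Qed.
Lemma mdvdD a p q : mdvd a p -> mdvd a q -> mdvd a (p + q).
Proof. by move=> [u ->] [v ->]; exists (u + v); rewrite mulrDr. Qed.
Lemma mdvdN a p : mdvd a p -> mdvd a (- p).
Proof. by move=> [u ->]; exists (- u); rewrite mulrN. Qed.
Lemma mdvdB a p q : mdvd a p -> mdvd a q -> mdvd a (p - q).
Proof. by move=> hp hq; apply: mdvdD => //; apply: mdvdN. Qed.
Lemma mdvd_mull a p q : mdvd a q -> mdvd a (p * q).
Proof. by move=> [u ->]; exists (p * u); rewrite mulrCA. Qed.
Lemma mdvd_mulr a p q : mdvd a p -> mdvd a (p * q).
Proof. by rewrite mulrC; apply: mdvd_mull. Qed.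
Lemma mdvdM a b p q : mdvd a p -> mdvd b q -> mdvd (a * b) (p * q).
Proof. by move=> [u ->] [v ->]; exists (u * v); rewrite mulrACA. Qed.
Lemma mdvd_trans a b p : mdvd a b -> mdvd b p -> mdvd a p.
Proof. by move=> [u ->] [v ->]; exists (u * v); rewrite mulrA. Qed.
Lemma mdvd_sum (I : Type) (r : seq I) (P : pred I) F a :
  (forall i, P i -> mdvd a (F i)) -> mdvd a (\sum_(i <- r | P i) F i).
Proof. by move=> h; elim/big_ind: _ => //; [exact: mdvd0 | move=> *; exact: mdvdD]. Qed.
Lemma mdvd_exp a m k : (m <= k)%N -> mdvd (a ^+ m) (a ^+ k).
Proof. by move=> h; exists (a ^+ (k - m)); rewrite -exprD subnKC. Qed.
Lemma mdvd_prod_mem (I : eqType) (r : seq I) (F : I -> S) i :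
  i \in r -> mdvd (F i) (\prod_(j <- r) F j).
Proof. by move=> h; rewrite (big_rem i) //=; apply/mdvd_mulr/mdvd_refl. Qed.
End Dvd.

Section LinForms.
Variables (R : realType).

Definition dera m n (t : 'I_m -> {mpoly R[n]}) (a : 'rV[R]_m) : {mpoly R[n]} :=
  \sum_(i < m) a 0 i *: t i.

Section Sub.
Variables (m n : nat) (t : 'I_m -> {mpoly R[n]}).
Definition msub : {mpoly R[m]} -> {mpoly R[n]} := mmap (@mpolyC n R) t.
HB.instance Definition _ := GRing.RMorphism.on msub.
Lemma msubC c : msub c%:MP = c%:MP. Proof. exact: mmapC. Qed.
Lemma msubX i : msub 'X_i = t i. Proof. by rewrite /msub mmapX mmap1U. Qed.
Lemma msubZ c p : msub (c *: p) = c *: msub p.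
Proof. by rewrite /msub mmapZ mul_mpolyC. Qed.
Lemma msub_lin a : msub (linform a) = dera t a.
Proof.
rewrite /linform /dera rmorph_sum; apply: eq_bigr => i _ /=.
by rewrite msubZ /var msubX.
Qed.
End Sub.

Section OneN.
Variable n : nat.
Implicit Types (a b : 'rV[R]_n) (p q : {mpoly R[n]}).

Lemma linformD a b : linform (a + b) = linform a + linform b.
Proof. by rewrite /linform -big_split; apply: eq_bigr => i _; rewrite mxE scalerDl. Qed.
Lemma linformZ c a : linform (c *: a) = c *: linform a.
Proof. by rewrite /linform scaler_sumr; apply: eq_bigr => i _; rewrite mxE scalerA. Qed.
Lemma linform0 : linform (0 : 'rV[R]_n) = 0.
Proof. by rewrite /linform big1 // => i _; rewrite mxE scale0r. Qed.
Lemma linformN a : linform (- a) = - linform a.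
Proof. by rewrite -scaleN1r linformZ scaleN1r. Qed.
Lemma linformB a b : linform (a - b) = linform a - linform b.
Proof. by rewrite linformD linformN. Qed.
Lemma linform_sum (I : Type) (r : seq I) P (F : I -> 'rV[R]_n) :
  linform (\sum_(i <- r | P i) F i) = \sum_(i <- r | P i) linform (F i).
Proof.
by elim/big_rec2: _ => [|i x y _ <-]; [rewrite linform0 | rewrite linformD].
Qed.
Lemma linform_coef a i : (linform a)@_U_(i)%MM = a 0 i.
Proof.
rewrite /linform raddf_sum (bigD1 i) //= big1 ?addr0 => [|j ji].
  by rewrite mcoeffZ /var mcoeffXU eqxx mulr1.
by rewrite mcoeffZ /var mcoeffXU (negbTE ji) mulr0.
Qed.
Lemma linform_eq0 a : (linform a == 0) = (a == 0).
Proof.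
apply/eqP/eqP => [h|->]; last exact: linform0.
by apply/rowP => i; rewrite -linform_coef h mcoeff0 mxE.
Qed.
Lemma linform_delta i : linform (delta_mx 0 i : 'rV[R]_n) = 'X_i.
Proof.
rewrite /linform (bigD1 i) //= big1 ?addr0 ?mxE ?eqxx ?scale1r //.
by move=> j ji; rewrite mxE eqxx (negbTE ji) scale0r.
Qed.

(* [act g p] is the polynomial function [x |-> p (x *m g)]. *)
Definition act (g : 'M[R]_n) : {mpoly R[n]} -> {mpoly R[n]} :=
  msub (fun i => linform (\row_j g j i)).
HB.instance Definition _ g := GRing.RMorphism.on (act g).
Lemma actC g c : act g c%:MP = c%:MP. Proof. exact: msubC. Qed.
Lemma actZ g c p : act g (c *: p) = c *: act g p. Proof. exact: msubZ. Qed.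
Lemma act_lin g a : act g (linform a) = linform (a *m g^T).
Proof.
rewrite /act msub_lin /dera.
transitivity (linform (\sum_i a 0 i *: \row_j g j i)).
  by rewrite linform_sum; apply: eq_bigr => i _; rewrite linformZ.
congr linform; apply/rowP => j; rewrite summxE !mxE.
by apply: eq_bigr => i _; rewrite !mxE.
Qed.
Lemma act_X g i : act g 'X_i = linform (\row_j g j i).
Proof. exact: msubX. Qed.
Lemma act_comp g h p : act g (act h p) = act (g *m h) p.
Proof.
apply: (mpoly_morph_ext (f := act g \o act h)) => [c|i] /=; first by rewrite !actC.
rewrite !act_X act_lin; congr linform; apply/rowP => j; rewrite !mxE.
by apply: eq_bigr => k _; rewrite !mxE mulrC.
Qed.
Lemma act1 p : act 1%:M p = p.
Proof.
apply: (mpoly_morph_ext (g := idfun)) => [c|i] /=; first by rewrite actC.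
rewrite act_X -linform_delta; congr linform; apply/rowP => j.
by rewrite !mxE eqxx.
Qed.

Definition projm a : 'M[R]_n := 1%:M - (dotp a a)^-1 *: (a^T *m a).

Lemma dotpE (u v : 'rV[R]_n) : dotp u v = \sum_i u 0 i * v 0 i.
Proof. by rewrite /dotp mxE; apply: eq_bigr => i _; rewrite mxE. Qed.
Lemma dotpC (u v : 'rV[R]_n) : dotp u v = dotp v u.
Proof. by rewrite !dotpE; apply: eq_bigr => i _; rewrite mulrC. Qed.
Lemma dotpDl (u v w : 'rV[R]_n) : dotp (u + v) w = dotp u w + dotp v w.
Proof. by rewrite /dotp mulmxDl mxE. Qed.
Lemma dotpZl c (u v : 'rV[R]_n) : dotp (c *: u) v = c * dotp u v.
Proof. by rewrite /dotp -scalemxAl mxE. Qed.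
Lemma dotpDr (u v w : 'rV[R]_n) : dotp w (u + v) = dotp w u + dotp w v.
Proof. by rewrite !(dotpC w) dotpDl. Qed.
Lemma dotpZr c (u v : 'rV[R]_n) : dotp u (c *: v) = c * dotp u v.
Proof. by rewrite !(dotpC u) dotpZl. Qed.
Lemma dotpNl (u v : 'rV[R]_n) : dotp (- u) v = - dotp u v.
Proof. by rewrite -scaleN1r dotpZl mulN1r. Qed.
Lemma dotpNr (u v : 'rV[R]_n) : dotp u (- v) = - dotp u v.
Proof. by rewrite !(dotpC u) dotpNl. Qed.
Lemma dotpBl (u v w : 'rV[R]_n) : dotp (u - v) w = dotp u w - dotp v w.
Proof. by rewrite dotpDl dotpNl. Qed.
Lemma dotpBr (u v w : 'rV[R]_n) : dotp w (u - v) = dotp w u - dotp w v.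
Proof. by rewrite dotpDr dotpNr. Qed.
Lemma dotp0l (u : 'rV[R]_n) : dotp 0 u = 0.
Proof. by rewrite /dotp mul0mx mxE. Qed.
Lemma dotp0r (u : 'rV[R]_n) : dotp u 0 = 0.
Proof. by rewrite dotpC dotp0l. Qed.
Lemma dotp_suml (I : Type) (r : seq I) (P : pred I) (F : I -> 'rV[R]_n) u :
  dotp (\sum_(i <- r | P i) F i) u = \sum_(i <- r | P i) dotp (F i) u.
Proof.
by elim/big_rec2: _ => [|i x y _ <-]; [rewrite dotp0l | rewrite dotpDl].
Qed.
Lemma dotp_sumr (I : Type) (r : seq I) (P : pred I) (F : I -> 'rV[R]_n) u :
  dotp u (\sum_(i <- r | P i) F i) = \sum_(i <- r | P i) dotp u (F i).
Proof. by rewrite dotpC dotp_suml; apply: eq_bigr => i _; rewrite dotpC. Qed.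
Lemma dotp_ge0 (u : 'rV[R]_n) : 0 <= dotp u u.
Proof. by rewrite dotpE sumr_ge0 // => i _; rewrite -expr2 sqr_ge0. Qed.
Lemma dotp_eq0 (u : 'rV[R]_n) : (dotp u u == 0) = (u == 0).
Proof.
apply/eqP/eqP => [|->]; last by rewrite dotp0l.
rewrite dotpE => /eqP; rewrite psumr_eq0 => [/allP h|i _]; last by rewrite -expr2 sqr_ge0.
apply/rowP => i; rewrite mxE; apply/eqP.
by have := h i (mem_index_enum _); rewrite /= mulf_eq0 orbb.
Qed.
Lemma dotp_gt0 (u : 'rV[R]_n) : (0 < dotp u u) = (u != 0).
Proof. by rewrite lt_def dotp_ge0 andbT dotp_eq0. Qed.
Lemma dotp_mulmx (u v : 'rV[R]_n) (g : 'M[R]_n) : dotp (u *m g) v = dotp u (v *m g^T).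
Proof. by rewrite /dotp trmx_mul trmxK mulmxA. Qed.

Lemma mul_outer (u a b : 'rV[R]_n) : u *m (a^T *m b) = dotp u a *: b.
Proof. by rewrite mulmxA [u *m a^T]mx11_scalar mul_scalar_mx. Qed.
Lemma mul_projm u a : u *m projm a = u - (dotp u a / dotp a a) *: a.
Proof. by rewrite mulmxBr mulmx1 -scalemxAr mul_outer scalerA mulrC. Qed.
Lemma mul_refl u a : u *m refl a = u - (2 * dotp u a / dotp a a) *: a.
Proof.
rewrite mulmxBr mulmx1 -scalemxAr mul_outer scalerA; congr (_ - _ *: _).
by rewrite mulrAC.
Qed.
Lemma projmT a : (projm a)^T = projm a.
Proof. by rewrite linearB /= trmx1 linearZ /= trmx_mul trmxK. Qed.
Lemma reflT a : (refl a)^T = refl a.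
Proof. by rewrite linearB /= trmx1 linearZ /= trmx_mul trmxK. Qed.

Lemma act_proj_lin a : a != 0 -> act (projm a) (linform a) = 0.
Proof.
move=> a0; rewrite act_lin projmT mul_projm divff ?dotp_eq0 // scale1r subrr.
exact: linform0.
Qed.
(** Congruence modulo the form respects sums and products, so the variables decide; for them the
    difference is an explicit multiple of the form. *)
Lemma proj_mod a p : mdvd (linform a) (p - act (projm a) p).
Proof.
move: p; apply: mpoly_ring_ind => [c|i|p q hp hq|p q hp hq].
- by rewrite actC subrr; apply: mdvd0.
- rewrite -linform_delta act_lin projmT mul_projm -linformB opprB addrCA subrr addr0.
  by rewrite linformZ -mul_mpolyC; apply/mdvd_mull/mdvd_refl.
- by rewrite rmorphD opprD addrACA; apply: mdvdD.
- rewrite rmorphM /= -[p * q](subrK (act (projm a) p * q)) -mulrBl -addrA -mulrBr.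
  by apply: mdvdD; [apply: mdvd_mulr | apply: mdvd_mull].
Qed.
(* Divisibility by a linear form is tested on its kernel: this makes linear forms prime. *)
Lemma mdvd_lin a p : a != 0 -> mdvd (linform a) p <-> act (projm a) p = 0.
Proof.
move=> a0; split=> [[q ->]|h]; first by rewrite rmorphM /= act_proj_lin ?mul0r.
by have := proj_mod a p; rewrite h subr0.
Qed.
Lemma lin_prime a p q : a != 0 -> mdvd (linform a) (p * q) ->
  mdvd (linform a) p \/ mdvd (linform a) q.
Proof.
move=> a0 /(mdvd_lin _ a0); rewrite rmorphM => /eqP; rewrite mulf_eq0.
by case/orP=> /eqP h; [left|right]; apply/mdvd_lin.
Qed.
Lemma lin_primeX a m p q : a != 0 -> ~ mdvd (linform a) p ->
  mdvd (linform a ^+ m) (p * q) -> mdvd (linform a ^+ m) q.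
Proof.
move=> a0 np; elim: m q => [|m IH] q; first by exists q; rewrite mul1r.
move=> [u]; rewrite exprS -mulrA => e.
have [//|[q' e']] := @lin_prime a p q a0 (ex_intro _ _ e).
rewrite e'; apply: mdvdM; first exact: mdvd_refl.
apply: IH; exists u; apply: (@mulfI _ (linform a)); first by rewrite linform_eq0.
by rewrite -e e' mulrCA.
Qed.
Lemma lin_ndvd a b : a != 0 -> (forall c, b <> c *: a) -> ~ mdvd (linform a) (linform b).
Proof.
move=> a0 h /(mdvd_lin _ a0); rewrite act_lin projmT mul_projm => /eqP.
by rewrite linform_eq0 subr_eq0 => /eqP; apply: h.
Qed.
Lemma lin_dvd_prod (I : Type) (r : seq I) (P : pred I) (F : I -> {mpoly R[n]}) a : a != 0 ->
  (forall i, P i -> ~ mdvd (linform a) (F i)) ->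
  ~ mdvd (linform a) (\prod_(i <- r | P i) F i).
Proof.
move=> a0 h; elim/big_ind: _ => [|p q hp hq|i /h //].
  move=> /(mdvd_lin _ a0); rewrite rmorph1 => /eqP; exact/negP/oner_neq0.
by case/(lin_prime a0).
Qed.
Lemma lin_dvdX a m p : a != 0 -> mdvd (linform a) (p ^+ m) -> mdvd (linform a) p.
Proof.
move=> a0 /(mdvd_lin _ a0); rewrite rmorphXn => /eqP; rewrite expf_eq0 => /andP[_ /eqP h].
exact/mdvd_lin.
Qed.
(** Induction on the list: a form is prime and divides none of the others, so its power still
    divides the cofactor of the product split off before. *)
Lemma lin_coprime_prod (I : eqType) (r : seq I) (v : I -> 'rV[R]_n) (m : I -> nat) p :
  uniq r -> (forall i, i \in r -> v i != 0) ->
  (forall i j, i \in r -> j \in r -> i != j -> forall c, v j <> c *: v i) ->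
  (forall i, i \in r -> mdvd (linform (v i) ^+ m i) p) ->
  mdvd (\prod_(i <- r) linform (v i) ^+ m i) p.
Proof.
elim: r => [|i r IH] /= in p *; first by rewrite big_nil; exists p; rewrite mul1r.
case/andP=> ir ur v0 np hd; rewrite big_cons.
have [u e] : mdvd (\prod_(j <- r) linform (v j) ^+ m j) p.
  apply: IH => // [j jr|j k jr kr|j jr]; first by rewrite v0 ?inE ?jr ?orbT.
    by apply: np; rewrite inE ?jr ?kr orbT.
  by apply: hd; rewrite inE jr orbT.
have h := hd i (mem_head _ _); rewrite {}e in h *.
rewrite mulrC; apply: mdvdM; first exact: mdvd_refl.
apply: lin_primeX h; first by rewrite v0 ?mem_head.
rewrite big_seq; apply: lin_dvd_prod => [|j jr]; first by rewrite v0 ?mem_head.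
move=> /lin_dvdX hx; move: (hx (v0 _ (mem_head _ _))).
apply: lin_ndvd; first by rewrite v0 ?mem_head.
by apply: np; rewrite ?mem_head ?inE ?jr ?orbT //; apply: contraNneq ir => ->.
Qed.

Lemma dotp_reflK (a : 'rV[R]_n) : a != 0 -> refl a *m refl a = 1%:M.
Proof.
move=> a0; apply/row_matrixP => i; rewrite !row1 rowE mulmxA !mul_refl.
set u := delta_mx _ _; rewrite dotpBl dotpZl mulfVK ?dotp_eq0 //.
rewrite -addrA -opprD -scalerDl.
suff -> : 2 * dotp u a / dotp a a + 2 * (dotp u a - 2 * dotp u a) / dotp a a = 0.
  by rewrite scale0r subr0.
by ring.
Qed.
Lemma proj_refl a : a != 0 -> projm a *m refl a = projm a.
Proof.
move=> a0; apply/row_matrixP => i; rewrite !rowE mulmxA mul_refl mul_projm.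
set u := delta_mx _ _; rewrite dotpBl dotpZl mulfVK ?dotp_eq0 //.
by rewrite subrr mulr0 mul0r scale0r subr0.
Qed.
(** A reflection fixes its hyperplane pointwise, so the difference restricts to zero there. *)
Lemma refl_dvd a p : a != 0 -> mdvd (linform a) (act (refl a) p - p).
Proof.
by move=> a0; apply/mdvd_lin => //; rewrite rmorphB /= act_comp proj_refl // subrr.
Qed.
Lemma anti_dvd a p : a != 0 -> act (refl a) p = - p -> mdvd (linform a) p.
Proof.
move=> a0 h; have [q e] := refl_dvd p a0; rewrite h in e.
exists (- 2^-1 *: q); rewrite -scalerAr -e -opprD -mulr2n scaleNr scalerN opprK.
by rewrite -scaler_nat scalerA mulVf ?scale1r ?pnatr_eq0.
Qed.
Lemma act_refl_lin a b : act (refl a) (linform b) = linform (b *m refl a).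
Proof. by rewrite act_lin reflT. Qed.
End OneN.
End LinForms.

End LinearFormDivisibility.

(** * Homogeneous components, derivatives and complex evaluation *)

Module HomogeneousPolynomials.
Import LinearFormDivisibility.

Section Homog.
Variables (R : realType).

Lemma homog_sum n (I : Type) (r : seq I) (P : pred I) (F : I -> {mpoly R[n]}) d :
  (forall i, P i -> F i \is d.-homog) -> \sum_(i <- r | P i) F i \is d.-homog.
Proof. by move=> h; elim/big_ind: _ => //; [exact: dhomog0 | move=> *; exact: dhomogD]. Qed.

Lemma linform_homog n (a : 'rV[R]_n) : linform a \is 1.-homog.
Proof.
apply: homog_sum => i _; apply: dhomogZ; rewrite dhomogX; apply/eqP; exact: mdeg1.
Qed.
Lemma homog_expn n (p : {mpoly R[n]}) d k : p \is d.-homog -> p ^+ k \is (d * k).-homog.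
Proof. exact: dhomogMn. Qed.

Lemma homog_prod_seq n (I : Type) (r : seq I) (F : I -> {mpoly R[n]}) (d : I -> nat) :
  (forall i, F i \is (d i).-homog) ->
  \prod_(i <- r) F i \is (\sum_(i <- r) d i).-homog.
Proof.
move=> h; elim: r => [|i r IH]; first by rewrite !big_nil; exact: dhomog1.
by rewrite !big_cons; apply: dhomogM.
Qed.

Lemma msub_homog m n (t : 'I_m -> {mpoly R[n]}) p d :
  (forall i, t i \is 1.-homog) -> p \is d.-homog -> msub t p \is d.-homog.
Proof.
move=> ht hp; rewrite (mpolyE p) rmorph_sum /= big_seq; apply: homog_sum => k kp.
rewrite msubZ; apply: dhomogZ; rewrite /msub mmapX /mmap1.
have <- : \sum_(i < m) (k i : nat) = d by rewrite -mdegE (dhomog_mf hp kp).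
apply: (@homog_prod_seq _ _ _ (fun i => t i ^+ k i) (fun i => k i : nat)) => i.
by have := homog_expn (k i) (ht i); rewrite mul1n.
Qed.
Lemma act_homog n (g : 'M[R]_n) p d : p \is d.-homog -> act g p \is d.-homog.
Proof. by apply: msub_homog => i; exact: linform_homog. Qed.

Lemma pihomogM n (p q : {mpoly R[n]}) d e : p \is d.-homog ->
  pihomog mdeg (d + e) (p * q) = p * pihomog mdeg e q.
Proof.
move=> hp; rewrite {1}(pihomog_partitionE (leqnn (mmeasure mdeg q))) mulr_sumr raddf_sum /=.
have [lt|ge] := ltnP e (msize q).
  rewrite (bigD1 (Ordinal lt)) //= pihomog_dE; last by apply: dhomogM => //; apply: pihomogP.
  rewrite big1 ?addr0 // => i ie; apply: (@pihomog_ne0 _ _ _ (d + i)%N).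
    by rewrite eqn_add2l; apply: contraNneq ie => h; apply/eqP/val_inj.
  by apply: dhomogM => //; apply: pihomogP.
rewrite big1 => [|i _]; last first.
  apply: (@pihomog_ne0 _ _ _ (d + i)%N).
    by rewrite eqn_add2l neq_ltn (leq_trans (ltn_ord i) ge).
  by apply: dhomogM => //; apply: pihomogP.
rewrite pihomogE big1_seq ?mulr0 // => m /andP[/eqP me /msize_mdeg_lt].
by rewrite me ltnNge ge.
Qed.

Lemma pihomog_all0 n (p : {mpoly R[n]}) : (forall d, pihomog mdeg d p = 0) -> p = 0.
Proof.
by move=> h; rewrite (pihomog_partitionE (leqnn (mmeasure mdeg p))) big1.
Qed.

(** Multiplication by the nonzero [p] shifts components without killing any, so a component of [q]
    in a wrong degree would survive in the product. *)
Lemma homogM_inv n (p q : {mpoly R[n]}) d f : p != 0 -> q != 0 ->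
  p \is d.-homog -> p * q \is f.-homog -> (d <= f)%N /\ q \is (f - d).-homog.
Proof.
move=> p0 q0 hp hpq.
have key e : (d + e)%N != f -> pihomog mdeg e q = 0.
  move=> ne; have := pihomogM q e hp.
  rewrite (@pihomog_ne0 _ _ _ f) // 1?eq_sym //.
  by move/esym/eqP; rewrite mulf_eq0 (negbTE p0) => /eqP.
have le : (d <= f)%N.
  rewrite leqNgt; apply/negP => lt; move/eqP: q0; apply.
  by apply: pihomog_all0 => e; apply: key; lia.
split=> //; suff -> : q = pihomog mdeg (f - d) q by apply: pihomogP.
apply/eqP; rewrite -subr_eq0; apply/eqP/pihomog_all0 => e; rewrite raddfB /=.
have [->|ne] := eqVneq e (f - d)%N.
  by rewrite (pihomog_dE (pihomogP _ _ _)) subrr.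
rewrite (@pihomog_ne0 _ _ _ (f - d)%N e (pihomog mdeg (f - d) q)) 1?eq_sym ?pihomogP // subr0.
apply: key.
by apply: contraNneq ne => <-; rewrite addKn.
Qed.

Lemma homogM_inv' n (p q : {mpoly R[n]}) d e : p != 0 ->
  p \is d.-homog -> p * q \is (d + e).-homog -> q \is e.-homog.
Proof.
move=> p0 hp hpq; have [->|q0] := eqVneq q 0; first exact: dhomog0.
by have [_] := homogM_inv p0 q0 hp hpq; rewrite addKn.
Qed.
Lemma homogM_small n (p q : {mpoly R[n]}) d f : p != 0 ->
  p \is d.-homog -> p * q \is f.-homog -> (f < d)%N -> q = 0.
Proof.
move=> p0 hp hpq lt; apply/eqP; apply: contraTT lt => q0.
by rewrite -leqNgt; case: (homogM_inv p0 q0 hp hpq).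
Qed.
(** The standing device for vanishing: a polynomial divisible by more than its degree allows is
    zero. *)
Lemma mdvd_small n (p q : {mpoly R[n]}) d f : p != 0 -> p \is d.-homog -> q \is f.-homog ->
  mdvd p q -> (f < d)%N -> q = 0.
Proof.
move=> p0 hp hq [u e] lt; have h : p * u \is f.-homog by rewrite -e.
by rewrite e (homogM_small p0 hp h lt) mulr0.
Qed.
Lemma homog0C n (p : {mpoly R[n]}) : p \is 0.-homog -> exists c, p = c%:MP.
Proof.
move=> /dhomogP h; exists p@_0; apply/mpolyP => m; rewrite mcoeffC.
have [->|m0] := eqVneq m 0%MM; first by rewrite ?eqxx mulr1.
rewrite ?(negbTE m0) mulr0; apply/memN_msupp_eq0/negP => /h /eqP.
by rewrite mdeg_eq0 (negbTE m0).
Qed.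
Lemma mdvd_eqdeg n (p q : {mpoly R[n]}) d : p != 0 -> p \is d.-homog -> q \is d.-homog ->
  mdvd p q -> exists c, q = c *: p.
Proof.
move=> p0 hp hq [u e]; have /homog0C [c uc] : u \is 0.-homog.
  by apply: (homogM_inv' p0 hp); rewrite addn0 -e.
by exists c; rewrite e uc mulrC mul_mpolyC.
Qed.

Lemma mderiv_homog n (p : {mpoly R[n]}) d i : p \is d.+1.-homog -> p^`M(i) \is d.-homog.
Proof.
move=> hp; rewrite (mpolyE p) raddf_sum /= big_seq; apply: homog_sum => k kp.
rewrite mderivZ mderivX; apply: dhomogZ.
have [->|ki] := eqVneq (k i) 0%N; first by rewrite scale0r dhomog0.
apply: dhomogZ; rewrite dhomogX /=; apply/eqP.
have ki1 : (U_(i) <= k)%MM by rewrite lep1mP.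
have := mdegD (k - U_(i))%MM U_(i)%MM; rewrite submK // (dhomog_mf hp kp) mdeg1.
by lia.
Qed.

Lemma euler n (p : {mpoly R[n]}) d : p \is d.-homog ->
  \sum_i 'X_i * p^`M(i) = d%:R *: p.
Proof.
move=> hp; under eq_bigr do rewrite {1}(mpolyE p) raddf_sum /= mulr_sumr.
rewrite exchange_big /= [in RHS](mpolyE p) scaler_sumr; rewrite big_seq [RHS]big_seq.
apply: eq_bigr => k kp; have <- : mdeg k = d := dhomog_mf hp kp.
rewrite mdegE natr_sum scaler_suml.
apply: eq_bigr => i _; rewrite mderivZ mderivX -!scalerAr scalerA mulrC -scalerA.
have [->|ki] := eqVneq (k i) 0%N; first by rewrite !scale0r.
have ki1 : (U_(i) <= k)%MM by rewrite lep1mP.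
by rewrite -mpolyXD addmC submK // !scalerA mulrC.
Qed.

Lemma subUmm n (i : 'I_n) : (U_(i) - U_(i) = 0)%MM.
Proof. by apply/mnmP => j; rewrite mnmBE mnm0E subnn. Qed.
Lemma mderiv_lin n (a : 'rV[R]_n) i : (linform a)^`M(i) = (a 0 i)%:MP.
Proof.
rewrite /linform raddf_sum (bigD1 i) //= big1 ?addr0 => [|j ji].
  by rewrite mderivZ mderivX mnm1E eqxx scale1r subUmm mpolyX0 -mul_mpolyC mulr1.
by rewrite mderivZ mderivX mnm1E (negbTE ji) scale0r scaler0.
Qed.
Lemma mderiv_act n (g : 'M[R]_n) p j :
  (act g p)^`M(j) = \sum_i g j i *: act g (p^`M(i)).
Proof.
move: p; apply: mpoly_ring_ind => [c|k|p q hp hq|p q hp hq].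
- rewrite actC mderivC big1 // => i _; by rewrite mderivC rmorph0 scaler0.
- rewrite act_X mderiv_lin (bigD1 k) //= big1 ?addr0 => [|i ik].
    by rewrite mderivX mnm1E eqxx scale1r subUmm mpolyX0 rmorph1 mxE -mul_mpolyC mulr1.
  by rewrite mderivX mnm1E eq_sym (negbTE ik) scale0r rmorph0 scaler0.
- rewrite rmorphD mderivD hp hq -big_split; apply: eq_bigr => i _.
  by rewrite mderivD rmorphD scalerDr.
- rewrite rmorphM mderivM hp hq mulr_suml mulr_sumr -big_split; apply: eq_bigr => i _.
  by rewrite mderivM rmorphD !rmorphM scalerDr -scalerAl -scalerAr.
Qed.
End Homog.

Section CEval.
Variables (R : realType) (n : nat).
Local Notation C := R[i].
Implicit Types (z : 'rV[C]_n) (p : {mpoly R[n]}).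
(** Polynomials stay real while eigenvectors of the Coxeter element are complex; hence evaluation
    over the extension. *)
Definition cev z : {mpoly R[n]} -> C := mmap (real_complex R) (fun i => z 0 i).
HB.instance Definition _ z := GRing.RMorphism.on (cev z).
Lemma cevC z c : cev z c%:MP = c%:C%C. Proof. exact: mmapC. Qed.
Lemma cevZ z c p : cev z (c *: p) = c%:C%C * cev z p. Proof. exact: mmapZ. Qed.
Lemma cevX z i : cev z 'X_i = z 0 i. Proof. by rewrite /cev mmapX mmap1U. Qed.
Lemma cev_lin z (a : 'rV[R]_n) : cev z (linform a) = \sum_i (a 0 i)%:C%C * z 0 i.
Proof. by rewrite /linform rmorph_sum; apply: eq_bigr => i _; rewrite /= cevZ cevX. Qed.
Lemma cev_act z g p : cev z (act g p) = cev (z *m map_mx (real_complex R) g) p.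
Proof.
apply: (mpoly_morph_ext (f := cev z \o act g)) => [c|i] /=; first by rewrite actC !cevC.
rewrite act_X cev_lin cevX mxE; apply: eq_bigr => j _; by rewrite !mxE mulrC.
Qed.
Lemma cev_scale z (t : C) p d : p \is d.-homog -> cev (t *: z) p = t ^+ d * cev z p.
Proof.
move=> hp; rewrite (mpolyE p) !rmorph_sum mulr_sumr big_seq [RHS]big_seq /=.
apply: eq_bigr => k kp; rewrite !cevZ mulrCA; congr (_ * _).
have <- : mdeg k = d := dhomog_mf hp kp.
rewrite /cev !mmapX /mmap1 mdegE -prodrXr -big_split /=.
by apply: eq_bigr => i _; rewrite mxE exprMn.
Qed.
Lemma cev_conj z p : cev (map_mx (@conjc R) z) p = conjc (cev z p).
Proof.
apply: (mpoly_morph_ext (g := (@conjc R : {rmorphism _ -> _}) \o cev z)) => [c|i] /=.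
  by rewrite !cevC conjc_real.
by rewrite !cevX mxE.
Qed.
End CEval.

End HomogeneousPolynomials.

(** * Saito's determinant criterion *)

Module SaitoCriterion.
Import LinearFormDivisibility HomogeneousPolynomials.

Section Saito.
Variables (R : realType) (n : nat).
Local Notation S := {mpoly R[n]}.

Definition cmx m k (A : 'M[R]_(m, k)) : 'M[S]_(m, k) := map_mx (@mpolyC n R) A.
Lemma cmxM m k p (A : 'M[R]_(m, k)) (B : 'M[R]_(k, p)) : cmx (A *m B) = cmx A *m cmx B.
Proof. exact: map_mxM. Qed.
Lemma cmx1 m : cmx (1%:M : 'M[R]_m) = 1%:M. Proof. exact: map_mx1. Qed.
Lemma act_cmx g m k (A : 'M[R]_(m, k)) : map_mx (act g) (cmx A) = cmx A.
Proof. by apply/matrixP => i j; rewrite !mxE actC. Qed.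

Lemma act_scal t (p : S) k : (act t%:M p)@_k = t ^+ mdeg k * p@_k.
Proof.
have aX (m : 'X_{1..n}) : act t%:M 'X_[m] = t ^+ mdeg m *: 'X_[m].
  rewrite mpolyXE_id rmorph_prod /= mdegE -prodrXr -scaler_prod; apply: eq_bigr => i _.
  rewrite rmorphXn /= act_X -exprZn; congr (_ ^+ _).
  rewrite -linform_delta -linformZ; congr linform; apply/rowP => j.
  by rewrite !mxE eqxx /= eq_sym mulr_natr.
rewrite {1}(mpolyE p) rmorph_sum raddf_sum /=.
rewrite [in RHS](mpolyE p) raddf_sum mulr_sumr; apply: eq_bigr => m _ /=.
rewrite actZ aX !mcoeffZ mcoeffX; have [->|_] := eqVneq m k; last by rewrite !mulr0.
by rewrite !mulr1 mulrC.
Qed.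
Lemma scal_homog d (p : S) : p \is d.-homog -> act 2%:M p = 2 ^+ d *: p.
Proof.
move=> hp; apply/mpolyP => k; rewrite act_scal mcoeffZ.
have [kp|/memN_msupp_eq0 ->] := boolP (k \in msupp p); last by rewrite !mulr0.
by rewrite (dhomog_mf hp kp : mdeg k = d).
Qed.
(** A single dilation detects the degree because the powers of 2 are distinct. Homogeneity thus
    becomes an equation, which passes through products and inverses of matrices. *)
Lemma homog_scal d (p : S) : act 2%:M p = 2 ^+ d *: p -> p \is d.-homog.
Proof.
move=> h; apply/dhomogP => k kp; have := congr1 (mcoeff k) h.
rewrite act_scal mcoeffZ => /(mulIf _) e; rewrite mcoeff_msupp in kp.
by apply: (@ieexprIn R 2 _ _ _ _ (e kp)); rewrite ?ltr0n // gt_eqF ?ltr1n.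
Qed.

Lemma det_homog m (M : 'M[S]_m) (d : 'I_m -> nat) :
  (forall i j, M i j \is (d j).-homog) -> \det M \is (\sum_j d j).-homog.
Proof.
move=> h; apply: homog_sum => s _.
have -> : (\sum_j d j = \sum_j d (s j))%N by rewrite (reindex_inj (@perm_inj _ s)).
have hp : \prod_i M i (s i) \is (\sum_j d (s j)).-homog.
  by apply: (@homog_prod_seq _ _ _ _ (fun i => M i (s i)) (fun j => d (s j))) => i.
by case: (perm.odd_perm s); rewrite ?expr1 ?expr0 ?mul1r // mulN1r dhomogN.
Qed.

(** Replacing a suitable row of [M] by the combination with coefficients [a] multiplies the
    determinant by a nonzero constant, and the new row is divisible by [q]. *)
Lemma row_dvd_det m (M : 'M[S]_m) (a : 'rV[R]_m) q :
  a != 0 -> (forall j, mdvd q ((cmx a *m M) 0 j)) -> mdvd q (\det M).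
Proof.
move=> /eqP a0 h; have [i ai] : exists i, a 0 i != 0.
  apply: contrapT => /forallNP ne; apply: a0; apply/rowP => i; rewrite mxE.
  by apply/eqP; have := ne i => /negP; rewrite negbK.
pose M' := \matrix_(k, j) (if k == i then (cmx a *m M) 0 j else M k j).
have e : \det M' = (a 0 i)%:MP * \det M.
  have -> : M' = (\matrix_(k, j) (if k == i then cmx a 0 j else (k == j)%:R)) *m M.
    apply/matrixP => k j; rewrite !mxE; case: eqP => [->|ki].
      by apply: eq_bigr => x _; rewrite !mxE eqxx.
    rewrite (bigD1 k) //= !mxE; case: (k =P i) => // _; rewrite eqxx mul1r big1 ?addr0 // => x xk.
    by rewrite !mxE; case: (k =P i) => // _; rewrite eq_sym (negbTE xk) mul0r.
  rewrite det_mulmx; congr (_ * _).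
  rewrite (expand_det_col _ i) (bigD1 i) //= big1 ?addr0 => [|k ki]; last first.
    by rewrite mxE (negbTE ki) mul0r.
  rewrite mxE eqxx /cofactor addnn -signr_odd odd_double expr0 mul1r mxE.
  set X := row' _ _; suff -> : X = 1%:M by rewrite det1 mulr1.
  by apply/matrixP => x y; rewrite !mxE eq_sym (negbTE (neq_lift _ _)) (inj_eq lift_inj).
have [u eu] : mdvd q (\det M').
  rewrite (expand_det_row _ i); apply: mdvd_sum => j _; apply: mdvd_mulr.
  by rewrite mxE eqxx.
by exists ((a 0 i)^-1%:MP * u); rewrite mulrCA -eu e mulrA -mpolyCM mulVf // mpolyC1 mul1r.
Qed.

Lemma adj_repl (P : 'M[S]_n) (th : 'cV[S]_n) j :
  (\adj P *m th) j 0 = \det (\matrix_(x, y) (if y == j then th x 0 else P x y)).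
Proof.
set N := \matrix_(_, _) _; rewrite (expand_det_col N j) mxE; apply: eq_bigr => k _; rewrite !mxE eqxx mulrC.
rewrite /cofactor; have -> : row' k (col' j N) = row' k (col' j P); last by [].
by apply/matrixP => x y; rewrite !mxE eq_sym (negbTE (neq_lift _ _)).
Qed.
Variables (I : eqType) (r : seq I) (v : I -> 'rV[R]_n) (mu : I -> nat).
Hypothesis ur : uniq r.
Hypothesis v0 : forall i, i \in r -> v i != 0.
Hypothesis vnp : forall i j, i \in r -> j \in r -> i != j -> forall c, v j <> c *: v i.

Definition in_multi (th : 'cV[S]_n) :=
  forall i, i \in r -> mdvd (linform (v i) ^+ mu i) ((cmx (v i) *m th) 0 0).

Lemma det_multi (M : 'M[S]_n) : (forall j, in_multi (col j M)) ->
  mdvd (\prod_(i <- r) linform (v i) ^+ mu i) (\det M).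
Proof.
move=> h; apply: lin_coprime_prod => // i ir; apply: (@row_dvd_det _ _ (v i)); first exact: v0.
move=> j; have := h j i ir; congr mdvd; rewrite !mxE.
by apply: eq_bigr => k _; rewrite !mxE.
Qed.

(** Cramer's rule: with one column of [M] replaced by [th] all columns remain in the module, so the
    determinant is divisible by the product of the forms, that is, by [\det M] up to a constant. The
    quotients are the coefficients. *)
Lemma saito (M : 'M[S]_n) (c : R) : c != 0 ->
  \det M = c *: \prod_(i <- r) linform (v i) ^+ mu i ->
  (forall j, in_multi (col j M)) ->
  forall th, in_multi th -> exists f : 'cV[S]_n, th = M *m f.
Proof.
move=> c0 dM hM th hth; set Q := \prod_(i <- r) _ in dM.
have Q0 : Q != 0.
  rewrite /Q big_seq prodf_seq_neq0; apply/allP => i ir; apply/implyP => _.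
  by rewrite expf_neq0 // linform_eq0 v0.
have key j : mdvd Q ((\adj M *m th) j 0).
  pose N := \matrix_(x, y) (if y == j then th x 0 else M x y).
  have -> : (\adj M *m th) j 0 = \det N.
    exact: adj_repl.
  apply: det_multi => y; have [->|yj] := eqVneq y j.
    suff -> : col j N = th by [].
    by apply/matrixP => x z; rewrite !mxE eqxx (ord1 z).
  suff -> : col y N = col y M by [].
  by apply/matrixP => x z; rewrite !mxE (negbTE yj).
have [f hf] := choice key.
have e : \det M *: th = M *m (Q *: \col_j f j).
  have -> : Q *: (\col_j f j) = \adj M *m th by apply/colP => j; rewrite !mxE -hf mxE.
  by rewrite mulmxA mul_mx_adj mul_scalar_mx.
exists ((c^-1)%:MP *: \col_j f j); apply/matrixP => i x; apply: (mulfI Q0).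
have := congr1 (fun A : 'cV[S]_n => (c^-1)%:MP * A i x) e.
rewrite -!scalemxAr !mxE dM -mul_mpolyC !mulrA -mpolyCM mulVf // mpolyC1 mul1r => ->.
by rewrite [_ * Q]mulrC.
Qed.
End Saito.

End SaitoCriterion.

(** * Terao's bases for constant multiplicities *)

Module TeraoInduction.
Import LinearFormDivisibility HomogeneousPolynomials SaitoCriterion.

Section Terao.
Variables (R : realType) (l : nat).
Local Notation S := {mpoly R[l]}.
Local Notation C := R[i].
(** [J] stands for the Jacobian matrix of basic invariants of degrees [e j + 1], and [jl] for the
    invariant of degree [h]. The vector [z] lies on no reflecting hyperplane, and among invariants
    of positive degree below 2 h only those of degree [h] may be nonzero at it. *)
Variables (Pos : seq 'rV[R]_l) (J : 'M[S]_l) (e : 'I_l -> nat) (h : nat) (jl : 'I_l) (c : R).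
Local Notation Q := (\prod_(a <- Pos) linform a : S).
Hypothesis uPos : uniq Pos.
Hypothesis Pos0 : forall a, a \in Pos -> a != 0.
Hypothesis Posnp : forall a b, a \in Pos -> b \in Pos -> a != b -> forall t, b <> t *: a.
Hypothesis Jhom : forall i j, J i j \is (e j).-homog.
Hypothesis c0 : c != 0.
Hypothesis detJ : \det J = c *: Q.
Hypothesis Jinv : forall a, a \in Pos -> map_mx (act (refl a)) J = cmx l (refl a) *m J.
Hypothesis e_gt0 : forall j, (0 < e j)%N.
Hypothesis e_lth : forall j, (e j < h)%N.
Hypothesis ejl : (e jl).+1 = h.
Hypothesis sum_e : (2 * \sum_j e j = l * h)%N.
Variable z : 'rV[C]_l.
Hypothesis zreg : cev z Q != 0.
Definition winv (f : S) := forall a, a \in Pos -> act (refl a) f = f.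
Definition wanti (f : S) := forall a, a \in Pos -> act (refl a) f = - f.
Hypothesis zinv : forall f d, winv f -> f \is d.-homog -> (0 < d < 2 * h)%N -> d != h ->
  cev z f = 0.
Variable k0 : C.
Hypothesis k00 : k0 != 0.
Hypothesis zJ : forall j, \sum_i z 0 i * cev z (J i j) = (j == jl)%:R * k0.

Let Q0 : Q != 0.
Proof.
rewrite big_seq prodf_seq_neq0; apply/allP => a ha; apply/implyP => _.
by rewrite linform_eq0 Pos0.
Qed.
Let detJ0 : \det J != 0.
Proof. by rewrite detJ scaler_eq0 (negbTE c0). Qed.

Lemma Jcancel (m : nat) (A B : 'M[S]_(l, m)) : J^T *m A = J^T *m B -> A = B.
Proof.
move=> /(congr1 (mulmx (\adj J^T))); rewrite !mulmxA !mul_adj_mx !mul_scalar_mx det_tr.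
move=> /matrixP E; apply/matrixP => i j; have := E i j; rewrite !mxE; exact: mulfI.
Qed.

(** For a Jacobian matrix [J] these are the coefficients of the primitive derivation,
    differentiation along the invariant [jl], multiplied by [\det J] so as to remain polynomial. *)
Definition eta : 'cV[S]_l := locked (col jl (\adj J^T)).
Lemma J_eta : J^T *m eta = \det J *: delta_mx jl 0.
Proof.
rewrite /eta -lock colE mulmxA mul_mx_adj det_tr mul_scalar_mx.
by rewrite [jl in RHS]lock; congr (_ *: _); apply/matrixP => i j; rewrite !mxE (ord1 j) -lock.
Qed.

Let hk : forall a, a \in Pos -> refl a *m refl a = 1%:M.
Proof. by move=> a /Pos0; exact: dotp_reflK. Qed.

(** If a reflection had determinant 1, [Q] would be invariant under it; cancelling the factor of [a]
    would make the product of the other forms anti-invariant, hence divisible by the form of [a]. *)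
Lemma wdetJ a : a \in Pos -> act (refl a) (\det J) = - \det J.
Proof.
move=> ha; rewrite -det_map_mx Jinv // det_mulmx /cmx det_map_mx.
suff -> : \det (refl a) = -1 by rewrite rmorphN1 mulN1r.
have a0 := Pos0 ha.
have : \det (refl a) ^+ 2 = 1 by rewrite expr2 -det_mulmx hk // det1.
move=> /eqP; rewrite sqrf_eq1 => /orP[/eqP d1|/eqP //]; exfalso.
have inv : act (refl a) (\det J) = \det J.
  by rewrite -det_map_mx Jinv // det_mulmx /cmx det_map_mx d1 rmorph1 mul1r.
have Qi : act (refl a) Q = Q.
  apply: (@scalerI _ _ c) => //; move: inv; rewrite detJ actZ //.
move: Qi; rewrite (big_rem a) //= rmorphM /= act_refl_lin mul_refl -mulrA divff ?dotp_eq0 //.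
rewrite mulr1 -[a in a - _]scale1r -scalerBl (_ : 1 - 2 = -1 :> R); last by ring.
rewrite scaleN1r linformN mulNr -mulrN => /(mulfI _) E2.
have {}E2 : act (refl a) (\prod_(y <- rem a Pos) linform y) = - \prod_(y <- rem a Pos) linform y.
  by rewrite -[in RHS]E2 ?opprK // linform_eq0.
have := anti_dvd a0 E2; rewrite big_seq; apply: lin_dvd_prod => // b.
rewrite mem_rem_uniq // inE => /andP[ba hb]; apply: lin_ndvd => //.
by apply: Posnp => //; rewrite eq_sym.
Qed.

Lemma wQ a : a \in Pos -> act (refl a) Q = - Q.
Proof.
by move=> ha; apply: (@scalerI _ _ c) => //; rewrite -actZ -detJ wdetJ // detJ scalerN.
Qed.

Lemma wanti_dvd f : wanti f -> mdvd Q f.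
Proof.
move=> hf; have := @lin_coprime_prod R l _ Pos id (fun=> 1%N) f uPos Pos0 Posnp.
by apply=> a ha; rewrite expr1; apply: anti_dvd; [exact: Pos0 | exact: hf].
Qed.

Definition dD (f : S) : S := \sum_i eta i 0 * f^`M(i).
Lemma dD_additive : additive dD.
Proof.
by move=> p q; rewrite /dD -sumrB; apply: eq_bigr => i _; rewrite mderivB mulrBr.
Qed.
HB.instance Definition _ := GRing.isAdditive.Build S S dD dD_additive.
Lemma dDM p q : dD (p * q) = dD p * q + p * dD q.
Proof.
rewrite /dD mulr_suml mulr_sumr -big_split; apply: eq_bigr => i _ /=.
by rewrite mderivM mulrDr !mulrA [p * eta i 0]mulrC.
Qed.
Lemma dDC t : dD t%:MP = 0.
Proof. by rewrite /dD big1 // => i _; rewrite mderivC mulr0. Qed.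
Lemma dD_lin a : dD (linform a) = (cmx l a *m eta) 0 0.
Proof. by rewrite /dD mxE; apply: eq_bigr => i _; rewrite mderiv_lin mxE mulrC. Qed.
Lemma dD_mulmx m n p (A : 'M[S]_(m, n)) (B : 'M[S]_(n, p)) :
  map_mx dD (A *m B) = map_mx dD A *m B + A *m map_mx dD B.
Proof.
apply/matrixP => i j; rewrite !mxE raddf_sum /= -big_split; apply: eq_bigr => k _.
by rewrite dDM !mxE.
Qed.
Lemma dD_cmx m n (A : 'M[R]_(m, n)) : map_mx dD (cmx l A) = 0.
Proof. by apply/matrixP => i j; rewrite !mxE dDC. Qed.

Lemma eta_equiv a : a \in Pos -> map_mx (act (refl a)) eta = - (cmx l (refl a) *m eta).
Proof.
move=> ha; have E := congr1 (map_mx (act (refl a))) J_eta.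
rewrite map_mxM -map_trmx Jinv // trmx_mul map_trmx reflT -mulmxA in E.
have {}E : J^T *m (cmx l (refl a) *m map_mx (act (refl a)) eta) = J^T *m (- eta).
  rewrite E mulmxN J_eta -scaleNr; apply/matrixP => i j; rewrite !mxE rmorphM /= wdetJ //.
  by rewrite rmorph_nat.
have := congr1 (mulmx (cmx l (refl a))) (Jcancel E).
by rewrite mulmxA -cmxM hk // cmx1 mul1mx mulmxN.
Qed.

Lemma dD_act a f : a \in Pos -> act (refl a) (dD f) = - dD (act (refl a) f).
Proof.
move=> ha; rewrite /dD rmorph_sum /= -sumrN.
have E i : act (refl a) (eta i 0) = - \sum_k (refl a i k)%:MP * eta k 0.
  have := congr1 (fun A : 'cV[S]_l => A i 0) (eta_equiv ha); rewrite !mxE => ->.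
  by congr (- _); apply: eq_bigr => k _; rewrite mxE.
under eq_bigr do rewrite rmorphM /= E mulNr mulr_suml.
under [RHS]eq_bigr do rewrite mderiv_act mulr_sumr.
rewrite !sumrN; congr (- _); rewrite exchange_big /=; apply: eq_bigr => i _.
apply: eq_bigr => k _; rewrite -mul_mpolyC mulrA; congr (_ * _); rewrite mulrC; congr (_ * _%:MP).
by have := congr1 (fun A : 'M[R]_l => A i k) (reflT a); rewrite mxE.
Qed.

Local Notation N := (\sum_j e j)%N.
Lemma Nge : (h.-1 <= N)%N.
Proof. by rewrite -ejl (bigD1 jl) //= leq_addr. Qed.
Lemma eta_hom i : eta i 0 \is (N - h.-1).-homog.
Proof.
apply: homog_scal; move: i; suff H : map_mx (act 2%:M) eta = (2 ^+ (N - h.-1))%:MP *: eta.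
  by move=> i; have := congr1 (fun A : 'cV[S]_l => A i 0) H; rewrite !mxE mul_mpolyC.
apply: (@Jcancel 1); apply/colP => j.
have dh : \det J \is N.-homog by apply: det_homog.
have E := congr1 (fun A : 'cV[S]_l => A j 0) (congr1 (map_mx (act 2%:M)) J_eta).
have jn : ((e jl) <= N)%N by rewrite (bigD1 jl) //= leq_addr.
rewrite /= map_mxM in E; rewrite !mxE in E; rewrite -scalemxAr J_eta !mxE.
apply: (@scalerI _ _ (2 ^+ e j : R)); first by rewrite expf_neq0 // pnatr_eq0.
transitivity (\sum_k (map_mx (act 2%:M) J^T) j k * (map_mx (act 2%:M) eta) k 0).
  rewrite scaler_sumr; apply: eq_bigr => k _.
  by rewrite !mxE (scal_homog (Jhom k j)) scalerAl.
rewrite E rmorphM /= (scal_homog dh) rmorph_nat eqxx andbT.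
case: (j =P jl) => [->|_]; last by rewrite !mulr0 !scaler0.
by rewrite !mulr1 mul_mpolyC scalerA -exprD -ejl /= subnKC.
Qed.
Lemma dD_hom f d : f \is d.+1.-homog -> dD f \is (d + (N - h.-1)).-homog.
Proof.
move=> hf; apply: homog_sum => i _; rewrite addnC.
by apply: dhomogM; [exact: eta_hom | exact: mderiv_homog].
Qed.
Lemma Q_hom : Q \is N.-homog.
Proof.
have -> : Q = c^-1 *: \det J by rewrite detJ scalerA mulVf ?scale1r.
by apply: dhomogZ; apply: det_homog.
Qed.

(** The image is anti-invariant, hence divisible by [Q]; yet its degree, d - 1 - (h - 1) plus the
    degree of [Q], is too small. *)
Lemma dD_low f d : winv f -> f \is d.-homog -> (d < h)%N -> dD f = 0.
Proof.
case: d => [|d] wf hf dh.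
  by have [t ->] := homog0C hf; rewrite dDC.
have an : wanti (dD f) by move=> a ha; rewrite dD_act // wf.
apply: (mdvd_small Q0 Q_hom (dD_hom hf) (wanti_dvd an)).
by have := Nge; have := e_gt0 jl; move: ejl dh; lia.
Qed.

Lemma exB : exists B : 'M[S]_l, J^T *m map_mx dD J = Q *: B.
Proof.
have H i j : mdvd Q ((J^T *m map_mx dD J) i j).
  apply: wanti_dvd => a ha.
  have := congr1 (fun A : 'M[S]_l => A i j) (map_mxM (act (refl a)) J^T (map_mx dD J)).
  rewrite /= [LHS]mxE => ->; rewrite -map_trmx Jinv //.
  have -> : map_mx (act (refl a)) (map_mx dD J) = - (cmx l (refl a) *m map_mx dD J).
    transitivity (- map_mx dD (cmx l (refl a) *m J)).
      by rewrite -Jinv //; apply/matrixP => x y; rewrite !mxE dD_act.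
    by rewrite dD_mulmx dD_cmx mul0mx add0r.
  rewrite trmx_mul map_trmx reflT mulmxN -mulmxA [cmx l _ *m (_ *m _)]mulmxA.
  by rewrite -cmxM hk // cmx1 mul1mx mxE.
have H2 (x : 'I_l * 'I_l) : mdvd Q ((J^T *m map_mx dD J) x.1 x.2) by [].
have [B hB] := choice H2; exists (\matrix_(i, j) B (i, j)).
by apply/matrixP => i j; rewrite !mxE -(hB (i, j)) mxE.
Qed.
(** Since [dD] is [c * Q] times the primitive derivation, this is J^T times the primitive derivative
    of J, up to the constant [c]. *)
Definition B : 'M[S]_l := projT1 (cid exB).
Lemma BE : J^T *m map_mx dD J = Q *: B.
Proof. exact: (projT2 (cid exB)). Qed.
Lemma B_inv i j : winv (B i j).
Proof.
move=> a ha; have E := congr1 (map_mx (act (refl a))) BE.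
have := congr1 (fun A : 'M[S]_l => A i j) E; rewrite map_mxM -map_trmx Jinv //.
have -> : map_mx (act (refl a)) (map_mx dD J) = - (cmx l (refl a) *m map_mx dD J).
  transitivity (- map_mx dD (cmx l (refl a) *m J)).
    by rewrite -Jinv //; apply/matrixP => x y; rewrite !mxE dD_act.
  by rewrite dD_mulmx dD_cmx mul0mx add0r.
rewrite trmx_mul map_trmx reflT mulmxN -mulmxA [cmx l _ *m (_ *m _)]mulmxA.
rewrite -cmxM hk // cmx1 mul1mx BE !mxE rmorphM /= wQ // mulNr => /oppr_inj.
by move/(mulfI Q0).
Qed.
Lemma B_hom i j : if (h <= e i + e j)%N then B i j \is (e i + e j - h).-homog
  else B i j == 0.
Proof.
have E : Q * B i j = (J^T *m map_mx dD J) i j by rewrite BE mxE.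
have H : Q * B i j \is (e i + ((e j).-1 + (N - h.-1))).-homog.
  rewrite E mxE; apply: homog_sum => k _; rewrite !mxE; apply: dhomogM => //.
  by apply: dD_hom; rewrite prednK.
have := Nge; have := e_gt0 j; have := e_gt0 i; have := ejl.
case: ifP => le h1 h2 h3 h4.
  by apply: (homogM_inv' Q0 Q_hom); move: H; congr (_ \is _.-homog); lia.
by apply/eqP/(homogM_small Q0 Q_hom H); lia.
Qed.
(** The entries are invariants of degree e_i + e_j - h, below h, and [dD_low] kills them. *)
Lemma dD_B : map_mx dD B = 0.
Proof.
apply/matrixP => i j; rewrite !mxE; have := B_hom i j; case: ifP => [le|_ /eqP ->].
  move=> hB; apply: (dD_low (@B_inv i j) hB).
  by have := e_lth i; have := e_lth j; move: le; lia.
by rewrite raddf0.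
Qed.

(** The Gram matrix of the differentials of the invariants; its primitive derivative, again up to
    [c], is the flat form [G1]. *)
Definition G := locked (J^T *m J).
Lemma GE : G = J^T *m J. Proof. by rewrite /G -lock. Qed.
Definition G1 := locked (B + B^T).
Lemma G1E : G1 = B + B^T. Proof. by rewrite /G1 -lock. Qed.
Lemma dD_G : map_mx dD G = Q *: G1.
Proof.
rewrite GE G1E dD_mulmx BE scalerDr addrC; congr (_ + _).
by have := congr1 trmx BE; rewrite trmx_mul trmxK linearZ /= map_trmx.
Qed.
Lemma dD_G1 : map_mx dD G1 = 0.
Proof. by rewrite G1E map_mxD -map_trmx dD_B trmx0 addr0. Qed.
Definition Bk k := B + G1 *+ k.
Lemma BkS k : Bk k.+1 = Bk k + G1.
Proof. by rewrite /Bk mulrSr addrA. Qed.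
Lemma dD_Bk k : map_mx dD (Bk k) = 0.
Proof.
elim: k => [|k IH]; first by rewrite /Bk mulr0n addr0 dD_B.
by rewrite BkS map_mxD IH dD_G1 addr0.
Qed.

(** Weights of the dilation by 2. The degrees of all entries of a matrix become one matrix equation,
    which can be inverted together with [Bk k]. *)
Definition Dg : 'M[S]_l := diag_mx (\row_j (2 ^+ e j)%:MP).
Lemma mulDg m (A : 'M[S]_(m, l)) i j : (A *m Dg) i j = A i j * (2 ^+ e j)%:MP.
Proof. by rewrite mul_mx_diag !mxE. Qed.
Lemma Dgmul m (A : 'M[S]_(l, m)) i j : (Dg *m A) i j = (2 ^+ e i)%:MP * A i j.
Proof. by rewrite mul_diag_mx !mxE. Qed.
Lemma two0 k : (2 ^+ k)%:MP != 0 :> S.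
Proof. by rewrite mpolyC_eq0 expf_neq0 // pnatr_eq0. Qed.
Lemma Dg_cancel m (A B' : 'M[S]_(l, m)) : Dg *m A = Dg *m B' -> A = B'.
Proof.
move=> E; apply/matrixP => i j; have := congr1 (fun X : 'M[S]_(l, m) => X i j) E.
by rewrite !Dgmul => /(mulfI (two0 _)).
Qed.
Local Notation sg := (map_mx (act 2%:M)).
Lemma sgJ : sg J = J *m Dg.
Proof. by apply/matrixP => i j; rewrite mulDg !mxE (scal_homog (Jhom i j)) mulrC mul_mpolyC. Qed.
Lemma trDg : Dg^T = Dg. Proof. exact: tr_diag_mx. Qed.
Lemma sgG : sg G = Dg *m G *m Dg.
Proof.
by rewrite GE map_mxM -map_trmx sgJ trmx_mul trDg -!mulmxA.
Qed.
Lemma sgB : (2 ^+ h)%:MP *: sg B = Dg *m B *m Dg.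
Proof.
apply/matrixP => i j; rewrite mulDg Dgmul !mxE; have := B_hom i j.
case: ifP => [le hB|_ /eqP ->]; last by rewrite rmorph0 !(mulr0, mul0r).
rewrite (scal_homog hB) -mul_mpolyC !mulrA -mpolyCM -exprD subnKC //.
by rewrite mulrAC -mpolyCM -exprD.
Qed.
Lemma sgG1 : (2 ^+ h)%:MP *: sg G1 = Dg *m G1 *m Dg.
Proof.
rewrite G1E map_mxD scalerDr sgB mulmxDr mulmxDl; congr (_ + _).
have := congr1 trmx sgB; rewrite linearZ /= map_trmx => ->.
by rewrite !trmx_mul trDg mulmxA.
Qed.
Lemma sgBk k : (2 ^+ h)%:MP *: sg (Bk k) = Dg *m Bk k *m Dg.
Proof.
elim: k => [|k IH]; first by rewrite /Bk mulr0n addr0 sgB.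
by rewrite BkS map_mxD scalerDr IH sgG1 -mulmxDl -mulmxDr.
Qed.
(** Entry (i, j) has weight e_i + e_j - h, so the determinant has weight 2 (sum of e) - l h = 0. *)
Lemma detBk_const k : exists t, \det (Bk k) = t%:MP.
Proof.
apply: homog0C; apply: homog_scal; rewrite expr0 scale1r.
have := congr1 determinant (sgBk k); rewrite detZ !det_mulmx det_map_mx /= => E.
have dDg : \det Dg = (2 ^+ N)%:MP.
  by rewrite det_diag -prodrXr rmorph_prod; apply: eq_bigr => i _; rewrite mxE.
rewrite -rmorphXn /= -exprM dDg mulrAC -mpolyCM -exprD addnn -mul2n sum_e mulnC in E.
exact: (mulfI (two0 _) E).
Qed.

Local Notation Jz := (map_mx (cev z) J).
Lemma cev_detJ : \det Jz != 0.
Proof.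
rewrite det_map_mx /= detJ cevZ mulf_neq0 //.
by rewrite fmorph_eq0.
Qed.
Lemma cev_eta i : cev z (eta i 0) = cev z (\det J) / k0 * z 0 i.
Proof.
have E1 : Jz^T *m map_mx (cev z) eta = Jz^T *m ((cev z (\det J) / k0) *: z^T).
  rewrite map_trmx -map_mxM J_eta -scalemxAr; apply/colP => j; rewrite !mxE rmorphM rmorph_nat /=.
  have -> : \sum_k map_mx (cev z) J^T j k * z^T k 0 = (j == jl)%:R * k0.
    by rewrite -zJ; apply: eq_bigr => k _; rewrite !mxE mulrC.
  by rewrite eqxx andbT mulrCA -!mulrA [k0^-1 * _]mulrC mulfV ?mulr1 // mulrC.
have u : Jz^T \in unitmx by rewrite unitmxE det_tr unitfE cev_detJ.
have := congr1 (mulmx (invmx Jz^T)) E1; rewrite !mulKmx // => E2.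
by have := congr1 (fun A : 'cV[C]_l => A i 0) E2; rewrite !mxE.
Qed.
Lemma cev_dD f d : f \is d.-homog -> cev z (dD f) = cev z (\det J) / k0 * d%:R * cev z f.
Proof.
move=> hf; rewrite /dD rmorph_sum /=; under eq_bigr do rewrite rmorphM /= cev_eta.
set K := _ / k0; under eq_bigr do rewrite -mulrA.
rewrite -mulr_sumr -[RHS]mulrA; congr (_ * _).
have := congr1 (cev z) (euler hf); rewrite rmorph_sum /= cevZ rmorph_nat => <-.
by apply: eq_bigr => i _; rewrite rmorphM /= cevX.
Qed.
Local Notation Gz := (map_mx (cev z) G).
Lemma Gz0 i j : (e i + e j)%N != h -> Gz i j = 0.
Proof.
move=> ne; rewrite mxE; apply: (@zinv _ (e i + e j)) => //.
- rewrite GE => a ha; have := congr1 (fun A : 'M[S]_l => A i j) (map_mxM (act (refl a)) J^T J).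
  rewrite /= [LHS]mxE => ->; rewrite -map_trmx Jinv // trmx_mul map_trmx reflT -mulmxA.
  by rewrite [cmx l _ *m (_ *m _)]mulmxA -cmxM hk // cmx1 mul1mx.
- by rewrite GE mxE; apply: homog_sum => k _; rewrite mxE; apply: dhomogM.
- by have := e_gt0 i; have := e_lth i; have := e_lth j; lia.
Qed.
Local Notation tau := (c%:C%C / k0).
Lemma cev_B i j : cev z (B i j) = tau * (Gz i j * (e j)%:R).
Proof.
have := congr1 (map_mx (cev z)) BE; rewrite map_mxM => E.
have := congr1 (fun A : 'M[C]_l => A i j) E.
rewrite !mxE rmorphM /= => E2; apply: (mulfI zreg); rewrite -E2.
transitivity (\sum_k cev z Q * (tau * (cev z (J^T i k * J k j) * (e j)%:R))); last first.
  by rewrite -mulr_sumr -mulr_sumr -mulr_suml GE [(J^T *m J) i j]mxE rmorph_sum.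
apply: eq_bigr => k _; rewrite !mxE (cev_dD (Jhom k j)) detJ cevZ rmorphM /=.
move: (cev z Q) (cev z (J k i)) (cev z (J k j)) => x y w.
by move: (c%:C%C) (k0^-1) ((e j)%:R : C) => u v t; ring.
Qed.
Lemma cev_G1 i j : cev z (G1 i j) = tau * h%:R * Gz i j.
Proof.
rewrite G1E [(B + _) i j]mxE [B^T i j]mxE rmorphD /= !cev_B.
have -> : Gz j i = Gz i j.
  rewrite [LHS]mxE [RHS]mxE GE; congr (cev z _); rewrite [LHS]mxE [RHS]mxE.
  by apply: eq_bigr => k _; rewrite [J^T j k]mxE [J^T i k]mxE mulrC.
have [E|ne] := eqVneq (e i + e j)%N h; last by rewrite Gz0 // !(mulr0, mul0r) addr0.
rewrite -E natrD; move: (c%:C%C) (k0^-1) ((e j)%:R : C) ((e i)%:R : C) (Gz i j) => u v t t' g.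
by ring.
Qed.
(** Only entries of [G] with e_i + e_j = h survive at [z]; on these [B] contributes the factor e_j
    and every copy of [G1] the factor h. *)
Lemma cev_Bk k : map_mx (cev z) (Bk k) = tau *: (Gz *m diag_mx (\row_j (e j + k * h)%:R)).
Proof.
apply/matrixP => i j.
have -> : map_mx (cev z) (Bk k) i j = tau * (Gz i j * (e j)%:R) + (tau * h%:R * Gz i j) *+ k.
  rewrite mxE /Bk; elim: k => [|k IH]; first by rewrite !mulr0n !addr0 cev_B.
  by rewrite [in LHS]mulrSr addrA [(_ + G1) i j]mxE rmorphD /= IH cev_G1 -addrA -mulrSr.
rewrite [RHS]mxE mul_mx_diag [X in _ = tau * X]mxE [(\row_j _) _ _]mxE natrD natrM.
rewrite -[(_ * Gz i j) *+ k]mulr_natr.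
by move: (c%:C%C) (k0^-1) (Gz i j) => u v g; ring.
Qed.
(** The determinant is constant, so one value suffices. At [z] the matrix is [G], invertible there,
    times a diagonal matrix with positive entries e_j + k h, up to a nonzero scalar. *)
Lemma Bk_unit k : Bk k \in unitmx.
Proof.
have [t E] := detBk_const k; rewrite unitmxE E; suff t0 : t != 0.
  apply/unitrP; exists (t^-1)%:MP; by rewrite -!mpolyCM mulfV // mulVf.
apply: contraTneq isT => t0.
have : \det (map_mx (cev z) (Bk k)) = 0 by rewrite det_map_mx /= E t0 mpolyC0 rmorph0.
rewrite cev_Bk detZ det_mulmx det_diag GE map_mxM -map_trmx det_mulmx det_tr => /eqP.
rewrite !mulf_eq0 (negbTE cev_detJ) /= expf_eq0 mulf_eq0 invr_eq0 (negbTE k00) orbF.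
rewrite fmorph_eq0 (negbTE c0) andbF /= prodf_seq_eq0 => /hasP[j _ /=].
by rewrite mxE pnatr_eq0 addn_eq0 -[e j == 0]negbK -lt0n e_gt0.
Qed.
Local Notation Bi k := (invmx (Bk k)).

(** Inverting [Bk] amounts to integrating once along the primitive derivation: by [dD_Rodd],
    differentiating [Rodd k.+1] returns [Rodd k] up to [Q] and an invertible matrix. Each round adds
    2 to the multiplicity and h to the degrees. *)
Fixpoint Rodd k : 'M[S]_l := if k is k'.+1 then Rodd k' *m Bi k' *m G else J.
Definition Reven k : 'M[S]_l := if k is k'.+1 then Rodd k' *m Bi k' *m J^T else 1%:M.

Lemma dD_Bi k : map_mx dD (Bi k) = 0.
Proof.
have := congr1 (map_mx dD) (mulmxV (Bk_unit k)); rewrite dD_mulmx dD_Bk mul0mx add0r.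
have -> : map_mx dD (1%:M : 'M[S]_l) = 0 by rewrite -(cmx1 R l) dD_cmx.
by move=> /(congr1 (mulmx (Bi k))); rewrite mulmx0 mulKmx ?Bk_unit.
Qed.
Lemma dD_J : map_mx dD J *m Bi 0 *m J^T = Q%:M.
Proof.
apply: Jcancel; rewrite !mulmxA BE -scalemxAl.
have -> : B = Bk 0 by rewrite /Bk mulr0n addr0.
by rewrite mulmxV ?Bk_unit // scalemx1 mul_mx_scalar mul_scalar_mx.
Qed.
Lemma dD_Rodd k : map_mx dD (Rodd k.+1) = Q *: (Rodd k *m Bi k *m Bk k.+1).
Proof.
elim: k => [|k IH].
  rewrite /= (dD_mulmx _ G) dD_G (dD_mulmx J) dD_Bi mulmx0 addr0 -scalemxAr BkS (mulmxDr _ (Bk 0) G1) scalerDr.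
  by congr (_ + _); rewrite mulmxKV ?Bk_unit // GE mulmxA dD_J mul_scalar_mx.
rewrite [Rodd k.+2]/= (dD_mulmx _ G) dD_G (dD_mulmx (_ *m G)) -[Rodd k *m _ *m G]/(Rodd k.+1) IH.
rewrite dD_Bi mulmx0 addr0.
rewrite -scalemxAr (BkS k.+1) (mulmxDr _ (Bk k.+1) G1) scalerDr; congr (_ + _).
rewrite mulmxKV ?Bk_unit // -!scalemxAl; congr (_ *: _).
by rewrite mulmxK ?Bk_unit.
Qed.

Section OneRoot.
Variable a : 'rV[R]_l.
Hypothesis ha : a \in Pos.
Let al : S := linform a.
Let al0 : al != 0. Proof. by rewrite linform_eq0 Pos0. Qed.
Lemma Q_split : exists2 q, Q = al * q & ~ mdvd al q.
Proof.
exists (\prod_(b <- rem a Pos) linform b); first by rewrite (big_rem a).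
rewrite big_seq; apply: lin_dvd_prod => [|b]; first exact: Pos0.
rewrite mem_rem_uniq // inE => /andP[ba hb]; apply: lin_ndvd; first exact: Pos0.
by apply: Posnp => //; rewrite eq_sym.
Qed.
(** Otherwise equivariance makes every entry of [eta] divisible by [al], hence every entry of
    [dD J], and its determinant by al^l. As [\det J] has one more factor, al^(l+1) would divide the
    determinant Q^l [\det B] of [BE], where [\det B] is a nonzero constant and [Q] contains [al]
    only once. *)
Lemma dDa_ndvd : ~ mdvd al (dD al).
Proof.
rewrite dD_lin => -[u hu].
have aeta i : mdvd al (eta i 0).
  have := refl_dvd (eta i 0) (Pos0 ha).
  have := congr1 (fun A : 'cV[S]_l => A i 0) (eta_equiv ha); rewrite mxE => ->.
  have -> : cmx l (refl a) *m eta = eta - (2 / dotp a a)%:MP *: ((cmx l a)^T *m (cmx l a *m eta)).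
    rewrite /cmx /refl map_mxB map_mx1 mulmxBl mul1mx map_mxZ map_mxM -scalemxAl mulmxA.
    by rewrite map_trmx.
  have -> : cmx l a *m eta = (al * u)%:M by rewrite [LHS]mx11_scalar hu.
  move=> [w hw]; rewrite mul_mx_scalar !mxE in hw.
  exists (2^-1 *: ((2 / dotp a a) *: ((a 0 i)%:MP * u) - w)).
  have <- : - 2^-1 *: (- eta i 0 *+ 2) = eta i 0.
    by rewrite -scaler_nat scalerA mulNr mulVf ?pnatr_eq0 // scaleN1r opprK.
  rewrite -scalerAr mulrBr -hw scaleNr -scalerN; congr (_ *: _).
  rewrite -mul_mpolyC; rewrite mulr2n; ring.
have adD f : mdvd al (dD f) by apply: mdvd_sum => i _; apply: mdvd_mulr.
have [q Qq nq] := Q_split.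
have H1 : mdvd (al ^+ l) (\det (map_mx dD J)).
  apply: mdvd_sum => s _; apply: mdvd_mull.
  have -> : al ^+ l = \prod_(i < l) al by rewrite prodr_const card_ord.
  elim/big_rec2: _ => [|i x y _ hxy]; first exact: mdvd_refl.
  by apply: mdvdM => //; rewrite mxE; exact: adD.
have := congr1 determinant BE; rewrite det_mulmx det_tr detZ detJ Qq.
have [t E] := detBk_const 0; have := Bk_unit 0; rewrite /Bk mulr0n addr0 in E *.
rewrite unitmxE E => ut; rewrite exprMn.
have t0 : t != 0 by apply: contraTneq ut => ->; rewrite mpolyC0 unitr0.
have [y ->] := H1 => E2.
have {}E2 : mdvd al (q ^+ l * t%:MP).
  exists (c *: q * y); apply: (mulfI (expf_neq0 l al0)).
  rewrite mulrA -E2 -!scalerAl -!scalerAr; congr (_ *: _); ring.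
case: (lin_prime (Pos0 ha) E2) => [/(lin_dvdX (Pos0 ha)) //|[x /(congr1 ( *%R (t^-1)%:MP))]].
rewrite -mpolyCM mulVf // mulrCA => E3.
have : mdvd al 1 by exists ((t^-1)%:MP * x); rewrite -E3 mpolyC1.
by move/(mdvd_lin _ (Pos0 ha)) => /eqP; rewrite rmorph1 oner_eq0.
Qed.
(** In the product rule the term m al^(m-1) dD(al) g must be divisible by al^m, and the prime [al]
    does not divide dD(al). *)
Lemma gain m g : (0 < m)%N -> mdvd (al ^+ m) (dD (al ^+ m * g)) -> mdvd al g.
Proof.
have dX k : dD (al ^+ k.+1) = k.+1%:R * (al ^+ k * dD al).
  elim: k => [|k IH]; first by rewrite expr1 expr0 !mul1r.
  by rewrite exprS dDM IH [k.+2%:R]mulrSr exprS; ring.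
case: m => // m _ [u]; rewrite dDM dX => E.
have {}E : m.+1%:R * (dD al * g) = al * (u - dD g).
  apply: (mulfI (expf_neq0 m al0)); rewrite [RHS]mulrA -exprSr mulrBr -E addrK.
  by move: (m.+1%:R : S) (al ^+ m) (dD al) => x y w; ring.
have : mdvd al (dD al * g).
  exists (m.+1%:R^-1 *: (u - dD g)); rewrite -scalerAr -E mulr_natl -scaler_nat scalerA.
  by rewrite mulVf ?pnatr_eq0 // scale1r.
by case/(lin_prime (Pos0 ha)) => // /dDa_ndvd.
Qed.
(** The recursion keeps the exponent 2k + 1. The derivative, by [dD_Rodd], carries one more factor
    from [Q], so [gain] applies twice and yields 2k + 3. *)
Lemma Rodd_dvd k j : mdvd (al ^+ k.*2.+1) ((cmx l a *m Rodd k) 0 j).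
Proof.
elim: k j => [|k IH] j.
  rewrite expr1; have := congr1 (mulmx (cmx l a)) (Jinv ha).
  rewrite mulmxA -cmxM mul_refl -mulrA divff ?dotp_eq0 ?Pos0 // mulr1.
  rewrite -[X in cmx l (X - _)]scale1r -scalerBl (_ : 1 - 2 = -1 :> R); last by ring.
  rewrite scaleN1r => E; apply: anti_dvd; first exact: Pos0.
  have := congr1 (fun A : 'rV[S]_l => A 0 j) E; rewrite /= -{1}(act_cmx (refl a) a) -map_mxM mxE => ->.
  by rewrite /cmx map_mxN mulNmx mxE.
have h1 : mdvd (al ^+ k.*2.+1) ((cmx l a *m Rodd k.+1) 0 j).
  rewrite /= !mulmxA mxE; apply: mdvd_sum => x _; apply: mdvd_mulr.
  by rewrite mxE; apply: mdvd_sum => y _; apply: mdvd_mulr; exact: IH.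
have h2 : mdvd (al ^+ k.*2.+2) (dD ((cmx l a *m Rodd k.+1) 0 j)).
  have := congr1 (fun A : 'rV[S]_l => A 0 j) (dD_mulmx (cmx l a) (Rodd k.+1)).
  rewrite dD_cmx mul0mx add0r dD_Rodd -scalemxAr mxE => ->; rewrite mxE exprS.
  apply: mdvdM; first by have [q -> _] := Q_split; apply/mdvd_mulr/mdvd_refl.
  rewrite !mulmxA mxE; apply: mdvd_sum => x _; apply: mdvd_mulr.
  by rewrite mxE; apply: mdvd_sum => y _; apply: mdvd_mulr; exact: IH.
case: h1 => g E; rewrite E in h2 *.
have [g' E'] : mdvd al g.
  by apply: (@gain k.*2.+1) => //; apply: mdvd_trans h2; apply: mdvd_exp; lia.
have E2 : al ^+ k.*2.+1 * g = al ^+ k.*2.+2 * g' by rewrite E' [in RHS]exprSr mulrA.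
rewrite E2 in h2 *; have [g'' ->] := gain (isT : (0 < k.*2.+2)%N) h2.
by exists g''; rewrite doubleS [in RHS]exprSr mulrA.
Qed.
(** Multiplied by [J] this matrix becomes [Rodd k], and [\det J] contains [al] exactly once, so
    passing back through [\adj J] costs one factor. *)
Lemma Reven_dvd k j : mdvd (al ^+ k.*2) ((cmx l a *m Reven k) 0 j).
Proof.
case: k => [|k]; first by rewrite expr0; eexists; rewrite mul1r.
have E : Reven k.+1 *m J = Rodd k.+1 by rewrite /= GE !mulmxA.
have E2 : (cmx l a *m Reven k.+1) *m (\det J)%:M = (cmx l a *m Rodd k.+1) *m \adj J.
  by rewrite -E -!mulmxA mul_mx_adj.
have : mdvd (al ^+ k.+1.*2.+1) ((\det J) * (cmx l a *m Reven k.+1) 0 j).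
  have := congr1 (fun A : 'rV[S]_l => A 0 j) E2; rewrite mul_mx_scalar mxE => ->.
  by rewrite mxE; apply: mdvd_sum => x _; apply: mdvd_mulr; exact: Rodd_dvd.
have [q Qq nq] := Q_split; rewrite detJ Qq => -[w].
rewrite exprS -mulrA -scalerAl -mulrA => /(congr1 ( *:%R c^-1)).
rewrite scalerA mulVf // scale1r scalerAr => /(mulfI al0) E3.
by apply: (lin_primeX (Pos0 ha) nq); exists (c^-1 *: w); rewrite E3 scalerAr.
Qed.
End OneRoot.

Lemma Rodd_det k : exists2 t : R, t != 0 & \det (Rodd k) = t *: \prod_(a <- Pos) linform a ^+ k.*2.+1.
Proof.
elim: k => [|k [t t0 E]].
  by exists c => //; rewrite /= detJ; congr (_ *: _); apply: eq_bigr => a _; rewrite expr1.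
have [b Eb] := detBk_const k; have ub := Bk_unit k.
have b0 : b != 0 by move: ub; rewrite unitmxE Eb; apply: contraTneq => ->; rewrite mpolyC0 unitr0.
exists (t * b^-1 * c * c); first by rewrite !mulf_neq0 ?invr_eq0.
rewrite /= !det_mulmx det_inv E Eb GE det_mulmx det_tr detJ !prodrXl.
have -> : (b%:MP)^-1 = (b^-1)%:MP :> S.
  apply: (mulrI (_ : b%:MP \is a GRing.unit)); first by move: ub; rewrite unitmxE Eb.
  by rewrite mulrV -?mpolyCM ?mulfV //; move: ub; rewrite unitmxE Eb.
rewrite -!mul_mpolyC !mpolyCM doubleS 4!exprS.
set q := \prod_(i <- Pos) linform i; move: (q ^+ k.*2) => w; move: q => q.
by move: (t%:MP) (b^-1)%:MP c%:MP => x y u; ring.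
Qed.
Lemma Reven_det k : exists2 t : R, t != 0 & \det (Reven k) = t *: \prod_(a <- Pos) linform a ^+ k.*2.
Proof.
case: k => [|k]; first by exists 1; rewrite ?oner_eq0 // det1 prodrXl expr0 scale1r.
have [t t0 E] := Rodd_det k.+1; exists (t / c); first by rewrite mulf_neq0 ?invr_eq0.
have E1 : Reven k.+1 *m J = Rodd k.+1 by rewrite /= GE !mulmxA.
have E2 := congr1 determinant E1; rewrite det_mulmx detJ E in E2.
apply: (mulIf Q0); apply: (@scalerI _ _ c) => //; rewrite scalerAr E2 -scalerAl scalerA mulrCA.
by rewrite mulfV // mulr1 !prodrXl -exprSr.
Qed.
Lemma sgBi k : Dg *m sg (Bi k) *m Dg = (2 ^+ h)%:MP *: Bi k.
Proof.
have E : (2 ^+ h)%:MP *: (sg (Bk k) *m sg (Bi k)) = (2 ^+ h)%:MP%:M.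
  by rewrite -map_mxM mulmxV ?Bk_unit // map_mx1 scalemx1.
rewrite scalemxAl sgBk in E.
have E2 : Bk k *m (Dg *m sg (Bi k) *m Dg) = Bk k *m ((2 ^+ h)%:MP *: Bi k).
  rewrite -scalemxAr mulmxV ?Bk_unit //; apply: Dg_cancel.
  by rewrite !mulmxA E scalemx1 mul_scalar_mx mul_mx_scalar.
by have := congr1 (mulmx (Bi k)) E2; rewrite !mulKmx ?Bk_unit.
Qed.
Lemma sgRodd k : sg (Rodd k) = (2 ^+ (k * h))%:MP *: (Rodd k *m Dg).
Proof.
elim: k => [|k IH]; first by rewrite mul0n expr0 mpolyC1 scale1r sgJ.
rewrite /= !map_mxM IH sgG !mulmxA -!scalemxAl mulSn addnC exprD mpolyCM -scalerA.
congr (_ *: _); transitivity (Rodd k *m (Dg *m sg (Bi k) *m Dg) *m G *m Dg).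
  by rewrite !mulmxA.
by rewrite sgBi -scalemxAr -!scalemxAl.
Qed.
Lemma sgReven k : sg (Reven k) = (2 ^+ (k * h))%:MP *: Reven k.
Proof.
case: k => [|k]; first by rewrite mul0n expr0 mpolyC1 scale1r map_mx1.
rewrite /= !map_mxM sgRodd -map_trmx sgJ trmx_mul trDg !mulmxA -!scalemxAl mulSn addnC exprD mpolyCM -scalerA.
congr (_ *: _); transitivity (Rodd k *m (Dg *m sg (Bi k) *m Dg) *m J^T).
  by rewrite !mulmxA.
by rewrite sgBi -scalemxAr -!scalemxAl.
Qed.
Lemma Rodd_hom k i j : Rodd k i j \is (e j + k * h).-homog.
Proof.
apply: homog_scal; have := congr1 (fun A : 'M[S]_l => A i j) (sgRodd k).
by rewrite [LHS]mxE [RHS]mxE mulDg => ->; rewrite mulrC -mulrA -mpolyCM -exprD mulrC mul_mpolyC.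
Qed.
Lemma Reven_hom k i j : Reven k i j \is (k * h).-homog.
Proof.
apply: homog_scal; have := congr1 (fun A : 'M[S]_l => A i j) (sgReven k).
by rewrite [LHS]mxE [RHS]mxE => ->; rewrite mul_mpolyC.
Qed.

Lemma Bk_act a k : a \in Pos -> map_mx (act (refl a)) (Bk k) = Bk k.
Proof.
move=> ha; apply/matrixP => i j; rewrite mxE.
have -> : Bk k i j = B i j + (B i j + B j i) *+ k.
  by rewrite [LHS]mxE mulmxnE; congr (_ + _ *+ _); rewrite G1E mxE [B^T _ _]mxE.
by rewrite rmorphD rmorphMn rmorphD /= !B_inv.
Qed.
Lemma Bi_act a k : a \in Pos -> map_mx (act (refl a)) (Bi k) = Bi k.
Proof.
move=> ha; have E := congr1 (map_mx (act (refl a))) (mulVmx (Bk_unit k)).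
rewrite map_mxM Bk_act // map_mx1 in E.
by rewrite -[LHS]mulmx1 -(mulmxV (Bk_unit k)) mulmxA E mul1mx.
Qed.
Lemma act_mul3 g (A1 A2 A3 : 'M[S]_l) :
  map_mx (act g) (A1 *m A2 *m A3) = map_mx (act g) A1 *m map_mx (act g) A2 *m map_mx (act g) A3.
Proof. by rewrite !map_mxM. Qed.
Lemma mul4 (X A1 A2 A3 : 'M[S]_l) : X *m A1 *m A2 *m A3 = X *m (A1 *m A2 *m A3).
Proof. by rewrite !mulmxA. Qed.
Lemma JT_act a : a \in Pos -> map_mx (act (refl a)) J^T = J^T *m cmx l (refl a).
Proof. by move=> ha; rewrite -map_trmx Jinv // trmx_mul /cmx map_trmx reflT. Qed.
Lemma G_act a : a \in Pos -> map_mx (act (refl a)) G = G.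
Proof.
move=> ha; rewrite GE map_mxM JT_act // Jinv // mulmxA -[J^T *m _ *m _]mulmxA.
by rewrite -cmxM hk // cmx1 mulmx1.
Qed.
Lemma Rodd_act a k : a \in Pos -> map_mx (act (refl a)) (Rodd k) = cmx l (refl a) *m Rodd k.
Proof.
move=> ha; elim: k => [|k IH]; first exact: Jinv.
by apply: (etrans (act_mul3 _ _ _ _)); rewrite IH (Bi_act k ha) (G_act ha); exact: mul4.
Qed.
Lemma Reven_act a k : a \in Pos -> map_mx (act (refl a)) (Reven k) = cmx l (refl a) *m Reven k *m cmx l (refl a).
Proof.
move=> ha; case: k => [|k]; first by rewrite map_mx1 mulmx1 -cmxM hk // cmx1.
by apply: (etrans (act_mul3 _ _ _ _)); rewrite (Rodd_act k ha) (Bi_act k ha) (JT_act ha) -!mulmxA.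
Qed.
End Terao.

End TeraoInduction.

(** * Root systems, heights and words in simple reflections *)

Module RootSystemBasics.
Import LinearFormDivisibility.

Section Basics.
Variables (R : realType) (n : nat).
Local Notation V := 'rV[R]_n.
Implicit Types (Phi : seq V) (a b v : V).

(** Spanning is left out so that the notion passes to the roots inside a subspace. *)
Definition rsys Phi := [/\ uniq Phi, 0 \notin Phi,
  (forall a, a \in Phi -> forall c : R, c *: a \in Phi -> (c = 1 \/ c = -1)),
  (forall a b, a \in Phi -> b \in Phi -> b *m refl a \in Phi) &
  (forall a b, a \in Phi -> b \in Phi -> exists z : int, 2 * dotp b a / dotp a a = z%:~R)].
Lemma root_rsys Phi : is_root_system Phi -> rsys Phi.
Proof. by case=> -[u z] _ r c i; split. Qed.

Section RS.
Variables (Phi : seq V) (v : V).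
Hypothesis rs : rsys Phi.
Hypothesis reg : regular_vec Phi v.
Local Notation Pos := (pos_system Phi v).

Lemma root_neq0 a : a \in Phi -> a != 0.
Proof. by case: rs => _ z _ _ _ h; apply: contraNneq z => <-. Qed.
Lemma refl_self a : a != 0 -> a *m refl a = - a.
Proof.
move=> a0; rewrite mul_refl -mulrA divff ?dotp_eq0 // mulr1 -[a in a - _]scale1r -scalerBl.
by rewrite (_ : 1 - 2 = -1 :> R) ?scaleN1r //; ring.
Qed.
Lemma rootN a : a \in Phi -> - a \in Phi.
Proof. by move=> h; rewrite -refl_self ?root_neq0 //; case: rs => _ _ _ H _; apply: H. Qed.
Lemma root_refl a b : a \in Phi -> b \in Phi -> b *m refl a \in Phi.
Proof. by case: rs => _ _ _ H _; apply: H. Qed.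
Lemma mem_pos a : (a \in Pos) = (0 < dotp v a) && (a \in Phi).
Proof. by rewrite mem_filter. Qed.
Lemma pos_root a : a \in Pos -> a \in Phi. Proof. by rewrite mem_pos => /andP[]. Qed.
Lemma pos_neq0 a : a \in Pos -> a != 0. Proof. by move/pos_root/root_neq0. Qed.
Lemma pos_uniq : uniq Pos. Proof. by case: rs => u *; apply: filter_uniq. Qed.
Lemma pos_or a : a \in Phi -> (a \in Pos) || (- a \in Pos).
Proof.
move=> h; rewrite !mem_pos h rootN // !andbT dotpNr oppr_gt0.
by have := reg h; case: ltrgtP.
Qed.
Lemma pos_notN a : a \in Pos -> - a \notin Pos.
Proof. by rewrite !mem_pos dotpNr oppr_gt0 => /andP[h _]; rewrite ltNge ltW. Qed.
Lemma pos_nprop a b : a \in Pos -> b \in Pos -> a != b -> forall t, b <> t *: a.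
Proof.
move=> ha hb ab t E; case: rs => _ _ H _ _.
have [t1|t1] := H a (pos_root ha) t (ltac:(by rewrite -E; exact: pos_root)).
  by move/eqP: ab; apply; rewrite E t1 scale1r.
by have := pos_notN ha; rewrite -scaleN1r -t1 -E hb.
Qed.
Lemma refl_orth a : a != 0 -> refl a *m (refl a)^T = 1%:M.
Proof. by move=> a0; rewrite reflT dotp_reflK. Qed.
Lemma dotp_refl a x y : a != 0 -> dotp (x *m refl a) (y *m refl a) = dotp x y.
Proof. by move=> a0; rewrite dotp_mulmx -mulmxA refl_orth // mulmx1. Qed.
(** Both Cartan integers are positive and their product is below 4 by strict Cauchy-Schwarz, so one
    of them is 1 and the corresponding reflection produces the difference up to sign. *)
Lemma dotp_pos_diff a b : a \in Phi -> b \in Phi -> a != b -> 0 < dotp a b -> a - b \in Phi.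
Proof.
move=> ha hb ab pab; case: rs => _ _ Hr _ Hz.
have [z1 E1] := Hz _ _ hb ha; have [z2 E2] := Hz _ _ ha hb.
have a0 : 0 < dotp a a by rewrite dotp_gt0 root_neq0.
have b0 : 0 < dotp b b by rewrite dotp_gt0 root_neq0.
have p1 : 0 < z1%:~R :> R by rewrite -E1 divr_gt0 // mulr_gt0.
have p2 : 0 < z2%:~R :> R by rewrite -E2 dotpC divr_gt0 // mulr_gt0.
rewrite !ltr0z in p1 p2.
have cs : dotp a b * dotp a b <= dotp a a * dotp b b /\
   (dotp a b * dotp a b = dotp a a * dotp b b -> exists t, b = t *: a).
  pose x := b - (dotp a b / dotp a a) *: a.
  have Ex : dotp x x = dotp b b - dotp a b * dotp a b / dotp a a.
    rewrite /x !dotpBl !dotpBr !dotpZl !dotpZr [dotp b a]dotpC; field; exact: lt0r_neq0.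
  split=> [|E].
    by have := dotp_ge0 x; rewrite Ex subr_ge0 ler_pdivrMr // [dotp b b * _]mulrC.
  exists (dotp a b / dotp a a); apply/eqP; rewrite -subr_eq0 -/x -dotp_eq0 Ex E.
  by rewrite mulrAC divff ?lt0r_neq0 // mul1r subrr.
case: cs => cs1 cs2.
have Ez : (z1 * z2)%:~R = 4 * (dotp a b * dotp a b / (dotp a a * dotp b b)) :> R.
  rewrite intrM -E1 -E2 [dotp b a]dotpC invfM; ring.
have le4 : (z1 * z2)%:~R <= 4 :> R.
  by rewrite Ez ler_piMr // ler_pdivrMr ?mulr_gt0 // mul1r.
have ne4 : (z1 * z2)%:~R != 4 :> R.
  apply: contraNneq ab => E; move: E; rewrite Ez -[RHS]mulr1 => /(mulfI _) E.
  have /cs2 [t Et] : dotp a b * dotp a b = dotp a a * dotp b b.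
    by have := E (ltac:(by rewrite pnatr_eq0)) => /divr1_eq.
  have tab : t *: a \in Phi by rewrite -Et.
  have [t1|t1] := Hr a ha t tab; first by rewrite Et t1 scale1r.
  by move: pab; rewrite Et t1 scaleN1r dotpNr oppr_gt0 ltNge ltW.
have : (z1 = 1 \/ z2 = 1)%Z.
  have : (z1 * z2 < 4)%R by rewrite -(ltr_int R) lt_neqAle ne4.
  by nia.
case=> Ez1.
  by have := root_refl hb ha; rewrite mul_refl E1 Ez1 scale1r.
have := root_refl ha hb; rewrite mul_refl E2 Ez1 scale1r => /rootN; by rewrite opprB.
Qed.
End RS.

(* words act on the right: the leftmost letter acts first *)
Lemma cox_cat (w1 w2 : seq V) : coxeter_elt (w1 ++ w2) = coxeter_elt w1 *m coxeter_elt w2.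
Proof. by elim: w1 => [|a w IH] /=; rewrite ?mul1mx // IH mulmxA. Qed.
Lemma cox_rev_mul (w : seq V) : (forall a, a \in w -> a != 0) ->
  coxeter_elt w *m coxeter_elt (rev w) = 1%:M.
Proof.
elim: w => [|a w IH] h /=; first by rewrite mul1mx.
rewrite rev_cons -cats1 cox_cat /= mulmx1 !mulmxA -[refl a *m _ *m _]mulmxA IH.
  by rewrite mulmx1 dotp_reflK // h ?mem_head.
by move=> b hb; apply: h; rewrite inE hb orbT.
Qed.
Lemma cox_tr (w : seq V) : (coxeter_elt w)^T = coxeter_elt (rev w).
Proof.
elim: w => [|a w IH] /=; first by rewrite trmx1.
by rewrite trmx_mul IH reflT rev_cons -cats1 cox_cat /= mulmx1.
Qed.

Section Simple.
Variables (Phi : seq V) (v : V) (s : seq V).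
Hypothesis rs : rsys Phi.
Hypothesis reg : regular_vec Phi v.
Local Notation Pos := (pos_system Phi v).
(* a linearly independent set of positive roots generating Pos with natural coefficients,
   independence being witnessed by a dual family *)
Definition simple_dual (dual : V -> V) := [/\ uniq s, {subset s <= Pos},
  (forall b, b \in Pos -> exists m : V -> nat, b = \sum_(a <- s) (m a)%:R *: a) &
  (forall a b, a \in s -> b \in s -> dotp (dual a) b = (a == b)%:R)].
Variable dual : V -> V.
Hypothesis sd : simple_dual dual.
Let us : uniq s. Proof. by case: sd. Qed.
Let sP a : a \in s -> a \in Pos. Proof. by case: sd => _ h _ _ /h. Qed.
Let s0 a : a \in s -> a != 0. Proof. by move/sP/(pos_neq0 rs). Qed.

Lemma dual_sum (m : V -> R) a : a \in s -> dotp (dual a) (\sum_(b <- s) m b *: b) = m a.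
Proof.
move=> ha; rewrite dotp_sumr (big_rem a) //= dotpZr.
case: sd => _ _ _ H; rewrite H // eqxx mulr1 big_seq big1 ?addr0 // => b.
by rewrite mem_rem_uniq // inE => /andP[ba hb]; rewrite dotpZr H // eq_sym (negbTE ba) mulr0.
Qed.
Lemma dual_ge0 a b : a \in s -> b \in Pos -> 0 <= dotp (dual a) b.
Proof.
move=> ha hb; case: sd => _ _ H _; have [m ->] := H b hb.
by rewrite dual_sum // ler0n.
Qed.
Lemma pos_expand b : b \in Pos -> b = \sum_(a <- s) dotp (dual a) b *: a.
Proof.
move=> hb; case: sd => _ _ H _; have [m E] := H b hb.
rewrite {1}E big_seq [RHS]big_seq; apply: eq_bigr => a ha; congr (_ *: _).
by rewrite E dual_sum.
Qed.
(** The reflection alters only the coordinate at [a]; a positive root other than [a] has another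
    positive coordinate, which decides its sign. *)
Lemma simple_refl_pos a b : a \in s -> b \in Pos -> b != a -> b *m refl a \in Pos.
Proof.
move=> ha hb ba; have hr := root_refl rs (pos_root (sP ha)) (pos_root hb).
case/orP: (pos_or rs reg hr) => // hn; exfalso.
have [c hc cb] : exists2 c, c \in s & (c != a) && (0 < dotp (dual c) b).
  apply: contrapT => /forall2NP H.
  have E : b = dotp (dual a) b *: a.
    rewrite {1}(pos_expand hb) (big_rem a) //= big_seq big1 ?addr0 // => c.
    rewrite mem_rem_uniq // inE => /andP[ca hc].
    have [//|/negP] := H c; rewrite ca /= -leNgt => le.
    have /eqP -> : dotp (dual c) b == 0 by rewrite eq_le le dual_ge0.
    by rewrite scale0r.
  by apply: (pos_nprop rs (sP ha) hb _ E); rewrite eq_sym.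
case/andP: cb => ca cb.
have := dual_ge0 hc hn; rewrite dotpNr mul_refl dotpBr dotpZr.
case: sd => _ _ _ H; rewrite (H c a) // (negbTE ca) mulr0 subr0 oppr_ge0.
by rewrite leNgt cb.
Qed.
Lemma simple_refl_neg a b : a \in s -> b \in Phi -> b \notin Pos -> b *m refl a \in Pos -> b = - a.
Proof.
move=> ha hb nb h; have hn : - b \in Pos by case/orP: (pos_or rs reg hb) => // hp; rewrite hp in nb.
apply/eqP; rewrite -eqr_oppLR; apply: contraTT isT => ne.
have := simple_refl_pos ha hn ne; rewrite mulNmx => /(pos_notN).
by rewrite opprK h.
Qed.

Definition ht b := \sum_(a <- s) dotp (dual a) b.
Lemma ht_nat b : b \in Pos -> exists k : nat, ht b = k%:R.
Proof.
move=> hb; case: sd => _ _ H _; have [m E] := H b hb.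
exists (\sum_(a <- s) m a)%N; rewrite natr_sum /ht big_seq [RHS]big_seq.
by apply: eq_bigr => a ha; rewrite E dual_sum.
Qed.
Definition sword (w : seq V) := all (mem s) w.
Lemma sword_neq0 w : sword w -> forall a, a \in w -> a != 0.
Proof. by move=> /allP h a /h /s0. Qed.
Lemma word_root w b : sword w -> b \in Phi -> b *m coxeter_elt w \in Phi.
Proof.
elim: w b => [|a w IH] b /=; first by rewrite mulmx1.
case/andP=> ha hw hb; rewrite mulmxA; apply: IH => //.
by apply: root_refl => //; apply/pos_root/sP.
Qed.
Lemma word_orth w : sword w -> coxeter_elt w *m (coxeter_elt w)^T = 1%:M.
Proof. by move=> hw; rewrite cox_tr cox_rev_mul //; apply: sword_neq0. Qed.
Lemma refl_conj w b : sword w ->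
  refl (b *m coxeter_elt w) = (coxeter_elt w)^T *m refl b *m coxeter_elt w.
Proof.
move=> hw; rewrite /refl dotp_mulmx -mulmxA word_orth // mulmx1 mulmxBr mulmxBl mulmx1.
rewrite -[_^T *m coxeter_elt w]/(_) ; congr (_ - _).
  by have := mulmx1C (word_orth hw).
by rewrite -scalemxAr -scalemxAl trmx_mul !mulmxA.
Qed.
(** Induction on the height: a positive root that is not simple has positive product with some
    simple root, and the reflection in that root lowers the height. *)
Lemma root_word b : b \in Phi -> exists w a, [/\ sword w, a \in s & b = a *m coxeter_elt w].
Proof.
have P k : forall c, c \in Pos -> ht c <= k%:R -> exists w a, [/\ sword w, a \in s & c = a *m coxeter_elt w].
  elim: k => [|k IH] c hc hk.
    have : 0 < dotp c c by rewrite dotp_gt0 (pos_neq0 rs hc).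
    rewrite {2}(pos_expand hc) big_seq big1 ?dotp0r ?ltxx // => a ha.
    suff /eqP -> : dotp (dual a) c == 0 by rewrite scale0r.
    rewrite eq_le dual_ge0 // andbT; apply: le_trans hk; rewrite /ht (big_rem a) //= lerDl.
    by rewrite big_seq sumr_ge0 // => x hx; apply: dual_ge0 => //; apply: mem_rem hx.
  have [cs|ncs] := boolP (c \in s); first by exists [::], c; split=> //; rewrite /= mulmx1.
  have [a ha ca] : exists2 a, a \in s & 0 < dotp c a.
    apply: contrapT => /forall2NP H.
    have : 0 < dotp c c by rewrite dotp_gt0 (pos_neq0 rs hc).
    rewrite {2}(pos_expand hc) dotp_sumr ltNge big_seq sumr_le0 // => a ha.
    rewrite dotpZr mulr_ge0_le0 ?dual_ge0 //.
    by have [//|/negP] := H a; rewrite -leNgt.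
  have ne : c != a by apply: contraNneq ncs => ->.
  have hp := simple_refl_pos ha hc ne.
  have [|w [b1 [hw hb E]]] := IH _ hp.
    have [z Ez] : exists z : int, 2 * dotp c a / dotp a a = z%:~R.
      by case: rs => _ _ _ _ H; exact: H (pos_root (sP ha)) (pos_root hc).
    have z1 : (1 <= z)%R.
      rewrite -gtz0_ge1 -(ltr0z R) -Ez divr_gt0 ?mulr_gt0 // dotp_gt0; exact: s0.
    have E : ht (c *m refl a) = ht c - z%:~R.
      rewrite mul_refl Ez /ht; under eq_bigr do rewrite dotpBr dotpZr.
      rewrite sumrB; congr (_ - _); rewrite (big_rem a) //= big_seq big1 ?addr0.
        by case: sd => _ _ _ H; rewrite H // eqxx mulr1.
      move=> x; rewrite mem_rem_uniq // inE => /andP[ba hb].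
      by case: sd => _ _ _ H; rewrite H // (negbTE ba) mulr0.
    rewrite E lerBlDr; apply: (le_trans hk); rewrite -natr1 lerD2l.
    by rewrite (_ : 1 = 1%:~R) // ler_int.
  exists (w ++ [:: a]), b1; split=> //; first by rewrite /sword all_cat -/(sword w) hw /= ha.
  by rewrite cox_cat mulmxA -E /= mulmx1 -mulmxA dotp_reflK ?mulmx1 ?s0.
move=> hb; case/orP: (pos_or rs reg hb) => hp.
  by have [k E] := ht_nat hp; apply: (P k) => //; rewrite E.
have [k E] := ht_nat hp; have [w [a [hw ha Eb]]] := P k _ hp (ltac:(by rewrite E)).
exists (a :: w), a; split=> //; first by rewrite /= ha.
by rewrite /= mulmxA refl_self ?s0 // mulNmx -Eb opprK.
Qed.
Lemma refl_word b : b \in Phi -> exists2 w, sword w & refl b = coxeter_elt w.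
Proof.
move=> /root_word [w [a [hw ha ->]]]; exists (rev w ++ a :: w).
  by rewrite /sword all_cat all_rev /= ha -/(sword w) hw.
by rewrite refl_conj // cox_tr cox_cat /= mulmxA.
Qed.

(* the deletion argument *)
Lemma word_pos1 w : sword w -> (forall b, b \in Pos -> b *m coxeter_elt w \in Pos) ->
  coxeter_elt w = 1%:M.
Proof.
have [k] := ubnP (size w); elim: k w => // k IH [|a w] //= lek /andP[ha hw] H.
have Hneg : (- a) *m coxeter_elt w \in Pos.
  by have := H a (sP ha); rewrite mulmxA refl_self ?s0.
have key w1 w2 : sword w2 -> (- a) *m coxeter_elt w1 \in Phi -> (- a) *m coxeter_elt w1 \notin Pos ->
   (- a) *m coxeter_elt (w1 ++ w2) \in Pos -> exists w3 b w4, [/\ w1 ++ w2 = w3 ++ b :: w4, b \in s &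
    a *m coxeter_elt w3 = b].
  elim: w2 w1 => [|b w2 IH2] w1 /=; first by rewrite cats0 => _ _ /negbTE ->.
  case/andP=> hb hw2 hr nP hP.
  have [hp|hnp] := boolP ((- a) *m coxeter_elt (rcons w1 b) \in Pos).
    exists w1, b, w2; split=> //; have := hp.
    rewrite -cats1 cox_cat /= mulmx1 mulmxA => /(simple_refl_neg hb hr nP) /eqP.
    by rewrite mulNmx eqr_opp => /eqP.
  rewrite -cat_rcons; apply: IH2 => //; rewrite ?cat_rcons //.
  rewrite -cats1 cox_cat /= mulmx1 mulmxA; apply: root_refl => //; exact/pos_root/sP.
have [|||w3 [b [w4 [E hb Eb]]]] := key [::] w hw; rewrite ?mulmx1 //=.
- by apply: rootN => //; apply/pos_root/sP.
- by apply: pos_notN; apply: sP.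
rewrite /= in E; subst w; move: hw; rewrite /sword all_cat /= => /and3P[h3 _ h4].
have Er : refl a *m coxeter_elt (w3 ++ b :: w4) = coxeter_elt (w3 ++ w4).
  rewrite !cox_cat /= -{1}Eb refl_conj // !mulmxA -[refl a *m _ *m _ *m _]mulmxA.
  rewrite -[refl a *m coxeter_elt w3 *m _]mulmxA.
  rewrite [_ *m (_ *m refl a)]mulmxA word_orth // mul1mx.
  by rewrite dotp_reflK ?s0 // mul1mx.
have := IH (w3 ++ w4); rewrite -Er; apply.
- by move: lek; rewrite !size_cat /=; lia.
- by rewrite /sword all_cat h3 h4.
- exact: H.
Qed.
End Simple.
End Basics.

End RootSystemBasics.

(** * Existence of simple systems, finiteness of the group, and reflections outside it *)

Module SimpleSystems.
Import LinearFormDivisibility RootSystemBasics.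

Section SimpleExists.
Variables (R : realType) (n : nat).
Local Notation V := 'rV[R]_n.

Definition rowsmx (s : seq V) : 'M[R]_(size s, n) := \matrix_(i < size s) s`_i.
Lemma mul_rowsmx (s : seq V) (u : 'rV[R]_(size s)) : u *m rowsmx s = \sum_i u 0 i *: s`_i.
Proof. by rewrite mulmx_sum_row; apply: eq_bigr => i _; rewrite rowK. Qed.
Lemma dual_of_free (s : seq V) : uniq s -> row_free (rowsmx s) ->
  exists dual : V -> V, forall a b, a \in s -> b \in s -> dotp (dual a) b = (a == b)%:R.
Proof.
move=> us fr; have E := mulmxVp fr.
pose dl (a : V) : V := if insub (index a s) is Some i then (col i (pinvmx (rowsmx s)))^T else 0.
exists dl => a b ha hb; rewrite /dl insubT ?index_mem //= => ia.
rewrite dotpC dotpE; have ib : (index b s < size s)%N by rewrite index_mem.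
have := congr1 (fun A : 'M[R]_(size s) => A (Ordinal ib) (Sub (index a s) ia)) E.
rewrite !mxE -val_eqE /= => E2; transitivity ((index b s == index a s)%:R : R).
  rewrite -E2; apply: eq_bigr => i _; rewrite !mxE /= nth_index //.
congr (nat_of_bool _)%:R; apply/eqP/eqP => [E3|-> //].
by rewrite -(nth_index 0 ha) -(nth_index 0 hb) E3.
Qed.

(** Split a relation by the signs of its coefficients: the common value [x] of both sides has
    nonpositive square norm by obtuseness, hence is zero, although [v] is positive on it. *)
Lemma obtuse_free (s : seq V) (v : V) : uniq s -> (forall a, a \in s -> 0 < dotp v a) ->
  (forall a b, a \in s -> b \in s -> a != b -> dotp a b <= 0) -> row_free (rowsmx s).
Proof.
move=> us pv ob; rewrite -kermx_eq0; apply/rowV0P => u /sub_kermxP; rewrite mul_rowsmx => E.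
have si (i : 'I_(size s)) : s`_i \in s by apply: mem_nth.
have key (u' : 'I_(size s) -> R) : \sum_i u' i *: s`_i = 0 -> forall i, u' i <= 0.
  move=> E' i; rewrite leNgt; apply/negP => pi.
  pose x := \sum_(j | 0 < u' j) u' j *: s`_j.
  have Ex : x = \sum_(j | ~~ (0 < u' j)) (- u' j) *: s`_j.
    apply/eqP; rewrite -subr_eq0 -sumrN; apply/eqP; rewrite -[RHS]E' [RHS](bigID (fun j => 0 < u' j)) /=.
    by congr (_ + _); apply: eq_bigr => j _; rewrite scaleNr opprK.
  have x0 : dotp x x <= 0.
    rewrite [X in dotp _ X]Ex dotp_suml sumr_le0 // => j pj; rewrite dotp_sumr sumr_le0 // => k nk.
    rewrite dotpZl dotpZr mulr_ge0_le0 ?(ltW pj) // mulr_ge0_le0 ?oppr_ge0 //; first by rewrite leNgt.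
    apply: ob => //; rewrite nth_uniq //; apply: contraNneq nk => jk.
    by rewrite -(val_inj jk).
  have {}x0 : x = 0 by apply/eqP; rewrite -dotp_eq0 eq_le x0 dotp_ge0.
  have := congr1 (dotp v) x0; rewrite dotp0r /x dotp_sumr (bigD1 i) //= => /eqP.
  rewrite gt_eqF // ltr_wpDr //; last by rewrite dotpZr mulr_gt0 // pv.
  by rewrite sumr_ge0 // => j /andP[pj _]; rewrite dotpZr mulr_ge0 ?(ltW pj) ?(ltW (pv _ _)).
apply/rowP => i; rewrite mxE; apply/eqP; rewrite eq_le (key (fun i => u 0 i)) //=.
rewrite -oppr_le0; apply: (key (fun i => - u 0 i)).
by under eq_bigr do rewrite scaleNr; rewrite sumrN E oppr0.
Qed.

Variables (Phi : seq V) (v : V).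
Hypothesis rs : rsys Phi.
Hypothesis reg : regular_vec Phi v.
Local Notation Pos := (pos_system Phi v).

(** The positive roots that are not sums of two positive roots. They are pairwise obtuse, since the
    difference of an acute pair would be a root and decompose one of them. Spanning is not assumed,
    so this serves every subsystem. *)
Lemma simple_exists : exists s dual, simple_dual Phi v s dual.
Proof.
pose dec a := has (fun b => has (fun c => a == b + c) Pos) Pos.
pose s := [seq a <- Pos | ~~ dec a].
have us : uniq s by apply: filter_uniq; apply: pos_uniq.
have sP : {subset s <= Pos} by move=> a; rewrite mem_filter => /andP[].
have ob a b : a \in s -> b \in s -> a != b -> dotp a b <= 0.
  move=> ha hb ab; rewrite leNgt; apply/negP => pab.
  have hr := dotp_pos_diff rs (pos_root (sP a ha)) (pos_root (sP b hb)) ab pab.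
  case/orP: (pos_or rs reg hr) => hp.
    move: ha; rewrite mem_filter => /andP[/negP []]; apply/hasP; exists b; first exact: sP.
    by apply/hasP; exists (a - b) => //; rewrite addrC subrK.
  move: hb; rewrite mem_filter => /andP[/negP []]; apply/hasP; exists a; first exact: sP.
  by apply/hasP; exists (- (a - b)) => //; rewrite opprB addrC subrK.
have pv a : a \in Pos -> 0 < dotp v a by rewrite mem_pos => /andP[].
have [dual hd] := dual_of_free us (obtuse_free us (fun a ha => pv a (sP a ha)) ob).
exists s, dual; split=> // b hb.
have [k] := ubnP (count (fun c => dotp v c < dotp v b) Pos); elim: k b hb => // k IH b hb lek.
have [db|nb] := boolP (dec b); last first.
  have bs : b \in s by rewrite mem_filter nb.
  exists (fun a => (a == b)%:R); rewrite (big_rem b) //= eqxx scale1r big_seq big1 ?addr0 // => a.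
  by rewrite mem_rem_uniq // inE => /andP[/negbTE -> _]; rewrite scale0r.
case/hasP: db => c hc /hasP[c' hc' /eqP E].
have small x y : x \in Pos -> y \in Pos -> b = x + y ->
   (count (fun c => (dotp v c < dotp v x)%R) Pos < count (fun c => (dotp v c < dotp v b)%R) Pos)%N.
  move=> hx hy Eb; have lt : dotp v x < dotp v b by rewrite Eb dotpDr ltrDl pv.
  rewrite -!size_filter; have ux : uniq (x :: [seq c <- Pos | dotp v c < dotp v x]).
    by rewrite /= mem_filter ltxx filter_uniq // pos_uniq.
  apply: (uniq_leq_size ux) => y'; rewrite inE => /orP[/eqP ->|]; rewrite mem_filter ?lt //.
  by case/andP=> h1 h2; rewrite mem_filter h2 (lt_trans h1 lt).
have [m1 E1] := IH c hc (leq_trans (small _ _ hc hc' E) lek).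
have [m2 E2] := IH c' hc' (leq_trans (small _ _ hc' hc (etrans E (addrC _ _))) lek).
exists (fun a => m1 a + m2 a)%N; rewrite E E1 E2 -big_split; apply: eq_bigr => a _.
by rewrite natrD scalerDl.
Qed.

Definition spanning := forall x : V, (forall a, a \in Phi -> dotp x a = 0) -> x = 0.

Lemma spanning_dual s dual : simple_dual Phi v s dual -> spanning ->
  forall x : V, x = \sum_(a <- s) dotp (dual a) x *: a.
Proof.
move=> sd sp x; apply/eqP; rewrite -subr_eq0; apply/eqP.
have [us sP _ H] := sd.
have red y : (forall a, a \in s -> dotp y a = 0) -> y = 0.
  move=> h; apply: sp => a ha; case/orP: (pos_or rs reg ha) => hp.
    rewrite (pos_expand sd hp) dotp_sumr big_seq big1 // => b hb.
    by rewrite dotpZr h // mulr0.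
  rewrite -[a]opprK dotpNr (pos_expand sd hp) dotp_sumr big_seq big1 ?oppr0 // => b hb.
  by rewrite dotpZr h // mulr0.
have /submxP[t Et] : (x <= rowsmx s)%MS.
  apply: submx_full; rewrite /row_full -mxrank_tr -/(row_free _) -kermx_eq0.
  apply/rowV0P => y /sub_kermxP E; apply: red => a ha.
  have ia : (index a s < size s)%N by rewrite index_mem.
  have := congr1 (fun A : 'rV[R]_(size s) => A 0 (Ordinal ia)) E; rewrite !mxE dotpE => E2.
  by rewrite -[RHS]E2; apply: eq_bigr => i _; rewrite !mxE /= nth_index.
rewrite Et mul_rowsmx; apply/eqP; rewrite subr_eq0; apply/eqP.
rewrite [RHS](big_nth 0) big_mkord; apply: eq_bigr => i _; congr (_ *: _).
rewrite dotp_sumr (bigD1 i) //= big1 ?addr0 => [|j ji]; first by rewrite dotpZr H ?mem_nth // eqxx mulr1.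
rewrite dotpZr H ?mem_nth // nth_uniq // eq_sym.
by have -> : (j == i :> nat) = false; [exact: negbTE | rewrite mulr0].
Qed.

(** An element of the group is determined by how it permutes [Phi]; [code] records the permutation
    as a function between finite types. *)
Lemma W_exists s dual : simple_dual Phi v s dual -> spanning ->
  exists2 Wl : seq 'M[R]_n, uniq Wl & forall g, g \in Wl <-> exists2 w, sword s w & g = coxeter_elt w.
Proof.
move=> sd sp; pose inW (g : 'M[R]_n) := exists2 w, sword s w & g = coxeter_elt w.
pose N := size Phi; pose code (g : 'M[R]_n) := [ffun i : 'I_N => inord (index (Phi`_i *m g) Phi) : 'I_N.+1].
pose pk (c : {ffun 'I_N -> 'I_N.+1}) : option 'M[R]_n :=
  if pselect (exists g, inW g /\ code g = c) is left H then Some (projT1 (cid H)) else None.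
exists (undup (pmap pk (enum {: {ffun 'I_N -> 'I_N.+1}}))); first exact: undup_uniq.
have stab g a : inW g -> a \in Phi -> a *m g \in Phi.
  by move=> [w hw ->] ha; apply: (word_root rs sd).
move=> g; rewrite mem_undup mem_pmap; split.
  case/mapP=> c _; rewrite /pk; case: pselect => // H [->]; by case: (cid H) => g' [].
move=> ig; apply/mapP; exists (code g); first by rewrite mem_enum.
rewrite /pk; case: pselect => [H|[]]; last by exists g.
case: (cid H) => g' [ig' Ec] /=; congr Some.
have Ea a : a \in Phi -> a *m g = a *m g'.
  move=> ha; have ia : (index a Phi < N)%N by rewrite index_mem.
  have := congr1 (fun f : {ffun 'I_N -> 'I_N.+1} => f (Ordinal ia)) Ec; rewrite !ffunE /= nth_index //.
  move=> /(congr1 val) /=; rewrite !inordK ?ltnS ?index_size // => E.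
  by rewrite -(nth_index 0 (stab g a ig ha)) -E nth_index // stab.
have [_ sP _ _] := sd.
apply/row_matrixP => i; rewrite !rowE (spanning_dual sd sp (delta_mx 0 i)) !mulmx_suml.
rewrite big_seq [RHS]big_seq; apply: eq_bigr => a ha; rewrite -!scalemxAl Ea //.
by apply: pos_root; apply: sP.
Qed.
End SimpleExists.

Section Given.
Variables (R : realType) (l : nat) (Phi : seq 'rV[R]_l) (v : 'rV[R]_l).
Hypothesis rsP : is_root_system Phi.
Hypothesis reg : regular_vec Phi v.
Lemma root_spanning : spanning Phi.
Proof.
move=> x h; case: rsP => _ sp _ _ _; have [c E] := sp x.
apply/eqP; rewrite -dotp_eq0 {2}E dotp_sumr big1 // => i _.
by rewrite dotpZr h ?mulr0 // mem_nth.
Qed.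
Lemma given_dual s : simple_system_of (pos_system Phi v) s -> exists dual, simple_dual Phi v s dual.
Proof.
move=> [us sz sP gen]; have rs := root_rsys rsP.
have red y : (forall a, a \in s -> dotp y a = 0) -> y = 0.
  have hP b : (forall a, a \in s -> dotp y a = 0) -> b \in pos_system Phi v -> dotp y b = 0.
    move=> h /gen [m ->]; rewrite dotp_sumr big1 // => i _; by rewrite dotpZr h ?mulr0 // mem_nth.
  move=> h; apply: root_spanning => a ha; case/orP: (pos_or rs reg ha) => hp; first exact: hP.
  by rewrite -[a]opprK dotpNr hP ?oppr0.
have fr : row_free (rowsmx s).
  have : row_full (rowsmx s).
    rewrite /row_full -mxrank_tr -/(row_free _) -kermx_eq0.
    apply/rowV0P => y /sub_kermxP E; apply: red => a ha.
    have ia : (index a s < size s)%N by rewrite index_mem.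
    have := congr1 (fun A : 'rV[R]_(size s) => A 0 (Ordinal ia)) E; rewrite !mxE dotpE => E2.
    by rewrite -[RHS]E2; apply: eq_bigr => i _; rewrite !mxE /= nth_index.
  by move=> /eqP fl; apply/eqP; rewrite fl sz.
have [dual hd] := dual_of_free us fr; exists dual; split=> // b /gen [m ->].
exists (fun a => if insub (index a s) is Some i then m i else 0%N).
rewrite [RHS](big_nth 0) big_mkord; apply: eq_bigr => i _; congr (_%:R *: _).
by rewrite index_uniq // valK.
Qed.
End Given.

Section NonRoot.
Variables (R : realType) (n : nat).
Local Notation V := 'rV[R]_n.

(** On the line t y + a each member of the list excludes at most one integer t, so one more value of
    t than there are members is enough. *)
Lemma avoid_hyperplanes (A : seq V) : (forall a, a \in A -> a != 0) ->
  exists y, forall a, a \in A -> dotp y a != 0.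
Proof.
elim: A => [|a A IH] h; first by exists 0.
have [|y hy] := IH; first by move=> b hb; apply: h; rewrite inE hb orbT.
have a0 : a != 0 by apply: h; exact: mem_head.
pose bad (t : nat) := [exists i : 'I_(size A).+1, dotp (t%:R *: y + a) ((a :: A)`_i) == 0].
(* each member excludes at most one parameter *)
have one b t t' : b \in a :: A -> dotp (t%:R *: y + a) b = 0 -> dotp (t'%:R *: y + a) b = 0 -> t = t' :> nat.
  move=> hb; rewrite !dotpDl !dotpZl => e1 e2.
  have : (t%:R - t'%:R) * dotp y b = 0 by rewrite mulrBl; lra.
  move=> /eqP; rewrite mulf_eq0 subr_eq0 eqr_nat => /orP[/eqP //|/eqP yb].
  move: hb; rewrite inE => /orP[/eqP Eb|hb]; last by have := hy b hb; rewrite yb eqxx.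
  by move: e1; rewrite yb mulr0 add0r Eb => /eqP; rewrite dotp_eq0 (negbTE a0).
have [t ht] : exists t : 'I_(size A).+2, ~~ bad t.
  apply: contrapT => /forallNP H.
  have Hi (t : 'I_(size A).+2) : exists i : 'I_(size A).+1, dotp (t%:R *: y + a) ((a :: A)`_i) = 0.
    by have /negP := H t; rewrite negbK => /existsP[i /eqP]; exists i.
  have [f hf] := choice Hi.
  have /leq_card : injective f.
    move=> t t' E; apply: val_inj; have h2 := hf t'; rewrite -E in h2.
    by apply: (one _ _ _ _ (hf t) h2); apply: mem_nth; exact: ltn_ord.
  by rewrite !card_ord ltnn.
exists (t%:R *: y + a) => b hb; apply: contraNneq ht => E; apply/existsP.
have ib : (index b (a :: A) < (size A).+1)%N by rewrite -[(size A).+1]/(size (a :: A)) index_mem.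
by exists (Ordinal ib); rewrite /= -[if _ then _ else _]/(index b (a :: A)) nth_index // E.
Qed.

Variables (Phi : seq V) (v : V) (s : seq V) (dual : V -> V).
Hypothesis rs : rsys Phi.
Hypothesis reg : regular_vec Phi v.
Hypothesis sd : simple_dual Phi v s dual.
(** Choose a regular point [p] on the mirror of [b] and move off it by a small multiple of [b] to
    get [u]. Then [u] and its mirror image lie in one chamber, so a group element exchanging them
    preserves that chamber's positive system and is the identity. *)
Lemma nonroot_separated b : b != 0 -> (forall a t, a \in pos_system Phi v -> b <> t *: a) ->
  exists2 u, dotp u b != 0 & forall w, sword s w -> u *m coxeter_elt w != u *m refl b.
Proof.
move=> b0 nr.
have pa a : a \in Phi -> a *m projm b != 0.
  move=> ha; rewrite mul_projm subr_eq0; apply/negP => /eqP E.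
  have a0 := root_neq0 rs ha.
  set t := dotp a b / dotp b b in E; have t0 : t != 0 by apply: contraNneq a0 => t0; rewrite E t0 scale0r.
  have Eb : b = t^-1 *: a by rewrite E scalerA mulVf ?scale1r.
  case/orP: (pos_or rs reg ha) => hp; first exact: (nr a t^-1 hp Eb).
  by apply: (nr (- a) (- t^-1) hp); rewrite scalerN scaleNr opprK.
have [|y hy] := @avoid_hyperplanes [seq a *m projm b | a <- Phi].
  by move=> x /mapP[a ha ->]; exact: pa.
pose p := y *m projm b.
have pb : dotp p b = 0 by rewrite /p mul_projm dotpBl dotpZl mulfVK ?subrr // dotp_eq0.
have preg : regular_vec Phi p.
  by move=> a ha; rewrite /p dotp_mulmx projmT; apply: hy; apply/mapP; exists a.
have [e e0 he] : exists2 e : R, 0 < e & forall a, a \in Phi -> `|e * dotp b a| < `|dotp p a|.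
  have : forall a, a \in Phi -> dotp p a != 0 by exact: preg.
  elim: Phi => [|a A IH] h; first by exists 1.
  have [|e e0 he] := IH; first by move=> c hc; apply: h; rewrite inE hc orbT.
  have pa0 : 0 < `|dotp p a| by rewrite normr_gt0 h ?mem_head.
  pose e' := `|dotp p a| / (1 + `|dotp b a|).
  have q0 : 0 < 1 + `|dotp b a| by rewrite ltr_pwDl.
  have e'0 : 0 < e' by rewrite divr_gt0.
  exists (Num.min e e'); first by rewrite lt_min e0 e'0.
  move=> c; rewrite inE => /orP[/eqP ->|hc]; rewrite normrM ger0_norm ?le_min ?ltW //=.
    apply: (@le_lt_trans _ _ (e' * `|dotp b a|)); first by rewrite ler_wpM2r // ge_min lexx orbT.
    by rewrite /e' mulrAC ltr_pdivrMr // ltr_pM2l // ltrDr ltr01.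
  apply: le_lt_trans (he c hc); rewrite normrM (ger0_norm (ltW e0)) ler_wpM2r // ge_min lexx //.
pose u := p + e *: b.
have Er : u *m refl b = p - e *: b.
  rewrite /u mulmxDl -scalemxAl refl_self // scalerN; congr (_ - _).
  by rewrite mul_refl pb mulr0 mul0r scale0r subr0.
exists u; first by rewrite /u dotpDl pb add0r dotpZl mulf_neq0 ?dotp_eq0 // gt_eqF.
move=> w hw; apply/negP => /eqP E.
have [s' [dual' sd']] := simple_exists rs preg.
have [w' hw' Ew] : exists2 w', sword s' w' & coxeter_elt w = coxeter_elt w'.
  elim: w hw {E} => [|a w IH] /=; first by exists [::].
  case/andP=> ha hw; have [w1 h1 E1] := IH hw.
  have [|w2 h2 E2] := refl_word rs preg sd' (b := a); first by case: sd => _ sP _ _; apply/pos_root/sP.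
  by exists (w2 ++ w1); [rewrite /sword all_cat -/(sword _ _) h2 | rewrite cox_cat -E2 -E1].
have sgn a : a \in Phi -> 0 < dotp p a -> (0 < dotp (p + e *: b) a) && (0 < dotp (p - e *: b) a).
  move=> ha pp; have := he a ha; rewrite (gtr0_norm pp) ltr_norml => /andP[h1 h2].
  by rewrite dotpDl dotpBl !dotpZl; apply/andP; split; lra.
have H : coxeter_elt w' = 1%:M.
  apply: (word_pos1 rs preg sd') => // c hc; rewrite -Ew.
  have hcw : c *m coxeter_elt w \in Phi by apply: (word_root rs sd) => //; exact: pos_root hc.
  case/orP: (pos_or rs preg hcw) => // hn; exfalso.
  have E1 : dotp (u *m coxeter_elt w) (c *m coxeter_elt w) = dotp u c.
    by rewrite dotp_mulmx -mulmxA (word_orth rs sd) // mulmx1.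
  rewrite E Er in E1.
  have /andP[h1 _] : (0 < dotp u c) && (0 < dotp (p - e *: b) c).
    by apply: sgn; [exact: pos_root hc | move: hc; rewrite mem_pos => /andP[]].
  have /andP[_ h2] : (0 < dotp u (- (c *m coxeter_elt w))) && (0 < dotp (p - e *: b) (- (c *m coxeter_elt w))).
    by apply: sgn; [exact: pos_root hn | move: hn; rewrite mem_pos => /andP[]].
  by rewrite dotpNr E1 oppr_gt0 ltNge ltW in h2.
move: E; rewrite Ew H mulmx1 Er /u => /addrI /eqP; rewrite -subr_eq0 opprK -scalerDl scaler_eq0 (negbTE b0) orbF.
by rewrite gt_eqF // addr_gt0.
Qed.
End NonRoot.

End SimpleSystems.

(** * Basic invariants and the degree of their Jacobian *)

Module ReflectionInvariants.
Import fraction LinearFormDivisibility HomogeneousPolynomials SaitoCriterion.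

Lemma sum_lift (S : nmodType) r (i : 'I_r.+1) (F : 'I_r.+1 -> S) :
  \sum_k F k = F i + \sum_(j < r) F (lift i j).
Proof.
rewrite (bigD1 i) //=; congr (_ + _).
rewrite (reindex_omap (lift i) (unlift i)) /=; last first.
  by move=> k ki; case: unliftP => [j ->|E] //=; rewrite E eqxx in ki.
by apply: eq_bigl => j; rewrite liftK eqxx andbT eq_sym neq_lift.
Qed.
(** Elimination without division on a nonzero entry of the first column. *)
Lemma wide_kernel (S : idomainType) r m (M : 'M[S]_(r, m)) : (m < r)%N ->
  exists2 h : 'rV[S]_r, h != 0 & h *m M = 0.
Proof.
elim: m r M => [|m IH] [|r] // M lt.
  exists (const_mx 1); last by apply/matrixP => i [].
  by apply/eqP => /rowP /(_ ord0); rewrite !mxE => /eqP; rewrite oner_eq0.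
have [[i Mi]|/forallNP H] := pselect (exists i, M i ord0 != 0); last first.
  have [|h h0 hE] := IH _ (\matrix_(i, j) M i (lift ord0 j)); first exact: ltnW.
  exists h => //; apply/rowP => j; rewrite !mxE; case: (unliftP ord0 j) => [j' ->|->].
    have := congr1 (fun A : 'rV[S]_m => A 0 j') hE; rewrite !mxE => E; rewrite -[RHS]E.
    by apply: eq_bigr => k _; rewrite !mxE.
  rewrite big1 // => k _; have /negP := H k; rewrite negbK => /eqP ->.
  by rewrite mulr0.
pose N := \matrix_(k < r, j < m) (M i ord0 * M (lift i k) (lift ord0 j) - M (lift i k) ord0 * M i (lift ord0 j)).
have [//|h h0 hE] := IH _ N.
pose g := \row_k (if unlift i k is Some j then M i ord0 * h 0 j else - \sum_j h 0 j * M (lift i j) ord0).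
exists g.
  apply: contra h0 => /eqP g0; apply/eqP/rowP => j; have := congr1 (fun A : 'rV[S]_r.+1 => A 0 (lift i j)) g0.
  by rewrite !mxE liftK => /eqP; rewrite mulf_eq0 (negbTE Mi) /= => /eqP.
apply/rowP => j; rewrite !mxE (sum_lift i) !mxE unlift_none.
have gl k : g 0 (lift i k) = M i ord0 * h 0 k by rewrite mxE liftK.
under [X in _ + X]eq_bigr do rewrite gl.
case: (unliftP ord0 j) => [j' ->|->]; last first.
  by rewrite mulNr mulr_suml addrC -sumrB big1 // => k _; rewrite -mulrA mulrC -!mulrA subrr.
have := congr1 (fun A : 'rV[S]_m => A 0 j') hE; rewrite !mxE => E; rewrite -[RHS]E.
rewrite mulNr mulr_suml addrC -sumrB; apply: eq_bigr => k _; rewrite !mxE mulrBr.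
by congr (_ - _); rewrite ?mulrA // [M i ord0 * _]mulrC.
Qed.

Lemma sub_chain (e a b : nat) : (a <= b)%N -> (b <= e)%N ->
  (e - b <= e - a)%N /\ (e - a - (e - b) = b - a)%N.
Proof. by split; lia. Qed.
Lemma pred_split (a b : nat) : (0 < a)%N -> (a <= b)%N -> b.-1 = (b - a + a.-1)%N.
Proof. lia. Qed.

Section Chev.
Variables (R : realType) (l : nat).
Local Notation S := {mpoly R[l]}.
Variables (Phi : seq 'rV[R]_l) (Wl : seq 'M[R]_l).
Hypothesis Phi0 : forall a, a \in Phi -> a != 0.
Hypothesis uW : uniq Wl.
Hypothesis W1 : 1%:M \in Wl.
Hypothesis WM : forall g h, g \in Wl -> h \in Wl -> g *m h \in Wl.
Hypothesis Wrefl : forall a, a \in Phi -> refl a \in Wl.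
Hypothesis Wgen : forall g, g \in Wl -> exists2 w, all (mem Phi) w & g = coxeter_elt w.
Hypothesis WT : forall g, g \in Wl -> g *m g^T = 1%:M.

Definition inv (f : S) := forall g, g \in Wl -> act g f = f.
Lemma inv0 : inv 0. Proof. by move=> g _; rewrite rmorph0. Qed.
Lemma invC c : inv c%:MP. Proof. by move=> g _; rewrite actC. Qed.
Lemma invD p q : inv p -> inv q -> inv (p + q).
Proof. by move=> hp hq g hg; rewrite rmorphD /= hp // hq. Qed.
Lemma invM p q : inv p -> inv q -> inv (p * q).
Proof. by move=> hp hq g hg; rewrite rmorphM /= hp // hq. Qed.
Lemma Wperm g : g \in Wl -> perm_eq (map (mulmx g) Wl) Wl.
Proof.
move=> hg; have ug : uniq (map (mulmx g) Wl).
  rewrite map_inj_in_uniq // => x y _ _ E.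
  by rewrite -[x]mul1mx -[y]mul1mx -(mulmx1C (WT hg)) -!mulmxA E.
have sub : {subset map (mulmx g) Wl <= Wl} by move=> x /mapP[y hy ->]; apply: WM.
have [_ E] := uniq_min_size ug sub (ltac:(by rewrite size_map)).
exact: uniq_perm.
Qed.
Let nW : (size Wl)%:R != 0 :> R.
Proof. by rewrite pnatr_eq0 size_eq0; case: Wl W1. Qed.
Definition avg (f : S) : S := (size Wl)%:R^-1 *: \sum_(g <- Wl) act g f.
Lemma avg_inv f : inv (avg f).
Proof.
move=> g hg; rewrite /avg actZ rmorph_sum /=; congr (_ *: _).
under eq_bigr do rewrite act_comp.
by rewrite -(big_map (mulmx g) xpredT (fun h => act h f)); apply: perm_big; exact: Wperm.
Qed.
Lemma avg_id f : inv f -> avg f = f.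
Proof.
move=> h; rewrite /avg big_seq; under eq_bigr do rewrite h //.
by rewrite -big_seq big_const_seq count_predT iter_addr_0 -scaler_nat scalerA mulVf ?scale1r.
Qed.
Lemma avgM f p : inv f -> avg (f * p) = f * avg p.
Proof.
move=> h; rewrite /avg -scalerAr mulr_sumr; congr (_ *: _); rewrite big_seq [RHS]big_seq.
by apply: eq_bigr => g hg; rewrite rmorphM /= h.
Qed.
Lemma avg_sum (I : Type) (r : seq I) (P : pred I) (F : I -> S) :
  avg (\sum_(i <- r | P i) F i) = \sum_(i <- r | P i) avg (F i).
Proof.
rewrite /avg -scaler_sumr [X in _ = _ *: X]exchange_big /=; congr (_ *: _).
by apply: eq_bigr => g _; rewrite rmorph_sum.
Qed.
Lemma avg_hom f d : f \is d.-homog -> avg f \is d.-homog.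
Proof. by move=> h; apply: dhomogZ; apply: homog_sum => g _; apply: act_homog. Qed.
Lemma pihomog_act (g : 'M[R]_l) d p : pihomog mdeg d (act g p) = act g (pihomog mdeg d p).
Proof.
rewrite {1}(pihomog_partitionE (leqnn (mmeasure mdeg p))) rmorph_sum raddf_sum /=.
have [lt|ge] := ltnP d (msize p).
  rewrite (bigD1 (Ordinal lt)) //= pihomog_dE ?act_homog ?pihomogP // big1 ?addr0 // => i id.
  apply: (@pihomog_ne0 _ _ _ i); last by apply/act_homog/pihomogP.
  by apply: contraNneq id => h; apply/eqP/val_inj.
rewrite big1 => [|i _]; last first.
  apply: (@pihomog_ne0 _ _ _ i); last by apply/act_homog/pihomogP.
  by rewrite neq_ltn (leq_trans (ltn_ord i) ge).
rewrite [in RHS]pihomogE big1_seq ?rmorph0 // => m /andP[/eqP me /msize_mdeg_lt].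
by rewrite me ltnNge ge.
Qed.
Lemma inv_pihomog f d : inv f -> inv (pihomog mdeg d f).
Proof. by move=> h g hg; rewrite -pihomog_act h. Qed.

(** The Hilbert ideal, generated by the homogeneous invariants of positive degree. *)
Definition inI (p : S) := exists m (a b : 'I_m -> S) (d : 'I_m -> nat),
  (forall j, [/\ inv (a j), (0 < d j)%N & a j \is (d j).-homog]) /\ p = \sum_j a j * b j.
Lemma inI0 : inI 0.
Proof. by exists 0%N, (fun=> 0), (fun=> 0), (fun=> 1%N); split=> [[]|] //; rewrite big_ord0. Qed.
Lemma inID p q : inI p -> inI q -> inI (p + q).
Proof.
move=> [m [a [b [d [h ->]]]]] [m' [a' [b' [d' [h' ->]]]]].
exists (m + m')%N, (fun i => match split i with inl j => a j | inr j => a' j end),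
  (fun i => match split i with inl j => b j | inr j => b' j end),
  (fun i => match split i with inl j => d j | inr j => d' j end).
split=> [j|]; first by case: (split j).
rewrite big_split_ord /=; congr (_ + _); apply: eq_bigr => j _.
  by rewrite (unsplitK (inl j)).
by rewrite (unsplitK (inr j)).
Qed.
Lemma inIM p q : inI p -> inI (p * q).
Proof.
move=> [m [a [b [d [h ->]]]]]; exists m, a, (fun j => b j * q), d; split=> //.
by rewrite mulr_suml; apply: eq_bigr => j _; rewrite mulrA.
Qed.
Lemma inI_inv f d : inv f -> (0 < d)%N -> f \is d.-homog -> inI f.
Proof.
move=> *; exists 1%N, (fun=> f), (fun=> 1), (fun=> d); split=> //.
by rewrite big_ord1 mulr1.
Qed.
Lemma inI_act g p : g \in Wl -> inI p -> inI (act g p).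
Proof.
move=> hg [m [a [b [d [h ->]]]]]; exists m, a, (fun j => act g (b j)), d; split=> //.
rewrite rmorph_sum; apply: eq_bigr => j _ /=; rewrite rmorphM /=.
by have [-> //] := h j.
Qed.
Lemma inI_sum (I : Type) (r : seq I) (P : pred I) (F : I -> S) :
  (forall i, P i -> inI (F i)) -> inI (\sum_(i <- r | P i) F i).
Proof. by move=> h; elim/big_ind: _ => //; [exact: inI0 | exact: inID]. Qed.

(** Induction on the degree. The change of the relation under a reflection is divisible by the root
    form, and the quotient is a relation of lower degree; so [u i0] is fixed modulo the ideal by the
    group and congruent to its average, which lies in the ideal. In degree 0 a nonzero constant is
    excluded by averaging the relation. *)
Lemma chevalley k (f u : 'I_k -> S) i0 d :
  (forall i, inv (f i)) -> \sum_i f i * u i = 0 -> u i0 \is d.-homog ->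
  ~ (exists c : 'I_k -> S, (forall i, inv (c i)) /\ f i0 = \sum_(i | i != i0) c i * f i) ->
  inI (u i0).
Proof.
move=> hf; elim: d u => [|d IH] u E hu nf.
  have [c Ec] := homog0C hu; rewrite Ec; have [->|c0] := eqVneq c 0.
    by rewrite mpolyC0; exact: inI0.
  exfalso; apply: nf; exists (fun i => - c^-1%:MP * avg (u i)); split=> [i|].
    by apply: invM; [rewrite -mpolyCN; exact: invC | exact: avg_inv].
  have := congr1 avg E; rewrite avg_sum (bigD1 i0) //= avgM // Ec (avg_id (invC c)).
  have -> : avg 0 = 0 by apply: avg_id; exact: inv0.
  move=> /eqP; rewrite addr_eq0 => /eqP E2; apply: (@scalerI _ _ c) => //.
  rewrite -mul_mpolyC mulrC E2 -sumrN scaler_sumr; apply: eq_bigr => i _.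
  rewrite avgM // mulNr mulNr scalerN; congr (- _).
  by rewrite -mulrA mul_mpolyC scalerA mulfV // scale1r mulrC.
have diff a : a \in Phi -> inI (act (refl a) (u i0) - u i0).
  move=> ha; have H i : mdvd (linform a) (act (refl a) (u i) - u i) by apply: refl_dvd; apply: Phi0.
  have [w hw] := choice H; rewrite hw mulrC; apply: inIM; apply: IH => //.
    apply: (@mulfI _ (linform a)); first by rewrite linform_eq0 Phi0.
    rewrite mulr0 mulr_sumr; transitivity (act (refl a) (\sum_i f i * u i) - \sum_i f i * u i).
      2: by rewrite E rmorph0 subrr.
    rewrite rmorph_sum -sumrB; apply: eq_bigr => i _ /=.
    by rewrite rmorphM /= hf ?Wrefl // -mulrBr hw mulrCA.
  apply: (@homogM_inv' _ _ (linform a) _ 1); rewrite ?linform_eq0 ?Phi0 ?linform_homog //.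
  by rewrite -hw; apply: rpredB => //; apply: act_homog.
have diffW g : g \in Wl -> inI (act g (u i0) - u i0).
  move=> /Wgen [w hw ->]; elim: w hw => [|a w IHw] /=.
    by rewrite act1 subrr => _; exact: inI0.
  case/andP=> ha hw; rewrite -act_comp; set X := act _ _.
  have -> : X - u i0 = (X - act (refl a) (u i0)) + (act (refl a) (u i0) - u i0).
    by rewrite addrA subrK.
  apply: inID; last exact: diff.
  by rewrite -rmorphB; apply: inI_act; [exact: Wrefl | exact: IHw].
rewrite -[u i0](subrK (avg (u i0))); apply: inID; last first.
  by apply: (@inI_inv _ d.+1) => //; [exact: avg_inv | exact: avg_hom].
have -> : u i0 - avg (u i0) = \sum_(g <- Wl) (- ((size Wl)%:R^-1 *: (act g (u i0) - u i0))).
  rewrite sumrN -scaler_sumr sumrB big_const_seq count_predT iter_addr_0.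
  have -> : u i0 *+ size Wl = (size Wl)%:R *: u i0 by rewrite scaler_nat.
  by rewrite scalerBr opprB scalerA mulVf // scale1r.
rewrite big_seq; apply: inI_sum => g hg; rewrite -scalerN -mul_mpolyC mulrC; apply: inIM.
by rewrite -mulrN1; apply: inIM; exact: diffW.
Qed.

Definition idl r (P : 'I_r -> S) (A : pred 'I_r) p := exists c : 'I_r -> S, p = \sum_(j | A j) c j * P j.
Lemma idlD r (P : 'I_r -> S) A p q : idl P A p -> idl P A q -> idl P A (p + q).
Proof.
move=> [c ->] [c' ->]; exists (fun j => c j + c' j); rewrite -big_split.
by apply: eq_bigr => j _; rewrite mulrDl.
Qed.
Lemma idlM r (P : 'I_r -> S) A p q : idl P A p -> idl P A (q * p).
Proof.
move=> [c ->]; exists (fun j => q * c j); rewrite mulr_sumr.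
by apply: eq_bigr => j _; rewrite mulrA.
Qed.
Lemma idl0 r (P : 'I_r -> S) A : idl P A 0.
Proof. by exists (fun=> 0); rewrite big1 // => j _; rewrite mul0r. Qed.
Lemma idl_sum r (P : 'I_r -> S) A (I : Type) (s : seq I) (B : pred I) (F : I -> S) :
  (forall i, B i -> idl P A (F i)) -> idl P A (\sum_(i <- s | B i) F i).
Proof. by move=> h; elim/big_ind: _ => //; [exact: idl0 | exact: idlD]. Qed.
Lemma idl_gen r (P : 'I_r -> S) (A : pred 'I_r) i : A i -> idl P A (P i).
Proof.
move=> Ai; exists (fun j => (j == i)%:R); rewrite (bigD1 i) //= eqxx mul1r big1 ?addr0 //.
by move=> j /andP[_ ji]; rewrite (negbTE ji) mul0r.
Qed.

(** Partial minimal systems of generators of the Hilbert ideal. The last clause makes a system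
    complete below each of its degrees, so that it can grow by an invariant of least missing
    degree. *)
Definition good r (P : 'I_r -> S) (d : 'I_r -> nat) :=
  [/\ forall i, [/\ inv (P i), (0 < d i)%N & P i \is (d i).-homog],
      forall i, ~ idl P (predC1 i) (P i) &
      forall i f e, inv f -> f \is e.-homog -> (0 < e < d i)%N -> idl P predT f].

Lemma pihomogMr (p q : S) e k : p \is e.-homog ->
  pihomog mdeg k (q * p) = if (e <= k)%N then pihomog mdeg (k - e) q * p else 0.
Proof.
move=> hp; case: leqP => [le|lt].
  by rewrite mulrC -{1}(subnKC le) pihomogM // mulrC.
rewrite {1}(pihomog_partitionE (leqnn (mmeasure mdeg q))) mulr_suml raddf_sum /= big1 // => i _.
apply: (@pihomog_ne0 _ _ _ (i + e)%N); last by apply: dhomogM => //; apply: pihomogP.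
by rewrite neq_ltn (leq_trans lt) ?leq_addl // orbT.
Qed.

Lemma good_small r (P : 'I_r -> S) d i f e : good P d -> inv f -> f \is e.-homog ->
  (0 < e < d i)%N -> idl P (predC1 i) f.
Proof.
move=> [h1 h2 h3] fi fe lt; have [c E] := h3 i f e fi fe lt.
exists (fun j => if (d j <= e)%N then pihomog mdeg (e - d j) (c j) else 0).
rewrite -(pihomog_dE fe) E raddf_sum /= (bigD1 i) //= (pihomogMr _ _ (_ : P i \is (d i).-homog)).
  rewrite leqNgt; case/andP: lt => _ ->; rewrite add0r; apply: eq_bigr => j _.
  rewrite (pihomogMr _ _ (_ : P j \is (d j).-homog)); first by case: ifP; rewrite ?mul0r.
  by have [] := h1 j.
by have [] := h1 i.
Qed.

(** The classical proof of algebraic independence, run on a relation between gradients so that it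
    gives independence over the whole ring. Make the coefficients invariant and homogeneous, keep a
    minimal generating subset of them, and eliminate the others; [chevalley] and Euler's formula
    then place one of the [P i] in the ideal of the rest. *)
Lemma good_indep r (P : 'I_r -> S) d : good P d ->
  forall h : 'I_r -> S, (forall s, \sum_i h i * (P i)^`M(s) = 0) -> forall i, h i = 0.
Proof.
move=> gP h0 E0 i1; have [h1 h2 h3] := gP; apply/eqP/negPn/negP => n0.
have Pi i : inv (P i) by case: (h1 i).
have Pd i : P i \is (d i).-homog by case: (h1 i).
have Pg i : (0 < d i)%N by case: (h1 i).
have [h [hi hE hn]] : exists h : 'I_r -> S, [/\ (forall i, inv (h i)),
   (forall s, \sum_i h i * (P i)^`M(s) = 0) & exists i, h i != 0].
  (* Multiplying by the other conjugates turns the chosen coefficient into its norm, which is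
     invariant and nonzero, so averaging does not destroy it. *)
  pose q := \prod_(g <- rem 1%:M Wl) act g (h0 i1).
  exists (fun i => avg (q * h0 i)); split=> [i|s|]; first exact: avg_inv.
    rewrite /avg; under eq_bigr do rewrite -scalerAl mulr_suml.
    rewrite -scaler_sumr exchange_big /= big_seq big1 ?scaler0 // => g hg.
    have D i : (P i)^`M(s) = \sum_k g s k *: act g (P i)^`M(k) by rewrite -mderiv_act Pi.
    under eq_bigr do rewrite D mulr_sumr.
    rewrite exchange_big /= big1 // => k _; under eq_bigr do rewrite -scalerAr -rmorphM -mulrA.
    by rewrite -scaler_sumr -rmorph_sum -mulr_sumr E0 mulr0 rmorph0 scaler0.
  exists i1; have Eq : q * h0 i1 = \prod_(g <- Wl) act g (h0 i1).
    by rewrite (big_rem 1%:M) //= act1 mulrC.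
  rewrite avg_id Eq; last first.
    move=> g hg; rewrite rmorph_prod /=; under eq_bigr do rewrite act_comp.
    rewrite -(big_map (mulmx g) xpredT (fun x => act x (h0 i1))).
    by apply: perm_big; exact: Wperm.
  rewrite big_seq prodf_seq_neq0; apply/allP => g hg; apply/implyP => _.
  apply: contraNneq n0 => z; rewrite -[h0 i1]act1 -(mulmx1C (WT hg)) -act_comp z rmorph0 //.
case: hn => i2 n2; have [e0 ne0] : exists e0, pihomog mdeg e0 (h i2) != 0.
  apply: contrapT => /forallNP H; move/eqP: n2; apply; apply: pihomog_all0 => e0.
  by apply/eqP; have := H e0 => /negP; rewrite negbK.
pose e := (e0 + d i2)%N.
pose k i := if (d i <= e)%N then pihomog mdeg (e - d i) (h i) else 0.
have ki i : inv (k i) by rewrite /k; case: ifP => _; [exact: inv_pihomog | exact: inv0].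
have kE s : \sum_i k i * (P i)^`M(s) = 0.
  have := congr1 (pihomog mdeg e.-1) (hE s); rewrite raddf0 raddf_sum /= => E1; rewrite -[RHS]E1.
  apply: eq_bigr => i _; rewrite (pihomogMr _ _ (_ : (P i)^`M(s) \is (d i).-1.-homog)).
    have := Pg i; rewrite /k; case: (leqP (d i) e) => le p0.
      have -> : ((d i).-1 <= e.-1)%N by lia.
      by congr (pihomog _ _ _ * _); lia.
    case: ifP => [le2|_]; rewrite mul0r //; exfalso.
    by have := Pg i2; rewrite /e in le le2; lia.
  by apply: mderiv_homog; rewrite prednK.
have kn : k i2 != 0 by rewrite /k /e leq_addl addnK.
have khom i m : (d i + m = e)%N -> k i \is m.-homog.
  by move=> Em; rewrite /k -Em leq_addr addKn pihomogP.
have k0 i : (e < d i)%N -> k i = 0 by rewrite /k ltnNge => /negbTE ->.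
(* A generating set of least cardinality supplies what [chevalley] asks for: a coefficient outside
   the ideal that the remaining ones generate with invariant multipliers. *)
pose gen (K : {set 'I_r}) := `[< forall i, exists c : 'I_r -> S, (forall j, inv (c j)) /\
   k i = \sum_(j in K) c j * k j >].
have genT : gen setT.
  apply/asboolP => i; exists (fun j => (j == i)%:R); split=> [j|].
    by rewrite -mpolyC_nat; exact: invC.
  rewrite (bigD1 i) ?inE //= eqxx mul1r big1 ?addr0 // => j /andP[_ ji].
  by rewrite (negbTE ji) mul0r.
case: (arg_minnP (fun K : {set 'I_r} => #|K|) genT) => K gK mK.
have [i0 iK] : exists i0, i0 \in K.
  apply: contrapT => /forallNP H; move/eqP: kn; apply; move/asboolP: gK => /(_ i2) [c [_ ->]].
  by rewrite big1 // => j jK; case: (H j).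
have nI : ~ (exists c : 'I_r -> S, (forall i, inv (c i)) /\ k i0 = \sum_(i in K :\ i0) c i * k i).
  move=> [c [ci Ec]]; have : gen (K :\ i0).
    apply/asboolP => i; move/asboolP: gK => /(_ i) [c' [ci' Ec']].
    exists (fun j => c' j + c' i0 * c j); split=> [j|]; first by apply: invD => //; apply: invM.
    rewrite Ec' (big_setD1 i0) //= Ec mulr_sumr -big_split /=; apply: eq_bigr => j _.
    by rewrite mulrDl mulrA addrC.
  by move=> /mK; rewrite [X in (X <= _)%N](cardsD1 i0) iK ltnn.
have [C HC] : exists C : 'I_r -> 'I_r -> S, forall i, (forall j, inv (C i j) /\
   (if (d i <= d j)%N then C i j \is (d j - d i).-homog else C i j == 0)) /\
   k i = \sum_(j in K) C i j * k j.
  suff Hc i : exists Ci : 'I_r -> S, (forall j, inv (Ci j) /\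
     (if (d i <= d j)%N then Ci j \is (d j - d i).-homog else Ci j == 0)) /\
     k i = \sum_(j in K) Ci j * k j by have [C HC] := choice Hc; exists C.
  move/asboolP: gK => /(_ i) [c [ci Ec]].
  exists (fun j => if (d i <= d j)%N then pihomog mdeg (d j - d i) (c j) else 0); split=> [j|].
    by case: ifP => _; split; rewrite ?pihomogP //; [exact: inv_pihomog | exact: inv0].
  have [lt|le] := ltnP e (d i).
    rewrite k0 // big1 // => j jK; case: ifP => le; last by rewrite mul0r.
    rewrite (k0 j) ?mulr0 //.
    exact: leq_trans le.
  rewrite -{1}(pihomog_dE (khom i _ (subnKC le))) Ec raddf_sum /=; apply: eq_bigr => j jK.
  have [lt|lej] := ltnP e (d j); first by rewrite (k0 j) // !mulr0 raddf0.
  rewrite (pihomogMr _ _ (khom j _ (subnKC lej))).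
  case: (leqP (d i) (d j)) => ij.
    by have [-> ->] := sub_chain ij lej.
  case: ifP => [le2|_]; last by rewrite mul0r.
  by exfalso; move: le2; rewrite leqNgt ltn_sub2l // (leq_trans ij).
pose u s j : S := if j \in K then (P j)^`M(s) + \sum_(i | i \notin K) C i j * (P i)^`M(s) else 0.
have uE s : \sum_j (if j \in K then k j else 0) * u s j = 0.
  rewrite -[RHS](kE s) (bigID (mem K)) /= [X in _ + X]big1 ?addr0; last first.
    by move=> j /negbTE jK; rewrite jK mul0r.
  rewrite [RHS](bigID (mem K)) /=.
  have -> : \sum_(i | i \notin K) k i * (P i)^`M(s) =
     \sum_(j in K) k j * \sum_(i | i \notin K) C i j * (P i)^`M(s).
    under [RHS]eq_bigr do rewrite mulr_sumr.
    rewrite [RHS]exchange_big /=; apply: eq_bigr => i _.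
    have [_ {1}->] := HC i; rewrite mulr_suml; apply: eq_bigr => j _.
    by rewrite mulrCA mulrA.
  rewrite -big_split /=; apply: eq_bigr => j jK; by rewrite /u jK -mulrDr.
have uI s : inI (u s i0).
  apply: (@chevalley r (fun j => if j \in K then k j else 0) (u s) i0 (d i0).-1) => //.
  - by move=> j; case: ifP => // _; exact: inv0.
  - rewrite /u iK; apply: dhomogD; first by apply: mderiv_homog; rewrite prednK.
    apply: homog_sum => i _; have [HCi _] := HC i; have [_] := HCi i0; case: ifP => [le h4|_ /eqP ->].
      rewrite (pred_split (Pg i) le).
      by apply: dhomogM => //; apply: mderiv_homog; rewrite prednK.
    by rewrite mul0r dhomog0.
  - move=> [c [ci]]; rewrite iK => Ec; apply: nI; exists c; split=> //; rewrite Ec.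
    rewrite (bigID (mem K)) /= [X in _ + X]big1 ?addr0.
      by apply: eq_big => j; rewrite ?inE // => /andP[_ ->].
    by move=> j /andP[_ /negbTE ->]; rewrite mulr0.
apply: (h2 i0).
have Eu : \sum_s 'X_s * u s i0 = (d i0)%:R *: P i0 + \sum_(i | i \notin K) (d i)%:R *: (C i i0 * P i).
  rewrite /u iK; under eq_bigr do rewrite mulrDr mulr_sumr.
  rewrite big_split /= (euler (Pd i0)); congr (_ + _); rewrite exchange_big /=; apply: eq_bigr => i _.
  by rewrite scalerAr -(euler (Pd i)) mulr_sumr; apply: eq_bigr => s _; rewrite mulrCA.
have Lo : idl P (predC1 i0) (\sum_s 'X_s * u s i0).
  have hom : \sum_s 'X_s * u s i0 \is (d i0).-homog.
    apply: homog_sum => s _; rewrite -(prednK (Pg i0)) -add1n; apply: dhomogM.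
      by rewrite dhomogX; apply/eqP; exact: mdeg1.
    rewrite /u iK; apply: dhomogD; first by apply: mderiv_homog; rewrite prednK.
    apply: homog_sum => i _; have [HCi _] := HC i; have [_] := HCi i0; case: ifP => [le h4|_ /eqP ->].
      rewrite (pred_split (Pg i) le).
      by apply: dhomogM => //; apply: mderiv_homog; rewrite prednK.
    by rewrite mul0r dhomog0.
  rewrite -(pihomog_dE hom) raddf_sum /=; apply: idl_sum => s _.
  have [m [a [b [dd [ha ->]]]]] := uI s; rewrite mulr_sumr raddf_sum /=; apply: idl_sum => j _.
  have [aj pj hj] := ha j; rewrite mulrCA mulrC (pihomogMr _ _ hj); case: ifP => [le|_]; last exact: idl0.
  case: (ltnP (dd j) (d i0)) => [lt|ge].
    by apply: idlM; apply: (good_small gP aj hj); rewrite pj.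
  have -> : (d i0 - dd j = 0)%N by apply/eqP; rewrite subn_eq0.
  have -> : pihomog mdeg 0 ('X_s * b j) = 0; last by rewrite mul0r; exact: idl0.
  rewrite mulrC (@pihomogMr 'X_s _ 1) //; rewrite dhomogX; apply/eqP; exact: mdeg1.
have -> : P i0 = ((d i0)%:R^-1)%:MP * (\sum_s 'X_s * u s i0
    + (-1) * \sum_(i | i \notin K) (d i)%:R *: (C i i0 * P i)).
  rewrite Eu mulN1r addrK mul_mpolyC scalerA mulVf ?scale1r // pnatr_eq0 -lt0n //.
apply: idlM; apply: idlD => //; apply: idlM; apply: idl_sum => i iK'.
rewrite scalerAl; apply: idlM; apply: idl_gen => /=.
by apply: contraNneq iK' => ->.
Qed.

Lemma good_le r (P : 'I_r -> S) d : good P d -> (r <= l)%N.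
Proof.
move=> gP; rewrite leqNgt; apply/negP => lt.
have [h h0 hE] := wide_kernel (\matrix_(i < r, s < l) (P i)^`M(s)) lt.
move/eqP: h0; apply; apply/rowP => i; rewrite mxE.
apply: (good_indep gP (h := fun i => h 0 i)) => s.
have := congr1 (fun A : 'rV[S]_l => A 0 s) hE; rewrite !mxE => E; rewrite -[RHS]E.
by apply: eq_bigr => k _; rewrite mxE.
Qed.

Lemma good_ext r (P : 'I_r -> S) d f e : good P d -> inv f -> f \is e.-homog -> (0 < e)%N ->
  ~ idl P predT f -> (forall g k, inv g -> g \is k.-homog -> (0 < k < e)%N -> idl P predT g) ->
  exists (P' : 'I_r.+1 -> S) d', good P' d'.
Proof.
move=> gP fi fe e0 nf min; have [h1 h2 h3] := gP.
have de j : (d j <= e)%N.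
  by rewrite leqNgt; apply/negP => lt; apply: nf; apply: (h3 j f e) => //; rewrite e0.
pose ext T (x : T) (F : 'I_r -> T) (i : 'I_r.+1) := if unlift ord_max i is Some j then F j else x.
have extL T x (F : 'I_r -> T) j : ext T x F (lift ord_max j) = F j by rewrite /ext liftK.
have extM T x (F : 'I_r -> T) : ext T x F ord_max = x by rewrite /ext unlift_none.
pose P' := ext _ f P; pose d' := ext _ e d; exists P', d'.
have PL j : P' (lift ord_max j) = P j by rewrite /P' /ext liftK.
have PM : P' ord_max = f by rewrite /P' /ext unlift_none.
have up (A : pred 'I_r.+1) g : idl P predT g -> (forall j, A (lift ord_max j)) -> idl P' A g.
  move=> [c E] hA; exists (ext _ 0 c); rewrite E [RHS]big_mkcond (sum_lift ord_max) extM mul0r.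
  rewrite if_same add0r; apply: eq_bigr => j _.
  by rewrite hA /P' /ext liftK.
split=> [i|i|i g k gi gk lt].
- by rewrite /P' /d' /ext; case: unliftP => [j _|_]; [exact: h1 | split].
- case: (unliftP ord_max i) => [j ->|->] -[c]; rewrite big_mkcond (sum_lift ord_max) /=.
    rewrite neq_lift PL PM => E.
    have {}E : P j = c ord_max * f + \sum_(k | k != j) c (lift ord_max k) * P k.
      rewrite E; congr (_ + _); rewrite [RHS]big_mkcond; apply: eq_bigr => k _.
      by rewrite (inj_eq lift_inj) PL.
    have [_ _ hj] := h1 j; have := congr1 (pihomog mdeg (d j)) E.
    rewrite raddfD raddf_sum /= (pihomog_dE hj) (pihomogMr _ _ fe).
    have -> : \sum_(k | k != j) pihomog mdeg (d j) (c (lift ord_max k) * P k) =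
      \sum_(k | k != j) (if (d k <= d j)%N then pihomog mdeg (d j - d k) (c (lift ord_max k)) else 0) * P k.
      apply: eq_bigr => k _; rewrite (pihomogMr _ _ (_ : P k \is (d k).-homog)).
        by case: ifP; rewrite ?mul0r.
      by case: (h1 k).
    set D := \sum_(k | _) _ => E2; have D1 : idl P (predC1 j) D by eexists; reflexivity.
    case: ifP E2 => [le|_]; last by rewrite add0r => E2; apply: (h2 j); rewrite E2.
    have -> : (d j - e = 0)%N by have := de j; lia.
    have [t ->] := homog0C (pihomogP mdeg 0 (c ord_max)).
    have [->|t0] := eqVneq t 0; first by rewrite mpolyC0 mul0r add0r => E2; apply: (h2 j); rewrite E2.
    move=> E2; apply: nf; have -> : f = (t^-1)%:MP * (P j + (-1) * D).
      by rewrite E2 mulN1r addrK mulrA -mpolyCM mulVf // mpolyC1 mul1r.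
    apply: idlM; apply: idlD; first exact: idl_gen.
    apply: idlM; case: D1 => cc ->; exists (fun k => if k != j then cc k else 0).
    rewrite big_mkcond; apply: eq_bigr => k _ /=; by case: ifP; rewrite ?mul0r.
  rewrite eqxx add0r PM => E; apply: nf; exists (fun j => c (lift ord_max j)); rewrite E.
  by apply: eq_bigr => j _; rewrite eq_sym neq_lift PL.
- apply: up => //; apply: (min g k) => //; case/andP: lt => -> lt /=; apply: (leq_trans lt).
  by rewrite /d' /ext; case: unliftP => [j _|_].
Qed.

Lemma good_max : exists r (P : 'I_r -> S) d, good P d /\
  forall f e, inv f -> f \is e.-homog -> (0 < e)%N -> idl P predT f.
Proof.
pose ex r := `[< exists (P : 'I_r -> S) d, good P d >].
have ex0 : exists r, ex r.
  by exists 0%N; apply/asboolP; exists (fun=> 0), (fun=> 0%N); split=> -[].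
have exl r : ex r -> (r <= l)%N by move=> /asboolP[P [d gP]]; apply: good_le gP.
case: (ex_maxnP ex0 exl) => r /asboolP[P [d gP]] mx; exists r, P, d; split=> //.
apply: contrapT => N.
pose bad e := `[< exists f, [/\ inv f, f \is e.-homog, (0 < e)%N & ~ idl P predT f] >].
have exb : exists e, bad e.
  apply: contrapT => /forallNP H; apply: N => f e fi fe e0; apply: contrapT => nf.
  by apply: (H e); apply/asboolP; exists f; split.
case: (ex_minnP exb) => e /asboolP[f [fi fe e0 nf]] mn.
have [|P' [d' gP']] := good_ext gP fi fe e0 nf.
  move=> g k gi gk /andP[k0 ke]; apply: contrapT => ng.
  have /mn : bad k by apply/asboolP; exists g; split.
  by rewrite leqNgt ke.
have /mx : ex r.+1 by apply/asboolP; exists P', d'.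
by rewrite ltnn.
Qed.

Section Full.
Variables (r : nat) (P : 'I_r -> S) (d : 'I_r -> nat).
Hypothesis gP : good P d.
Hypothesis full : forall f e, inv f -> f \is e.-homog -> (0 < e)%N -> idl P predT f.
Let Pi i : inv (P i). Proof. by case: gP => /(_ i) []. Qed.
Let Pd i : P i \is (d i).-homog. Proof. by case: gP => /(_ i) []. Qed.
Let Pg i : (0 < d i)%N. Proof. by case: gP => /(_ i) []. Qed.

Definition dspan f := exists q : 'I_r -> S, forall s, f^`M(s) = \sum_j q j * (P j)^`M(s).
(** Averaging an expression of [f] in the ideal makes its multipliers invariant and of lower degree;
    the product rule and induction do the rest. *)
Lemma dspan_hom e f : inv f -> f \is e.-homog -> dspan f.
Proof.
have [k] := ubnP e; elim: k e f => // k IH [|e] f lek fi fe.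
  have [c ->] := homog0C fe; exists (fun=> 0) => s.
  by rewrite mderivC big1 // => j _; rewrite mul0r.
have [c E] := full fi fe isT.
pose c' j := if (d j <= e.+1)%N then avg (pihomog mdeg (e.+1 - d j) (c j)) else 0.
have ci j : inv (c' j) by rewrite /c'; case: ifP => _; [exact: avg_inv | exact: inv0].
have Ef : f = \sum_j c' j * P j.
  rewrite -{1}(avg_id fi) -{1}(pihomog_dE fe) E raddf_sum /= avg_sum; apply: eq_bigr => j _.
  rewrite (pihomogMr _ _ (Pd j)) /c'; case: ifP => _; first by rewrite mulrC avgM // mulrC.
  by rewrite mul0r avg_id //; exact: inv0.
have H j : dspan (c' j).
  apply: (IH (e.+1 - d j)%N) => //; first by have := Pg j; lia.
  by rewrite /c'; case: ifP => _; [apply/avg_hom/pihomogP | exact: dhomog0].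
have [q hq] := choice H.
exists (fun j => c' j + \sum_i q i j * P i) => s.
rewrite {1}Ef raddf_sum /=; under eq_bigr do rewrite mderivM hq mulr_suml.
rewrite big_split /= exchange_big /= addrC -big_split /=; apply: eq_bigr => j _.
rewrite mulrDl mulr_suml; congr (_ + _); apply: eq_bigr => i _.
by rewrite mulrAC.
Qed.
Lemma dspan_inv f : inv f -> dspan f.
Proof.
move=> fi; have H (e : 'I_(msize f)) : dspan (pihomog mdeg e f).
  by apply: (@dspan_hom e); [exact: inv_pihomog | exact: pihomogP].
have [q hq] := choice H; exists (fun j => \sum_e q e j) => s.
rewrite {1}(pihomog_partitionE (leqnn (mmeasure mdeg f))) raddf_sum /=.
under eq_bigr do rewrite hq.
by rewrite exchange_big /=; apply: eq_bigr => j _; rewrite mulr_suml.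
Qed.

Definition orb (u : 'rV[R]_l) := undup [seq u *m g | g <- Wl].
Lemma orb_self u : u \in orb u.
Proof. by rewrite mem_undup; apply/mapP; exists 1%:M => //; rewrite mulmx1. Qed.
Lemma orbP u w : reflect (exists2 g, g \in Wl & w = u *m g) (w \in orb u).
Proof. by rewrite mem_undup; apply: (iffP mapP). Qed.
(** The derivative of the orbit polynomial [Fpoly u] at its root, the form of [u]. *)
Definition Fu u : S := \prod_(w <- rem u (orb u)) linform (u - w).

Lemma WTin g : g \in Wl -> g^T \in Wl.
Proof.
move=> hg; have : 1%:M \in map (mulmx g) Wl by rewrite (perm_mem (Wperm hg)).
case/mapP=> h hh E; suff -> : g^T = h by [].
by rewrite -[h]mul1mx -(mulmx1C (WT hg)) -mulmxA -E mulmx1.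
Qed.
Lemma orb_perm u g : g \in Wl -> perm_eq (map (fun w => w *m g) (orb u)) (orb u).
Proof.
move=> hg; have ug : uniq (map (fun w => w *m g) (orb u)).
  rewrite map_inj_in_uniq ?undup_uniq // => x y _ _ E.
  by rewrite -[x]mulmx1 -[y]mulmx1 -(WT hg) !mulmxA E.
have sub : {subset map (fun w => w *m g) (orb u) <= orb u}.
  move=> x /mapP[y /orbP[k hk ->] ->]; apply/orbP; exists (k *m g); first exact: WM.
  by rewrite mulmxA.
have [_ E] := uniq_min_size ug sub (ltac:(by rewrite size_map)).
by apply: uniq_perm => //; exact: undup_uniq.
Qed.
Definition Fpoly u : {poly S} := \prod_(w <- orb u) ('X - (linform w)%:P).
Lemma Fpoly_inv u k : inv (Fpoly u)`_k.
Proof.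
move=> g hg; have E : map_poly (act g) (Fpoly u) = Fpoly u.
  rewrite /Fpoly rmorph_prod /=.
  under eq_bigr do rewrite rmorphB /= map_polyX map_polyC /= act_lin.
  by rewrite -[RHS](perm_big _ (orb_perm u (WTin hg))) /= big_map.
by rewrite -{2}E coef_map.
Qed.
(** The orbit polynomial has invariant coefficients and vanishes at the form of [u]. Differentiating
    that identity expresses [Fu u] times the differential of the form through differentials of
    invariants. *)
Lemma Fu_span (u : 'rV[R]_l) : exists q : 'I_r -> S, forall s, (u 0 s)%:MP * Fu u = \sum_j q j * (P j)^`M(s).
Proof.
set U := linform u; have Fr : Fpoly u = ('X - U%:P) * \prod_(w <- rem u (orb u)) ('X - (linform w)%:P).
  by rewrite /Fpoly (big_rem u) ?orb_self.
have F0 : (Fpoly u).[U] = 0 by rewrite Fr hornerM hornerXsubC subrr mul0r.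
have F1 : (Fpoly u)^`().[U] = Fu u.
  rewrite Fr derivM hornerD !hornerM derivXsubC hornerC mul1r hornerXsubC subrr mul0r addr0.
  rewrite horner_prod; apply: eq_bigr => w _; by rewrite hornerXsubC linformB.
have [q hq] := choice (fun k : 'I_(size (Fpoly u)) => dspan_inv (Fpoly_inv u k)).
exists (fun j => - \sum_(k < size (Fpoly u)) U ^+ k * q k j) => s.
have := congr1 (mderiv s) F0; rewrite raddf0 horner_coef raddf_sum /=.
have dX k : (U ^+ k)^`M(s) = (u 0 s)%:MP * (k%:R * U ^+ k.-1).
  elim: k => [|k IH]; first by rewrite expr0 mul0r mulr0 -mpolyC1 mderivC.
  rewrite exprS mderivM IH mderiv_lin; case: k {IH} => [|k] /=.
    by rewrite mul0r !mulr0 addr0 mul1r.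
  by rewrite [U ^+ k.+1]exprS [k.+2%:R]mulrS; ring.
under eq_bigr do rewrite mderivM dX hq.
rewrite big_split /= => /eqP; rewrite addrC addr_eq0 => /eqP E2.
have <- : \sum_(i < size (Fpoly u)) (Fpoly u)`_i * ((u 0 s)%:MP * (i%:R * U ^+ i.-1)) = (u 0 s)%:MP * Fu u.
  have Ed (p : {poly S}) : p^`().[U] = \sum_(i < size p) p`_i * (i%:R * U ^+ i.-1).
    rewrite -{1}[p]coefK poly_def raddf_sum horner_sum; apply: eq_bigr => i _ /=.
    by rewrite derivZ derivXn hornerZ hornerMn hornerXn mulr_natl.
  by rewrite -F1 Ed mulr_sumr; apply: eq_bigr => i _; rewrite mulrCA.
rewrite E2; under eq_bigr do rewrite mulr_suml.
rewrite exchange_big /= -sumrN; apply: eq_bigr => j _; rewrite mulNr mulr_suml; congr (- _).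
by apply: eq_bigr => k _; rewrite mulrC mulrA.
Qed.

(** Some difference u - w is proportional to [b]; as [w] has the length of [u], it must be the
    mirror image of [u] in [b]. *)
Lemma Fu_dvd u (b : 'rV[R]_l) : b != 0 -> mdvd (linform b) (Fu u) ->
  dotp u b != 0 /\ exists2 g, g \in Wl & u *m g = u *m refl b.
Proof.
move=> b0 H; have [w hw E] : exists2 w, w \in rem u (orb u) & mdvd (linform b) (linform (u - w)).
  apply: contrapT => /forall2NP N; move: H; rewrite /Fu big_seq; apply: lin_dvd_prod => // w hw.
  by case: (N w).
move: hw; rewrite mem_rem_uniq ?undup_uniq // inE => /andP[wu /orbP[g hg Ew]].
have [t Et] : exists t, u - w = t *: b.
  by apply: contrapT => /forallNP N; apply: (lin_ndvd b0 N).
have Ew2 : w = u - t *: b by rewrite -Et opprB addrC subrK.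
have nw : dotp w w = dotp u u by rewrite Ew dotp_mulmx -mulmxA WT // mulmx1.
have t0 : t != 0 by apply: contraNneq wu => t0; rewrite Ew2 t0 scale0r subr0.
have Et2 : 2 * dotp u b = t * dotp b b.
  move: nw; rewrite Ew2 !dotpBl !dotpBr !dotpZl !dotpZr [dotp b u]dotpC => nw.
  by apply: (mulfI t0); lra.
split; last by exists g => //; rewrite -Ew Ew2 mul_refl Et2 mulfK // dotp_eq0.
apply: contraNneq t0 => ub; move: Et2; rewrite ub mulr0 => /esym/eqP.
by rewrite mulf_eq0 dotp_eq0 (negbTE b0) orbF.
Qed.
Lemma Fu_sq u (b : 'rV[R]_l) : b != 0 -> ~ mdvd (linform b ^+ 2) (Fu u).
Proof.
move=> b0 H; have [|_ [g hg Eg]] := Fu_dvd b0 (u := u).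
  by apply: mdvd_trans H; rewrite expr2; apply/mdvd_mulr/mdvd_refl.
set w0 := u *m refl b in Eg.
have key w : w \in rem u (orb u) -> mdvd (linform b) (linform (u - w)) -> w = w0.
  rewrite mem_rem_uniq ?undup_uniq // inE => /andP[wu /orbP[g' hg' Ew]] E.
  have [t Et] : exists t, u - w = t *: b.
    by apply: contrapT => /forallNP N; apply: (lin_ndvd b0 N).
  have Ew2 : w = u - t *: b by rewrite -Et opprB addrC subrK.
  have nw : dotp w w = dotp u u by rewrite Ew dotp_mulmx -mulmxA WT // mulmx1.
  have t0 : t != 0 by apply: contraNneq wu => t0; rewrite Ew2 t0 scale0r subr0.
  have Et2 : 2 * dotp u b = t * dotp b b.
    move: nw; rewrite Ew2 !dotpBl !dotpBr !dotpZl !dotpZr [dotp b u]dotpC => nw.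
    by apply: (mulfI t0); lra.
  by rewrite Ew2 /w0 mul_refl Et2 mulfK // dotp_eq0.
have [w1|w1] := boolP (w0 \in rem u (orb u)); last first.
  have : mdvd (linform b) (Fu u) by apply: mdvd_trans H; rewrite expr2; apply/mdvd_mulr/mdvd_refl.
  rewrite /Fu big_seq; apply: lin_dvd_prod => // w hw hd; have E := key w hw hd.
  by rewrite -E hw in w1.
move: H; rewrite /Fu (big_rem w0) //= mulrC expr2 => H.
have nr : ~ mdvd (linform b) (\prod_(w <- rem w0 (rem u (orb u))) linform (u - w)).
  rewrite big_seq; apply: lin_dvd_prod => // w hw hd.
  have ur : uniq (rem u (orb u)) by rewrite rem_uniq ?undup_uniq.
  move: hw; rewrite mem_rem_uniq // inE => /andP[ww hw].
  by move/eqP: ww; apply; apply: key.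
have := lin_primeX (m := 2) b0 nr; rewrite expr2 => /(_ _ H).
have hs : linform (u - w0) \is 1.-homog := linform_homog _.
have hb2 : linform b * linform b \is 2.-homog by apply: (@dhomogM _ _ _ 1 _ 1); apply: linform_homog.
move=> hd; have : linform (u - w0) = 0.
  by apply: (mdvd_small _ hb2 hs hd) => //; rewrite mulf_neq0 // linform_eq0.
move/eqP; rewrite linform_eq0 subr_eq0 => /eqP E; move: w1.
by rewrite -E mem_rem_uniq ?undup_uniq // inE eqxx.
Qed.
Lemma Fu_neq0 u : Fu u != 0.
Proof.
rewrite /Fu big_seq prodf_seq_neq0; apply/allP => w hw; apply/implyP => _.
rewrite linform_eq0 subr_eq0; apply: contraTneq hw => <-.
by rewrite mem_rem_uniq ?undup_uniq // inE eqxx.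
Qed.

Lemma r_ge : (l <= r)%N.
Proof.
rewrite leqNgt; apply/negP => lt.
have [h h0 hE] := wide_kernel (\matrix_(s < l, j < r) (P j)^`M(s)) lt.
move/eqP: h0; apply; apply/rowP => i; rewrite mxE.
have [q hq] := Fu_span (delta_mx 0 i).
have : h 0 i * Fu (delta_mx 0 i) = 0.
  transitivity (\sum_s h 0 s * (((delta_mx 0 i : 'rV[R]_l) 0 s)%:MP * Fu (delta_mx 0 i))).
    rewrite (bigD1 i) //= mxE !eqxx mpolyC1 mul1r big1 ?addr0 // => s si.
    by rewrite mxE eqxx (negbTE si) mpolyC0 mul0r mulr0.
  under eq_bigr do rewrite hq mulr_sumr.
  rewrite exchange_big big1 // => j _ /=; under eq_bigr do rewrite mulrCA.
  rewrite -mulr_sumr; have := congr1 (fun A : 'rV[S]_r => A 0 j) hE; rewrite !mxE => E.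
  rewrite [X in q j * X](_ : _ = 0) ?mulr0 // -[RHS]E.
  by apply: eq_bigr => x _; rewrite mxE.
by move=> /eqP; rewrite mulf_eq0 (negbTE (Fu_neq0 _)) orbF => /eqP.
Qed.
End Full.

Lemma dvd_lin_prod (I : Type) (L : seq I) (w : I -> 'rV[R]_l) (D X : S) (t : R) :
  t != 0 -> (forall i, w i != 0) -> D * X = t *: \prod_(i <- L) linform (w i) ->
  exists (T : seq I) t', t' != 0 /\ D = t' *: \prod_(i <- T) linform (w i).
Proof.
move=> t0 w0; elim: L D X => [|i L IH] D X.
  rewrite big_nil => E; have D0 : D != 0.
    by apply: contra_eq_neq E => ->; rewrite mul0r eq_sym scaler_eq0 (negbTE t0) oner_eq0.
  have X0 : X != 0.
    by apply: contra_eq_neq E => ->; rewrite mulr0 eq_sym scaler_eq0 (negbTE t0) oner_eq0.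
  have := congr1 (fun p : S => msize p) E; rewrite msizeM // msizeZ // msize1 => Es.
  have : msize D == 1%N.
    have := D0; rewrite -msize_poly_eq0; have := X0; rewrite -msize_poly_eq0.
    by move: (msize D) (msize X) Es => x y; lia.
  by move=> /msize_poly1P [c c0 ->]; exists [::], c; split=> //; rewrite big_nil -mul_mpolyC mulr1.
rewrite big_cons => E; have h : mdvd (linform (w i)) (D * X).
  by exists (t *: \prod_(j <- L) linform (w j)); rewrite E -scalerAr.
have l0 : linform (w i) != 0 by rewrite linform_eq0.
case: (lin_prime (w0 i) h) => -[D' E'].
  have [|T [t' [t0' ET]]] := IH D' X.
    by apply: (mulfI l0); rewrite mulrA -E' E -scalerAr.
  by exists (i :: T), t'; split=> //; rewrite E' ET big_cons scalerAr.
by apply: (IH D D'); apply: (mulfI l0); rewrite mulrCA -E' E -scalerAr.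
Qed.

Variable Pos : seq 'rV[R]_l.
Hypothesis Pos0 : forall a, a \in Pos -> a != 0.
Hypothesis nonroot : forall b : 'rV[R]_l, b != 0 -> (forall a t, a \in Pos -> b <> t *: a) ->
  exists2 u, dotp u b != 0 & forall g, g \in Wl -> u *m g != u *m refl b.

(** The degree bound takes the place of a Molien series. For every basis u_k the Jacobian
    determinant divides the product of the [Fu (u k)], up to a constant, so it is a product of
    linear forms. A basis through [b] with its other members orthogonal to [b] shows that no form
    occurs twice; starting instead from a vector supplied by [nonroot] shows that only root forms
    occur. *)
Theorem basic_invariants : exists (P : 'I_l -> S) (d : 'I_l -> nat),
  [/\ forall j, inv (P j), forall j, (0 < d j)%N /\ P j \is (d j).-homog,
   \det (\matrix_(i, j) (P j)^`M(i)) != 0 & (\sum_j (d j).-1 <= size Pos)%N].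
Proof.
have [r [P [d [gP full]]]] := good_max.
have Er : r = l by apply/eqP; rewrite eqn_leq (good_le gP) (r_ge gP full).
subst r; exists P, d; have [h1 _ _] := gP.
have Jd : \det (\matrix_(i, j) (P j)^`M(i)) != 0.
  set J := \matrix_(i, j) _; apply/negP => /eqP D0.
  have [q hq] := choice (fun k : 'I_l => Fu_span gP full (delta_mx 0 k)).
  have E : J *m \matrix_(j, k) q k j = diag_mx (\row_k Fu (delta_mx 0 k)).
    apply/matrixP => s k; rewrite !mxE; under eq_bigr do rewrite !mxE mulrC.
    rewrite -hq mxE eqxx /= eq_sym; case: eqP => [->|_]; first by rewrite mpolyC1 mul1r mulr1n.
    by rewrite mpolyC0 mul0r mulr0n.
  have := congr1 determinant E; rewrite det_mulmx D0 mul0r det_diag => /esym/eqP.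
  by apply/negP; rewrite prodf_seq_neq0; apply/allP => k _; rewrite mxE Fu_neq0.
split=> // [j|j|]; [by case: (h1 j) | by case: (h1 j) |].
set J := \matrix_(i, j) _ in Jd; set D := \det J in Jd.
have span (u : 'I_l -> 'rV[R]_l) : exists X, D * X = (\det (\matrix_(i, k) u k 0 i))%:MP * \prod_k Fu (u k).
  have [q hq] := choice (fun k : 'I_l => Fu_span gP full (u k)).
  exists (\det (\matrix_(j, k) q k j)); rewrite -det_mulmx.
  have -> : J *m \matrix_(j, k) q k j = cmx l (\matrix_(i, k) u k 0 i) *m diag_mx (\row_k Fu (u k)).
    apply/matrixP => s k; rewrite mul_mx_diag !mxE hq; apply: eq_bigr => j _.
    by rewrite !mxE mulrC.
  by rewrite det_mulmx /cmx det_map_mx det_diag; congr (_ * _); apply: eq_bigr => k _; rewrite mxE.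
have basis b u0 : b != 0 -> dotp u0 b != 0 -> exists (u : 'I_l -> 'rV[R]_l) i0,
   [/\ u i0 = u0, forall i, i != i0 -> dotp (u i) b = 0 & \det (\matrix_(i, k) u k 0 i) != 0].
  move=> b0 ub; have [i0 bi] : exists i, b 0 i != 0.
    apply: contrapT => /forallNP ne; move/eqP: b0; apply; apply/rowP => i; rewrite mxE.
    by apply/eqP; have := ne i => /negP; rewrite negbK.
  pose u i := if i == i0 then u0 else (delta_mx 0 i : 'rV[R]_l) *m projm b.
  exists u, i0; split=> [|i ii|]; first by rewrite /u eqxx.
    rewrite /u (negbTE ii) mul_projm dotpBl dotpZl mulfVK ?subrr // dotp_eq0 //.
  rewrite -det_tr; apply/det0P => -[t t0 E]; move/eqP: t0; apply.
  have Es : \sum_k t 0 k *: u k = 0.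
    rewrite -[RHS]E; apply/rowP => j; rewrite summxE !mxE; apply: eq_bigr => k _; by rewrite !mxE.
  have ti0 : t 0 i0 = 0.
    have := congr1 (fun x => dotp x b) Es; rewrite dotp0l dotp_suml (bigD1 i0) //= big1.
      by rewrite addr0 dotpZl /u eqxx => /eqP; rewrite mulf_eq0 (negbTE ub) orbF => /eqP.
    move=> k ki; rewrite dotpZl /u (negbTE ki) mul_projm dotpBl dotpZl mulfVK ?subrr ?mulr0 //.
    by rewrite dotp_eq0.
  pose y := \sum_(k | k != i0) t 0 k *: (delta_mx 0 k : 'rV[R]_l).
  have yp : y *m projm b = 0.
    rewrite -[RHS]Es (bigD1 i0) //= ti0 scale0r add0r mulmx_suml; apply: eq_bigr => k ki.
    by rewrite /u (negbTE ki) scalemxAl.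
  have yc k : y 0 k = if k == i0 then 0 else t 0 k.
    rewrite /y summxE; case: eqP => [->|/eqP ki].
      by rewrite big1 // => j ji; rewrite !mxE eqxx eq_sym (negbTE ji) mulr0.
    rewrite (bigD1 k) //= !mxE !eqxx mulr1 big1 ?addr0 // => j /andP[_ jk].
    by rewrite !mxE eqxx eq_sym (negbTE jk) mulr0.
  move: yp; rewrite mul_projm => /eqP; rewrite subr_eq0 => /eqP yp.
  have c0 : dotp y b / dotp b b = 0.
    have := congr1 (fun x : 'rV[R]_l => x 0 i0) yp; rewrite yc eqxx mxE => /esym/eqP.
    by rewrite mulf_eq0 (negbTE bi) orbF => /eqP.
  rewrite c0 scale0r in yp; apply/rowP => k; rewrite mxE; have := yc k; rewrite yp mxE.
  by case: eqP => [->|].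
have prodD (F : 'I_l -> S) (u : 'I_l -> 'rV[R]_l) i0 : \prod_k Fu (u k) = Fu (u i0) * \prod_(k | k != i0) Fu (u k).
  by rewrite (bigD1 i0).
have strip b m (u : 'I_l -> 'rV[R]_l) i0 : b != 0 -> (forall i, i != i0 -> dotp (u i) b = 0) ->
   \det (\matrix_(i, k) u k 0 i) != 0 -> mdvd (linform b ^+ m) D -> mdvd (linform b ^+ m) (Fu (u i0)).
  move=> b0 ob du hd; have [X EX] := span u.
  have h : mdvd (linform b ^+ m) (\prod_(k | k != i0) Fu (u k) * Fu (u i0)).
    have -> : \prod_(k | k != i0) Fu (u k) * Fu (u i0) = (\det (\matrix_(i, k) u k 0 i))^-1%:MP * (D * X).
      by rewrite EX mulrA -mpolyCM mulVf // mpolyC1 mul1r (prodD (fun=> 0) _ i0) mulrC.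
    by apply: mdvd_mull; apply: mdvd_mulr.
  apply: lin_primeX h => //; apply: lin_dvd_prod => // k ki /(Fu_dvd b0) [].
  by rewrite ob // eqxx.
have sq b : b != 0 -> ~ mdvd (linform b ^+ 2) D.
  move=> b0 hd; have [||u [i0 [_ ob du]]] := @basis b b => //; first by rewrite dotp_eq0.
  exact: Fu_sq b0 (strip _ _ _ _ b0 ob du hd).
have rt b : b != 0 -> mdvd (linform b) D -> exists2 a, a \in Pos & exists t, b = t *: a.
  move=> b0 hd; apply: contrapT => /forall2NP N.
  have [|u0 ub hu] := nonroot b0.
    by move=> a t ha E; have [//|] := N a; apply; exists t.
  have [u [i0 [Eu ob du]]] := basis _ _ b0 ub.
  have := strip b 1%N u i0 b0 ob du; rewrite expr1 => /(_ hd) /(Fu_dvd b0) [_ [g hg Eg]].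
  by have := hu g hg; rewrite -Eu Eg eqxx.
have [X EX] := span (fun k => delta_mx 0 k).
have [T [t [t0 ET]]] : exists (T : seq 'rV[R]_l) t, t != 0 /\ D = t *: \prod_(w <- T) linform w.
  pose fix_w (w : 'rV[R]_l) := if w == 0 then const_mx 1 else w.
  have Ed : \det (\matrix_(i, k) (delta_mx 0 k : 'rV[R]_l) 0 i) = 1 :> R.
    suff -> : \matrix_(i, k) (delta_mx 0 k : 'rV[R]_l) 0 i = 1%:M by rewrite det1.
    by apply/matrixP => i k; rewrite !mxE eqxx.
  rewrite Ed mpolyC1 mul1r in EX.
  pose L := flatten [seq [seq (delta_mx 0 k - w : 'rV[R]_l) | w <- rem (delta_mx 0 k) (orb (delta_mx 0 k))] | k <- enum 'I_l].
  have EL : \prod_k Fu (delta_mx 0 k) = \prod_(w <- L) linform w.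
    by rewrite /L big_flatten big_map big_enum /=; apply: eq_bigr => k _; rewrite big_map.
  have L0 w : w \in L -> w != 0.
    move=> /flattenP[s /mapP[k _ ->] /mapP[x hx ->]]; rewrite subr_eq0; apply: contraTneq hx => <-.
    by rewrite mem_rem_uniq ?undup_uniq // inE eqxx.
  have EX' : D * X = 1 *: \prod_(i <- enum 'I_(size L)) linform (tnth (in_tuple L) i).
    by rewrite scale1r EX EL big_enum [LHS](big_tnth _ _ L).
  have [||T [t [t0 ET]]] := dvd_lin_prod _ _ EX'; rewrite ?oner_eq0 //.
    by move=> i; apply: L0; apply: mem_tnth.
  by exists (map (tnth (in_tuple L)) T), t; split=> //; rewrite big_map.
have T0 w : w \in T -> w != 0.
  move=> hw; apply: contraNneq Jd => w0; rewrite ET (big_rem w) //= w0 linform0 mul0r scaler0 //.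
have Tr w : w \in T -> mdvd (linform w) D.
  by move=> hw; rewrite ET -mul_mpolyC; apply: mdvd_mull; apply: mdvd_prod_mem.
have Hf (w : 'rV[R]_l) : exists a : 'rV[R]_l, w \in T -> a \in Pos /\ exists t, w = t *: a.
  have [hw|_] := boolP (w \in T); last by exists 0.
  by have [a ha ht] := rt w (T0 w hw) (Tr w hw); exists a.
have [f fP] := choice Hf.
have uf T1 T2 : T = T1 ++ T2 -> uniq (map f T2).
  elim: T2 T1 => [|x T2 IH] T1 E //=; rewrite (IH (rcons T1 x)) ?cat_rcons // andbT.
  apply/negP => /mapP[y hy Exy].
  have hx : x \in T by rewrite E mem_cat mem_head orbT.
  have hy' : y \in T by rewrite E mem_cat inE hy !orbT.
  have [fx [tx Ex]] := fP x hx; have [_ [ty Ey]] := fP y hy'; rewrite -Exy in Ey.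
  apply: (sq (f x)); first exact: Pos0.
  rewrite ET E big_cat big_cons /= [\prod_(j <- T2) _](big_rem y) //=.
  have -> : linform x = tx%:MP * linform (f x) by rewrite {1}Ex linformZ mul_mpolyC.
  have -> : linform y = ty%:MP * linform (f x) by rewrite {1}Ey linformZ mul_mpolyC.
  rewrite -mul_mpolyC expr2.
  by exists ((t%:MP * tx%:MP * ty%:MP) * (\prod_(i <- T1) linform i * \prod_(i <- rem y T2) linform i)); ring.
have lT : (size T <= size Pos)%N.
  rewrite -(size_map f); apply: uniq_leq_size; first exact: (uf [::]).
  by move=> x /mapP[w hw ->]; have [] := fP w hw.
have hD1 : D \is (\sum_j (d j).-1).-homog.
  by apply: det_homog => i j; rewrite mxE; apply: mderiv_homog; have [_ p0 hp] := h1 j; rewrite prednK.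
have hD2 : D \is (size T).-homog.
  rewrite ET; apply: dhomogZ; have := @homog_prod_seq R l _ T (fun w => linform w) (fun=> 1%N).
  by rewrite sum1_size; apply=> w; exact: linform_homog.
by rewrite (dhomog_uniq Jd hD1 hD2).
Qed.
End Chev.

End ReflectionInvariants.

(** * Coxeter elements: conjugacy and sign changes along orbits *)

Module CoxeterOrbits.
Import LinearFormDivisibility RootSystemBasics SimpleSystems.

Section Cox.
Variables (R : realType) (n : nat).
Local Notation V := 'rV[R]_n.
Variables (Phi : seq V) (v : V) (s : seq V) (dual : V -> V).
Hypothesis rs : rsys Phi.
Hypothesis reg : regular_vec Phi v.
Hypothesis sd : simple_dual Phi v s dual.
Local Notation Pos := (pos_system Phi v).
Let us : uniq s. Proof. by case: sd. Qed.
Let sP a : a \in s -> a \in Pos. Proof. by case: sd => _ h _ _ /h. Qed.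
Let s0 a : a \in s -> a != 0. Proof. by move/sP/(pos_neq0 rs). Qed.
Let sD a b : a \in s -> b \in s -> dotp (dual a) b = (a == b)%:R.
Proof. by case: sd => _ _ _; apply. Qed.

(** The first letter removes only its own root from the positive ones and permutes the others, so
    each letter accounts for at most one root. *)
Lemma trans_count w : sword s w -> (count (fun b => b *m coxeter_elt w \notin Pos) Pos <= size w)%N.
Proof.
elim: w => [|a w IH] /=; first by move=> _; rewrite (eq_in_count (a2 := pred0)) ?count_pred0 // => b hb; rewrite mulmx1 hb.
case/andP=> ha hw.
have pm : perm_eq Pos (a :: rem a Pos) by rewrite perm_to_rem // sP.
rewrite (seq.permP pm) /=; apply: (@leq_trans (1 + count (fun b => b *m coxeter_elt w \notin Pos) Pos)); last first.
  by rewrite add1n ltnS IH.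
apply: leq_add; first by case: (_ \notin _).
have -> : count (fun b => b *m (refl a *m coxeter_elt w) \notin Pos) (rem a Pos) =
          count (fun b => b *m coxeter_elt w \notin Pos) [seq b *m refl a | b <- rem a Pos].
  by rewrite count_map; apply: eq_count => b /=; rewrite mulmxA.
rewrite -!size_filter; apply: uniq_leq_size.
  apply: filter_uniq; rewrite map_inj_uniq ?rem_uniq ?pos_uniq // => x y E.
  by rewrite -[x]mulmx1 -[y]mulmx1 -(dotp_reflK (s0 ha)) !mulmxA E.
move=> x; rewrite !mem_filter => /andP[-> /mapP[b hb ->]] /=.
move: hb; rewrite mem_rem_uniq ?pos_uniq // inE => /andP[ba hb].
by rewrite -mem_pos; apply: (simple_refl_pos rs reg sd).
Qed.

Lemma fix_words (x : V) w : (forall b, b \in w -> dotp x b = 0) -> x *m coxeter_elt w = x.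
Proof.
elim: w => [|a w IH] h /=; first by rewrite mulmx1.
rewrite mulmxA mul_refl h ?mem_head // mulr0 mul0r scale0r subr0 IH // => b hb.
by apply: h; rewrite inE hb orbT.
Qed.
(** Pair with the dual vector of the first letter: the later letters fix that vector, so the first
    reflection must leave this coordinate of [x] unchanged, which forces orthogonality. *)
Lemma cox_nofix w (x : V) : uniq w -> sword s w -> x *m coxeter_elt w = x ->
  forall a, a \in w -> dotp x a = 0.
Proof.
elim: w => [|a w IH] //= /andP[aw uw] /andP[ha hw] E.
have y0 : dotp x a = 0.
  have E1 : dotp (x *m refl a *m coxeter_elt w) (dual a) = dotp (x *m refl a) (dual a).
    rewrite dotp_mulmx cox_tr fix_words // => b; rewrite mem_rev => hb.
    rewrite sD //; last by move/allP: hw => /(_ b hb).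
    by case: eqP => // E2; rewrite E2 hb in aw.
  move: E1; rewrite -mulmxA E mul_refl dotpBl dotpZl [dotp a (dual a)]dotpC sD // eqxx mulr1.
  move=> /eqP; rewrite eq_sym subr_eq -subr_eq0 opprD addrA subrr sub0r oppr_eq0 mulf_eq0 invr_eq0.
  by rewrite dotp_eq0 (negbTE (s0 ha)) orbF mulf_eq0 pnatr_eq0 /= => /eqP.
have E2 : x *m coxeter_elt w = x.
  by move: E; rewrite mulmxA mul_refl y0 mulr0 mul0r scale0r subr0.
by move=> b; rewrite inE => /orP[/eqP -> //|]; exact: IH.
Qed.

Lemma simple_obtuse a b : a \in s -> b \in s -> a != b -> dotp a b <= 0.
Proof.
move=> ha hb ab; rewrite leNgt; apply/negP => pab.
have hr := dotp_pos_diff rs (pos_root (sP ha)) (pos_root (sP hb)) ab pab.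
case/orP: (pos_or rs reg hr) => hp.
  have := dual_ge0 sd hb hp; rewrite dotpBr !sD // eqxx eq_sym (negbTE ab) sub0r.
  by rewrite oppr_ge0 ler10.
have := dual_ge0 sd ha hp; rewrite dotpNr dotpBr !sD // eqxx (negbTE ab) subr0.
by rewrite oppr_ge0 ler10.
Qed.
Definition nrm (a : V) := Num.sqrt (dotp a a).
Lemma nrm_gt0 a : a != 0 -> 0 < nrm a.
Proof. by move=> a0; rewrite sqrtr_gt0 dotp_gt0. Qed.
Lemma nrm_sq a : nrm a * nrm a = dotp a a.
Proof. by rewrite -expr2 sqr_sqrtr // dotp_ge0. Qed.
(** The product of the two Cartan integers is a positive integer, so 4 times the squared cosine is
    at least 1. *)
Lemma neighbour_bound a b : a \in s -> b \in s -> a != b -> dotp a b != 0 ->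
  dotp a b <= - (nrm a * nrm b) / 2.
Proof.
move=> ha hb ab nz; have le := simple_obtuse ha hb ab.
have pa := nrm_gt0 (s0 ha); have pb := nrm_gt0 (s0 hb).
case: (rs) => _ _ _ _ Hz.
have [z1 E1] := Hz _ _ (pos_root (sP hb)) (pos_root (sP ha)).
have [z2 E2] := Hz _ _ (pos_root (sP ha)) (pos_root (sP hb)).
have Ez : (z1 * z2)%:~R = 4 * (dotp a b * dotp a b / (dotp a a * dotp b b)) :> R.
  by rewrite intrM -E1 -E2 [dotp b a]dotpC invfM; ring.
have aa : 0 < dotp a a by rewrite dotp_gt0 s0.
have bb : 0 < dotp b b by rewrite dotp_gt0 s0.
have sq : 0 < dotp a b * dotp a b by rewrite -expr2 exprn_even_gt0.
have z0 : 0 < (z1 * z2)%:~R :> R by rewrite Ez mulr_gt0 // divr_gt0 // mulr_gt0.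
have z1' : 1 <= (z1 * z2)%:~R :> R.
  by rewrite (_ : 1 = 1%:~R) // ler_int -gtz0_ge1 -(ltr0z R).
have H : (nrm a * nrm b) ^+ 2 <= 4 * (dotp a b) ^+ 2.
  rewrite exprMn !expr2 !nrm_sq; move: z1'; rewrite Ez mulrA ler_pdivlMr ?mulr_gt0 // mul1r //.
have : `|nrm a * nrm b| <= `|2 * dotp a b|.
  rewrite -ler_sqr ?nnegrE ?normr_ge0 // !real_normK ?num_real //.
  by rewrite [(2 * _) ^+ 2]exprMn (_ : 2 ^+ 2 = 4 :> R) //; ring.
have le2 : 2 * dotp a b <= 0 by lra.
rewrite (ger0_norm (mulr_ge0 (ltW pa) (ltW pb))) (ler0_norm le2); lra.
Qed.
(** If every root had two neighbours, each would contribute at most -1/2 to its row in the Gram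
    matrix of unit vectors, and the sum of these independent vectors would have nonpositive square
    norm. *)
Lemma leaf_exists t : uniq t -> {subset t <= s} -> t != [::] ->
  exists2 a, a \in t & exists b0, forall b, b \in t -> b != a -> b != b0 -> dotp a b = 0.
Proof.
move=> ut ts tn; apply: contrapT => /forall2NP N.
have two a : a \in t -> exists b1 b2, [/\ b1 \in t, b2 \in t, b1 != a, b2 != a & b1 != b2] /\
   (dotp a b1 != 0) && (dotp a b2 != 0).
  move=> ha; have [//|/forallNP H] := N a.
  have [b1 [h1 h1a n1]] : exists b, [/\ b \in t, b != a & dotp a b != 0].
    apply: contrapT => /forallNP H1; apply: (H a) => b hb ba _.
    by apply/eqP/negPn/negP => n1; apply: (H1 b).
  have [b2 [h2 h2a n2 n12]] : exists b, [/\ b \in t, b != a, dotp a b != 0 & b != b1].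
    apply: contrapT => /forallNP H1; apply: (H b1) => b hb ba bb.
    by apply/eqP/negPn/negP => n2; apply: (H1 b).
  by exists b1, b2; rewrite n1 n2; split=> //; split=> //; rewrite eq_sym.
pose x := \sum_(a <- t) (nrm a)^-1 *: a.
have x0 : dotp x x <= 0.
  rewrite /x dotp_suml big_seq sumr_le0 // => a ha; rewrite dotp_sumr (big_rem a) //=.
  have [b1 [b2 [[h1 h2 h1a h2a h12] /andP[n1 n2]]]] := two a ha.
  have r1 : b1 \in rem a t by rewrite mem_rem_uniq // inE h1a.
  have r2 : b2 \in rem b1 (rem a t) by rewrite mem_rem_uniq ?rem_uniq // inE eq_sym h12 mem_rem_uniq // inE h2a.
  rewrite (big_rem b1) //= (big_rem b2) //= !dotpZl !dotpZr -nrm_sq.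
  have pa := nrm_gt0 (s0 (ts _ ha)); have p1 := nrm_gt0 (s0 (ts _ h1)); have p2 := nrm_gt0 (s0 (ts _ h2)).
  have B b : b \in t -> b != a -> dotp a b != 0 -> (nrm a)^-1 * ((nrm b)^-1 * dotp a b) <= - 2^-1.
    move=> hb ba nb; have pb := nrm_gt0 (s0 (ts _ hb)).
    have := neighbour_bound (ts _ ha) (ts _ hb) (ltac:(by rewrite eq_sym)) nb => H.
    rewrite mulrCA ler_pdivrMl // ler_pdivrMl //; apply: le_trans H _; by rewrite le_eqVlt; apply/orP; left; apply/eqP; ring.
  have H1 := B b1 h1 h1a n1; have H2 := B b2 h2 h2a n2.
  have E : (nrm a)^-1 * ((nrm a)^-1 * (nrm a * nrm a)) = 1 by field; exact: lt0r_neq0.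
  rewrite E; set Y := \sum_(_ <- _) _; have Y0 : Y <= 0.
    rewrite /Y big_seq sumr_le0 // => b hb; rewrite dotpZl dotpZr.
    have hb1 : b \in rem a t by apply: (mem_rem (mem_rem hb)).
    move: hb1; rewrite mem_rem_uniq // inE => /andP[ba hbt].
    have pb := nrm_gt0 (s0 (ts _ hbt)).
    rewrite mulr_ge0_le0 ?invr_ge0 ?(ltW pa) // mulr_ge0_le0 ?invr_ge0 ?(ltW pb) //.
    by apply: simple_obtuse; rewrite ?ts // eq_sym.
  lra.
have {}x0 : x = 0 by apply/eqP; rewrite -dotp_eq0 eq_le x0 dotp_ge0.
case: t tn ut ts @x x0 {N two} => // a t _ /andP[at' ut] ts x x0.
have := congr1 (dotp (dual a)) x0; rewrite dotp0r /x dotp_sumr big_cons big_seq big1.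
  rewrite addr0 dotpZr sD ?ts ?mem_head // eqxx mulr1 => /eqP.
  by rewrite invr_eq0 gt_eqF // nrm_gt0 // s0 // ts ?mem_head.
move=> b hb; rewrite dotpZr sD ?ts ?mem_head ?inE ?hb ?orbT //.
by case: eqP => [E|]; rewrite ?mulr0 //; rewrite E hb in at'.
Qed.

Inductive ceq : seq V -> seq V -> Prop :=
| ceq_refl u : ceq u u
| ceq_sym u w : ceq u w -> ceq w u
| ceq_trans u w t : ceq u w -> ceq w t -> ceq u t
| ceq_swap u a b w : dotp a b = 0 -> ceq (u ++ a :: b :: w) (u ++ b :: a :: w)
| ceq_rot a u : ceq (a :: u) (rcons u a).
Lemma ceq_perm u w : ceq u w -> perm_eq u w.
Proof.
elim=> {u w} [u|u w _|u w t _ h1 _ h2|u a b w _|a u].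
- exact: perm_refl.
- by rewrite perm_sym.
- exact: perm_trans h1 h2.
- by rewrite perm_cat2l -[a :: _ :: _]/([:: a; b] ++ w) -[b :: _ :: _]/([:: b; a] ++ w) perm_cat2r; apply/seq.permP => p /=; rewrite addnCA.
- by rewrite perm_sym perm_rcons.
Qed.
Lemma ceq_front p u a w : (forall b, b \in u -> dotp a b = 0) -> ceq (p ++ u ++ a :: w) (p ++ a :: u ++ w).
Proof.
elim: u p => [|b u IH] p h /=; first exact: ceq_refl.
apply: (@ceq_trans _ (p ++ b :: a :: u ++ w)).
  rewrite -cat_rcons -(cat_rcons b p (a :: _)); apply: IH => x hx; by apply: h; rewrite inE hx orbT.
by apply: ceq_sym; apply: ceq_swap; apply: h; exact: mem_head.
Qed.
(** Only a rotation of the tail needs care. A letter commuting with [a] is exchanged with it first;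
    for the neighbour [b0], rotate [a] to the end, bring it forward to just behind [b0], and rotate
    [b0]. *)
Lemma ceq_cons a b0 u w : uniq u -> (forall b, b \in u -> b != b0 -> dotp a b = 0) ->
  ceq u w -> ceq (a :: u) (a :: w).
Proof.
move=> uu hu h; elim: h uu hu => {u w} [u|u w h IH|u w t h1 IH1 h2 IH2|u x b w h|x u] uu hu.
- exact: ceq_refl.
- apply: ceq_sym; have pm := ceq_perm h; apply: IH; first by rewrite (perm_uniq pm).
  by move=> b; rewrite (perm_mem pm); exact: hu.
- have pm := ceq_perm h1; apply: ceq_trans (IH1 uu hu) _; apply: IH2.
    by rewrite -(perm_uniq pm).
  by move=> b; rewrite -(perm_mem pm); exact: hu.
- exact: (ceq_swap (a :: u)).
- move: uu => /= /andP[xu uu].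
  have last : ceq (x :: a :: u) (a :: rcons u x) by exact: (ceq_rot x (a :: u)).
  have [E|ne] := eqVneq x b0; last first.
    apply: ceq_trans last; apply: (ceq_swap [::]); apply: hu => //; exact: mem_head.
  apply: ceq_trans last; apply: (ceq_trans (ceq_rot a (x :: u))) => /=.
  have := @ceq_front [:: x] u a [::]; rewrite /= !cats0 cats1; apply=> b hb; apply: hu.
    by rewrite inE hb orbT.
  by apply: contraNneq xu => E2; rewrite E -E2.
Qed.
Lemma ceq_leaf_front a b0 t : uniq t -> a \in t -> (forall b, b \in t -> b != a -> b != b0 -> dotp a b = 0) ->
  exists2 u, ceq t (a :: u) & perm_eq t (a :: u).
Proof.
move=> ut ha; case/splitPr: ha ut => t1 t2 ut h.
move: ut; rewrite cat_uniq /= => /and3P[u1 /norP[a1 /hasPn d12] /andP[a2 u2]].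
suff H : ceq (t1 ++ a :: t2) (a :: t1 ++ t2) by exists (t1 ++ t2) => //; apply: ceq_perm.
have [b1|b1] := boolP (b0 \in t1); last first.
  apply: (ceq_front [::]) => b hb; apply: h; rewrite ?mem_cat ?hb //.
    by apply: contraNneq a1 => <-.
  by apply: contraNneq b1 => <-.
have h2 b : b \in t2 -> dotp a b = 0.
  move=> hb; apply: h; rewrite ?mem_cat ?inE ?hb ?orbT //.
    by apply: contraNneq a2 => <-.
  by apply: contraTneq hb => ->; apply/negP => /d12; rewrite b1.
apply: (@ceq_trans _ (rcons (t1 ++ t2) a)); last exact/ceq_sym/ceq_rot.
have := @ceq_front t1 t2 a [::] h2; rewrite cats0 catA cats1 => /ceq_sym; exact.
Qed.
(** Pull a leaf to the front of both orderings and recurse. With [ceq_conj] all Coxeter elements of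
    one simple system are conjugate, which permits the passage to a bipartite one. *)
Lemma ceq_all t t' : uniq t -> {subset t <= s} -> perm_eq t t' -> ceq t t'.
Proof.
have [k] := ubnP (size t); elim: k t t' => // k IH t t' lek ut ts pm.
have [t0|tn] := eqVneq t [::].
  by move: pm; rewrite t0 perm_sym => /perm_nilP ->; exact: ceq_refl.
have [a ha [b0 hb]] := leaf_exists ut ts tn.
have [u E pu] := ceq_leaf_front ut ha hb.
have ut' : uniq t' by rewrite -(perm_uniq pm).
have ha' : a \in t' by rewrite -(perm_mem pm).
have hb' b : b \in t' -> b != a -> b != b0 -> dotp a b = 0 by rewrite -(perm_mem pm); exact: hb.
have [u' E' pu'] := ceq_leaf_front ut' ha' hb'.
apply: (ceq_trans E); apply: ceq_trans (ceq_sym E').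
have /andP[au uu] : (a \notin u) && uniq u by rewrite -[_ && _]/(uniq (a :: u)) -(perm_uniq pu).
have mu x : x \in u -> x \in t by move=> hx; rewrite (perm_mem pu) inE hx orbT.
apply: (@ceq_cons a b0) => // [b hbu bb|].
  by apply: hb => //; [exact: mu | apply: contraNneq au => <-].
apply: IH => //.
- by move: lek; rewrite (perm_size pu).
- by move=> x /mu/ts.
- by rewrite -(perm_cons a) -(permPl pu) (permPl pm).
Qed.
Definition conjm (M N : 'M[R]_n) := exists P P' : 'M[R]_n, [/\ P *m P' = 1%:M, P' *m P = 1%:M & N = P *m M *m P'].
Lemma ceq_conj u w : (forall a, a \in u -> a != 0) -> ceq u w -> conjm (coxeter_elt u) (coxeter_elt w).
Proof.
move=> hu h; elim: h hu => {u w} [u|u w h IH|u w t h1 IH1 h2 IH2|u a b w h|a u] hu.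
- by exists 1%:M, 1%:M; rewrite !mul1mx mulmx1.
- have [|P [P' [E1 E2 E]]] := IH; first by move=> a ha; apply: hu; rewrite -(perm_mem (ceq_perm h)).
  by exists P', P; split=> //; rewrite E !mulmxA E2 mul1mx -mulmxA E2 mulmx1.
- have [P [P' [E1 E2 E]]] := IH1 hu.
  have [|Q [Q' [F1 F2 F]]] := IH2; first by move=> a ha; apply: hu; rewrite (perm_mem (ceq_perm h1)).
  exists (Q *m P), (P' *m Q'); split.
  + by rewrite !mulmxA -[Q *m P *m P']mulmxA E1 mulmx1.
  + by rewrite !mulmxA -[P' *m Q' *m Q]mulmxA F2 mulmx1.
  + by rewrite F E !mulmxA.
- exists 1%:M, 1%:M; rewrite !mul1mx mulmx1; split=> //; rewrite !cox_cat /= !mulmxA; congr (_ *m _).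
  rewrite -!mulmxA; congr (_ *m _); apply/row_matrixP => i; rewrite !rowE !mulmxA.
  set y := delta_mx _ _; rewrite !mul_refl !dotpBl !dotpZl h [dotp b a]dotpC h !mulr0 !subr0.
  by rewrite addrAC.
- have a0 : a != 0 by apply: hu; exact: mem_head.
  exists (refl a), (refl a); rewrite dotp_reflK //; split=> //.
  by rewrite -cats1 cox_cat /= mulmx1 mulmxA dotp_reflK // mul1mx.
Qed.
Lemma bipartite : exists f : V -> bool, forall a b, a \in s -> b \in s -> a != b -> dotp a b != 0 -> f a != f b.
Proof.
suff H t : uniq t -> {subset t <= s} -> exists f : V -> bool,
    forall a b, a \in t -> b \in t -> a != b -> dotp a b != 0 -> f a != f b by apply: H.
have [k] := ubnP (size t); elim: k t => // k IH t lek ut ts.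
have [->|tn] := eqVneq t [::]; first by exists xpredT.
have [a ha [b0 hb]] := leaf_exists ut ts tn.
have sz : (size (rem a t) < k)%N.
  by move: lek; rewrite size_rem //; case: (size t) (size_eq0 t) tn => [<-|m _ _].
have [f hf] := IH (rem a t) sz (rem_uniq _ ut) (ltac:(by move=> x /mem_rem/ts)).
exists (fun x => if x == a then ~~ f b0 else f x) => x y hx hy xy nz.
have inr z : z \in t -> z != a -> z \in rem a t by rewrite mem_rem_uniq // inE => -> ->.
have [Ex|nx] := eqVneq x a; have [Ey|ny] := eqVneq y a.
- by rewrite Ex Ey eqxx in xy.
- have -> : y = b0; last by case: (f b0).
  by apply/eqP/negPn/negP => ne; move: nz; rewrite Ex hb // eqxx.
- have -> : x = b0; last by case: (f b0).
  by apply/eqP/negPn/negP => ne; move: nz; rewrite Ey dotpC hb // eqxx.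
- by apply: hf => //; apply: inr.
Qed.

Lemma mxpowS (c : 'M[R]_n) k : mxpow c k.+1 = c *m mxpow c k. Proof. by []. Qed.
Lemma mxpowSr (c : 'M[R]_n) k : mxpow c k.+1 = mxpow c k *m c.
Proof. by elim: k => [|k IH]; rewrite mxpowS ?mulmx1 ?mul1mx // {1}IH -mulmxA. Qed.
Lemma mxpowD (c : 'M[R]_n) j k : mxpow c (j + k) = mxpow c j *m mxpow c k.
Proof. by elim: j => [|j IH]; rewrite ?mul1mx // addSn !mxpowS IH mulmxA. Qed.

Section Orbits.
Variables (t : seq V) (h : nat).
Hypothesis pt : perm_eq t s.
Hypothesis sp : spanning Phi.
Let c := coxeter_elt t.
Hypothesis h0 : (0 < h)%N.
Hypothesis ch : mxpow c h = 1%:M.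
Let tw : sword s t. Proof. by apply/allP => a; rewrite (perm_mem pt). Qed.
Let ut : uniq t. Proof. by rewrite (perm_uniq pt). Qed.
Lemma pow_root b j : b \in Phi -> b *m mxpow c j \in Phi.
Proof.
by move=> hb; elim: j => [|j IH]; rewrite ?mulmx1 // mxpowSr mulmxA; apply: (word_root rs sd).
Qed.
Lemma nofix (x : V) : x *m c = x -> x = 0.
Proof.
move=> E; have H := cox_nofix ut tw E; apply: sp => a ha.
have red b : b \in Pos -> dotp x b = 0.
  move=> hb; rewrite (pos_expand sd hb) dotp_sumr big_seq big1 // => d hd.
  by rewrite dotpZr H ?mulr0 // (perm_mem pt).
case/orP: (pos_or rs reg ha) => hp; first exact: red.
by rewrite -[a]opprK dotpNr red ?oppr0.
Qed.
Lemma orbit_sum (b : V) : \sum_(j < h) b *m mxpow c j = 0.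
Proof.
apply: nofix; rewrite mulmx_suml; case: h h0 ch => // k _ ck.
rewrite big_ord_recr [RHS]big_ord_recl /= addrC; congr (_ + _).
  by rewrite -mulmxA -mxpowSr ck.
by apply: eq_bigr => j _; rewrite -mulmxA -mxpowSr.
Qed.
Definition trans (b : V) (j : nat) := (b *m mxpow c j \in Pos) && (b *m mxpow c j.+1 \notin Pos).
Lemma pow_mod j : mxpow c j = mxpow c (j %% h).
Proof.
rewrite {1}(divn_eq j h) mxpowD; suff -> : mxpow c (j %/ h * h) = 1%:M by rewrite mul1mx.
by elim: (j %/ h)%N => [|k IH] //; rewrite mulSn mxpowD ch IH mul1mx.
Qed.
(** The orbit sum vanishes because the Coxeter element fixes no nonzero vector. So the orbit meets
    both signs, and a cyclic sequence with both signs drops at least once. *)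
Lemma trans_ge1 b : b \in Phi -> (1 <= \sum_(j < h) trans b j)%N.
Proof.
move=> hb; rewrite lt0n sum_nat_eq0; apply/negP => /forallP H.
have nt j : trans b j = false.
  have := H (Ordinal (ltn_pmod j h0)); rewrite /= eqb0 => /negbTE.
  by rewrite /trans !mxpowSr -(pow_mod j).
have up j k : b *m mxpow c j \in Pos -> b *m mxpow c (k + j) \in Pos.
  move=> hj; elim: k => // k IH; apply/negPn/negP => hn.
  by have := nt (k + j)%N; rewrite /trans IH -[(k + j).+1]/(k.+1 + j)%N hn.
have S0 := congr1 (dotp v) (orbit_sum b); rewrite dotp0r dotp_sumr in S0.
have [[j hj]|/forallNP N] := pselect (exists j, b *m mxpow c j \in Pos).
  have all k : b *m mxpow c k \in Pos.
    rewrite pow_mod; have := up j (k + j * h.-1)%N hj.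
    by rewrite -addnA -mulnSr prednK // pow_mod addnC modnMDl.
  move/eqP: S0; rewrite gt_eqF //; case: h h0 => // k _; rewrite big_ord_recl ltr_pwDl //.
    by have := all 0%N; rewrite mem_pos => /andP[].
  by apply: sumr_ge0 => i _; have := all (lift ord0 i); rewrite mem_pos => /andP[/ltW].
move/eqP: S0; rewrite lt_eqF //; case: h h0 => // k _.
have neg j : dotp v (b *m mxpow c j) < 0.
  have := reg (pow_root j hb); rewrite neq_lt => /orP[//|p].
  by case: (N j); rewrite mem_pos p pow_root.
rewrite big_ord_recl -oppr_gt0 opprD ltr_pwDl //; first by rewrite oppr_gt0; exact: (neg 0%N).
by rewrite oppr_ge0 sumr_le0 // => i _; apply: ltW; apply: (neg (lift ord0 i)).
Qed.
Lemma pow_perm j : perm_eq [seq b *m mxpow c j | b <- Phi] Phi.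
Proof.
case: (rs) => uP _ _ _ _.
have uq : uniq [seq b *m mxpow c j | b <- Phi].
  rewrite map_inj_uniq // => x y E.
  have I : mxpow c j *m mxpow c (j * h.-1) = 1%:M.
    by rewrite -mxpowD -mulnS prednK // pow_mod modnMl.
  by rewrite -[x]mulmx1 -[y]mulmx1 -I !mulmxA E.
have sub : {subset [seq b *m mxpow c j | b <- Phi] <= Phi}.
  by move=> x /mapP[b hb ->]; apply: pow_root.
have [_ E] := uniq_min_size uq sub (ltac:(by rewrite size_map)).
exact: uniq_perm.
Qed.
(** Powers of the Coxeter element permute [Phi], so every step contributes at most the length of the
    word. *)
Lemma trans_total : (\sum_(b <- Phi) \sum_(j < h) trans b j <= h * size s)%N.
Proof.
rewrite exchange_big /= -[X in (_ <= X * _)%N]card_ord -sum_nat_const; apply: leq_sum => j _.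
have -> : (\sum_(b <- Phi) trans b j = \sum_(b <- [seq b *m mxpow c j | b <- Phi]) ((b \in Pos) && (b *m c \notin Pos)))%N.
  by rewrite big_map; apply: eq_bigr => b _; rewrite /trans mxpowSr mulmxA.
rewrite (perm_big _ (pow_perm j)) /= -(perm_size pt); apply: leq_trans (trans_count tw).
rewrite /pos_system count_filter -sum1_count [X in (_ <= X)%N]big_mkcond /=; apply: leq_sum => b _.
rewrite -/(pos_system Phi v); rewrite [X in nat_of_bool (X && _)]mem_pos /=.
by case: (0 < dotp v b); rewrite ?andbF //=; case: (_ \in Phi); case: (_ \notin _).
Qed.
Lemma size_Phi : size Phi = (size Pos).*2.
Proof.
case: (rs) => uP _ _ _ _.
suff pm : perm_eq Phi (Pos ++ map -%R Pos) by rewrite (perm_size pm) size_cat size_map addnn.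
apply: uniq_perm => //.
  rewrite cat_uniq (pos_uniq v rs) /= map_inj_uniq ?(pos_uniq v rs) ?andbT; last exact: oppr_inj.
  by apply/hasPn => x /mapP[y hy ->]; apply: pos_notN.
move=> x; rewrite mem_cat; apply/idP/orP => [hx|[/pos_root //|/mapP[y hy ->]]].
  case/orP: (pos_or rs reg hx) => hh; [by left | right; apply/mapP; exists (- x) => //; by rewrite opprK].
by move/pos_root: hy => /(RootSystemBasics.rootN rs).
Qed.
Lemma two_N_le : ((size Pos).*2 <= h * size s)%N.
Proof.
rewrite -size_Phi -sum1_size; apply: leq_trans trans_total; rewrite big_seq [X in (_ <= X)%N]big_seq.
by apply: leq_sum => b hb; exact: trans_ge1.
Qed.
Lemma trans_one : ((size Pos).*2 = h * size s)%N -> forall b, b \in Phi -> (\sum_(j < h) trans b j = 1)%N.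
Proof.
move=> E b hb; apply/eqP; rewrite eqn_leq trans_ge1 // andbT leqNgt; apply/negP => lt.
have := trans_total; rewrite -E -size_Phi (big_rem b) //= leqNgt => /negP; apply.
rewrite (perm_size (perm_to_rem hb)) /= -[(size _).+1]add1n -addn1 addnAC; apply: leq_add => //.
rewrite -sum1_size big_seq [X in (_ <= X)%N]big_seq; apply: leq_sum => x hx; apply: trans_ge1.
exact: mem_rem hx.
Qed.
End Orbits.
End Cox.

End CoxeterOrbits.

(** * Perron vectors of symmetric matrices *)

Module PerronVector.
Import spectral sesquilinear LinearFormDivisibility RootSystemBasics SimpleSystems.

Section Top.
Variables (R : realType).
Local Notation C := R[i].
Local Notation rc := (real_complex R).
Lemma Re_mulr (x : C) (y : R) : complex.Re (x * y%:C%C) = complex.Re x * y.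
Proof. by case: x => a b /=; rewrite mulr0 subr0. Qed.
Lemma Im_mulr (x : C) (y : R) : complex.Im (x * y%:C%C) = complex.Im x * y.
Proof. by case: x => a b /=; rewrite mulr0 add0r. Qed.
Lemma Re_sum (I : Type) (r : seq I) (F : I -> C) : complex.Re (\sum_(i <- r) F i) = \sum_(i <- r) complex.Re (F i).
Proof. by apply: (big_morph (@complex.Re R)) => // -[a b] [c d]. Qed.
Lemma Im_sum (I : Type) (r : seq I) (F : I -> C) : complex.Im (\sum_(i <- r) F i) = \sum_(i <- r) complex.Im (F i).
Proof. by apply: (big_morph (@complex.Im R)) => // -[a b] [c d]. Qed.
(** The complex spectral theorem gives real eigenvalues; the real or the imaginary part of an
    eigenvector for the largest one is a real eigenvector. *)
Lemma sym_top n (A : 'M[R]_n) : (0 < n)%N -> A^T = A ->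
  exists (mu : R) (y : 'rV[R]_n), [/\ y != 0, y *m A = mu *: y &
    forall w : 'rV[R]_n, dotp (w *m A) w <= mu * dotp w w].
Proof.
move=> n0 As; pose AC := map_mx rc A.
have reA : AC \is a realmx.
  by apply/mxOverP => i j; rewrite mxE; apply/CrealP; apply/eqP; rewrite eq_complex /= oppr0 !eqxx.
have hs : AC \is hermsymmx.
  apply: realsym_hermsym => //; apply/eqP; rewrite expr0 scale1r map_mx_id //.
  by rewrite map_trmx As.
have /orthomx_spectralP E := hermitian_normalmx hs.
have rD := hermitian_spectral_diag_real hs.
have uP := spectral_unitarymx AC; have Pu := spectral_unit AC.
move: (spectralmx AC) (spectral_diag AC) E rD uP Pu => P D E rD uP Pu.
have DE i : D 0 i = (complex.Re (D 0 i))%:C%C.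
  by move/mxOverP: rD => /(_ 0 i) h; rewrite RRe_real.
pose d i := complex.Re (D 0 i).
case: (@Order.TotalTheory.arg_maxP _ R _ (Ordinal n0) xpredT d isT) => i0 _ mx.
have eig : row i0 P *m AC = D 0 i0 *: row i0 P.
  rewrite -row_mul E !mulmxA mulmxV // mul1mx.
  by apply/rowP => j; rewrite mxE mul_diag_mx !mxE.
have [y y0 Ey] : exists2 y : 'rV[R]_n, y != 0 & y *m A = d i0 *: y.
  pose y1 := \row_k complex.Re (P i0 k); pose y2 := \row_k complex.Im (P i0 k).
  have E1 : y1 *m A = d i0 *: y1.
    apply/rowP => j; have /rowP/(_ j)/(congr1 (@complex.Re R)) := eig.
    rewrite !mxE (DE i0) [_ %:C%C * _]mulrC Re_mulr -/(d i0) mulrC => <-.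
    by rewrite Re_sum; apply: eq_bigr => k _; rewrite !mxE Re_mulr.
  have E2 : y2 *m A = d i0 *: y2.
    apply/rowP => j; have /rowP/(_ j)/(congr1 (@complex.Im R)) := eig.
    rewrite !mxE (DE i0) [_ %:C%C * _]mulrC Im_mulr -/(d i0) mulrC => <-.
    by rewrite Im_sum; apply: eq_bigr => k _; rewrite !mxE Im_mulr.
  have [z1|] := eqVneq y1 0; last by exists y1.
  have [z2|] := eqVneq y2 0; last by exists y2.
  have : row i0 P = 0.
    apply/rowP => k; have /rowP/(_ k) := z1; have /rowP/(_ k) := z2; rewrite !mxE.
    by case: (P i0 k) => a b /= -> ->.
  move/(congr1 (mulmx^~ (invmx P))); rewrite mul0mx -row_mul mulmxV // => /rowP/(_ i0).
  by rewrite !mxE eqxx => /eqP; rewrite oner_eq0.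
exists (d i0), y; split=> // w; rewrite -subr_ge0.
pose wC := map_mx rc w; pose u := wC *m invmx P.
have cw : map_mx (Num.conj : C -> C) wC = wC.
  by apply/rowP => j; rewrite !mxE; apply/eqP; rewrite eq_complex /= oppr0 !eqxx.
have uc i : (P *m wC^T) i 0 = (u 0 i)^*.
  have -> : (u 0 i)^* = (map_mx Num.conj u) 0 i by rewrite [RHS]mxE.
  have -> : P *m wC^T = (wC *m P^T)^T by rewrite trmx_mul trmxK.
  by rewrite [LHS]mxE /u map_mxM cw invmx_unitary // map_mxCK.
have F1 : (dotp (w *m A) w)%:C%C = \sum_i D 0 i * (u 0 i * (u 0 i)^*).
  have -> : (dotp (w *m A) w)%:C%C = (wC *m AC *m wC^T) 0 0.
    by rewrite /dotp /wC /AC -map_mxM map_trmx -map_mxM [RHS]mxE.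
  rewrite E !mulmxA -/u -[_ *m P *m _]mulmxA mxE; apply: eq_bigr => i _.
  by rewrite uc mul_mx_diag !mxE mulrCA mulrA mulrAC.
have F2 : (dotp w w)%:C%C = \sum_i (u 0 i * (u 0 i)^*).
  have -> : (dotp w w)%:C%C = (wC *m wC^T) 0 0.
    by rewrite /dotp /wC map_trmx -map_mxM [RHS]mxE.
  rewrite -[wC in wC *m _](mulmxKV Pu) -/u -mulmxA mxE; apply: eq_bigr => i _.
  by rewrite uc.
rewrite -lecR rmorphB rmorphM /= F1 F2 mulr_sumr -sumrB sumr_ge0 // => i _.
rewrite -mulrBl mulr_ge0 ?mul_conjC_ge0 // DE -rmorphB /= lecR subr_ge0; exact: mx.
Qed.

(* Perron-Frobenius for symmetric matrices: [|y|] maximises the Rayleigh quotient with [y] *)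
Lemma perron n (A : 'M[R]_n) : (0 < n)%N -> A^T = A -> (forall i j, 0 <= A i j) ->
  (forall P : pred 'I_n, (exists i, P i) -> (forall i j, P i -> ~~ P j -> A i j = 0) -> forall i, P i) ->
  exists (mu : R) (x : 'rV[R]_n), [/\ forall i, 0 < x 0 i, x *m A = mu *: x &
    forall w : 'rV[R]_n, dotp (w *m A) w <= mu * dotp w w].
Proof.
move=> n0 As A0 irr; have [mu [y [y0 Ey le]]] := sym_top n0 As.
pose x : 'rV[R]_n := \row_i `|y 0 i|.
have xy : dotp x x = dotp y y.
  by rewrite !dotpE; apply: eq_bigr => i _; rewrite !mxE -normrM ger0_norm // -expr2 sqr_ge0.
have ge : dotp (y *m A) y <= dotp (x *m A) x.
  rewrite !dotpE; apply: ler_sum => i _; rewrite !mxE !mulr_suml; apply: ler_sum => j _.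
  by rewrite !mxE; apply: le_trans (ler_norm _) _; rewrite !normrM (ger0_norm (A0 _ _)).
have eqx : dotp (x *m A) x = mu * dotp x x.
  by apply/eqP; rewrite eq_le le xy; move: ge; rewrite Ey dotpZl => ->.
(* The first variation vanishes at a maximum: the quadratic 2 t b + t^2 q is never negative, but it
   is negative at t = -b / (q + 1) unless b = 0. *)
have null w : dotp (x *m A) w = mu * dotp x w.
  pose q := mu * dotp w w - dotp (w *m A) w; pose b := mu * dotp x w - dotp (x *m A) w.
  have key t : 0 <= t * (2 * b) + t * t * q.
    have := le (x + t *: w); rewrite -subr_ge0 mulmxDl -scalemxAl !(dotpDl, dotpDr, dotpZl, dotpZr).
    have -> : dotp (w *m A) x = dotp (x *m A) w by rewrite dotp_mulmx As dotpC.
    rewrite eqx [dotp w x]dotpC => h; apply: le_trans h _; rewrite le_eqVlt; apply/orP; left; apply/eqP.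
    by rewrite /q /b; ring.
  have q0 : 0 <= q by rewrite subr_ge0.
  apply/eqP; rewrite eq_sym -subr_eq0 -/b; apply: contraTT isT => b0.
  have := key (- b / (q + 1)); rewrite leNgt => /negP; case.
  have q1 : 0 < q + 1 by lra.
  have -> : - b / (q + 1) * (2 * b) + - b / (q + 1) * (- b / (q + 1)) * q =
            - (b ^+ 2 * ((q + 2) / (q + 1) ^+ 2)) by field; exact: lt0r_neq0.
  rewrite oppr_lt0 mulr_gt0 ?exprn_even_gt0 // divr_gt0 ?exprn_gt0 //; lra.
have Ex : x *m A = mu *: x.
  apply/rowP => j; have := null (delta_mx 0 j); rewrite -dotpZl !dotpE.
  rewrite (bigD1 j) //= big1 ?addr0; last by move=> i ij; rewrite [delta_mx _ _ _ _]mxE (negbTE ij) andbF mulr0.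
  rewrite (bigD1 j) //= big1 ?addr0; last by move=> i ij; rewrite [delta_mx _ _ _ _]mxE (negbTE ij) andbF mulr0.
  by rewrite [delta_mx _ _ _ _]mxE !eqxx !mulr1.
exists mu, x; split=> // i; rewrite lt0r [in X in _ && X]mxE normr_ge0 andbT.
apply: (irr (fun i => x 0 i != 0)).
  apply: contrapT => /forallNP H; move/eqP: y0; apply; apply/rowP => k.
  have := H k; rewrite mxE normr_eq0 => /negP; rewrite negbK => /eqP ->; by rewrite mxE.
move=> {}i j xi; rewrite negbK => /eqP xj.
have := congr1 (fun X : 'rV[R]_n => X 0 j) Ex; rewrite !mxE in xj *; rewrite xj mulr0.
move=> /eqP; rewrite psumr_eq0; last by move=> k _; rewrite mxE mulr_ge0.
move=> /allP /(_ i (mem_index_enum _)); rewrite /= mulf_eq0 => /orP[h|/eqP //].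
by rewrite h in xi.
Qed.
End Top.

End PerronVector.

(** * Connected diagrams and the two colour vectors *)

Module BipartiteEigenvector.
Import LinearFormDivisibility RootSystemBasics SimpleSystems CoxeterOrbits PerronVector.

Section Plane.
Variables (R : realType) (n : nat).
Local Notation V := 'rV[R]_n.
Variables (Phi : seq V) (v : V) (s : seq V) (dual : V -> V).
Hypothesis rs : rsys Phi.
Hypothesis reg : regular_vec Phi v.
Hypothesis sd : simple_dual Phi v s dual.
Hypothesis sp : spanning Phi.
Hypothesis irr : irreducible_rs Phi.
Local Notation Pos := (pos_system Phi v).
Let us : uniq s. Proof. by case: sd. Qed.
Let sP a : a \in s -> a \in Pos. Proof. by case: sd => _ h _ _ /h. Qed.
Let s0 a : a \in s -> a != 0. Proof. by move/sP/(pos_neq0 rs). Qed.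
Let sD a b : a \in s -> b \in s -> dotp (dual a) b = (a == b)%:R.
Proof. by case: sd => _ _ _; apply. Qed.

Lemma simple_span (x : V) : (forall a, a \in s -> dotp x a = 0) -> x = 0.
Proof.
move=> H; apply: sp => a ha.
have red b : b \in Pos -> dotp x b = 0.
  move=> hb; rewrite (pos_expand sd hb) dotp_sumr big_seq big1 // => d hd.
  by rewrite dotpZr H ?mulr0.
case/orP: (pos_or rs reg ha) => hp; first exact: red.
by rewrite -[a]opprK dotpNr red ?oppr0.
Qed.
Lemma root_expand b : b \in Phi -> b = \sum_(a <- s) dotp (dual a) b *: a.
Proof.
move=> hb; case/orP: (pos_or rs reg hb) => hp; first exact: (pos_expand sd hp).
have := pos_expand sd hp => E; rewrite -[b in LHS]opprK E -sumrN.
by apply: eq_bigr => a _; rewrite dotpNr scaleNr opprK.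
Qed.
Lemma s_neq0 : s != [::].
Proof.
case: irr; case: (Phi) root_expand (root_neq0 rs) => // a P H H0 _ _; apply: contraTneq (H0 a (mem_head _ _)) => E.
by rewrite negbK; apply/eqP; rewrite (H a (mem_head _ _)) E big_nil.
Qed.
(** [K J b] says that [b] is supported on [J]. Simple reflections preserve support on a union of
    components, so every root is supported on [I] or on its complement, and irreducibility excludes
    one of these. *)
Lemma simple_connected (I : pred V) : (exists2 a, a \in s & I a) ->
  (forall a b, a \in s -> b \in s -> I a -> ~~ I b -> dotp a b = 0) -> forall a, a \in s -> I a.
Proof.
move=> [a0 ha0 Ia0] H.
pose K (J : pred V) (b : V) := all (fun a => J a || (dotp (dual a) b == 0)) s.
have step (J : pred V) w b : (forall a b, a \in s -> b \in s -> J a -> ~~ J b -> dotp a b = 0) ->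
    sword s w -> b \in Phi -> K J b -> K J (b *m coxeter_elt w).
  move=> HJ; elim: w b => [|c w IH] b /=; first by rewrite mulmx1.
  case/andP=> hc hw hb Kb; rewrite mulmxA; apply: IH => //.
    by apply: root_refl => //; exact/pos_root/sP.
  apply/allP => a ha; case Ja: (J a) => //=; rewrite mul_refl dotpBr dotpZr (sD ha hc).
  have /allP/(_ a ha) := Kb; rewrite Ja /= => /eqP ->; rewrite sub0r oppr_eq0.
  case: (eqVneq a c) => [E|_]; last by rewrite mulr0.
  rewrite -E mulr1 (root_expand hb) dotp_suml big_seq big1 ?mulr0 ?mul0r //.
  move=> d hd; have /allP/(_ d hd) := Kb; rewrite dotpZl.
  have [Jd _|_ /= /eqP ->] := boolP (J d); last by rewrite mul0r.
  by rewrite (HJ d a) // ?Ja // mulr0.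
have Hc a b : a \in s -> b \in s -> predC I a -> ~~ predC I b -> dotp a b = 0.
  by move=> ha hb /= na; rewrite negbK => Ib; rewrite dotpC H.
have dich b : b \in Phi -> K I b \/ K (predC I) b.
  move=> /(root_word rs reg sd) [w [a [hw ha ->]]].
  have Ka (J : pred V) : J a -> K J a.
    by move=> Ja; apply/allP => d hd; rewrite sD //; case: (eqVneq d a) => [->|]; rewrite ?Ja ?eqxx ?orbT.
  case Ia: (I a); [left | right]; apply: step => //; try exact/pos_root/sP; apply: Ka => //=.
  by rewrite Ia.
case: irr => _ /(_ (K I)) [].
- move=> a b ha hb Ka nKb; have [Kb|Kb] := dich b hb; first by rewrite Kb in nKb.
  rewrite (root_expand ha) (root_expand hb) dotp_suml big_seq big1 // => d hd; rewrite dotp_sumr big_seq big1 // => d' hd'.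
  rewrite dotpZl dotpZr; have /allP/(_ d hd) := Ka; have /allP/(_ d' hd') := Kb; rewrite /=.
  have [Id|_] := boolP (I d) => /=; last by move=> _ /eqP ->; rewrite mul0r.
  have [_|Id'] := boolP (I d') => /= [/eqP -> _|_ _]; first by rewrite mul0r mulr0.
  by rewrite (H d d') // !mulr0.
- move=> /allP A a ha; have := A a (pos_root (sP ha)) => /allP/(_ a ha).
  by rewrite sD // eqxx oner_eq0 orbF.
- move=> /allP A; have := A a0 (pos_root (sP ha0)) => /=; case/negP; apply/allP => d hd.
  by rewrite sD //; case: (eqVneq d a0) => [->|]; rewrite ?Ia0 ?eqxx ?orbT.
Qed.

(** The inequality mu < 2 expresses positivity of the inner product on the nonzero vector [y] built
    from the Perron weights: its square norm is 2 - mu times a positive sum. *)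
Lemma perron_simple : exists (mu : R) (X : V -> R), [/\ 0 <= mu, mu < 2, (forall a, a \in s -> 0 < X a) &
  forall a, a \in s -> \sum_(b <- s | b != a) 2 * X b / dotp b b * dotp b a = - (mu * X a)].
Proof.
(* This scale makes [A] symmetric and 2 - A the Gram matrix of the roots rescaled to square length
   2. *)
pose N (a : V) := Num.sqrt (dotp a a / 2).
have N0 a : a \in s -> 0 < N a by move=> ha; rewrite sqrtr_gt0 divr_gt0 // dotp_gt0 s0.
have NN a : N a * N a = dotp a a / 2 by rewrite -expr2 sqr_sqrtr // divr_ge0 // dotp_ge0.
pose m := size s; pose a (i : 'I_m) := s`_i.
have ha i : a i \in s by apply: mem_nth.
have aI i j : (a i == a j) = (i == j) by rewrite /a nth_uniq.
pose A : 'M[R]_m := \matrix_(i, j) (if i == j then 0 else - dotp (a i) (a j) / (N (a i) * N (a j))).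
have m0 : (0 < m)%N by rewrite lt0n size_eq0 s_neq0.
have AT : A^T = A.
  by apply/matrixP => i j; rewrite !mxE eq_sym dotpC [N _ * N _]mulrC.
have A0 i j : 0 <= A i j.
  rewrite mxE; case: eqP => // /eqP ij; rewrite divr_ge0 ?oppr_ge0 //; last by rewrite mulr_ge0 // ltW // N0.
  by apply: (simple_obtuse rs reg sd) => //; rewrite aI.
have Airr (P : pred 'I_m) : (exists i, P i) -> (forall i j, P i -> ~~ P j -> A i j = 0) -> forall i, P i.
  move=> [i0 Pi0] H.
  pose I (b : V) := [exists i, (b == a i) && P i].
  have Ia i : I (a i) = P i.
    apply/existsP/idP => [[j /andP[]]|Pi]; last by exists i; rewrite eqxx.
    by rewrite aI => /eqP ->.
  have all : forall b, b \in s -> I b.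
    apply: simple_connected; first by exists (a i0); rewrite ?Ia.
    move=> b1 b2 /(nthP 0)[i1 h1 <-] /(nthP 0)[i2 h2 <-].
    rewrite -[s`_i1]/(a (Ordinal h1)) -[s`_i2]/(a (Ordinal h2)) !Ia => P1 P2.
    have := H _ _ P1 P2; rewrite mxE; case: eqP => [E|_]; first by rewrite -E P1 in P2.
    move/eqP; rewrite mulf_eq0 invr_eq0 oppr_eq0 => /orP[/eqP //|].
    by rewrite gt_eqF // mulr_gt0 ?N0.
  by move=> i; rewrite -Ia; apply: all.
have [mu [x [x0 Ex _]]] := perron m0 AT A0 Airr.
pose X (b : V) := \sum_(i | a i == b) x 0 i * N (a i).
have Xa i : X (a i) = x 0 i * N (a i).
  rewrite /X (eq_bigl (fun j => j == i)) ?big_pred1_eq // => j; exact: aI.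
have X0 b : b \in s -> 0 < X b.
  by move=> /(nthP 0)[i hi <-]; rewrite -[s`_i]/(a (Ordinal hi)) Xa mulr_gt0 ?N0.
have EX b : b \in s -> \sum_(d <- s | d != b) 2 * X d / dotp d d * dotp d b = - (mu * X b).
  move=> /(nthP 0)[j0 hj <-]; pose j := Ordinal hj; rewrite -[s`_j0]/(a j).
  rewrite (big_nth 0) big_mkord Xa.
  have := congr1 (fun Y : 'rV[R]_m => Y 0 j) Ex; rewrite !mxE => E.
  rewrite mulrA -E mulr_suml -sumrN [RHS](bigID (fun i => i == j)) /= big_pred1_eq mxE eqxx mulr0 mul0r oppr0 add0r.
  apply: eq_big => i; first by rewrite -/(a i) aI.
  rewrite -/(a i) aI => ij; rewrite -/(a i) Xa mxE (negbTE ij).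
  have -> : dotp (a i) (a i) = 2 * (N (a i) * N (a i)) by rewrite NN mulrC divfK // pnatr_eq0.
  have n1 := lt0r_neq0 (N0 _ (ha i)); have n2 := lt0r_neq0 (N0 _ (ha j)).
  by field; rewrite n1 n2.
have [b hb] : exists b, b \in s by exists (a (Ordinal m0)).
have mu0 : 0 <= mu.
  rewrite -(pmulr_lge0 _ (X0 b hb)) -oppr_le0 -EX // big_seq_cond sumr_le0 // => d /andP[hd db].
  rewrite mulr_ge0_le0 ?divr_ge0 ?mulr_ge0 ?(ltW (X0 _ hd)) ?dotp_ge0 //.
  exact: (simple_obtuse rs reg sd).
exists mu, X; split=> //.
pose y := \sum_(d <- s) (2 * X d / dotp d d) *: d.
have y0 : y != 0.
  apply/negP => /eqP E; have := congr1 (dotp (dual b)) E; rewrite dotp0r.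
  rewrite (dual_sum sd (fun d => 2 * X d / dotp d d)) // => /eqP; rewrite gt_eqF // divr_gt0 ?mulr_gt0 ?X0 // dotp_gt0; exact: s0.
have Ey : dotp y y = (2 - mu) * \sum_(d <- s) 2 * X d / dotp d d * X d.
  rewrite {1}/y dotp_suml mulr_sumr big_seq [RHS]big_seq; apply: eq_bigr => d hd; rewrite dotpZl dotpC.
  rewrite /y dotp_suml; under eq_bigr do rewrite dotpZl.
  rewrite (bigD1_seq d) //= EX // divfK ?dotp_eq0 ?s0 //; ring.
have : 0 < dotp y y by rewrite dotp_gt0.
rewrite Ey pmulr_lgt0 ?subr_gt0 // (big_rem b) //= ltr_pwDl //.
  by rewrite mulr_gt0 ?divr_gt0 ?mulr_gt0 ?X0 ?dotp_gt0 ?s0.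
rewrite big_seq sumr_ge0 // => d /mem_rem hd.
by rewrite mulr_ge0 ?divr_ge0 ?mulr_ge0 ?dotp_ge0 ?(ltW (X0 _ hd)).
Qed.

Lemma refl_orth_prod (u : V) w : uniq w -> (forall a, a \in w -> a != 0) ->
  (forall a b, a \in w -> b \in w -> a != b -> dotp a b = 0) ->
  u *m coxeter_elt w = u - \sum_(a <- w) (2 * dotp u a / dotp a a) *: a.
Proof.
elim: w u => [|a w IH] u /=; first by rewrite big_nil subr0 mulmx1.
case/andP=> aw uw nz H; rewrite mulmxA IH //; last 2 first.
- by move=> b hb; apply: nz; rewrite inE hb orbT.
- by move=> b d hb hd; apply: H; rewrite inE ?hb ?hd orbT.
rewrite mul_refl big_cons opprD addrA; congr (_ - _); rewrite big_seq [RHS]big_seq; apply: eq_bigr => b hb.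
by rewrite dotpBl dotpZl (H a b) ?mem_head ?inE ?hb ?orbT ?mulr0 ?subr0 //; apply: contraNneq aw => ->.
Qed.

Section Colour.
Variables (mu : R) (X : V -> R).
Hypothesis X0 : forall a, a \in s -> 0 < X a.
Hypothesis EX : forall a, a \in s -> \sum_(b <- s | b != a) 2 * X b / dotp b b * dotp b a = - (mu * X a).
(** The part of one colour of a vector that has products [X a] with the simple roots, so the two
    colours add up to a point of the open chamber. *)
Definition cvec (g : pred V) : V := \sum_(a <- s | g a) X a *: dual a.
Lemma cvec_dot g a : a \in s -> dotp (cvec g) a = X a *+ g a.
Proof.
move=> ha; rewrite /cvec dotp_suml big_mkcond (big_rem a) //= big_seq big1 ?addr0.
  by case: (g a); rewrite // dotpZl sD // eqxx mulr1.
move=> b; rewrite mem_rem_uniq // inE => /andP[ba hb]; case: (g b) => //.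
by rewrite dotpZl sD // (negbTE ba) mulr0.
Qed.
Variable (g : pred V).
Hypothesis bip : forall a b, a \in s -> b \in s -> a != b -> g a = g b -> dotp a b = 0.
Let w := [seq a <- s | g a].
Let hw a : a \in w -> g a && (a \in s). Proof. by rewrite mem_filter. Qed.
(** Reflections of one colour commute, so their product subtracts all components at once. Comparing
    products with the simple roots, the other colour is governed by the Perron equation [EX]. *)
Lemma cvec_refl1 : cvec g *m coxeter_elt w = - cvec g + mu *: cvec (predC g).
Proof.
rewrite refl_orth_prod ?filter_uniq //; last 2 first.
- by move=> a /hw/andP[_ /s0].
- by move=> a b /hw/andP[ga ha] /hw/andP[gb hb] ab; apply: bip; rewrite ?ga ?gb.
apply/eqP; rewrite -subr_eq0; apply/eqP/simple_span => a ha.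
have ES : dotp (\sum_(b <- w) (2 * dotp (cvec g) b / dotp b b) *: b) a =
    \sum_(b <- s | g b) 2 * X b / dotp b b * dotp b a.
  rewrite /w big_filter dotp_suml big_seq_cond [RHS]big_seq_cond; apply: eq_bigr => b /andP[hb gb].
  by rewrite dotpZl cvec_dot // gb.
rewrite !(dotpBl, dotpDl, dotpNl, dotpZl) ES !cvec_dot //=; case ga: (g a); rewrite /= ?mulr1n ?mulr0n.
  rewrite big_mkcond (big_rem a) //= ga big_seq big1 ?addr0 ?divfK ?dotp_eq0 ?s0 //; first by ring.
  move=> b; rewrite mem_rem_uniq // inE => /andP[ba hb]; case gb: (g b) => //.
  by rewrite (bip hb ha) ?mulr0 // gb ga.
rewrite !sub0r oppr0 add0r; have <- : \sum_(b <- s | b != a) 2 * X b / dotp b b * dotp b a =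
   \sum_(b <- s | g b) 2 * X b / dotp b b * dotp b a; last by rewrite EX //; ring.
rewrite (bigID g) /= [X in _ + X]big1_seq ?addr0; last first.
  move=> b /andP[/andP[ba ngb] hb]; rewrite (bip hb ha ba) ?mulr0 //.
  by rewrite (negbTE ngb) ga.
apply: eq_bigl => b; case: eqP => // ->; by rewrite ga.
Qed.
Lemma cvec_refl2 : cvec (predC g) *m coxeter_elt w = cvec (predC g).
Proof.
apply: fix_words => a /hw/andP[ga ha]; by rewrite cvec_dot //= ga.
Qed.
End Colour.
End Plane.

End BipartiteEigenvector.

(** * A regular eigenvector on the Coxeter plane *)

Module CoxeterPlane.
Import LinearFormDivisibility HomogeneousPolynomials RootSystemBasics SimpleSystems CoxeterOrbits PerronVector BipartiteEigenvector.

Section CDot.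
Variables (R : realType) (n : nat).
Local Notation C := R[i].
Local Notation rc := (real_complex R).
(** Bilinear rather than Hermitian, so that eigenvalues pass through without conjugation. *)
Definition cdot (z : 'rV[C]_n) (b : 'rV[R]_n) : C := \sum_i (b 0 i)%:C%C * z 0 i.
Lemma cdot_mul z b (g : 'M[R]_n) : cdot (z *m map_mx rc g) b = cdot z (b *m g^T).
Proof.
rewrite /cdot; under eq_bigr do rewrite mxE mulr_sumr; rewrite exchange_big /=.
apply: eq_bigr => i _; rewrite [in RHS]mxE rmorph_sum mulr_suml; apply: eq_bigr => j _.
by rewrite !mxE rmorphM /=; move: (_%:C%C) (_%:C%C) => x y; ring.
Qed.
Lemma cdotZ t z b : cdot (t *: z) b = t * cdot z b.
Proof. by rewrite /cdot mulr_sumr; apply: eq_bigr => i _; rewrite mxE mulrCA. Qed.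
Lemma cdotN z b : cdot z (- b) = - cdot z b.
Proof. by rewrite /cdot -sumrN; apply: eq_bigr => i _; rewrite mxE rmorphN mulNr. Qed.
End CDot.

Section Plane2.
Variables (R : realType) (n : nat).
Local Notation V := 'rV[R]_n.
Local Notation C := R[i].
Local Notation rc := (real_complex R).
Variables (Phi : seq V) (v : V) (s : seq V) (dual : V -> V).
Hypothesis rs : rsys Phi.
Hypothesis reg : regular_vec Phi v.
Hypothesis sd : simple_dual Phi v s dual.
Hypothesis sp : spanning Phi.
Hypothesis irr : irreducible_rs Phi.
Local Notation Pos := (pos_system Phi v).
Let us : uniq s. Proof. by case: sd. Qed.
Let sP a : a \in s -> a \in Pos. Proof. by case: sd => _ h _ _ /h. Qed.

Lemma mxpow_word (t : seq V) k : mxpow (coxeter_elt t) k = coxeter_elt (flatten (nseq k t)).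
Proof. by elim: k => // k IH; rewrite mxpowS IH /= cox_cat. Qed.

(** The two colour vectors [p] and [q] span a plane stable under both colour products, which act
    there by matrices with the single parameter mu. Regularity comes from p + q lying in the open
    chamber; for the same reason a power of the Coxeter element that fixes [z], hence p + q,
    preserves the positive roots and is the identity. *)
Theorem coxeter_plane : exists (t : seq V) (z : 'rV[C]_n) (lam xi u0 : C) (tb : seq V),
  [/\ perm_eq t s, z *m map_mx rc (coxeter_elt t) = lam *: z,
      (forall k, lam ^+ k = 1 -> mxpow (coxeter_elt t) k = 1%:M),
      (forall b, b \in Pos -> 0 < complex.Re (u0 * cdot z b)) &
      [/\ sword s tb, z *m map_mx rc (coxeter_elt tb) = xi *: map_mx (@conjc R) z & xi * lam = -1]].
Proof.
have [mu [X [mu0 mu2 X0 EX]]] := perron_simple rs reg sd irr.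
have [f hf] := bipartite rs reg sd.
have bip (g : pred V) : (forall a b, (g a == g b) = (f a == f b)) ->
    forall a b, a \in s -> b \in s -> a != b -> g a = g b -> dotp a b = 0.
  move=> E a b ha hb ab gab; apply/eqP/negPn/negP => nz.
  by have := hf a b ha hb ab nz; rewrite -E gab eqxx.
have bf := bip f (fun _ _ => erefl).
have bf' := bip (predC f) (ltac:(by move=> a b /=; case: (f a); case: (f b))).
pose p := cvec s dual X f; pose q := cvec s dual X (predC f).
have p1 := cvec_refl1 rs reg sd sp EX bf; have p2 := cvec_refl2 sd X f.
have q1 := cvec_refl1 rs reg sd sp EX bf'; have q2 := cvec_refl2 sd X (predC f).
have Ef : cvec s dual X (predC (predC f)) = cvec s dual X f.
  by apply: eq_bigl => a /=; rewrite negbK.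
rewrite Ef -/p -/q in p1 p2 q1 q2.
set tw := [seq a <- s | f a] in p1 p2; set tb := [seq a <- s | predC f a] in q1 q2.
(* [kap] is the number of modulus 1 with kap + conj kap = - mu; it is not real because mu < 2. *)
pose kr := - mu / 2; pose ki := Num.sqrt (1 - kr ^+ 2).
have kr1 : -1 < kr by rewrite /kr; lra.
have kr2 : kr <= 0 by rewrite /kr; lra.
have sq : 0 < 1 - kr ^+ 2 by nra.
have ki0 : 0 < ki by rewrite sqrtr_gt0.
have kk : ki * ki = 1 - kr * kr by rewrite -expr2 sqr_sqrtr ?ltW.
have muE : mu = - 2 * kr by rewrite /kr; field.
pose kap : C := (kr +i* ki)%C.
pose z : 'rV[C]_n := map_mx rc p + kap *: map_mx rc q.
pose t := tw ++ tb.
have pt : perm_eq t s by rewrite perm_filterC.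
have zE (M : 'M[R]_n) a b c d : p *m M = a *: p + b *: q -> q *m M = c *: p + d *: q ->
   z *m map_mx rc M = (a%:C%C + kap * c%:C%C) *: map_mx rc p + (b%:C%C + kap * d%:C%C) *: map_mx rc q.
  move=> E1 E2; rewrite /z mulmxDl -scalemxAl -!map_mxM E1 E2; apply/rowP => i.
  rewrite !mxE !rmorphD !rmorphM /=.
  by move: (rc _) (rc _) (a%:C%C) (b%:C%C) (c%:C%C) (d%:C%C) => ? ? ? ? ? ?; ring.
have Ec1 : p *m coxeter_elt t = (mu * mu - 1) *: p + (- mu) *: q.
  rewrite cox_cat mulmxA p1 mulmxDl mulNmx -scalemxAl q1 q2; apply/rowP => i; rewrite !mxE; ring.
have Ec2 : q *m coxeter_elt t = mu *: p + (-1) *: q.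
  by rewrite cox_cat mulmxA p2 q1 scaleN1r addrC.
have Eb1 : p *m coxeter_elt tb = 1 *: p + 0 *: q by rewrite q2 scale1r scale0r addr0.
have Eb2 : q *m coxeter_elt tb = mu *: p + (-1) *: q by rewrite q1 scaleN1r addrC.
have ceq (x y : C) : complex.Re x = complex.Re y -> complex.Im x = complex.Im y -> x = y.
  by case: x y => a b [c d] /= -> ->.
(* With u0 = 1 + conj kap the real part of u0 (x + kap y) is (1 + kr) (x + y), positive on positive
   roots. *)
exists t, z, (conjc kap ^+ 2), (- kap ^+ 2), (1 + conjc kap), tb.
have zc : z *m map_mx rc (coxeter_elt t) = conjc kap ^+ 2 *: z.
  rewrite (zE _ _ _ _ _ Ec1 Ec2) /z scalerDr scalerA; congr (_ *: _ + _ *: _).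
    by apply: ceq; rewrite expr2 /= ?muE; [have := kk | ]; nra.
  by apply: ceq; rewrite expr2 /= ?muE; have := kk; nra.
have dotpos b : b \in Pos -> [/\ 0 <= dotp p b, 0 <= dotp q b & 0 < dotp p b + dotp q b].
  move=> hb; have E g : dotp (cvec s dual X g) b = \sum_(a <- s) dotp (dual a) b * (X a *+ g a).
    rewrite {1}(pos_expand sd hb) dotp_sumr big_seq [RHS]big_seq; apply: eq_bigr => a ha.
    by rewrite dotpZr (cvec_dot sd).
  have nn g : 0 <= dotp (cvec s dual X g) b.
    rewrite E big_seq sumr_ge0 // => a ha; rewrite mulr_ge0 ?(dual_ge0 sd) //.
    by rewrite mulrn_wge0 // ltW // X0.
  split; [exact: nn | exact: nn |].
  rewrite /p /q !E -big_split /=; rewrite lt_neqAle; apply/andP; split; last first.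
    by rewrite big_split /= -!E addr_ge0.
  rewrite eq_sym; apply/negP => /eqP.
  have -> : \sum_(a <- s) (dotp (dual a) b * (X a *+ f a) + dotp (dual a) b * (X a *+ ~~ f a)) =
            \sum_(a <- s) dotp (dual a) b * X a.
    by apply: eq_bigr => a _; case: (f a); rewrite /= ?mulr1n ?mulr0n mulr0 ?addr0 ?add0r.
  move=> /eqP; rewrite big_seq psumr_eq0; last first.
    by move=> a ha; rewrite mulr_ge0 ?(dual_ge0 sd) // ltW // X0.
  move=> /allP H; have := pos_neq0 rs hb; rewrite (pos_expand sd hb) => /eqP; apply.
  rewrite big_seq big1 // => a ha; have := H a ha; rewrite ha /= mulf_eq0 (gt_eqF (X0 _ ha)) orbF => /eqP ->.
  by rewrite scale0r.
have cz b : cdot z b = (dotp p b)%:C%C + kap * (dotp q b)%:C%C.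
  rewrite /cdot /z !dotpE !rmorph_sum mulr_sumr -big_split; apply: eq_bigr => i _ /=.
  rewrite !mxE !rmorphM /=; move: (rc _) (rc _) (_%:C%C) => ? ? ?; ring.
split=> //.
- move=> k; rewrite mxpow_word => lk; set w := flatten _.
  have hw : sword s w.
    apply/allP => a /flattenP[l]; rewrite mem_nseq => /andP[_ /eqP ->]; by rewrite (perm_mem pt).
  have zw : z *m map_mx rc (coxeter_elt w) = z.
    have -> : z *m map_mx rc (coxeter_elt w) = (conjc kap ^+ 2) ^+ k *: z; last by rewrite lk scale1r.
    rewrite /w -mxpow_word; elim: (k) => [|j IH]; first by rewrite map_mx1 mulmx1 expr0 scale1r.
    by rewrite mxpowSr map_mxM mulmxA IH -scalemxAl zc scalerA -exprSr.
  have zM : z *m map_mx rc (coxeter_elt w) = map_mx rc (p *m coxeter_elt w) + kap *: map_mx rc (q *m coxeter_elt w).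
    by rewrite /z mulmxDl -scalemxAl -!map_mxM.
  have zI (a b : V) i : complex.Im ((map_mx rc a + kap *: map_mx rc b) 0 i) = ki * b 0 i.
    by rewrite !mxE /= mulr0 !add0r.
  have zR (a b : V) i : complex.Re ((map_mx rc a + kap *: map_mx rc b) 0 i) = a 0 i + kr * b 0 i.
    by rewrite !mxE /= mulr0 subr0.
  rewrite zM in zw.
  have qw : q *m coxeter_elt w = q.
    apply/rowP => i; have /rowP/(_ i)/(congr1 (@complex.Im R)) := zw.
    by rewrite !zI => /(mulfI (lt0r_neq0 ki0)).
  have pw : p *m coxeter_elt w = p.
    apply/rowP => i; have /rowP/(_ i)/(congr1 (@complex.Re R)) := zw.
    by rewrite !zR qw => /addIr.
  apply: (word_pos1 rs reg sd hw) => b hb.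
  have rb := word_root rs sd hw (pos_root hb).
  have pq : (p + q) *m (coxeter_elt w)^T = p + q.
    by rewrite -{1}pw -{1}qw -mulmxDl -mulmxA (word_orth rs sd hw) mulmx1.
  have E : dotp (p + q) (b *m coxeter_elt w) = dotp p b + dotp q b.
    by rewrite dotpC dotp_mulmx pq dotpC dotpDl.
  case/orP: (pos_or rs reg rb) => // nb.
  have [_ _ h1] := dotpos _ hb; have [_ _ h2] := dotpos _ nb.
  by move: h2; rewrite -dotpDl dotpNr E oppr_gt0 ltNge ltW.
- move=> b hb; have [h1 h2 h3] := dotpos b hb; rewrite cz /=.
  move: (dotp p b) (dotp q b) h1 h2 h3 => x y h1 h2 h3.
  set T := (T in 0 < T); have -> : T = (x + y) * (1 + kr) + (ki * ki - (1 - kr * kr)) * y by rewrite /T; ring.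
  by rewrite kk subrr mul0r addr0 mulr_gt0 //; lra.
- split.
  + by apply/allP => a; rewrite mem_filter => /andP[].
  + have cz' : map_mx (@conjc R) z = map_mx rc p + conjc kap *: map_mx rc q.
      by apply/rowP => i; rewrite !mxE rmorphD rmorphM /=; congr (_ + _ * _); apply: ceq; rewrite /= ?oppr0.
    rewrite (zE _ _ _ _ _ Eb1 Eb2) cz' scalerDr scalerA; congr (_ *: _ + _ *: _).
      by apply: ceq; rewrite expr2 /= ?muE; have := kk; nra.
    by apply: ceq; rewrite expr2 /= ?muE; have := kk; nra.
  + by apply: ceq; rewrite !expr2 /=; have := kk; nra.
Qed.
End Plane2.

End CoxeterPlane.

(** * Degrees of invariants and eigenvalues of the Coxeter element *)

Module CoxeterEigenvalues.
Import LinearFormDivisibility HomogeneousPolynomials SaitoCriterion TeraoInduction RootSystemBasics SimpleSystems ReflectionInvariants CoxeterOrbits PerronVector BipartiteEigenvector CoxeterPlane RootsOfUnity.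

Section MxGen.
Lemma perm_map_in (T U : eqType) (f : T -> U) (D : pred T) s1 s2 : {in D &, injective f} ->
  all D s1 -> all D s2 -> perm_eq (map f s1) (map f s2) -> perm_eq s1 s2.
Proof.
move=> fI /allP D1 /allP D2 /seq.permP E; apply/allP => x hx; apply/eqP.
have Dx : D x by move: hx; rewrite mem_cat => /orP[/D1|/D2].
have cm s : {subset s <= D} -> count_mem x s = count_mem (f x) (map f s).
  move=> Ds; rewrite count_map; apply: eq_in_count => y hy /=.
  by apply/eqP/eqP => [->//|]; apply: fI => //; exact: Ds.
by rewrite /= !cm.
Qed.
Lemma big_enum_map (T : Type) (x : T) (op : T -> T -> T) (U : Type) n (F : 'I_n -> U) (G : U -> T) :
  \big[op/x]_(y <- [seq F j | j <- enum 'I_n]) G y = \big[op/x]_j G (F j).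
Proof. by rewrite big_map enumT. Qed.
Lemma big_enum_map2 (T : Type) (x : T) (op : T -> T -> T) (U U' : Type) n (F : 'I_n -> U) (H : U -> U') (G : U' -> T) :
  \big[op/x]_(y <- [seq H k | k <- [seq F j | j <- enum 'I_n]]) G y = \big[op/x]_j G (H (F j)).
Proof. by rewrite big_map (big_enum_map _ _ F (fun k => G (H k))). Qed.
Lemma det1B (F : comNzRingType) n (u : 'cV[F]_n) (w : 'rV[F]_n) : \det (1%:M - u *m w) = 1 - (w *m u) 0 0.
Proof.
have E1 : block_mx 1%:M u w (1%:M : 'M_1) = block_mx 1%:M 0 w 1%:M *m block_mx 1%:M u 0 (1%:M - w *m u).
  by rewrite mulmx_block !mul1mx !mulmx1 !mulmx0 !mul0mx !addr0 addrC subrK.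
have E2 : block_mx 1%:M u w (1%:M : 'M_1) = block_mx 1%:M u 0 1%:M *m block_mx (1%:M - u *m w) 0 w 1%:M.
  by rewrite mulmx_block !mul1mx !mulmx1 !mulmx0 !mul0mx !add0r subrK.
have := congr1 determinant E1; rewrite E2 !det_mulmx !det_lblock !det_ublock !det1 !mul1r mulr1.
by move=> ->; rewrite det_mx11 !mxE eqxx.
Qed.
Lemma char_poly_conj (F : comNzRingType) n (P P' M : 'M[F]_n) : P *m P' = 1%:M ->
  char_poly (P *m M *m P') = char_poly M.
Proof.
move=> E; rewrite /char_poly.
have -> : char_poly_mx (P *m M *m P') = map_mx polyC P *m char_poly_mx M *m map_mx polyC P'.
  rewrite /char_poly_mx mulmxBr mulmxBl !map_mxM; congr (_ - _).
  by rewrite mul_mx_scalar -scalemxAl -map_mxM E map_mx1 scalemx1.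
rewrite !det_mulmx mulrAC -det_mulmx -map_mxM E map_mx1 det1 mul1r //.
Qed.
Lemma char_poly_trmx (F : comNzRingType) n (M : 'M[F]_n) : char_poly M^T = char_poly M.
Proof.
rewrite /char_poly -[RHS]det_tr; congr (\det _).
by rewrite /char_poly_mx linearB /= tr_scalar_mx map_trmx.
Qed.
Lemma char_poly_dg (F : comNzRingType) n (d : 'rV[F]_n) : char_poly (diag_mx d) = \prod_i ('X - (d 0 i)%:P).
Proof. by rewrite char_poly_trig ?diag_mx_is_trig //; apply: eq_bigr => i _; rewrite mxE eqxx mulr1n. Qed.
End MxGen.

Section Exps.
Variables (R : realType) (l : nat).
Local Notation V := 'rV[R]_l.
Local Notation C := R[i].
Local Notation S := {mpoly R[l]}.
Local Notation rc := (real_complex R).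
Lemma det_refl (a : V) : a != 0 -> \det (refl a) = -1.
Proof.
move=> a0; rewrite /refl scalemxAl det1B -scalemxAr mxE -/(dotp a a) divfK ?dotp_eq0 //; ring.
Qed.
Lemma act_word (s w : seq V) (f : S) : sword s w -> (forall a, a \in s -> act (refl a) f = f) ->
  act (coxeter_elt w) f = f.
Proof.
move=> hw H; elim: w hw => [|a w IH] /=; first by rewrite act1.
by case/andP=> ha hw; rewrite -act_comp ?IH ?H.
Qed.

Variables (Phi : seq V) (v : V) (s : seq V) (dual : V -> V) (h : nat).
Hypothesis rs : rsys Phi.
Hypothesis reg : regular_vec Phi v.
Hypothesis sd : simple_dual Phi v s dual.
Hypothesis sp : spanning Phi.
Hypothesis irr : irreducible_rs Phi.
Hypothesis sz : size s = l.
Local Notation Pos := (pos_system Phi v).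
Let us : uniq s. Proof. by case: sd. Qed.
Let sP a : a \in s -> a \in Pos. Proof. by case: sd => _ h' _ _ /h'. Qed.
Let exb : exists b, b \in Pos.
Proof.
by have := s_neq0 rs reg sd irr; case: (s) sP => // a t H _; exists a; apply: H; exact: mem_head.
Qed.

Section Data.
Variables (t : seq V) (z : 'rV[C]_l) (lam xi u0 : C) (tb : seq V).
Hypothesis pt : perm_eq t s.
Let c := coxeter_elt t.
Hypothesis zc : z *m map_mx rc c = lam *: z.
Hypothesis lamk : forall k, lam ^+ k = 1 -> mxpow c k = 1%:M.
Hypothesis zpos : forall b, b \in Pos -> 0 < complex.Re (u0 * cdot z b).
Hypothesis tbs : sword s tb.
Hypothesis zb : z *m map_mx rc (coxeter_elt tb) = xi *: map_mx (@conjc R) z.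
Hypothesis xil : xi * lam = -1.
Hypothesis h0 : (0 < h)%N.
Hypothesis ch : mxpow c h = 1%:M.
Hypothesis cmin : forall k, (0 < k < h)%N -> mxpow c k != 1%:M.
Let ts : sword s t. Proof. by apply/allP => a; rewrite (perm_mem pt). Qed.
Let powword k : exists2 w, sword s w & mxpow c k = coxeter_elt w.
Proof.
exists (flatten (nseq k t)); last exact: mxpow_word.
by apply/allP => a /flattenP[u]; rewrite mem_nseq => /andP[_ /eqP ->]; rewrite (perm_mem pt).
Qed.
Lemma z_neq0 : z != 0.
Proof.
case: exb => b hb; apply: contraTneq (zpos hb) => ->; rewrite /cdot big1 ?mulr0 ?ltxx // => i _.
by rewrite mxE mulr0.
Qed.
Lemma zpow k : z *m map_mx rc (mxpow c k) = lam ^+ k *: z.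
Proof.
elim: k => [|k IH]; first by rewrite map_mx1 mulmx1 expr0 scale1r.
by rewrite mxpowSr map_mxM mulmxA IH -scalemxAl zc scalerA -exprSr.
Qed.
Lemma lam_h : lam ^+ h = 1.
Proof.
have := zpow h; rewrite ch map_mx1 mulmx1 => /eqP; rewrite -subr_eq0 -{1}[z]scale1r -scalerBl scaler_eq0.
by rewrite (negbTE z_neq0) orbF subr_eq0 => /eqP <-.
Qed.
Lemma lam_dvd k : (lam ^+ k == 1) = (h %| k)%N.
Proof.
apply/eqP/idP => [/lamk E|/dvdnP[q ->]]; last by rewrite mulnC exprM lam_h expr1n.
rewrite /dvdn; apply: contraTT isT => nz; have := @cmin (k %% h)%N.
by rewrite lt0n nz ltn_pmod // -(pow_mod (t := t) ch) E eqxx => /(_ isT).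
Qed.
Lemma h_gt1 : (1 < h)%N.
Proof.
rewrite ltn_neqAle h0 andbT eq_sym; apply/negP => /eqP h1; case: exb => b hb.
have E : c = 1%:M by have := ch; rewrite h1 /mxpow /= mulmx1.
have := nofix rs reg sd pt sp (x := b); rewrite -/c E mulmx1 => /(_ erefl) b0.
by have := pos_neq0 rs hb; rewrite b0 eqxx.
Qed.
Lemma lam0 : lam != 0.
Proof. by apply/negP => /eqP E; have := lam_h; rewrite E expr0n gtn_eqF // => /eqP; rewrite eq_sym oner_eq0. Qed.
Lemma cdot_pow b j : cdot z (b *m mxpow c j) = (lam^-1) ^+ j * cdot z b.
Proof.
have -> : b *m mxpow c j = b *m ((mxpow c j)^T)^T by rewrite trmxK.
rewrite -cdot_mul -cdotZ; congr cdot; have [w hw E] := powword j.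
have F : z = (lam^-1) ^+ j *: (z *m map_mx rc (mxpow c j)).
  by rewrite zpow scalerA exprVn mulVf ?scale1r // expf_neq0 // lam0.
by rewrite {1}F -scalemxAl -mulmxA -map_mxM E (word_orth rs sd hw) map_mx1 mulmx1.
Qed.
Lemma cdot_neq0 b : b \in Phi -> cdot z b != 0.
Proof.
have red a : a \in Pos -> cdot z a != 0.
  by move=> /zpos; apply: contraTneq => ->; rewrite mulr0 ltxx.
by move=> hb; case/orP: (pos_or rs reg hb) => /red //; rewrite cdotN oppr_eq0.
Qed.
(** Equality in the root count leaves one sign change per orbit. Started just after it, the orbit
    gives a real sequence u lam^(-j) with one sign change, as [one_sign_change] requires. *)
Lemma lam_om : ((size Pos).*2 = h * size s)%N -> lam = om R h \/ lam * om R h = 1.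
Proof.
move=> E; have T1 := trans_one rs reg sd pt sp h0 ch E.
case: exb => b hb; have rb := pos_root hb.
have [j0 tj] : exists j : 'I_h, trans Phi v t b j.
  apply: contrapT => /forallNP H; have := T1 b rb; rewrite big1 // => j _.
  by apply/eqP; rewrite eqb0; apply/negP.
pose b' := b *m mxpow c j0.+1; have rb' : b' \in Phi by apply: (pow_root rs sd pt).
pose ps j := b' *m mxpow c j \in Pos.
have n0 : b' \notin Pos by case/andP: tj.
have ph : ps h.-1.
  rewrite /ps /b' -mulmxA -mxpowD addSnnS prednK // mxpowD ch mulmx1; by case/andP: tj.
have up j : (j.+1 < h)%N -> ps j -> ps j.+1.
  move=> jh pj; apply/negPn/negP => nj; have jh' : (j < h)%N by exact: ltnW.
  have hh : (h.-1 < h)%N by rewrite prednK.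
  have := T1 b' rb'; rewrite (bigD1 (Ordinal hh)) //= (bigD1 (Ordinal jh')) /=; last first.
    by rewrite -val_eqE /= neq_ltn -ltnS prednK // jh.
  have t1 : trans Phi v t b' h.-1 = true.
    by rewrite /trans -/c; apply/andP; split=> //; rewrite prednK // ch mulmx1.
  have t2 : trans Phi v t b' j = true by rewrite /trans -/c; apply/andP.
  by rewrite t1 t2.
have [L pL Lmin] : exists2 L, ps L & forall j, ps j -> (L <= j)%N.
  by case: (ex_minnP (ex_intro ps _ ph)) => L h1 h2; exists L.
have Lh : (L < h)%N by apply: leq_ltn_trans (Lmin _ ph) _; rewrite prednK.
have upL j : (L <= j < h)%N -> ps j.
  case/andP=> Lj; rewrite -(subnKC Lj); elim: (j - L)%N => [|i IH]; rewrite ?addn0 // addnS => ih.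
  by apply: up => //; apply: IH; apply: ltnW.
have RE j : u0 * cdot z (b' *m mxpow c j) = u0 * cdot z b' * (lam^-1) ^+ j.
  by rewrite cdot_pow -mulrA; congr (_ * _); rewrite mulrC.
have := @one_sign_change R h L (lam^-1) (u0 * cdot z b') h0 (ltnW Lh).
case.
- by rewrite exprVn lam_h invr1.
- rewrite invr_eq1 -[lam]expr1 lam_dvd dvdn1; by rewrite gtn_eqF ?h_gt1.
- move=> j jL; rewrite -RE; have nj : ~~ ps j by apply/negP => /Lmin; rewrite leqNgt jL.
  have rj : b' *m mxpow c j \in Phi by apply: (pow_root rs sd pt).
  case/orP: (pos_or rs reg rj) => hp; first by rewrite /ps hp in nj.
  have := zpos hp; rewrite cdotN mulrN; case: (u0 * _) => x y /=; by rewrite oppr_gt0.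
- by move=> j hj; rewrite -RE; apply: zpos; apply: upL.
- by move=> <-; right; rewrite mulfV ?lam0.
- by move=> E1; left; rewrite -[LHS]mulr1 -E1 mulrA mulfV ?lam0 // mul1r.
Qed.

Section Inv.
Variables (P : 'I_l -> S) (d : 'I_l -> nat).
Hypothesis Pinv : forall j w, sword s w -> act (coxeter_elt w) (P j) = P j.
Hypothesis d0 : forall j, (0 < d j)%N.
Hypothesis Phom : forall j, P j \is (d j).-homog.
Let J0 : 'M[S]_l := \matrix_(i, j) (P j)^`M(i).
Hypothesis J00 : \det J0 != 0.
Hypothesis Nge : (\sum_j (d j).-1 <= size Pos)%N.
Local Notation Q := (\prod_(a <- Pos) linform a : S).
Lemma J0_eq w : sword s w -> J0 = cmx l (coxeter_elt w) *m map_mx (act (coxeter_elt w)) J0.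
Proof.
move=> hw; apply/matrixP => i j; rewrite !mxE -{1}(Pinv j hw) mderiv_act.
by apply: eq_bigr => k _; rewrite !mxE -mul_mpolyC.
Qed.
Lemma J0_refl a : a \in Pos -> map_mx (act (refl a)) J0 = cmx l (refl a) *m J0.
Proof.
move=> ha; have [w hw E] := refl_word rs reg sd (pos_root ha).
by rewrite E {2}(J0_eq hw) mulmxA -cmxM -E dotp_reflK ?(pos_neq0 rs ha) // cmx1 mul1mx.
Qed.
Lemma J0_hom i j : J0 i j \is ((d j).-1).-homog.
Proof. by rewrite mxE; apply: mderiv_homog; rewrite prednK. Qed.
Lemma Q_dvd : mdvd Q (\det J0).
Proof.
have := @lin_coprime_prod R l _ Pos id (fun=> 1%N) (\det J0) (pos_uniq v rs) (@pos_neq0 _ _ _ _ rs)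
  (fun a b => @pos_nprop _ _ _ _ rs a b).
rewrite (eq_bigr (fun a => linform a)); last by move=> a _; rewrite expr1.
apply=> a ha; rewrite expr1; apply: anti_dvd; first exact: pos_neq0 ha.
by rewrite -det_map_mx J0_refl // det_mulmx /cmx det_map_mx det_refl ?(pos_neq0 rs ha) // rmorphN1 mulN1r.
Qed.
Lemma Q_hom' : Q \is (size Pos).-homog.
Proof. by rewrite -sum1_size; apply: homog_prod_seq => a; exact: linform_homog. Qed.
Lemma Q_neq0 : Q != 0.
Proof.
rewrite big_seq prodf_seq_neq0; apply/allP => a ha; apply/implyP => _.
by rewrite linform_eq0 (pos_neq0 rs ha).
Qed.
Lemma N_eq : (\sum_j (d j).-1 = size Pos)%N.
Proof.
apply/eqP; rewrite eqn_leq Nge /= leqNgt; apply/negP => lt.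
by move/eqP: J00; apply; apply: (mdvd_small Q_neq0 Q_hom' (det_homog J0_hom) Q_dvd).
Qed.
Lemma det_J0 : exists2 k : R, k != 0 & \det J0 = k *: Q.
Proof.
have hd : \det J0 \is (size Pos).-homog by rewrite -N_eq; apply: det_homog J0_hom.
have [k E] := mdvd_eqdeg Q_neq0 Q_hom' hd Q_dvd; exists k => //.
by apply: contraNneq J00 => k0; rewrite E k0 scale0r.
Qed.
Lemma cevQ : cev z Q != 0.
Proof.
rewrite rmorph_prod big_seq prodf_seq_neq0; apply/allP => a ha; apply/implyP => _.
by rewrite /= cev_lin; apply: cdot_neq0; apply: pos_root ha.
Qed.
Let Jz := map_mx (cev z) J0.
Lemma Jz_unit : Jz \in unitmx.
Proof.
rewrite unitmxE unitfE det_map_mx; have [k k0 ->] := det_J0.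
by rewrite /= cevZ mulf_neq0 ?cevQ // fmorph_eq0.
Qed.
(** Equivariance moves the Coxeter element into the argument, where it rescales [z], and homogeneity
    turns the scale into a power of [lam]. The columns are thus a basis of eigenvectors. *)
Lemma Jz_eig : Jz = map_mx rc c *m (Jz *m diag_mx (\row_j lam ^+ (d j).-1)).
Proof.
rewrite /Jz {1}(J0_eq ts) map_mxM; congr (_ *m _).
  by apply/matrixP => i j; rewrite mxE [cmx _ _ _ _]mxE [RHS]mxE; exact: cevC.
apply/matrixP => i j.
have -> : (map_mx (cev z) (map_mx (act (coxeter_elt t)) J0)) i j = cev z (act c (J0 i j)).
  by rewrite mxE; congr (cev z _); rewrite mxE.
have -> : (map_mx (cev z) J0 *m diag_mx (\row_k lam ^+ (d k).-1)) i j = cev z (J0 i j) * lam ^+ (d j).-1.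
  by rewrite mul_mx_diag mxE; congr (_ * _); rewrite mxE.
by rewrite cev_act zc (cev_scale z lam (J0_hom i j)) mulrC.
Qed.
Lemma charpoly1 : map_poly rc (char_poly c) = \prod_j ('X - (lam ^+ (d j).-1)%:P).
Proof.
rewrite -[char_poly c]char_poly_trmx map_char_poly.
have E : map_mx rc c^T = Jz *m diag_mx (\row_j lam ^+ (d j).-1) *m invmx Jz.
  have := congr1 (mulmx (map_mx rc c^T)) Jz_eig; rewrite mulmxA -map_mxM.
  by rewrite (mulmx1C (word_orth rs sd ts)) map_mx1 mul1mx => <-; rewrite mulmxK ?Jz_unit.
rewrite E char_poly_conj ?mulmxV ?Jz_unit // char_poly_dg.
by apply: eq_bigr => j _; rewrite mxE.
Qed.
Lemma charpoly2 : map_poly rc (char_poly c) = \prod_j ('X - ((lam^-1) ^+ (d j).-1)%:P).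
Proof.
rewrite map_char_poly.
have DD : diag_mx (\row_j lam ^+ (d j).-1) *m diag_mx (\row_j (lam^-1) ^+ (d j).-1) = 1%:M.
  rewrite mulmx_diag; apply/matrixP => i j; rewrite !mxE -exprMn mulfV ?lam0 // expr1n; by case: eqP.
have E : map_mx rc c = Jz *m diag_mx (\row_j (lam^-1) ^+ (d j).-1) *m invmx Jz.
  have := congr1 (mulmx^~ (diag_mx (\row_j (lam^-1) ^+ (d j).-1) *m invmx Jz)) Jz_eig.
  by rewrite -!mulmxA [diag_mx _ *m (_ *m invmx Jz)]mulmxA DD mul1mx mulmxV ?Jz_unit // mulmx1 => <-.
rewrite E char_poly_conj ?mulmxV ?Jz_unit // char_poly_dg.
by apply: eq_bigr => j _; rewrite mxE.
Qed.
Let r j := ((d j).-1 %% h)%N.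
Lemma lam_r j : lam ^+ (d j).-1 = lam ^+ r j.
Proof. by rewrite {1}(divn_eq (d j).-1 h) exprD mulnC exprM lam_h expr1n mul1r. Qed.
Lemma r_gt0 j : (0 < r j)%N.
Proof.
rewrite lt0n; apply/negP => /eqP r0.
have : root (map_poly rc (char_poly c)) (rc 1).
  rewrite charpoly1 /root horner_prod (bigD1 j) //= lam_r r0 expr0 hornerXsubC.
  by rewrite (_ : rc 1 = 1) // subrr mul0r.
rewrite fmorph_root -eigenvalue_root_char => /eigenvalueP[x]; rewrite scale1r => E /eqP; apply.
exact: (nofix rs reg sd pt sp E).
Qed.
Let r_lt j : (r j < h)%N. Proof. by rewrite /r ltn_pmod. Qed.
Lemma lam_inj : {in [pred k | (k < h)%N] &, injective (fun k => lam ^+ k)}.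
Proof.
move=> i j; rewrite !inE; wlog le : i j / (i <= j)%N => [H hi hj E|hi hj E].
  by have [le|le] := leqP i j; [apply: H | apply/esym; apply: H => //; exact: ltnW].
have : lam ^+ (j - i) == 1.
  apply/eqP/(@mulfI _ (lam ^+ i)); first by rewrite expf_neq0 ?lam0.
  by rewrite -exprD subnKC // mulr1.
rewrite lam_dvd => dv; have : (j - i == 0)%N.
  by apply: contraTT dv => nz; rewrite gtnNdvd ?lt0n //; apply: leq_ltn_trans hj; exact: leq_subr.
by rewrite subn_eq0 => le2; apply/eqP; rewrite eqn_leq le le2.
Qed.
(** The Coxeter matrix is orthogonal, so its transpose is its inverse and has the same
    characteristic polynomial; [charpoly1] and [charpoly2] list the same eigenvalues with opposite
    exponents. *)
Lemma r_sym : perm_eq [seq r j | j <- enum 'I_l] [seq (h - r j)%N | j <- enum 'I_l].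
Proof.
have E' : perm_eq (map (fun k => lam ^+ k) [seq r j | j <- enum 'I_l]) (map (fun k => lam ^+ k) [seq (h - r j)%N | j <- enum 'I_l]).
  apply: prod_XsubC_eq; rewrite !big_enum_map2.
  transitivity (map_poly rc (char_poly c)).
    by rewrite charpoly1; apply: eq_bigr => j _; rewrite lam_r.
  rewrite charpoly2; apply: eq_bigr => j _; congr ('X - _%:P).
  rewrite exprVn lam_r -[LHS]mul1r -lam_h -(subnK (ltnW (r_lt j))) exprD subnK ?(ltnW (r_lt j)) //.
  by rewrite mulfK // expf_neq0 ?lam0.
apply: (perm_map_in lam_inj _ _ E'); apply/allP => k /mapP[j _ ->]; rewrite inE //.
by rewrite ltn_subrL r_gt0 h0.
Qed.
Lemma sum_r : (2 * \sum_j r j = l * h)%N.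
Proof.
have := perm_sumn r_sym; rewrite !sumnE !big_enum_map => E.
rewrite mul2n -addnn {2}E -big_split /= (eq_bigr (fun=> h)); last by move=> j _; rewrite subnKC // ltnW.
by rewrite sum_nat_const card_ord.
Qed.
(** N = sum of d_j - 1, which is at least the sum of the r_j = l h / 2, which is at least N by
    counting sign changes. Equality leaves no room for a reduction modulo h. *)
Lemma N2 : ((size Pos).*2 = h * size s)%N /\ forall j, (d j).-1 = r j.
Proof.
have le1 := two_N_le rs reg sd pt sp h0 ch; rewrite sz in le1.
have le2 : (\sum_j r j <= \sum_j (d j).-1)%N by apply: leq_sum => j _; exact: leq_mod.
have E : (\sum_j r j = \sum_j (d j).-1)%N.
  apply/eqP; rewrite eqn_leq le2 /= N_eq -(leq_pmul2l (m := 2)) // sum_r mul2n mulnC; exact: le1.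
split; first by rewrite -N_eq -E -mul2n sum_r sz mulnC.
move=> j; apply/eqP; rewrite eq_sym.
have := leqif_sum (fun j (_ : true) => leqif_eq (leq_mod (d j).-1 h)).
by move=> /leqifP; rewrite -/(r _) E; case: ifP => [/forallP/(_ j) //|_]; rewrite ltnn.
Qed.
End Inv.
End Data.
End Exps.

End CoxeterEigenvalues.

(** * Terao's bases for the given root system *)

Module MultiarrangementBases.
Import LinearFormDivisibility HomogeneousPolynomials SaitoCriterion TeraoInduction RootSystemBasics SimpleSystems ReflectionInvariants CoxeterOrbits PerronVector BipartiteEigenvector CoxeterPlane RootsOfUnity CoxeterEigenvalues.

Section Final.
Variables (R : realType) (l : nat).
Local Notation V := 'rV[R]_l.
Local Notation C := R[i].
Local Notation S := {mpoly R[l]}.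
Local Notation rc := (real_complex R).

Lemma conj_pow (M N : 'M[R]_l) : conjm M N -> forall k, (mxpow N k == 1%:M) = (mxpow M k == 1%:M).
Proof.
move=> [P [P' [E1 E2 E]]] k.
have -> : mxpow N k = P *m mxpow M k *m P'.
  elim: k => [|k IH]; first by rewrite mulmx1 E1.
  by rewrite !mxpowSr IH E !mulmxA -[_ *m P' *m P]mulmxA E2 mulmx1.
apply/eqP/eqP => [H|->]; last by rewrite mulmx1 E1.
by have := congr1 (fun X => P' *m X *m P) H; rewrite !mulmxA E2 mul1mx -mulmxA mulmx1 E2 mulmx1.
Qed.

Lemma terao_bases (Phi : seq V) (v : V) (s : seq V) (h : nat) (e : 'I_l -> nat) :
  is_root_system Phi -> irreducible_rs Phi -> regular_vec Phi v ->
  simple_system_of (pos_system Phi v) s -> is_order (coxeter_elt s) h -> are_exponents (coxeter_elt s) h e ->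
  exists (m : 'I_l -> nat) (Ro Re : nat -> 'M[S]_l),
  [/\ perm_eq [seq m j | j <- enum 'I_l] [seq e j | j <- enum 'I_l],
      forall j, (0 < m j < h)%N,
      perm_eq [seq m j | j <- enum 'I_l] [seq (h - m j)%N | j <- enum 'I_l],
      ((size (pos_system Phi v)).*2 = h * l)%N /\ (1 < h)%N &
      forall k,
      [/\ forall a j, a \in pos_system Phi v -> mdvd (linform a ^+ k.*2.+1) ((cmx l a *m Ro k) 0 j),
          (exists2 t : R, t != 0 & \det (Ro k) = t *: \prod_(a <- pos_system Phi v) linform a ^+ k.*2.+1) /\
          (forall i j, Ro k i j \is (m j + k * h).-homog),
          forall a j, a \in pos_system Phi v -> mdvd (linform a ^+ k.*2) ((cmx l a *m Re k) 0 j),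
          (exists2 t : R, t != 0 & \det (Re k) = t *: \prod_(a <- pos_system Phi v) linform a ^+ k.*2) /\
          (forall i j, Re k i j \is (k * h).-homog) &
          forall a, a \in pos_system Phi v -> map_mx (act (refl a)) (Re k) = cmx l (refl a) *m Re k *m cmx l (refl a)]].
Proof.
move=> RS irr reg ss [h0 ch0 cmin0] [elt echar].
have rs := root_rsys RS; have sp := root_spanning RS.
have [dual sd] := given_dual RS reg ss; have sz : size s = l by case: ss.
have [us sP _ _] := sd.
have [t [z [lam [xi [u0 [tb [pt zc lamk zpos [tbs zb xil]]]]]]]] := coxeter_plane rs reg sd sp irr.
have s0 a : a \in s -> a != 0 by move/sP/(pos_neq0 rs).
have cj : conjm (coxeter_elt s) (coxeter_elt t).
  by apply: (ceq_conj s0); apply: (ceq_all rs reg sd) => //; rewrite perm_sym.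
have ch : mxpow (coxeter_elt t) h = 1%:M by apply/eqP; rewrite (conj_pow cj) ch0.
have cmin k : (0 < k < h)%N -> mxpow (coxeter_elt t) k != 1%:M by rewrite (conj_pow cj); exact: cmin0.
have cc : char_poly (coxeter_elt t) = char_poly (coxeter_elt s).
  by case: cj => P [P' [E1 E2 ->]]; apply: char_poly_conj.
have [Wl uW WP] := W_exists rs reg sd sp.
have [P [d [Pi Ph J00 Nge]]] : exists (P : 'I_l -> S) (d : 'I_l -> nat),
  [/\ forall j, ReflectionInvariants.inv Wl (P j), forall j, (0 < d j)%N /\ P j \is (d j).-homog,
   \det (\matrix_(i, j) (P j)^`M(i)) != 0 & (\sum_j (d j).-1 <= size (pos_system Phi v))%N].
  apply: (@basic_invariants R l Phi Wl (root_neq0 rs) uW).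
  - by apply/WP; exists [::].
  - move=> g g' /WP[w hw ->] /WP[w' hw' ->]; apply/WP; exists (w ++ w'); last by rewrite cox_cat.
    by rewrite /sword all_cat -/(sword s w) hw.
  - by move=> a ha; apply/WP; have [w hw E] := refl_word rs reg sd ha; exists w.
  - move=> g /WP[w hw ->]; exists w => //; apply/allP => a /(allP hw) /sP; exact: pos_root.
  - by move=> g /WP[w hw ->]; exact: (word_orth rs sd hw).
  - by move=> a; exact: (pos_neq0 rs).
  - move=> b b0 nb; have [u ub H] := nonroot_separated rs reg sd b0 nb; exists u => // g /WP[w hw ->]; exact: H.
have Pinv j w : sword s w -> act (coxeter_elt w) (P j) = P j by move=> hw; apply: Pi; apply/WP; exists w.
have d0 j : (0 < d j)%N by case: (Ph j).
have Phom j : P j \is (d j).-homog by case: (Ph j).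
set J0 : 'M[S]_l := \matrix_(i, j) _ in J00.
have lh := lam_h rs reg sd irr zc zpos ch.
have ld := lam_dvd rs reg sd irr zc lamk zpos h0 ch cmin.
have lam0' := lam0 rs reg sd irr zc zpos h0 ch.
have h1 := h_gt1 rs reg sd sp irr pt h0 ch.
have Jhom0 := J0_hom d0 Phom.
have Jrefl := J0_refl rs reg sd Pinv.
have [k1 k10 dJ] := det_J0 rs reg sd Pinv d0 Phom J00 Nge.
have [N2E dr] := N2 rs reg sd sp irr sz pt zc lamk zpos h0 ch cmin Pinv d0 Phom J00 Nge.
have ch1 := charpoly1 rs reg sd pt zc zpos Pinv d0 Phom J00 Nge.
have ch2 := charpoly2 rs reg sd irr pt zc zpos h0 ch Pinv d0 Phom J00 Nge.
have rg := r_gt0 rs reg sd sp irr pt zc zpos ch Pinv d0 Phom J00 Nge.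
have rsym := r_sym rs reg sd sp irr pt zc lamk zpos h0 ch cmin Pinv d0 Phom J00 Nge.
have sumr := sum_r rs reg sd sp irr pt zc lamk zpos h0 ch cmin Pinv d0 Phom J00 Nge.
have cQ := @cevQ _ _ _ _ rs reg z u0 zpos.
pose m j := (d j).-1.
have mr j : m j = ((d j).-1 %% h)%N by rewrite /m {1}dr.
have m0 j : (0 < m j)%N by rewrite mr rg.
have mh j : (m j < h)%N by rewrite mr ltn_pmod.
have dm j : d j = (m j).+1 by rewrite /m prednK.
have me : perm_eq [seq m j | j <- enum 'I_l] [seq e j | j <- enum 'I_l].
  have E : perm_eq (map (fun k => om R h ^+ k) [seq m j | j <- enum 'I_l]) (map (fun k => om R h ^+ k) [seq e j | j <- enum 'I_l]).
    apply: prod_XsubC_eq; rewrite !big_enum_map2.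
    have -> : \prod_i ('X - (om R h ^+ e i)%:P) = map_poly rc (char_poly (coxeter_elt t)).
      by rewrite cc echar; apply: eq_bigr => j _; rewrite om_exp.
    case: (lam_om rs reg sd sp irr pt zc lamk zpos h0 ch cmin N2E) => Eo; first by rewrite -Eo ch1.
    have -> : om R h = lam^-1 by rewrite -[RHS]mulr1 -Eo mulKf.
    by rewrite ch2.
  by apply: (perm_map_in (@om_inj R h) _ _ E); apply/allP => k /mapP[j _ ->]; rewrite inE.
have msym : perm_eq [seq m j | j <- enum 'I_l] [seq (h - m j)%N | j <- enum 'I_l].
  have E1 : [seq m j | j <- enum 'I_l] = [seq ((d j).-1 %% h)%N | j <- enum 'I_l] by apply: eq_map => j; exact: mr.
  have E2 : [seq (h - m j)%N | j <- enum 'I_l] = [seq (h - (d j).-1 %% h)%N | j <- enum 'I_l] by apply: eq_map => j; rewrite mr.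
  by rewrite E1 E2.
have Pz0 j : d j != h -> cev z (P j) = 0.
  move=> nj; have := cev_act z (coxeter_elt t) (P j).
  rewrite Pinv ?(ltac:(by apply/allP => a; rewrite (perm_mem pt)) : sword s t) // zc (cev_scale _ _ (Phom j)).
  move=> /eqP; rewrite -subr_eq0 -{1}[cev z (P j)]mul1r -mulrBl mulf_eq0 subr_eq0 eq_sym ld => /orP[|/eqP //].
  move=> dv; case/negP: nj; apply/eqP; apply/eqP; rewrite eqn_leq (dvdn_leq _ dv) // andbT dm; exact: mh.
have eu j : \sum_i z 0 i * cev z (J0 i j) = (d j)%:R * cev z (P j).
  have := congr1 (cev z) (euler (Phom j)); rewrite rmorph_sum cevZ rmorph_nat => <-.
  by apply: eq_bigr => i _; rewrite rmorphM /= cevX [J0 i j]mxE.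
have Ju : map_mx (cev z) J0 \in unitmx.
  by rewrite unitmxE unitfE det_map_mx dJ /= cevZ mulf_neq0 // fmorph_eq0.
(* The matrix at [z] is invertible and [z] is not zero, so by Euler's formula some invariant is
   nonzero at [z]; the eigenvalue forces its degree to be [h]. *)
have [jl Pjl] : exists jl, cev z (P jl) != 0.
  apply: contrapT => /forallNP H.
  have : z *m map_mx (cev z) J0 = 0.
    apply/rowP => j; rewrite !mxE; under eq_bigr do rewrite mxE; rewrite eu.
    by have := H j => /negP; rewrite negbK => /eqP ->; rewrite mulr0.
  move=> /(congr1 (mulmx^~ (invmx (map_mx (cev z) J0)))); rewrite mulmxK // mul0mx => /eqP.
  by rewrite (negbTE (z_neq0 rs reg sd irr zpos)).
have djl : d jl = h by apply/eqP; apply: contraNT Pjl => /Pz0 ->.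
have xih : xi ^+ h = (-1) ^+ h by rewrite -xil exprMn lh mulr1.
(* The word [tb] carries [z] to a multiple of its conjugate. Hence the values at [z] of all
   invariants of degree [h] are real multiples of one of them. *)
have Pconj j : d j = h -> cev z (P j) = (-1) ^+ h * conjc (cev z (P j)).
  move=> dj; rewrite -{1}(Pinv j tb tbs) cev_act zb (cev_scale _ _ (Phom j)) dj xih.
  by rewrite cev_conj.
have ratio j : exists tj : R, d j = h -> cev z (P j) = tj%:C%C * cev z (P jl).
  have [dj|] := eqVneq (d j) h; last by move=> /eqP nj; exists 0.
  exists (complex.Re (cev z (P j) / cev z (P jl))) => _.
  suff <- : cev z (P j) / cev z (P jl) = (complex.Re (cev z (P j) / cev z (P jl)))%:C%C by rewrite divfK.
  set q := _ / _; have : conjc q = q.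
    rewrite /q rmorphM fmorphV /= [in RHS](Pconj j dj) [in X in _ = _ / X](Pconj jl djl).
    by rewrite invfM mulrACA mulfV ?expf_neq0 ?oppr_eq0 ?oner_eq0 // mul1r.
  case: q => x y [] Ey; congr (_ +i* _)%C; lra.
pose T j := projT1 (cid (ratio j)).
have TE j : d j = h -> cev z (P j) = (T j)%:C%C * cev z (P jl) by exact: (projT2 (cid (ratio j))).
(* Real multiples of the invariant [jl] are subtracted from the others of degree [h], so that [jl]
   alone remains nonzero at [z]. That the degree [h] occurs only once has not been shown at this
   stage. *)
pose tau : 'rV[R]_l := \row_j (if (j != jl) && (d j == h) then T j else 0).
pose E : 'M[R]_l := (delta_mx 0 jl : 'rV[R]_l)^T *m tau.
have EE : E *m E = 0.
  rewrite /E mulmxA -[_ *m tau *m _]mulmxA.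
  have -> : tau *m (delta_mx 0 jl : 'rV[R]_l)^T = 0.
    by apply/matrixP => i j; rewrite !ord1 trmx_delta -colE !mxE eqxx.
  by rewrite mulmx0 mul0mx.
pose U := 1%:M - E.
have UU : U *m (1%:M + E) = 1%:M.
  by rewrite /U mulmxDr mulmx1 mulmxBl mul1mx EE subr0 subrK.
have dU : \det U != 0.
  by apply/negP => /eqP H; have := congr1 determinant UU; rewrite det_mulmx H mul0r det1 => /eqP; rewrite eq_sym oner_eq0.
pose J := J0 *m cmx l U.
have JE i j : J i j = J0 i j - (tau 0 j) *: J0 i jl.
  rewrite /J /U /cmx map_mxB map_mx1 mulmxBr mulmx1 !mxE; congr (_ - _).
  rewrite (bigD1 jl) //= big1 ?addr0 => [|k kj].
    by rewrite !mxE big_ord1 !mxE !eqxx mul1r mulrC mul_mpolyC.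
  by rewrite !mxE big_ord1 !mxE (negbTE kj) andbF mul0r mpolyC0 mulr0.
have Jhom i j : J i j \is (m j).-homog.
  rewrite JE rpredB ?Jhom0 // mxE; case: ifP => [/andP[_ /eqP dj]|_]; last by rewrite scale0r rpred0.
  by rewrite rpredZ // /m dj -djl Jhom0.
have detJ : \det J = (k1 * \det U) *: \prod_(a <- pos_system Phi v) linform a.
  by rewrite /J det_mulmx dJ /cmx det_map_mx /= -[in RHS]scalerA -scalerAl mulrC mul_mpolyC.
have c0 : k1 * \det U != 0 by rewrite mulf_neq0.
have Jinv a : a \in pos_system Phi v -> map_mx (act (refl a)) J = cmx l (refl a) *m J.
  by move=> ha; rewrite /J map_mxM Jrefl // act_cmx mulmxA.
have sum_m : (2 * \sum_j m j = l * h)%N by rewrite -sumr; congr (_ * _)%N; apply: eq_bigr => j _; exact: mr.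
have zinv f df : winv (pos_system Phi v) f -> f \is df.-homog -> (0 < df < 2 * h)%N -> df != h -> cev z f = 0.
  move=> wf fh /andP[df0 df2] dfh; have := cev_act z (coxeter_elt t) f.
  rewrite (@act_word _ _ s) //; last 2 first.
  - by apply/allP => a; rewrite (perm_mem pt).
  - by move=> a /sP; exact: wf.
  rewrite zc (cev_scale _ _ fh) => /eqP; rewrite -subr_eq0 -{1}[cev z f]mul1r -mulrBl mulf_eq0 subr_eq0 eq_sym ld.
  case/orP=> [/dvdnP[q Eq]|/eqP //]; exfalso; move: df0 df2 dfh; rewrite Eq.
  by case: q {Eq} => [|[|q]] //; rewrite ?mul1n ?eqxx // ltn_mul2r => _ /andP[_].
have zJ j : \sum_i z 0 i * cev z (J i j) = (j == jl)%:R * (h%:R * cev z (P jl)).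
  under eq_bigr do rewrite JE rmorphB /= cevZ mulrBr mulrCA.
  rewrite sumrB -mulr_sumr !eu djl mxE; have [->|nj] := eqVneq j jl.
    by rewrite djl rmorph0 mul0r subr0 mul1r.
  have [dj|nd] /= := eqVneq (d j) h; last by rewrite Pz0 // rmorph0 !mul0r mulr0 subr0.
  by rewrite TE // dj mul0r mulrCA subrr.
have k00 : h%:R * cev z (P jl) != 0 by rewrite mulf_neq0 // pnatr_eq0 -lt0n.
have ejl : (m jl).+1 = h by rewrite -dm djl.
have uPos := pos_uniq v rs.
have Pos0 a : a \in pos_system Phi v -> a != 0 by exact: (pos_neq0 rs).
have Posnp a b : a \in pos_system Phi v -> b \in pos_system Phi v -> a != b -> forall t, b <> t *: a by exact: (pos_nprop rs).
exists m, (Rodd jl uPos Pos0 Posnp c0 detJ Jinv), (Reven jl uPos Pos0 Posnp c0 detJ Jinv).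
split=> //; first by move=> j; rewrite m0 mh.
  by split=> //; move: N2E; rewrite sz.
move=> k; split.
- move=> a j ha; exact: (Rodd_dvd uPos Pos0 Posnp Jhom c0 detJ Jinv m0 mh ejl sum_m cQ zinv k00 zJ ha).
- split; first exact: (Rodd_det uPos Pos0 Posnp Jhom c0 detJ Jinv m0 mh ejl sum_m cQ zinv k00 zJ).
  move=> i j; exact: (Rodd_hom uPos Pos0 Posnp Jhom c0 detJ Jinv m0 mh ejl sum_m cQ zinv k00 zJ).
- move=> a j ha; exact: (Reven_dvd uPos Pos0 Posnp Jhom c0 detJ Jinv m0 mh ejl sum_m cQ zinv k00 zJ ha).
- split; first exact: (Reven_det uPos Pos0 Posnp Jhom c0 detJ Jinv m0 mh ejl sum_m cQ zinv k00 zJ).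
  move=> i j; exact: (Reven_hom uPos Pos0 Posnp Jhom c0 detJ Jinv m0 mh ejl sum_m cQ zinv k00 zJ).
- move=> a ha; exact: (Reven_act uPos Pos0 Posnp Jhom c0 detJ Jinv m0 mh ejl sum_m cQ zinv k00 zJ).
Qed.
End Final.

End MultiarrangementBases.

(** * Multiple addition of hyperplanes to a free arrangement *)

Module MultipleAddition.
Import LinearFormDivisibility HomogeneousPolynomials SaitoCriterion CoxeterEigenvalues.

Section MAT.
Variables (R : realType) (n : nat).
Local Notation V := 'rV[R]_n.
Local Notation S := {mpoly R[n]}.
Local Notation lf := (@linform R n).

Definition simple_arr (A : seq V) := [/\ uniq A, (forall a, a \in A -> a != 0) &
  forall a b, a \in A -> b \in A -> a != b -> forall t, b <> t *: a].
Lemma simple_sub (A B : seq V) : uniq B -> {subset B <= A} -> simple_arr A -> simple_arr B.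
Proof. by move=> uB sub [_ h1 h2]; split=> // [a /sub|a b /sub ha /sub hb]; [exact: h1 | exact: h2]. Qed.
Definition app (M : 'M[S]_n) (a : V) j : S := (cmx n a *m M) 0 j.
Lemma appE M a j : app M a j = \sum_i a 0 i *: M i j.
Proof. by rewrite /app mxE; apply: eq_bigr => i _; rewrite !mxE mul_mpolyC. Qed.
(** A basis in the form of Saito's criterion: the determinant clause stands for generation and
    independence and is easy to carry through column operations. *)
Definition freeb (A : seq V) (M : 'M[S]_n) (dg : 'I_n -> nat) :=
  [/\ forall i j, M i j \is (dg j).-homog, forall a j, a \in A -> mdvd (lf a) (app M a j) &
      exists2 c : R, c != 0 & \det M = c *: \prod_(a <- A) lf a].

Lemma app_comb M a b c e j : app M (c *: a + e *: b) j = c *: app M a j + e *: app M b j.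
Proof.
rewrite !appE !scaler_sumr -big_split; apply: eq_bigr => i _.
by rewrite !mxE scalerDl !scalerA.
Qed.
Lemma act_proj_lf (a b : V) : act (projm a) (lf b) = lf (b *m projm a).
Proof. by rewrite act_lin projmT. Qed.
Lemma mdvd_act (g : 'M[R]_n) (p q : S) : mdvd p q -> mdvd (act g p) (act g q).
Proof. by case=> r ->; exists (act g r); rewrite rmorphM. Qed.
Lemma proj_prop (a u w : V) (c : R) : a != 0 -> w *m projm a = c *: (u *m projm a) -> exists e, w = c *: u + e *: a.
Proof.
move=> a0; rewrite !mul_projm => E; exists (dotp w a / dotp a a - c * (dotp u a / dotp a a)).
move/eqP: E; rewrite subr_eq => /eqP {1}->; rewrite scalerBr scalerA scalerBl -addrA; congr (_ + _).
by rewrite addrC.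
Qed.
Lemma proj_neq0 (a b : V) : a != 0 -> (forall t, b <> t *: a) -> b *m projm a != 0.
Proof. by move=> a0 H; rewrite mul_projm subr_eq0; apply/eqP => E; apply: (H _ E). Qed.

Section TeraoPoly.
Variables (A : seq V) (a : V).
Hypothesis sA : simple_arr A.
Hypothesis a0 : a != 0.
Hypothesis anp : forall b, b \in A -> forall t, b <> t *: a.
Let pr (b : V) : V := b *m projm a.
Let prp (u w : V) := exists c, pr w = c *: pr u.

Lemma reps (B : seq V) : {subset B <= A} -> exists K L : seq V, [/\ perm_eq B (K ++ L),
  (forall k k', k \in K -> k' \in K -> k != k' -> ~ prp k k') & forall b, b \in L -> exists2 k, k \in K & prp k b].
Proof.
elim: B => [|b B IH] BA; first by exists [::], [::].
have [|K [L [pm h1 h2]]] := IH; first by move=> x hx; apply: BA; rewrite inE hx orbT.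
have [[k hk p]|N] := pselect (exists2 k, k \in K & prp k b).
  exists K, (b :: L); split=> //; first by rewrite perm_sym perm_catC /= perm_cons perm_catC perm_sym.
  by move=> b'; rewrite inE => /orP[/eqP ->|/h2 //]; exists k.
exists (b :: K), L; split; first by rewrite /= perm_cons.
  move=> k k'; rewrite !inE => /orP[/eqP ->|hk] /orP[/eqP ->|hk'] kk; rewrite ?eqxx // in kk *.
  - move=> [c E]; apply: N; exists k' => //.
    have c0 : c != 0.
      apply: contraTneq isT => c0; have hA : k' \in A by apply: BA; rewrite inE (perm_mem pm) mem_cat hk' orbT.
      by have := proj_neq0 a0 (anp hA); rewrite -/(pr k') E c0 scale0r eqxx.
    by exists c^-1; rewrite E scalerA mulVf // scale1r.
  - by move=> p; apply: N; exists k.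
  - exact: h1.
by move=> b' /h2[k hk p]; exists k => //; rewrite inE hk orbT.
Qed.
(** Members of one class have the trace of [k], so b = c k + e a with e nonzero. Eliminating between
    the divisibilities at [k] and at [b] shows that [b] divides th - a g, with [g] independent of
    [b]; restricting to [a] gives one factor for each member other than [k]. *)
Lemma class_dvd (k : V) (L : seq V) (th : S) (tv : V -> S) : k \in A -> uniq L -> {subset L <= A} -> k \notin L ->
  (forall b, b \in L -> prp k b) -> (forall b, b \in A -> mdvd (lf b) (tv b)) ->
  (forall c e : R, tv (c *: k + e *: a) = c *: tv k + e *: th) ->
  mdvd (\prod_(b <- L) lf (pr b)) (act (projm a) th).
Proof.
move=> kA uL LA kL prL dv lin; have [uA nz np] := sA.
have [g Eg] := dv k kA.
have H b : b \in L -> mdvd (lf b) (th - lf a * g).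
  move=> hb; have [c Ec] := prL b hb; have [e Eb] := proj_prop a0 Ec.
  have bk : b != k by apply: contraNneq kL => <-.
  have e0 : e != 0.
    apply/eqP => E0; apply: (np k b kA (LA _ hb) _ c); first by rewrite eq_sym.
    by rewrite Eb E0 scale0r addr0.
  have bnz := nz b (LA _ hb).
  suff HP : mdvd (lf b) (lf k * (th - lf a * g)).
    case: (lin_prime bnz HP) => // nd; exfalso; move: nd; apply: lin_ndvd => //.
    by apply: np => //; exact: LA.
  have [g' Eg'] := dv b (LA _ hb); rewrite Eb lin -Eb in Eg'.
  have Elb : lf b = c *: lf k + e *: lf a by rewrite Eb linformD !linformZ.
  exists (e^-1 *: (lf k * g' - g * lf k)).
  apply: (@scalerI _ _ e) => //; rewrite -[in RHS]scalerAr scalerA divff // scale1r.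
  have Eth : e%:MP * th = lf b * g' - c%:MP * (lf k * g).
    by rewrite -Eg' -Eg !mul_mpolyC addrC addKr.
  transitivity (lf k * (e%:MP * th) - e%:MP * lf a * g * lf k).
    by rewrite -mul_mpolyC; move: (e%:MP) (lf k) (lf a) (th) (g) => x y p q r; ring.
  rewrite Eth Elb -!mul_mpolyC; move: (c%:MP) (e%:MP) (lf k) (lf a) (g) (g') => x y p q r r'; ring.
have := @lin_coprime_prod R n _ L id (fun=> 1%N) (th - lf a * g) uL.
rewrite (eq_bigr (fun b => lf b)); last by move=> b _; rewrite expr1.
move=> HH; have {}HH : mdvd (\prod_(b <- L) lf b) (th - lf a * g).
  apply: HH => [b /LA /nz //|b b' /LA hb /LA hb'|b hb]; [exact: np | by rewrite expr1; apply: H].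
have := mdvd_act (projm a) HH; rewrite rmorphB rmorphM /= act_proj_lin // mul0r subr0 rmorph_prod.
by under eq_bigr do rewrite /= act_proj_lf.
Qed.
Lemma prod_fibre (K L : seq V) (ka : V -> V) (F : V -> S) : uniq K -> (forall b, b \in L -> ka b \in K) ->
  \prod_(b <- L) F (ka b) = \prod_(k <- K) F k ^+ size [seq b <- L | ka b == k].
Proof.
move=> uK; elim: L => [|b L IH] h; first by rewrite big_nil big1 // => k _; rewrite expr0.
rewrite big_cons IH; last by move=> b' hb'; apply: h; rewrite inE hb' orbT.
have hb := h b (mem_head _ _); rewrite (big_rem (ka b)) //= [RHS](big_rem (ka b)) //= eqxx /= exprS mulrA.
congr (_ * _); rewrite big_seq [RHS]big_seq; apply: eq_bigr => k; rewrite mem_rem_uniq // inE eq_sym => /andP[kb _].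
by rewrite (negbTE kb).
Qed.
Variables (X : eqType) (g : V -> X) (d : nat).
Hypothesis gP : forall b b', b \in A -> b' \in A -> g b = g b' -> exists c, pr b' = c *: pr b.
Hypothesis cnt : (d + size (undup (map g A)) <= size A)%N.
(** One representative per trace is set aside and every further hyperplane contributes a factor, at
    least [d] in all. The key [g] may be finer than the trace, since an upper bound for the number
    of traces suffices. *)
Lemma terao_poly : exists2 L : seq V, {subset L <= A} /\ size L = d &
  forall (tv : V -> S), (forall u w c e, tv (c *: u + e *: w) = c *: tv u + e *: tv w) ->
  (forall b, b \in A -> mdvd (lf b) (tv b)) ->
  exists f : S, mdvd (lf a) (tv a - f * \prod_(b <- L) lf (pr b)).
Proof.
have [uA nz np] := sA; have [K [L0 [pm h1 h2]]] := reps (fun x (hx : x \in A) => hx).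
have KA b : b \in K -> b \in A by move=> hb; rewrite (perm_mem pm) mem_cat hb.
have LA b : b \in L0 -> b \in A by move=> hb; rewrite (perm_mem pm) mem_cat hb orbT.
have : uniq (K ++ L0) by rewrite -(perm_uniq pm).
rewrite cat_uniq => /and3P[uK /hasPn dis uL].
have szK : (size K <= size (undup (map g A)))%N.
  rewrite -(size_map g); apply: uniq_leq_size.
    rewrite map_inj_in_uniq // => k k' hk hk' E; apply/eqP; apply: contraT => kk.
    by case: (h1 k k' hk hk' kk); apply: gP => //; apply: KA.
  by move=> x /mapP[k hk ->]; rewrite mem_undup map_f // KA.
have szL : (d <= size L0)%N.
  move: cnt; rewrite (perm_size pm) size_cat => c1.
  by rewrite -(leq_add2r (size K)) [X in (_ <= X)%N]addnC; apply: leq_trans c1; rewrite leq_add2l.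
exists (take d L0); first by split; [move=> b /mem_take /LA | rewrite size_takel].
move=> tv lin dv.
pose ka (b : V) := if pselect (exists2 k, k \in K & prp k b) is left H then s2val (cid2 H) else 0.
have kaP b : b \in L0 -> ka b \in K /\ prp (ka b) b.
  by move=> /h2 H; rewrite /ka; case: pselect => // H'; case: cid2 => k /= ? ?.
have prnz b : b \in A -> pr b != 0 by move=> hb; apply: proj_neq0 => //; apply: anp.
have D1 : mdvd (\prod_(k <- K) lf (pr k) ^+ size [seq b <- L0 | ka b == k]) (act (projm a) (tv a)).
  apply: (@lin_coprime_prod R n _ K pr) => //.
  - by move=> k /KA /prnz.
  - by move=> k k' hk hk' kk c E; apply: (h1 k k' hk hk' kk); exists c.
  move=> k hk; set Lk := [seq _ <- _ | _].
  have LkA b : b \in Lk -> b \in L0 /\ ka b = k by rewrite mem_filter => /andP[/eqP ? ?].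
  have := @class_dvd k Lk (tv a) tv (KA _ hk) (filter_uniq _ uL).
  move=> /(_ (fun b hb => LA b (proj1 (LkA b hb)))) HH.
  have {HH} HH := HH _ _ dv (fun c e => lin k a c e).
  apply: mdvd_trans (HH _ _); last first.
  - by move=> b /LkA[/kaP[_ +] E]; rewrite E.
  - by apply/negP => /LkA[/dis /=]; rewrite hk.
  elim: Lk LkA {HH} => [|b Lk IH] LkA; first by rewrite big_nil expr0; exists 1; rewrite mulr1.
  rewrite big_cons exprS; apply: mdvdM; last by apply: IH => b' hb'; apply: LkA; rewrite inE hb' orbT.
  have [/kaP[_ [c E]] Ek] := LkA b (mem_head _ _); rewrite E linformZ Ek; exists c%:MP; by rewrite mulrC mul_mpolyC.
have D2 : mdvd (\prod_(b <- take d L0) lf (pr b)) (act (projm a) (tv a)).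
  apply: mdvd_trans (_ : mdvd _ (\prod_(b <- L0) lf (pr b))) _.
    by exists (\prod_(b <- drop d L0) lf (pr b)); rewrite -big_cat cat_take_drop.
  apply: mdvd_trans D1; rewrite -(prod_fibre _ uK); last by move=> b /kaP[].
  move: LA kaP => {szL uL dis pm h2}; elim: L0 => [|b L0 IH] LA kaP; first by rewrite !big_nil; exists 1; rewrite mulr1.
  rewrite !big_cons; apply: mdvdM; last first.
    by apply: IH => b' hb'; [apply: LA | apply: kaP]; rewrite inE hb' orbT.
  have [_ [c E]] := kaP b (mem_head _ _); have c0 : c != 0.
    by apply: contraTneq (prnz b (LA _ (mem_head _ _))) => c0; rewrite E c0 scale0r eqxx.
  exists (c^-1)%:MP; rewrite E linformZ mulrC mul_mpolyC scalerA mulVf // scale1r //.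
have [f Ef] := D2; exists f.
rewrite [f * _]mulrC -Ef; exact: proj_mod.
Qed.
End TeraoPoly.

Section Addition.
Variable d : nat.
(** The hyperplanes are added one at a time. For [a] take a column [j0] of degree [d] with nonzero
    constant, use it to clear the other columns modulo [a], and multiply it by [a]. Column [e] is
    never touched and row [i0] stays zero outside it; this preserves the Euler derivation. *)
Lemma mult_add (e i0 : 'I_n) (H A : seq V) (M : 'M[S]_n) (dg : 'I_n -> nat) (b : V -> S) (C : V -> 'I_n -> R) :
  uniq H -> freeb A M dg ->
  (forall j, j != e -> M i0 j = 0) ->
  (forall a, a \in H -> exists2 f : 'I_n -> S, f e = 0 & forall j, [/\ mdvd (lf a) (app M a j - f j * b a),
     (d <= dg j)%N -> f j \is (dg j - d).-homog, (dg j < d)%N -> f j = 0 & dg j = d -> f j = (C a j)%:MP]) ->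
  (forall y : V -> R, (forall j, dg j = d -> \sum_(a <- H) y a * C a j = 0) -> forall a, a \in H -> y a = 0) ->
  exists (M' : 'M[S]_n) (P : {set 'I_n}), [/\ #|P| = size H, forall j, j \in P -> dg j = d,
    freeb (H ++ A) M' (fun j => dg j + (j \in P))%N, e \notin P /\ (forall i, M' i e = M i e) &
    forall j, j != e -> M' i0 j = 0].
Proof.
elim: H A M dg C => [|a H IH] A M dg C.
  move=> _ fr z _ _; exists M, set0; rewrite cards0; split=> //; [by move=> j; rewrite inE | | by rewrite inE].
  have [h1 h2 h3] := fr; split=> // i j; by rewrite inE addn0.
case/andP=> aH uH [hom dv [c c0 dM]] zr hf indep.
have ha := mem_head a H.
have [j0 dj0 Cj0] : exists2 j0, dg j0 = d & C a j0 != 0.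
  apply: contrapT => /forall2NP N.
  have : (fun x : V => (x == a)%:R : R) a = 0.
    apply: (indep (fun x => (x == a)%:R)) => // j dj; rewrite big_cons eqxx mul1r big_seq big1 ?addr0.
      by have [//|/negP] := N j; rewrite negbK => /eqP.
    by move=> x hx; case: eqP => [E|]; rewrite ?mul0r //; rewrite -E hx in aH.
  by rewrite eqxx => /eqP; rewrite oner_eq0.
set c1 := C a j0 in Cj0.
have [f fe Hf] := hf a ha.
have fj0 : f j0 = c1%:MP by case: (Hf j0) => _ _ _; apply.
have ej0 : e != j0.
  by apply/eqP => E; move/eqP: Cj0; apply; apply/eqP; rewrite -(mpolyC_eq0 n) -fj0 -E fe.
pose w : 'rV[S]_n := \row_j (if j == j0 then 0 else c1^-1 *: f j).
pose T1 : 'M[S]_n := 1%:M - delta_mx j0 0 *m w.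
pose D1 : 'M[S]_n := diag_mx (\row_j (if j == j0 then lf a else 1)).
pose M1 := M *m T1 *m D1.
have MT i j : (M *m T1) i j = if j == j0 then M i j0 else M i j - c1^-1 *: (f j * M i j0).
  rewrite /T1 mulmxBr mulmx1 mulmxA -colE [LHS]mxE [X in _ + X]mxE [X in _ - X]mxE big_ord1 !mxE.
  by case: eqP => [->|_]; rewrite ?mulr0 ?subr0 // scalerAl mulrC.
have M1E i j : M1 i j = if j == j0 then M i j0 * lf a else M i j - c1^-1 *: (f j * M i j0).
  by rewrite /M1 mul_mx_diag [LHS]mxE MT [X in _ * X]mxE; case: eqP; rewrite ?mulr1.
have app1 x j : app M1 x j = if j == j0 then app M x j0 * lf a else app M x j - c1^-1 *: (f j * app M x j0).
  rewrite !appE; case: ifP => jj.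
    by rewrite mulr_suml; apply: eq_bigr => i _; rewrite M1E jj scalerAl.
  rewrite mulr_sumr scaler_sumr -sumrB; apply: eq_bigr => i _; rewrite M1E jj scalerBr; congr (_ - _).
  by rewrite -scalerAr !scalerA mulrC.
pose dg1 j := (dg j + (j == j0))%N.
have fr1 : freeb (a :: A) M1 dg1.
  split.
  - move=> i j; rewrite M1E /dg1; have [->|jj] := eqVneq j j0.
      by apply: dhomogM => //; exact: linform_homog.
    rewrite addn0 rpredB // rpredZ //; case: (Hf j) => _ h1 h2 _.
    have [lt|le] := ltnP (dg j) d; first by rewrite h2 // mul0r rpred0.
    by rewrite -(subnK le) -{2}dj0; apply: dhomogM => //; exact: h1.
  - move=> x j; rewrite inE app1; case/orP => [/eqP ->|hx]; last first.
      case: ifP => _; first by apply: mdvd_mulr; apply: dv.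
      by apply: mdvdB; [apply: dv | rewrite -mul_mpolyC mulrA; apply: mdvd_mull; apply: dv].
    case: ifP => jj; first by exists (app M a j0); rewrite mulrC.
    have [hj _ _ _] := Hf j; have [h0 _ _ _] := Hf j0; rewrite fj0 in h0.
    have -> : app M a j - c1^-1 *: (f j * app M a j0) =
      (app M a j - f j * b a) - (c1^-1)%:MP * (f j * (app M a j0 - c1%:MP * b a)).
      rewrite -mul_mpolyC; have E : (c1^-1)%:MP * c1%:MP = 1 :> S by rewrite -mpolyCM mulVf.
      transitivity (app M a j - f j * b a + ((c1^-1)%:MP * c1%:MP * (f j * b a) - (c1^-1)%:MP * (f j * app M a j0))).
        by rewrite E mul1r; move: (f j) (b a) (app M a j) => p q r; ring.
      by move: (f j) (b a) (app M a j) (app M a j0) ((c1^-1)%:MP) (c1%:MP) => p q r t x' y; ring.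
    by apply: mdvdB => //; apply: mdvd_mull; apply: mdvd_mull.
  - exists c => //; rewrite /M1 !det_mulmx det_diag /T1 det1B dM.
    have -> : (w *m (delta_mx j0 0 : 'cV[S]_n)) 0 0 = 0.
      by rewrite -colE !mxE eqxx.
    rewrite subr0 mulr1 (eq_bigr (fun j => if j == j0 then lf a else 1)); last by move=> j _; rewrite mxE.
    by rewrite -big_mkcond big_pred1_eq big_cons -scalerAl mulrC.
pose C1 x j := C x j - c1^-1 * C a j * C x j0.
have d1 j : dg1 j = d -> j != j0 /\ dg j = d.
  rewrite /dg1; have [->|] := eqVneq j j0; last by rewrite addn0.
  by rewrite dj0 addn1 => /eqP; rewrite eqn_leq ltnn.
have zr1 j : j != e -> M1 i0 j = 0.
  by move=> je; rewrite M1E !zr // ?mul0r ?mulr0 ?scaler0 ?subr0; [case: ifP | rewrite eq_sym].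
have [||M' [P [cP hP fP [eP ce] zP]]] := IH (a :: A) M1 dg1 C1 uH fr1 zr1.
- move=> x hx; have [fx fxe Hx] := hf x (ltac:(by rewrite inE hx orbT)).
  exists (fun j => if j == j0 then fx j0 * lf a else fx j - c1^-1 *: (f j * fx j0)).
    by rewrite (negbTE ej0) fe fxe mul0r scaler0 subr0.
  move=> j.
  have [hj hj1 hj2 hj3] := Hx j; have [hk _ _ hk3] := Hx j0; have [_ gj1 gj2 gj3] := Hf j.
  rewrite app1 /dg1; have [Ej|jj] := eqVneq j j0.
    split.
    + by rewrite mulrAC -mulrBl; apply: mdvd_mulr.
    + by move=> _; rewrite Ej dj0 addn1 subSnn hk3 // mul_mpolyC rpredZ // linform_homog.
    + by rewrite Ej dj0 addn1 ltnNge leqnSn.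
    + by rewrite Ej dj0 addn1 => /eqP; rewrite eqn_leq ltnn.
  rewrite addn0; split.
  + have -> : app M x j - c1^-1 *: (f j * app M x j0) - (fx j - c1^-1 *: (f j * fx j0)) * b x =
       (app M x j - fx j * b x) - (c1^-1)%:MP * (f j * (app M x j0 - fx j0 * b x)).
      by rewrite -!mul_mpolyC; move: (f j) (b x) (app M x j) (app M x j0) (fx j) (fx j0) ((c1^-1)%:MP) => p q r t x1 y x2; ring.
    by apply: mdvdB => //; apply: mdvd_mull; apply: mdvd_mull.
  + move=> le; rewrite rpredB ?hj1 // rpredZ // hk3 // mulrC mul_mpolyC rpredZ //; exact: gj1.
  + by move=> lt; rewrite hj2 // gj2 // mul0r scaler0 subr0.
  + move=> E; rewrite hj3 // gj3 // hk3 // /C1 -mpolyCM -mul_mpolyC -mpolyCM -mpolyCB mulrA //.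
- move=> y Hy x hx.
  (* A relation between the reduced rows lifts to the original rows; the coefficient at [a] is
     forced by the pivot column. *)
  pose y' x := if x == a then - (c1^-1 * \sum_(x <- H) y x * C x j0) else y x.
  have yH z : z \in H -> y' z = y z by move=> hz; rewrite /y'; case: eqP => // E; rewrite -E hz in aH.
  rewrite -yH //; apply: (indep y'); last by rewrite inE hx orbT.
  move=> j dj; rewrite big_cons big_seq (eq_bigr (fun x => y x * C x j)); last by move=> z hz; rewrite yH.
  rewrite -big_seq /y' eqxx.
  have [Ej|jj] := eqVneq j j0; first by rewrite Ej -/c1 mulNr mulrAC mulVf // mul1r addNr.
  have := Hy j; rewrite /dg1 (negbTE jj) addn0 dj => /(_ erefl).
  rewrite (eq_bigr (fun z => y z * C z j - c1^-1 * C a j * (y z * C z j0))); last by move=> z _; rewrite /C1; ring.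
  by rewrite sumrB -mulr_sumr => E; rewrite -[RHS]E; ring.
exists M', (j0 |: P); have jP : j0 \notin P.
  by apply/negP => /hP /d1[]; rewrite eqxx.
split.
- by rewrite cardsU1 jP cP.
- by move=> j; rewrite inE => /orP[/set1P -> //|/hP /d1[]].
- have [h1 h2 h3] := fP.
  have Ed j : (dg1 j + (j \in P) = dg j + (j \in j0 |: P))%N.
    by rewrite /dg1 in_setU1; have [->|] := eqVneq j j0; rewrite /= ?(negbTE jP) ?addn0.
  split.
  + by move=> i j; rewrite -Ed.
  + move=> x j hx; apply: h2; move: hx; rewrite !mem_cat !inE; by rewrite -orbA => /or3P[] ->; rewrite ?orbT.
  + have [k k0 E] := h3; exists k => //; rewrite E; congr (_ *: _); apply: perm_big.
    by rewrite -[a :: A]cat1s perm_catCA.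
- split; first by rewrite in_setU1 (negbTE ej0) (negbTE eP).
  by move=> i; rewrite ce M1E (negbTE ej0) fe mul0r scaler0 subr0.
- exact: zP.
Qed.

(* at a real point lying on exactly the new hyperplanes the basis matrix is invertible *)
Lemma generic_rank (H A : seq V) (M : 'M[S]_n) dg (L : V -> seq V) (C : V -> 'I_n -> R) (x : V) (dual : V -> V) :
  freeb A M dg -> uniq H ->
  (forall a, a \in H -> dotp x a = 0) -> (forall a, a \in A -> dotp x a != 0) ->
  (forall a b, a \in H -> b \in H -> dotp (dual a) b = (a == b)%:R) ->
  (forall a, a \in H -> a != 0 /\ {subset L a <= A}) ->
  (forall a, a \in H -> forall j, exists f : S, [/\ mdvd (lf a) (app M a j - f * \prod_(b <- L a) lf (b *m projm a)),
     dg j != d -> f = 0 & dg j = d -> f = (C a j)%:MP]) ->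
  (forall y : V -> R, (forall j, dg j = d -> \sum_(a <- H) y a * C a j = 0) -> forall a, a \in H -> y a = 0).
Proof.
move=> [hom dv [c c0 dM]] uH xH xA dl HL Hf y Hy a ha.
pose ev : S -> R := meval (fun i => x 0 i).
have evl b : ev (lf b) = dotp x b.
  rewrite /ev raddf_sum dotpE; apply: eq_bigr => i _; rewrite /= mevalZ mevalXU mulrC //.
have evd a' p : dotp x a' = 0 -> mdvd (lf a') p -> ev p = 0.
  by move=> E [q ->]; rewrite /ev mevalM -/(ev _) evl E mul0r.
pose N : 'M[R]_n := map_mx ev M.
have uN : N \in unitmx.
  rewrite unitmxE unitfE det_map_mx dM /= mevalZ mulf_neq0 // rmorph_prod.
  by rewrite big_seq prodf_seq_neq0; apply/allP => b hb; apply/implyP => _; rewrite /= -/(ev _) evl xA.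
pose bx a' := \prod_(b <- L a') dotp x b.
have bx0 a' : a' \in H -> bx a' != 0.
  move=> /HL[_ sub]; rewrite /bx big_seq prodf_seq_neq0; apply/allP => b hb; apply/implyP => _; exact/xA/sub.
have key a' j : a' \in H -> (a' *m N) 0 j = (if dg j == d then C a' j else 0) * bx a'.
  move=> ha'; have [f [h1 h2 h3]] := Hf a' ha' j.
  have := evd a' _ (xH _ ha') h1; rewrite /ev mevalB mevalM rmorph_prod => /eqP.
  rewrite subr_eq0 => /eqP E.
  have -> : (a' *m N) 0 j = ev (app M a' j).
    by rewrite appE /ev raddf_sum mxE; apply: eq_bigr => i _; rewrite /= mevalZ mxE.
  rewrite /ev E; congr (_ * _).
    case: eqP => [dj|/eqP dj]; first by rewrite h3 // mevalC.
    by rewrite h2 ?meval0.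
  apply: eq_bigr => b _; rewrite /= -/(ev _) evl mul_projm dotpBr dotpZr (xH a' ha') mulr0 subr0 //.
have : (\sum_(a' <- H) (y a' / bx a') *: a') *m N = 0.
  apply/rowP => j; rewrite mulmx_suml summxE [RHS]mxE.
  rewrite big_seq (eq_bigr (fun a' => y a' * (if dg j == d then C a' j else 0))); last first.
    move=> a' ha'; rewrite -scalemxAl mxE key // -mulrA; congr (_ * _); by rewrite mulrCA mulVf ?bx0 // mulr1.
  rewrite -big_seq; case: eqP => [dj|_]; first exact: Hy.
  by rewrite big1 // => a' _; rewrite mulr0.
move=> /(congr1 (mulmx^~ (invmx N))); rewrite mulmxK // mul0mx => /(congr1 (dotp (dual a))).
rewrite dotp0r dotp_sumr (big_rem a) //= dotpZr dl // eqxx mulr1 big_seq big1 ?addr0.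
  by move/eqP; rewrite mulf_eq0 invr_eq0 (negbTE (bx0 _ ha)) orbF => /eqP.
by move=> b; rewrite mem_rem_uniq // inE => /andP[ba hb]; rewrite dotpZr dl // eq_sym (negbTE ba) mulr0.
Qed.
End Addition.

Lemma pihomogS (p q : S) d e : p \is d.-homog -> (e < d)%N -> pihomog mdeg e (p * q) = 0.
Proof.
move=> hp lt; rewrite {1}(pihomog_partitionE (leqnn (mmeasure mdeg q))) mulr_sumr raddf_sum /= big1 // => i _.
apply: (@pihomog_ne0 _ _ _ (d + i)%N); last by apply: dhomogM => //; apply: pihomogP.
by rewrite neq_ltn (leq_trans lt (leq_addr _ _)) orbT.
Qed.
Lemma homog_mod (a : V) (p f B : S) d d' : p \is d'.-homog -> B \is d.-homog -> mdvd (lf a) (p - f * B) ->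
  exists f', [/\ mdvd (lf a) (p - f' * B), (d <= d')%N -> f' \is (d' - d).-homog & (d' < d)%N -> f' = 0].
Proof.
move=> hp hB [q Eq].
have : pihomog mdeg d' (p - f * B) = pihomog mdeg d' (lf a * q) by rewrite Eq.
rewrite raddfB /= pihomog_dE // [f * B]mulrC.
have dv : mdvd (lf a) (pihomog mdeg d' (lf a * q)).
  case: d' {hp} => [|d']; last by rewrite -add1n pihomogM ?linform_homog //; exists (pihomog mdeg d' q).
  rewrite (@pihomogS _ _ 1) ?linform_homog //; exact: mdvd0.
have [le|lt] := leqP d d' => E.
  exists (pihomog mdeg (d' - d) f); split=> //.
    by rewrite mulrC -(@pihomogM _ _ _ _ _ _ hB) subnKC // E.
  by move=> _; apply: pihomogP.
exists 0; split=> //.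
by rewrite mul0r subr0; move: E; rewrite (@pihomogS B f d d' hB lt) subr0 => ->.
Qed.
Lemma terao_family (X : eqType) d (H A : seq V) (M : 'M[S]_n) dg : freeb A M dg -> simple_arr A ->
  (forall a, a \in H -> [/\ a != 0, forall b, b \in A -> forall t, b <> t *: a & exists2 g : V -> X,
     forall b b', b \in A -> b' \in A -> g b = g b' -> exists c, b' *m projm a = c *: (b *m projm a) &
     (d + size (undup (map g A)) <= size A)%N]) ->
  exists (L : V -> seq V) (f : V -> 'I_n -> S), forall a, a \in H -> {subset L a <= A} /\ forall j,
    [/\ mdvd (lf a) (app M a j - f a j * \prod_(b <- L a) lf (b *m projm a)),
      (d <= dg j)%N -> f a j \is (dg j - d).-homog & (dg j < d)%N -> f a j = 0].
Proof.
move=> [hom dv _] sA HH.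
have key (a : V) : exists Lf : seq V * ('I_n -> S), a \in H -> {subset Lf.1 <= A} /\ forall j,
    [/\ mdvd (lf a) (app M a j - Lf.2 j * \prod_(b <- Lf.1) lf (b *m projm a)),
      (d <= dg j)%N -> Lf.2 j \is (dg j - d).-homog & (dg j < d)%N -> Lf.2 j = 0].
  have [ha|] := boolP (a \in H); last by exists ([::], fun=> 0).
  have [a0 np [g gP cnt]] := HH a ha.
  have [L [LA sz] HL] := terao_poly sA a0 np gP cnt.
  have : forall j, exists f, [/\ mdvd (lf a) (app M a j - f * \prod_(b <- L) lf (b *m projm a)),
      (d <= dg j)%N -> f \is (dg j - d).-homog & (dg j < d)%N -> f = 0].
    move=> j; have [|f Hf] := HL (fun x => app M x j) (fun u w c e => app_comb M u w c e j).
      by move=> b hb; apply: dv.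
    apply: homog_mod Hf.
      by rewrite appE; apply: homog_sum => i _; apply: rpredZ; exact: hom.
    rewrite -sz -sum1_size.
    by apply: (@homog_prod_seq _ _ _ _ _ (fun=> 1%N)) => b; exact: linform_homog.
  by move=> /choice[f Hf]; exists (L, f).
by have [F HF] := choice key; exists (fun a => (F a).1), (fun a => (F a).2) => a ha; apply: HF.
Qed.
End MAT.

End MultipleAddition.

(** * Roots in the span of the roots of a fixed height *)

Module EqualHeightRoots.
Import LinearFormDivisibility RootSystemBasics SimpleSystems CoxeterOrbits BipartiteEigenvector.

Section SubRS.
Variables (R : realType) (n : nat).
Local Notation V := 'rV[R]_n.
Variables (Phi : seq V) (v : V).
Hypothesis rs : rsys Phi.
Lemma sub_rsys (P : pred V) : (forall a b, a \in Phi -> b \in Phi -> P a -> P b -> P (b *m refl a)) ->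
  rsys [seq b <- Phi | P b].
Proof.
move=> H; case: rs => uP z0 h1 h2 h3; split; first exact: filter_uniq.
- by rewrite mem_filter negb_and z0 orbT.
- by move=> a; rewrite mem_filter => /andP[Pa ha] c; rewrite mem_filter => /andP[_ hc]; apply: h1 ha _ hc.
- move=> a b; rewrite !mem_filter => /andP[Pa ha] /andP[Pb hb]; by rewrite H //= h2.
- by move=> a b; rewrite !mem_filter => /andP[_ ha] /andP[_ hb]; apply: h3.
Qed.
Lemma sub_reg (P : pred V) : regular_vec Phi v -> regular_vec [seq b <- Phi | P b] v.
Proof. by move=> H a; rewrite mem_filter => /andP[_]; exact: H. Qed.
Lemma sub_pos (P : pred V) b : (b \in pos_system [seq b <- Phi | P b] v) = P b && (b \in pos_system Phi v).
Proof. by rewrite !mem_pos mem_filter andbCA. Qed.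
End SubRS.

Section Forest.
Variables (R : realType) (n : nat).
Local Notation V := 'rV[R]_n.
Variables (Phi : seq V) (v : V) (s : seq V) (dual : V -> V).
Hypothesis rs : rsys Phi.
Hypothesis reg : regular_vec Phi v.
Hypothesis sd : simple_dual Phi v s dual.
Let us : uniq s. Proof. by case: sd. Qed.
Let sP a : a \in s -> a \in pos_system Phi v. Proof. by case: sd => _ h _ _ /h. Qed.
Let s0 a : a \in s -> a != 0. Proof. by move/sP/(pos_neq0 rs). Qed.
Let sD a b : a \in s -> b \in s -> dotp (dual a) b = (a == b)%:R.
Proof. by case: sd => _ _ _; apply. Qed.
Lemma sum_root_adj a b : a \in s -> b \in s -> a != b -> a + b \in Phi -> dotp a b != 0.
Proof.
move=> ha hb ab hr; apply/negP => /eqP E.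
have h1 := root_refl rs (pos_root (sP ha)) hr.
have Ex : (a + b) *m refl a = b - a.
  rewrite mulmxDl (refl_self (s0 ha)) mul_refl [dotp b a]dotpC E mulr0 mul0r scale0r subr0 addrC //.
rewrite Ex in h1; case/orP: (pos_or rs reg h1) => hp.
  by have := dual_ge0 sd ha hp; rewrite dotpBr !sD // eqxx (negbTE ab) sub0r oppr_ge0 ler10.
by have := dual_ge0 sd hb hp; rewrite dotpNr dotpBr !sD // eqxx eq_sym (negbTE ab) subr0 oppr_ge0 ler10.
Qed.
(** Remove a leaf: only the edge to its one possible neighbour is lost with it. *)
Lemma forest_edges (T E : seq V) : uniq T -> {subset T <= s} -> T != [::] -> uniq E ->
  (forall e, e \in E -> exists a b, [/\ a \in T, b \in T, a != b, dotp a b != 0 & e = a + b]) ->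
  (size E < size T)%N.
Proof.
have [k] := ubnP (size T); elim: k T E => // k IH T E lek uT Ts Tn uE HE.
have [a ha [b0 hb]] := leaf_exists rs reg sd uT Ts Tn.
pose e0 : V := a + b0; have pT := perm_to_rem ha; rewrite (perm_size pT) /= in lek *.
have key e : e \in E -> e != e0 -> exists x y, [/\ x \in rem a T, y \in rem a T, x != y, dotp x y != 0 & e = x + y].
  move=> /HE [x [y [hx hy xy nz Ee]]] ne.
  have nb x' y' : x' \in T -> y' \in T -> x' != y' -> dotp x' y' != 0 -> e = x' + y' -> x' != a.
    move=> hx' hy' xy' nz' Ee'; apply: contraNneq ne => Ea; apply/eqP; rewrite Ee' Ea /e0; congr (_ + _).
    apply/eqP; apply: contraNT nz' => nb; rewrite Ea hb //; by rewrite eq_sym -Ea.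
  exists x, y; split=> //; rewrite mem_rem_uniq // inE.
    by rewrite hx (nb x y).
  by have := nb y x hy hx; rewrite eq_sym dotpC addrC hy => /(_ xy nz Ee) ->.
have [T1|T1] := eqVneq (rem a T) [::].
  rewrite T1 ltnS /=; case: E {uE} HE key => // e E HE key.
  have [x [y [hx hy xy _ _]]] := HE e (mem_head _ _); move: hx hy xy.
  rewrite !(perm_mem pT) T1 !inE => /eqP -> /eqP ->; by rewrite eqxx.
have := IH (rem a T) (filter (predC1 e0) E) lek (rem_uniq _ uT) _ T1 (filter_uniq _ uE).
move=> H; have {}H : (size (filter (predC1 e0) E) < size (rem a T))%N.
  apply: H; first by move=> x /mem_rem/Ts.
  by move=> e; rewrite mem_filter /= => /andP[h1 h2]; apply: key.
rewrite ltnS; apply: leq_trans H; rewrite size_filter.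
have : (count (pred1 e0) E <= 1)%N by rewrite count_uniq_mem //; case: (_ \in _).
have h := count_predC (pred1 e0) E; move=> le; rewrite -h.
by apply: (@leq_trans (1 + count (predC (pred1 e0)) E)%N); [rewrite leq_add2r | ].
Qed.
End Forest.

Section EqualHeight.
Variables (R : realType) (n : nat).
Local Notation V := 'rV[R]_n.
Variables (Phi : seq V) (v : V) (s : seq V) (dual : V -> V).
Hypothesis rs : rsys Phi.
Hypothesis reg : regular_vec Phi v.
Hypothesis sd : simple_dual Phi v s dual.
Local Notation Pos := (pos_system Phi v).
Local Notation ht := (ht s dual).
Let us : uniq s. Proof. by case: sd. Qed.
Let sP a : a \in s -> a \in Pos. Proof. by case: sd => _ h _ _ /h. Qed.
Lemma htD x y : ht (x + y) = ht x + ht y.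
Proof. by rewrite /ht -big_split; apply: eq_bigr => a _; rewrite /= dotpDr. Qed.
Lemma htZ c x : ht (c *: x) = c * ht x.
Proof. by rewrite /ht mulr_sumr; apply: eq_bigr => a _; rewrite dotpZr. Qed.
Lemma htN x : ht (- x) = - ht x. Proof. by rewrite -scaleN1r htZ mulN1r. Qed.
Lemma htB x y : ht (x - y) = ht x - ht y. Proof. by rewrite htD htN. Qed.
Lemma ht_sum (I : Type) (r : seq I) (F : I -> V) : ht (\sum_(i <- r) F i) = \sum_(i <- r) ht (F i).
Proof. by elim/big_rec2: _ => [|i y x _ <-]; rewrite ?htD // -(scale0r 0) htZ mul0r. Qed.
Lemma ht_pos b : b \in Pos -> exists k : nat, (0 < k)%N /\ ht b = k%:R.
Proof.
move=> hb; have [k E] := ht_nat sd hb; exists k; split=> //; rewrite lt0n; apply/negP => /eqP k0.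
have H a : a \in s -> dotp (dual a) b = 0.
  move: E; rewrite k0 /ht big_seq => /eqP; rewrite psumr_eq0; last by move=> x hx; exact: (dual_ge0 sd).
  by move=> /allP H ha; have := H a ha; rewrite ha => /eqP.
have := pos_neq0 rs hb; rewrite (pos_expand sd hb) big_seq big1 ?eqxx // => a ha; by rewrite H // scale0r.
Qed.
Lemma ht_root0 b : b \in Phi -> ht b != 0.
Proof.
move=> hb; case/orP: (pos_or rs reg hb) => hp; have [k [k0 E]] := ht_pos hp.
  by rewrite E pnatr_eq0 -lt0n.
by move: E; rewrite htN => /eqP; rewrite eqr_oppLR => /eqP ->; rewrite oppr_eq0 pnatr_eq0 -lt0n.
Qed.
Variable i : nat.
Hypothesis i0 : (0 < i)%N.
Let iR : 0 < i%:R :> R. Proof. by rewrite ltr0n. Qed.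
Definition level := [seq a <- Pos | ht a == i%:R].
Let H := level.
Let HP a : a \in H -> a \in Pos. Proof. by rewrite mem_filter => /andP[]. Qed.
Let Hh a : a \in H -> ht a = i%:R. Proof. by rewrite mem_filter => /andP[/eqP]. Qed.
Lemma level_uniq : uniq H. Proof. exact/filter_uniq/pos_uniq. Qed.
(** An acute pair of equal height would differ by a root of height zero. *)
Lemma level_free : row_free (rowsmx H).
Proof.
apply: (obtuse_free (v := v)) level_uniq _ _.
  by move=> a /HP; rewrite mem_pos => /andP[].
move=> a b ha hb ab; rewrite leNgt; apply/negP => pab.
have := ht_root0 (dotp_pos_diff rs (pos_root (HP ha)) (pos_root (HP hb)) ab pab).
by rewrite htB !Hh // subrr eqxx.
Qed.
Lemma level_dual : exists dl : V -> V, forall a b, a \in H -> b \in H -> dotp (dl a) b = (a == b)%:R.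
Proof. exact: (dual_of_free level_uniq level_free). Qed.

Definition inspan (b : V) := `[< exists c : V -> R, b = \sum_(a <- H) c a *: a >].
Lemma inspan_comb b b' x : inspan b -> inspan b' -> inspan (b - x *: b').
Proof.
move=> /asboolP[c ->] /asboolP[c' ->]; apply/asboolP; exists (fun a => c a - x * c' a).
by rewrite scaler_sumr -sumrB; apply: eq_bigr => a _; rewrite scalerBl scalerA.
Qed.
Lemma inspan_lev a : a \in H -> inspan a.
Proof.
move=> ha; apply/asboolP; exists (fun x => (x == a)%:R).
rewrite (big_rem a) //= eqxx scale1r big_seq big1 ?addr0 // => b; rewrite mem_rem_uniq ?level_uniq // inE.
by move=> /andP[ba _]; rewrite (negbTE ba) scale0r.
Qed.
Let Psi := [seq b <- Phi | inspan b].
Let rsPsi : rsys Psi.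
Proof. by apply: sub_rsys => // a b ha hb Pa Pb; rewrite mul_refl inspan_comb. Qed.
Let regPsi : regular_vec Psi v. Proof. exact: sub_reg. Qed.
Definition ihit (b : V) := inspan b && `[< exists z : int, ht b = z%:~R * i%:R >].
Let Psi1 := [seq b <- Phi | ihit b].
Let rsPsi1 : rsys Psi1.
Proof.
apply: sub_rsys => // a b ha hb /andP[Pa /asboolP[z Ez]] /andP[Pb /asboolP[z' Ez']].
case: (rs) => _ _ _ _ /(_ _ _ ha hb) [w Ew]; rewrite mul_refl Ew; apply/andP; split; first exact: inspan_comb.
by apply/asboolP; exists (z' - w * z); rewrite htB htZ Ez Ez' intrB intrM; ring.
Qed.
Let regPsi1 : regular_vec Psi1 v. Proof. exact: sub_reg. Qed.
Let Pos1 := pos_system Psi1 v.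
Let rho := \sum_(g <- Pos1) (2 / dotp g g) *: g.
(** In [Psi1] heights are multiples of [i], so a root of height [i] is indecomposable and simple
    there. Its reflection then permutes the other positive roots of [Psi1], as for the usual sum of
    positive coroots. In the larger system [Psi] such a root may fail to be simple. *)
Lemma rho_level a : a \in H -> dotp rho a = 2.
Proof.
move=> ha; have a0 := pos_neq0 rs (HP ha).
have a1 : a \in Pos1.
  rewrite sub_pos HP // andbT /ihit inspan_lev //; apply/asboolP; exists 1; by rewrite Hh // mul1r.
have [s1 [dl sd1]] := simple_exists rsPsi1 regPsi1.
have as1 : a \in s1.
  have [us1 s1P gen dlP] := sd1; have [m Em] := gen a a1.
  have hge d : d \in s1 -> i%:R <= ht d.
    move=> /s1P; rewrite sub_pos => /andP[/andP[_ /asboolP[z Ez]] hd].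
    have [k [k0 Ek]] := ht_pos hd; rewrite Ez ler_peMl ?ler0n // -[1]/(1%:~R) ler_int -gtz0_ge1.
    by rewrite -(ltr0z R) -(pmulr_lgt0 _ iR) -Ez Ek ltr0n.
  have [d hd md] : exists2 d, d \in s1 & (0 < m d)%N.
    apply: contrapT => /forall2NP N; move/eqP: a0; apply; rewrite Em big_seq big1 // => d hd.
    by have [//|/negP] := N d; rewrite -leqNgt leqn0 => /eqP ->; rewrite scale0r.
  have E : ht a = \sum_(d <- s1) (m d)%:R * ht d by rewrite {1}Em ht_sum; apply: eq_bigr => x _; rewrite htZ.
  have md1 : m d = 1%N /\ forall d', d' \in s1 -> d' != d -> m d' = 0%N.
    have tot : (\sum_(x <- s1) m x <= 1)%N.
      rewrite -(ler_nat R) natr_sum -(ler_pM2r iR) mul1r mulr_suml -[leRHS](Hh ha) E big_seq [leRHS]big_seq.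
      by apply: ler_sum => x hx; rewrite ler_wpM2l ?ler0n ?hge.
    move: tot; rewrite (big_rem d) //= => tot.
    have [m1 r0] : m d = 1%N /\ (\sum_(x <- rem d s1) m x = 0)%N.
      by move: tot md; move: (\sum_(x <- _) _)%N (m d) => x y; clear; lia.
    split=> //.
    move=> d' hd' dd'; move: r0 => /eqP; rewrite big_seq sum_nat_seq_eq0 => /allP/(_ d').
    by rewrite mem_rem_uniq // inE dd' hd' => /(_ isT) /eqP.
  suff -> : a = d by [].
  rewrite Em (big_rem d) //= (proj1 md1) scale1r big_seq big1 ?addr0 // => x.
  by rewrite mem_rem_uniq // inE => /andP[xd hx]; rewrite (proj2 md1) // scale0r.
have pm : perm_eq [seq g *m refl a | g <- rem a Pos1] (rem a Pos1).
  have u1 : uniq Pos1 by apply: pos_uniq.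
  have sub : {subset [seq g *m refl a | g <- rem a Pos1] <= rem a Pos1}.
    move=> x /mapP[g hg ->]; move: hg; rewrite !mem_rem_uniq // !inE => /andP[ga hg].
    rewrite (simple_refl_pos rsPsi1 regPsi1 sd1) // andbT; apply/negP => /eqP E.
    have : g = - a by rewrite -[g]mulmx1 -(dotp_reflK a0) mulmxA E refl_self.
    by move=> Eg; have := pos_notN a1; rewrite -Eg hg.
  have uq : uniq [seq g *m refl a | g <- rem a Pos1].
    rewrite map_inj_uniq ?rem_uniq // => x y E.
    by rewrite -[x]mulmx1 -[y]mulmx1 -(dotp_reflK a0) !mulmxA E.
  have [_ E] := uniq_min_size uq sub (ltac:(by rewrite size_map)).
  by apply: uniq_perm => //; apply: rem_uniq.
have Er : rho *m refl a = rho - (4 / dotp a a) *: a.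
  have S1 : rho = (2 / dotp a a) *: a + \sum_(g <- rem a Pos1) (2 / dotp g g) *: g by rewrite /rho (big_rem a).
  have S2 : \sum_(g <- rem a Pos1) (2 / dotp g g) *: g *m refl a = \sum_(g <- rem a Pos1) (2 / dotp g g) *: g.
    rewrite -[RHS](perm_big _ pm) big_map /=; apply: eq_bigr => g _.
    by rewrite dotp_refl // scalemxAl.
  rewrite {1}S1 mulmxDl mulmx_suml S2 -scalemxAl refl_self // S1 scalerN.
  by rewrite addrAC -scalerBl; congr (_ + _); rewrite -scaleNr; congr (_ *: _); ring.
move: Er; rewrite mul_refl => /addrI /oppr_inj /eqP; rewrite -subr_eq0 -scalerBl scaler_eq0 (negbTE a0) orbF.
rewrite -mulrBl mulf_eq0 invr_eq0 dotp_eq0 (negbTE a0) orbF subr_eq0 => /eqP; lra.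
Qed.
Lemma rho_ht b : inspan b -> dotp rho b = 2 * ht b / i%:R.
Proof.
move=> /asboolP[c ->]; rewrite dotp_sumr ht_sum mulr_sumr mulr_suml big_seq [RHS]big_seq.
apply: eq_bigr => a ha; rewrite dotpZr htZ rho_level // Hh //; field; exact: lt0r_neq0.
Qed.
Lemma rho_int b : b \in Phi -> exists z : int, dotp rho b = z%:~R.
Proof.
move=> hb; rewrite /rho dotp_suml; have : {subset Pos1 <= Phi} by move=> x; rewrite sub_pos => /andP[_ /pos_root].
elim: Pos1 => [|g L IH] LP; first by exists 0; rewrite big_nil.
have [|z Ez] := IH; first by move=> x hx; apply: LP; rewrite inE hx orbT.
case: (rs) => _ _ _ _ /(_ g b (LP _ (mem_head _ _)) hb) [w Ew].
by exists (w + z); rewrite big_cons dotpZl Ez intrD -Ew [dotp b g]dotpC; congr (_ + _); rewrite mulrAC.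
Qed.

(** On the span, [rho] is 2 ht / i and takes positive integral values on the positive roots. Let T1
    and T2 be the simple roots of [Psi] with values 1 and 2. A root of height [i] is in T2 or joins
    two adjacent members of T1; a forest has fewer edges than vertices, so a nonempty T1 leaves
    fewer such roots than the dimension of their span. *)
Theorem level_span_ht b : b \in Pos -> inspan b -> i%:R <= ht b.
Proof.
move=> hb ib; have [sP' [dl sd']] := simple_exists rsPsi regPsi.
have [us' s'P gen dlP] := sd'.
have bP : b \in pos_system Psi v by rewrite sub_pos ib hb.
have inP d : d \in pos_system Psi v -> inspan d /\ d \in Pos by rewrite sub_pos => /andP[].
have val d : d \in pos_system Psi v -> exists k : nat, (0 < k)%N /\ dotp rho d = k%:R.
  move=> /inP[id hd]; have [z Ez] := rho_int (pos_root hd).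
  have z0 : (0 < z)%R.
    rewrite -(ltr0z R) -Ez rho_ht //; have [k [k0 ->]] := ht_pos hd.
    by rewrite divr_gt0 // mulr_gt0 // ltr0n.
  exists `|z|%N; split; first by lia.
  by rewrite Ez -[in LHS](gtz0_abs z0).
have [all2|] := pselect (forall d, d \in sP' -> 2 <= dotp rho d).
  have [d hd [m Em md]] : exists2 d, d \in sP' & exists2 m : V -> nat, b = \sum_(a <- sP') (m a)%:R *: a & (0 < m d)%N.
    have [m Em] := gen b bP; apply: contrapT => /forall2NP N.
    have := pos_neq0 rs hb; rewrite Em big_seq big1 ?eqxx // => d hd.
    have [//|N2] := N d; have [->|m0] := posnP (m d); first by rewrite scale0r.
    by case: N2; exists m.
  have : 2 <= dotp rho b.
    rewrite Em dotp_sumr (big_rem d) //= -[2]addr0; apply: lerD.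
      rewrite dotpZr; apply: le_trans (all2 d hd) _; rewrite ler_peMl ?ler1n //.
      by apply: le_trans (all2 d hd).
    rewrite big_seq sumr_ge0 // => x /mem_rem hx; rewrite dotpZr mulr_ge0 ?ler0n //.
    by apply: le_trans (all2 x hx).
  rewrite rho_ht // ler_pdivlMr // => h2; lra.
move=> nall; exfalso.
pose T1 := [seq d <- sP' | dotp rho d == 1]; pose T2 := [seq d <- sP' | dotp rho d == 2].
have T1n : T1 != [::].
  apply/negP => /eqP E; apply: nall => d hd; have [k [k0 Ek]] := val d (s'P d hd).
  rewrite Ek ler_nat ltn_neqAle k0 andbT eq_sym; apply/negP => /eqP k1.
  have : d \in T1 by rewrite mem_filter Ek k1 eqxx hd.
  by rewrite E.
pose E := [seq a <- H | a \notin T2].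
have edges : (size E < size T1)%N.
  apply: (forest_edges rsPsi regPsi sd') => //; first exact: filter_uniq.
  - by move=> d; rewrite mem_filter => /andP[].
  - exact/filter_uniq/level_uniq.
  move=> a; rewrite mem_filter => /andP[aT ha].
  have aP : a \in pos_system Psi v by rewrite sub_pos HP // inspan_lev.
  have [m Em] := gen a aP.
  have nat1 d : d \in sP' -> exists k : nat, (0 < k)%N /\ dotp rho d = k%:R by move/s'P/val.
  have tot : \sum_(d <- sP') (m d)%:R * dotp rho d = 2.
    by rewrite -(rho_level ha) [in RHS]Em dotp_sumr; apply: eq_bigr => d _; rewrite dotpZr.
  have [d hd md] : exists2 d, d \in sP' & (0 < m d)%N.
    apply: contrapT => /forall2NP N; have := pos_neq0 rs (HP ha); rewrite Em big_seq big1 ?eqxx // => d hd.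
    by have [//|/negP] := N d; rewrite -leqNgt leqn0 => /eqP ->; rewrite scale0r.
  have ge1 x : x \in sP' -> 1 <= dotp rho x by move=> /nat1[k [k0 ->]]; rewrite ler1n.
  have rest0 (L : seq V) : {subset L <= sP'} -> \sum_(x <- L) (m x)%:R * dotp rho x < 1 -> forall x, x \in L -> m x = 0%N.
    move=> Ls lt x hx; move: lt; rewrite (big_rem x) //= => lt; apply/eqP; rewrite -leqn0 leqNgt; apply/negP => mx.
    have : 1 * 1 <= (m x)%:R * dotp rho x by apply: ler_pM; rewrite ?ler1n ?ge1 ?Ls.
    have : 0 <= \sum_(y <- rem x L) (m y)%:R * dotp rho y.
      by rewrite big_seq sumr_ge0 // => y /mem_rem/Ls hy; rewrite mulr_ge0 ?ler0n // (le_trans _ (ge1 y hy)).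
    by move: lt; lra.
  have T := tot; rewrite (big_rem d) //= in T.
  set Z := \sum_(_ <- _) _ in T.
  have Z0 : 0 <= Z by rewrite /Z big_seq sumr_ge0 // => y /mem_rem hy; rewrite mulr_ge0 ?ler0n // (le_trans _ (ge1 y hy)).
  have [k [k0 Ek]] := nat1 d hd.
  have asum L c : perm_eq sP' (d :: L) -> (forall x, x \in L -> m x = 0%N) -> c = m d -> a = c%:R *: d.
    move=> pm z ->; rewrite Em (perm_big _ pm) big_cons big_seq big1 => [|x hx]; [exact: addr0 | by rewrite z // scale0r].
  (* If the remaining part has value below 1 it is zero, and [a] is a multiple of [d], hence [d]
     itself, which puts [a] in the excluded T2. Otherwise [d] accounts for at most 1. *)
  have nd : m d = 1%N /\ k = 1%N.
    have [z0|z0] := ltP Z 1.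
      have zz := rest0 _ (fun x hx => mem_rem hx) z0.
      have Ea := asum _ (m d) (perm_to_rem hd) zz erefl.
      have m1 : (m d = 1)%N.
        case: (rs) => _ _ h1 _ _; have dP := pos_root (proj2 (inP d (s'P d hd))).
        have hap := pos_root (HP ha); rewrite Ea in hap.
        case: (h1 d dP _ hap) => E1; last by have := ler0n R (m d); rewrite E1 lerNr oppr0 ler10.
        by apply/eqP; rewrite -(eqr_nat R) E1.
      exfalso; move: aT; rewrite Ea m1 scale1r mem_filter hd andbT => /negP; apply; apply/eqP.
      have := rho_level ha; by rewrite Ea m1 scale1r.
    have le2 : ((m d * k)%N%:R : R) <= 1 by rewrite natrM -Ek; lra.
    rewrite -[1]/(1%:R) ler_nat in le2; move: md k0 le2; clear; nia.
  case: nd => m1 k1.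
  have Z1 : Z = 1 by move: T; rewrite m1 Ek k1 mul1r; lra.
  have [d' hd' md'] : exists2 d', d' \in rem d sP' & (0 < m d')%N.
    apply: contrapT => /forall2NP N; have : Z = 0; last by rewrite Z1 => /eqP; rewrite oner_eq0.
    rewrite /Z big_seq big1 // => x hx; have [//|/negP] := N x; rewrite -leqNgt leqn0 => /eqP ->; by rewrite mul0r.
  have hds := mem_rem hd'; have dd' : d != d' by move: hd'; rewrite mem_rem_uniq // inE eq_sym => /andP[].
  have [k' [k0' Ek']] := nat1 d' hds.
  have T' := Z1; rewrite /Z (big_rem d') //= in T'; set Z' := \sum_(_ <- _) _ in T'.
  have Z0' : 0 <= Z' by rewrite /Z' big_seq sumr_ge0 // => y /mem_rem/mem_rem hy; rewrite mulr_ge0 ?ler0n // (le_trans _ (ge1 y hy)).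
  have le1 : ((m d' * k')%N%:R : R) <= 1 by rewrite natrM -Ek'; lra.
  rewrite -[1]/(1%:R) ler_nat in le1.
  have [m1' k1'] : m d' = 1%N /\ k' = 1%N by move: md' k0' le1; clear; nia.
  have zz : forall x, x \in rem d' (rem d sP') -> m x = 0%N.
    apply: rest0; first by move=> x /mem_rem/mem_rem.
    by rewrite -/Z'; move: T'; rewrite m1' Ek' k1' mul1r; lra.
  have Ea : a = d + d'.
    rewrite Em (big_rem d) //= (big_rem d') //= m1 m1' !scale1r big_seq big1 ?addr0 // => x hx; by rewrite zz // scale0r.
  exists d, d'; split=> //; try by rewrite mem_filter ?Ek ?Ek' ?k1 ?k1' eqxx ?hd ?hds.
  by apply: (sum_root_adj rsPsi regPsi sd') => //; rewrite -Ea; exact: pos_root aP.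
have dimle : (size sP' <= size H)%N.
  have fr : row_free (rowsmx sP').
    apply: (obtuse_free (v := v)) us' _ _; first by move=> a /s'P; rewrite mem_pos => /andP[].
    by move=> a c ha hc ac; apply: (simple_obtuse rsPsi regPsi sd').
  rewrite -(eqP (fr : \rank _ == _)); apply: leq_trans (rank_leq_row (rowsmx H)); apply: mxrankS.
  apply/row_subP => j; rewrite rowK.
  have /inP[/asboolP[c Ec] _] := s'P _ (mem_nth 0 (ltn_ord j)); rewrite Ec (big_nth 0) big_mkord.
  apply: summx_sub => k _; apply: scalemx_sub; have -> : H`_k = row k (rowsmx H) by rewrite rowK.
  exact: row_sub.
have szH : (size H <= size T2 + size E)%N.
  rewrite -(size_cat T2 E); apply: uniq_leq_size level_uniq _ => a ha; rewrite mem_cat.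
  by have [//|nt] := boolP (a \in T2); rewrite /= mem_filter nt.
have szT : (size T1 + size T2 <= size sP')%N.
  rewrite -size_cat; apply: uniq_leq_size.
    rewrite cat_uniq !filter_uniq // andbT /=; apply/hasPn => d; rewrite !mem_filter => /andP[/eqP -> _].
    by rewrite negb_and (_ : (2 == 1 :> R) = false) //; apply/negbTE; rewrite -[1]/(1%:R) eqr_nat.
  by move=> d; rewrite mem_cat !mem_filter => /orP[] /andP[].
by move: edges dimle szH szT; clear; lia.
Qed.
End EqualHeight.

End EqualHeightRoots.

(** * Coordinates in a rank two subsystem *)

Module RankTwoGeometry.
Import LinearFormDivisibility RootSystemBasics SimpleSystems CoxeterOrbits BipartiteEigenvector EqualHeightRoots RankTwoTables.

Lemma size_undup_le (T A B : eqType) (L : seq T) (f : T -> A) (g : T -> B) :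
  {in L &, forall x y, g x = g y -> f x = f y} -> (size (undup (map f L)) <= size (undup (map g L)))%N.
Proof.
case: L => [|x0 L0] // H; set L := x0 :: L0 in H *.
pose hh (y : B) := f (nth x0 L (find (fun x => g x == y) L)).
rewrite -(size_map hh (undup (map g L))); apply: uniq_leq_size (undup_uniq _) _ => y.
rewrite mem_undup => /mapP[x hx ->]; apply/mapP; exists (g x); first by rewrite mem_undup map_f.
have hs : has (fun x' => g x' == g x) L by apply/hasP; exists x.
by apply: H => //; [apply: mem_nth; rewrite -has_find | apply/esym/eqP; exact: (nth_find x0 hs)].
Qed.

Section R2.
Variables (R : realType) (n : nat).
Local Notation V := 'rV[R]_n.
Definition r2 (e1 e2 : V) (g : nat * nat) : V := g.1%:R *: e1 + g.2%:R *: e2.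
Definition zr2 (e1 e2 : V) (g : int * int) : V := g.1%:~R *: e1 + g.2%:~R *: e2.
Lemma zr2E e1 e2 g : r2 e1 e2 g = zr2 e1 e2 (g.1%:Z, g.2%:Z). Proof. by []. Qed.

(** The two simple reflections in integral coordinates. Signed pairs are needed because closure of
    the list of roots is checked by computation on both signs. *)
Definition zs1 (q : nat) (g : int * int) : int * int := (- g.1 + q%:Z * g.2, g.2).
Definition zs2 (p : nat) (g : int * int) : int * int := (g.1, - g.2 + p%:Z * g.1).
Definition zl (G : seq (nat * nat)) : seq (int * int) :=
  [seq (g.1%:Z, g.2%:Z) | g <- G] ++ [seq (- g.1%:Z, - g.2%:Z) | g <- G].
Definition cartan_types : seq ((nat * nat) * seq (nat * nat)) :=
  [:: ((0, 0)%N, G_A1A1); ((1, 1)%N, G_A2); ((2, 1)%N, G_B2); ((3, 1)%N, G_G2)].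

Section Class.
Variables (Psi : seq V) (v e1 e2 : V) (dl : V -> V) (p q : nat) (G : seq (nat * nat)).
Hypothesis rs : rsys Psi.
Hypothesis reg : regular_vec Psi v.
Hypothesis sd : simple_dual Psi v [:: e1; e2] dl.
Hypothesis Ep : 2 * dotp e1 e2 / dotp e2 e2 = - p%:R.
Hypothesis Eq : 2 * dotp e1 e2 / dotp e1 e1 = - q%:R.
Hypothesis ty : ((p, q), G) \in cartan_types.
Local Notation r2' := (r2 e1 e2).
Local Notation zr2' := (zr2 e1 e2).
Let e1P : e1 \in pos_system Psi v. Proof. by case: sd => _ h _ _; apply: h; rewrite mem_head. Qed.
Let e2P : e2 \in pos_system Psi v. Proof. by case: sd => _ h _ _; apply: h; rewrite !inE eqxx orbT. Qed.
Let n1 : dotp e1 e1 != 0. Proof. by rewrite dotp_eq0 (pos_neq0 rs e1P). Qed.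
Let n2 : dotp e2 e2 != 0. Proof. by rewrite dotp_eq0 (pos_neq0 rs e2P). Qed.
Lemma zrefl1 g : zr2' g *m refl e1 = zr2' (zs1 q g).
Proof.
rewrite mul_refl /zr2 /zs1 /= !dotpDl !dotpZl [dotp e2 e1]dotpC.
have -> : 2 * (g.1%:~R * dotp e1 e1 + g.2%:~R * dotp e1 e2) / dotp e1 e1 =
   2 * g.1%:~R - g.2%:~R * q%:R by rewrite -[q%:R]opprK -Eq; field.
rewrite rmorphD rmorphN rmorphM /= addrAC -scalerBl; congr (_ *: _ + _).
by rewrite -[(Posz q)%:~R]/(q%:R); ring.
Qed.
Lemma zrefl2 g : zr2' g *m refl e2 = zr2' (zs2 p g).
Proof.
rewrite mul_refl /zr2 /zs2 /= !dotpDl !dotpZl.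
have -> : 2 * (g.1%:~R * dotp e1 e2 + g.2%:~R * dotp e2 e2) / dotp e2 e2 =
   2 * g.2%:~R - g.1%:~R * p%:R by rewrite -[p%:R]opprK -Ep; field.
rewrite rmorphD rmorphN rmorphM /= -addrA -scalerBl; congr (_ + _ *: _).
by rewrite -[(Posz p)%:~R]/(p%:R); ring.
Qed.
Lemma zclosed g : g \in zl G -> (zs1 q g \in zl G) && (zs2 p g \in zl G).
Proof.
have H : all (fun g => (zs1 q g \in zl G) && (zs2 p g \in zl G)) (zl G).
  by move: ty; rewrite !inE => /or4P[] /eqP[-> -> ->]; vm_compute.
by move/(allP H).
Qed.
Lemma root_coord b : b \in Psi -> exists2 g, g \in zl G & b = zr2' g.
Proof.
move=> /(root_word rs reg sd) [w [a [hw ha ->]]].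
have [g0 hg0 ->] : exists2 g, g \in zl G & a = zr2' g.
  have GG : ((1, 0)%N \in G) && ((0, 1)%N \in G) by move: ty; rewrite !inE => /or4P[] /eqP[_ _ ->].
  case/andP: GG => g1 g2; move: ha; rewrite !inE => /orP[] /eqP ->.
    by exists (1, 0); [rewrite mem_cat; apply/orP; left; apply/mapP; exists (1, 0)%N | rewrite /zr2 /= scale1r scale0r addr0].
  by exists (0, 1); [rewrite mem_cat; apply/orP; left; apply/mapP; exists (0, 1)%N | rewrite /zr2 /= scale1r scale0r add0r].
elim: w g0 hg0 hw => [|d w IH] g hg /=; first by move=> _; exists g; rewrite ?mulmx1.
case/andP=> hd hw; rewrite mulmxA; have /andP[z1 z2] := zclosed hg.
by move: hd; rewrite !inE => /orP[] /eqP ->; rewrite ?zrefl1 ?zrefl2; apply: IH.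
Qed.
Lemma coord_root g : g \in G -> r2' g \in Psi.
Proof.
have r1 := pos_root e1P; have r2 := pos_root e2P.
have f1 g' : zr2' g' \in Psi -> zr2' (zs1 q g') \in Psi by rewrite -zrefl1; apply: root_refl.
have f2 g' : zr2' g' \in Psi -> zr2' (zs2 p g') \in Psi by rewrite -zrefl2; apply: root_refl.
have a10 : zr2' (1, 0) \in Psi by rewrite /zr2 /= scale1r scale0r addr0.
have a01 : zr2' (0, 1) \in Psi by rewrite /zr2 /= scale1r scale0r add0r.
have b1 := f1 _ a01; have b2 := f2 _ a10; have b3 := f2 _ b1; have b4 := f1 _ b2.
rewrite zr2E; move: ty b1 b2 b3 b4; rewrite !inE => /or4P[] /eqP[-> -> ->] b1 b2 b3 b4; rewrite !inE.
- by case/orP=> /eqP ->.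
- by case/or3P=> /eqP ->.
- by case/or4P=> /eqP ->.
- by case/or4P=> [/eqP ->|/eqP ->|/eqP ->|/or3P[] /eqP ->].
Qed.
Lemma r2_inj : injective r2'.
Proof.
have [us _ _ D] := sd; have m1 : e1 \in [:: e1; e2] by rewrite mem_head.
have m2 : e2 \in [:: e1; e2] by rewrite !inE eqxx orbT.
have ne : (e1 == e2) = false by move: us => /=; rewrite inE andbT => /negbTE.
move=> [x y] [x' y'] E; have E1 := congr1 (dotp (dl e1)) E; have E2 := congr1 (dotp (dl e2)) E.
move: E1 E2; rewrite /r2 /= !dotpDr !dotpZr !D // !eqxx ne [e2 == e1]eq_sym ne !mulr0 !mulr1 !addr0 !add0r.
by move=> /eqP; rewrite eqr_nat => /eqP -> /eqP; rewrite eqr_nat => /eqP ->.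
Qed.
Lemma pos_coord : perm_eq (pos_system Psi v) (map r2' G).
Proof.
have uG : uniq G by move: ty; rewrite !inE => /or4P[] /eqP[_ _ ->].
have v1 : 0 < dotp v e1 by move: e1P; rewrite mem_pos => /andP[].
have v2 : 0 < dotp v e2 by move: e2P; rewrite mem_pos => /andP[].
have G0 g : g \in G -> 0 < dotp v (r2' g).
  have : all (fun g : nat * nat => (0 < g.1 + g.2)%N) G by move: ty; rewrite !inE => /or4P[] /eqP[_ _ ->].
  move=> /allP H /H; rewrite /r2 dotpDr !dotpZr; case: g => [x y] /=; rewrite addn_gt0 => /orP[] h0.
    by rewrite ltr_pwDl ?mulr_gt0 ?ltr0n // mulr_ge0 ?ler0n // ltW.
  by rewrite ltr_wpDl ?mulr_gt0 ?ltr0n // mulr_ge0 ?ler0n // ltW.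
apply: uniq_perm; [exact: (pos_uniq v rs) | by rewrite map_inj_uniq //; exact: r2_inj |].
move=> b; apply/idP/mapP => [hb|[g hg ->]]; last by rewrite mem_pos G0 // coord_root.
have [g + E] := root_coord (pos_root hb); rewrite mem_cat => /orP[] /mapP[g' hg' Eg]; exists g' => //; first by rewrite E Eg.
exfalso; move: hb; rewrite mem_pos => /andP[+ _]; rewrite E Eg.
have -> : zr2' (- g'.1%:Z, - g'.2%:Z) = - r2' g' by rewrite /zr2 /= !rmorphN /= !scaleNr -opprD.
by rewrite dotpNr oppr_gt0 ltNge ltW // G0.
Qed.
Lemma dotp_r2 g g' : dotp (r2' g) (r2' g') =
  (g.1 * g'.1)%:R * dotp e1 e1 + (g.1 * g'.2 + g.2 * g'.1)%:R * dotp e1 e2 + (g.2 * g'.2)%:R * dotp e2 e2.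
Proof. by rewrite /r2 !dotpDl !dotpDr !dotpZl !dotpZr [dotp e2 e1]dotpC natrD !natrM; ring. Qed.
(** Summands are twice the squared cosines. Once all products are expressed through [dotp e2 e2] the
    four types reduce to rational arithmetic. *)
Lemma cos_sum g : g \in G -> \sum_(g' <- rem g G) 2 * dotp (r2' g) (r2' g') ^+ 2 / (dotp (r2' g) (r2' g) * dotp (r2' g') (r2' g'))
  = (size G)%:R - 2.
Proof.
have E12 : dotp e1 e2 = - (p%:R / 2) * dotp e2 e2.
  by have := Ep => /(congr1 (fun x => x * dotp e2 e2)); rewrite divfK //; lra.
have [p0|p0] := eqVneq p 0%N.
  have E0 : dotp e1 e2 = 0 by rewrite E12 p0 mul0r oppr0 mul0r.
  move: ty; rewrite p0 !inE => /or4P[] /eqP[] // _ -> ; rewrite /G_A1A1 !inE => /orP[] /eqP -> /=.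
    by rewrite big_seq1 !dotp_r2 E0 /= !(mul0r, mulr0, mul1r, addr0, add0r) expr0n /= !(mul0r, mulr0, mul1r); lra.
  by rewrite big_seq1 !dotp_r2 E0 /= !(mul0r, mulr0, mul1r, addr0, add0r) expr0n /= !(mul0r, mulr0, mul1r); lra.
have E11 : dotp e1 e1 = p%:R * dotp e2 e2.
  have q1 : q = 1%N by move: ty p0; rewrite !inE => /or4P[] /eqP[-> -> _].
  have := Eq => /(congr1 (fun x => x * dotp e1 e1)); rewrite divfK // q1 E12; lra.
pose t := dotp e2 e2; rewrite -/t in E12 E11; have tn : t != 0 := n2.
pose fm (g g' : nat * nat) : R := (g.1 * g'.1)%:R * p%:R - (g.1 * g'.2 + g.2 * g'.1)%:R * (p%:R / 2) + (g.2 * g'.2)%:R.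
have fmE x y : dotp (r2' x) (r2' y) = fm x y * t by rewrite dotp_r2 E11 E12 /fm -/t; ring.
rewrite (eq_bigr (fun g' => 2 * fm g g' ^+ 2 / (fm g g * fm g' g'))); last first.
  move=> g' _; rewrite !fmE exprMn !invfM !mulrA; move: (fm g g') (fm g g)^-1 (fm g' g')^-1 => x y w.
  by field.
rewrite /fm {fmE fm E11 E12}; move: ty p0; rewrite !inE => /or4P[] /eqP[-> _ ->] // _; rewrite ?inE.
- by case/or3P => /eqP -> /=; rewrite !big_cons big_nil /=; field.
- by case/or4P => /eqP -> /=; rewrite !big_cons big_nil /=; field.
- by case/or4P => [/eqP ->|/eqP ->|/eqP ->|/or3P[] /eqP ->] /=; rewrite !big_cons big_nil /=; field.
Qed.
End Class.

Section Pts.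
Variables (a : V) (k0 : R).
(** The point of the plane of [a] and [b] where they take the values [k0] and [k]. Within one plane
    through [a] it labels the trace on the hyperplane [a = k0]. *)
Definition pt (b : V) (k : R) : V :=
  (k0 / dotp a a) *: a + ((k - k0 * dotp a b / dotp a a) / dotp (b *m projm a) (b *m projm a)) *: (b *m projm a).
Hypothesis a0 : a != 0.
Lemma pt_a b k : dotp (pt b k) a = k0.
Proof.
rewrite /pt dotpDl !dotpZl divfK ?dotp_eq0 //.
have -> : dotp (b *m projm a) a = 0; last by rewrite mulr0 addr0.
by rewrite mul_projm dotpBl dotpZl divfK ?dotp_eq0 // subrr.
Qed.
Lemma pt_b b k : (forall t, b <> t *: a) -> dotp (pt b k) b = k.
Proof.
move=> nb; have pb : b *m projm a != 0 by rewrite mul_projm subr_eq0; apply/eqP => /nb.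
have E : dotp (b *m projm a) b = dotp (b *m projm a) (b *m projm a).
  have z : dotp (b *m projm a) a = 0.
    by rewrite mul_projm dotpBl dotpZl divfK ?dotp_eq0 // subrr.
  transitivity (dotp (b *m projm a) (b - (dotp b a / dotp a a) *: a)); last by rewrite -mul_projm.
  by rewrite dotpBr dotpZr z mulr0 subr0.
by rewrite /pt dotpDl !dotpZl E divfK ?dotp_eq0 // mulrAC addrC subrK.
Qed.
Lemma pt_span b k : exists x y, pt b k = x *: a + y *: b.
Proof.
rewrite /pt mul_projm; set y := (_ / dotp (b - _) _).
exists (k0 / dotp a a - y * (dotp b a / dotp a a)), y.
by rewrite scalerBr scalerBl scalerA -addrA; congr (_ + _); rewrite addrC.
Qed.
End Pts.

Section Count.
Variables (e1 e2 : V) (dl : V -> V) (G : seq (nat * nat)) (Pos : seq V).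
Hypothesis D12 : forall x y x' y' : R, x *: e1 + y *: e2 = x' *: e1 + y' *: e2 -> x = x' /\ y = y'.
Hypothesis ty : G \in types2.
Local Notation r2' := (r2 e1 e2).
Hypothesis pm : perm_eq Pos (map r2' G).
Variables (ga : nat * nat) (k0 : int) (K : V -> seq int) (rng : nat * nat -> seq int).
Hypothesis hga : ga \in G.
Let a := r2' ga.
Hypothesis KE : forall g, g \in G -> K (r2' g) = rng g.
Let uG : uniq G. Proof. by move: ty; rewrite !inE => /or4P[] /eqP ->. Qed.
Let rI : injective r2'.
Proof.
move=> [x y] [x' y'] /D12[] /= /eqP; rewrite eqr_nat => /eqP -> /eqP; by rewrite eqr_nat => /eqP ->.
Qed.
Lemma det_rel (g g' g'' : nat * nat) : (det2 g g')%:~R *: r2' g'' = (det2 g'' g')%:~R *: r2' g + (det2 g g'')%:~R *: r2' g'.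
Proof.
rewrite /r2 /det2 !scalerDr !scalerA !rmorphB !rmorphM /=.
rewrite addrACA -!scalerDl; congr (_ *: _ + _ *: _); rewrite -!pmulrn; ring.
Qed.
Lemma det_indep g g' : det2 g g' != 0 -> forall t, r2' g' <> t *: r2' g.
Proof.
move=> nz t; rewrite /r2 scalerDr !scalerA => /D12[E1 E2]; move/eqP: nz; apply; apply/eqP.
by rewrite -(intr_eq0 R) /det2 rmorphB !rmorphM /= -!pmulrn E1 E2; apply/eqP; ring.
Qed.
Let prem : perm_eq (rem a Pos) (map r2' (rem ga G)).
Proof.
have ha : a \in Pos by rewrite (perm_mem pm) map_f.
rewrite -(perm_cons a) -(permPl (perm_to_rem ha)); apply: (perm_trans pm).
by have := perm_map r2' (perm_to_rem hga).
Qed.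
Lemma count_via c cf : good_cf G ga c cf ->
  (size (undup [seq pt a k0%:~R b k%:~R | b <- rem a Pos, k <- K b]) <= size (undup (keys cf rng k0)))%N /\
  (\sum_(b <- rem a Pos) size (K b) = size (keys cf rng k0))%N.
Proof.
case/and4P=> hc dc /eqP Ecf /allP Hcf.
pose L := flatten [seq [seq (x, k) | k <- rng x.1] | x <- cf].
have mapL (T : Type) (f : entry -> int -> T) :
    map (fun y => f y.1 y.2) L = flatten [seq [seq f x k | k <- rng x.1] | x <- cf].
  rewrite /L; elim: (cf) => //= x l IH; rewrite map_cat IH -map_comp; congr (_ ++ _).
have inL y : y \in L -> y.1 \in cf.
  by move=> /flattenP[l /mapP[x hx ->] /mapP[k hk ->]].
have inG x : x \in cf -> x.1 \in G /\ x.1 != ga.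
  move=> hx; have : x.1 \in rem ga G by rewrite -Ecf map_f.
  by rewrite mem_rem_uniq // inE => /andP[].
have a0 : a != 0.
  apply: contraTneq dc => E; rewrite negbK; apply: contraTT isT => nz.
  by case: (det_indep nz (t := 0)) => //; exfalso; move: nz; rewrite /det2; move/eqP: E; rewrite /a /r2; have := @D12 ga.1%:R ga.2%:R 0 0; rewrite !scale0r addr0 => H /eqP /H[/eqP]; rewrite pnatr_eq0 => /eqP -> /eqP; rewrite pnatr_eq0 => /eqP ->; rewrite !mul0r subrr eqxx.
split.
- have pp : perm_eq [seq pt a k0%:~R b k%:~R | b <- rem a Pos, k <- K b] (map (fun y => pt a k0%:~R (r2' y.1.1) y.2%:~R) L).
    rewrite (mapL _ (fun x k => pt a k0%:~R (r2' x.1) k%:~R)).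
    apply: (perm_trans (perm_flatten (perm_map _ prem))); rewrite -map_comp -Ecf -map_comp.
    have -> : [seq ((fun b => [seq pt a k0%:~R b k%:~R | k <- K b]) \o r2' \o (fun x : entry => x.1)) i | i <- cf] =
              [seq [seq pt a k0%:~R (r2' x.1) k%:~R | k <- rng x.1] | x <- cf].
      by apply/eq_in_map => x hx /=; rewrite KE //; case: (inG x hx).
    exact: perm_refl.
  have pu (T : eqType) (s1 s2 : seq T) : perm_eq s1 s2 -> size (undup s1) = size (undup s2).
    by move=> /perm_mem E; apply/perm_size/uniq_perm; rewrite ?undup_uniq // => x; rewrite !mem_undup.
  rewrite (pu _ _ _ pp) /keys -(mapL _ (fun x k => x.2.1 * k0 + x.2.2 * k)).
  apply: size_undup_le.
  have key (y : entry * int) : y.1 \in cf -> dotp (pt a k0%:~R (r2' y.1.1) y.2%:~R) (r2' c) = (y.1.2.1 * k0 + y.1.2.2 * y.2)%:~R / 6.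
    move=> hy; have /and3P[nz /eqP c1 /eqP c2] := Hcf _ hy.
    have nzR : (det2 ga y.1.1)%:~R != 0 :> R by rewrite intr_eq0.
    apply: (mulfI nzR); rewrite -dotpZr det_rel dotpDr !dotpZr (@pt_a a k0%:~R a0) (@pt_b a k0%:~R a0 _ _ (det_indep nz)).
    move: (det2 ga y.1.1) (det2 c y.1.1) (det2 ga c) c1 c2 {nz nzR} => D D1 D2 c1 c2.
    have := congr1 (fun z : int => z%:~R : R) c1; have := congr1 (fun z : int => z%:~R : R) c2.
    rewrite !(intrM, intrD) ?mulr1z => h2 h1.
    apply: (@mulIf _ 6); first by rewrite pnatr_eq0.
    rewrite [X in _ = X * 6]mulrA divfK ?pnatr_eq0 // [RHS]mulrDr ![in RHS]mulrA h1 h2; ring.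
  move=> x y /inL hx /inL hy E.
  apply/eqP; rewrite -subr_eq0 -dotp_eq0; apply/eqP.
  set w := _ - _; have wa : dotp w a = 0 by rewrite /w dotpBl !(@pt_a a k0%:~R a0) subrr.
  have wc : dotp w (r2' c) = 0 by rewrite /w dotpBl !key // E subrr.
  have wr g : dotp w (r2' g) = 0.
    have nzR : (det2 ga c)%:~R != 0 :> R by rewrite intr_eq0.
    by apply: (mulfI nzR); rewrite mulr0 -dotpZr det_rel dotpDr !dotpZr wa wc !mulr0 addr0.
  have [x1 [y1 E1]] := pt_span a k0%:~R (r2' x.1.1) x.2%:~R.
  have [x2 [y2 E2]] := pt_span a k0%:~R (r2' y.1.1) y.2%:~R.
  by rewrite {2}/w E1 E2 dotpBr !dotpDr !dotpZr wa !wr !mulr0 addr0 subrr.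
- rewrite (perm_big _ prem) /= big_map -Ecf big_map /keys size_flatten /shape -map_comp sumnE big_map big_seq [RHS]big_seq.
  by apply: eq_bigr => x hx; rewrite /= size_map KE //; case: (inG x hx).
Qed.
End Count.
End R2.

End RankTwoGeometry.

(** * The trace inequality in each plane through a root *)

Module RankTwoCounting.
Import LinearFormDivisibility RootSystemBasics SimpleSystems CoxeterOrbits PerronVector BipartiteEigenvector EqualHeightRoots RankTwoTables RankTwoGeometry.

Section HtRho.
Variables (R : realType) (n : nat).
Local Notation V := 'rV[R]_n.
Variables (Phi : seq V) (v : V) (s : seq V) (dual : V -> V).
Hypothesis rs : rsys Phi.
Hypothesis reg : regular_vec Phi v.
Hypothesis sd : simple_dual Phi v s dual.
Local Notation Pos := (pos_system Phi v).
(** The reflection in [a] permutes the other positive roots and negates their products with [a], so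
    only g = a contributes. *)
Lemma rho_simple a : a \in s -> \sum_(g <- Pos) dotp g a / dotp g g = 1.
Proof.
move=> ha; have [us sP _ _] := sd; have a1 := sP _ ha; have a0 := pos_neq0 rs a1.
have u1 : uniq Pos by apply: pos_uniq.
have pm : perm_eq [seq g *m refl a | g <- rem a Pos] (rem a Pos).
  have sub : {subset [seq g *m refl a | g <- rem a Pos] <= rem a Pos}.
    move=> x /mapP[g hg ->]; move: hg; rewrite !mem_rem_uniq // !inE => /andP[ga hg].
    rewrite (simple_refl_pos rs reg sd) // andbT; apply/negP => /eqP E.
    have : g = - a by rewrite -[g]mulmx1 -(dotp_reflK a0) mulmxA E refl_self.
    by move=> Eg; have := pos_notN a1; rewrite -Eg hg.
  have uq : uniq [seq g *m refl a | g <- rem a Pos].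
    rewrite map_inj_uniq ?rem_uniq // => x y E.
    by rewrite -[x]mulmx1 -[y]mulmx1 -(dotp_reflK a0) !mulmxA E.
  have [_ E] := uniq_min_size uq sub (ltac:(by rewrite size_map)).
  by apply: uniq_perm => //; apply: rem_uniq.
rewrite (big_rem a) //= divff ?dotp_eq0 //; set X := \sum_(_ <- _) _.
have : X = - X; last by lra.
rewrite {1}/X -(perm_big _ pm) big_map /= -sumrN; apply: eq_bigr => g _.
by rewrite dotp_refl // dotp_mulmx reflT refl_self // dotpNr mulNr.
Qed.
Lemma ht_rho b : b \in Pos -> ht s dual b = \sum_(g <- Pos) dotp g b / dotp g g.
Proof.
move=> hb; rewrite {2}(pos_expand sd hb).
under eq_bigr do rewrite dotp_sumr mulr_suml; rewrite exchange_big /= /ht big_seq [RHS]big_seq.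
apply: eq_bigr => a ha; under eq_bigr do rewrite dotpZr -mulrA.
by rewrite -mulr_sumr rho_simple // mulr1.
Qed.
End HtRho.

Section Schur.
Variables (R : realType) (l : nat).
Local Notation V := 'rV[R]_l.
Variables (Phi : seq V) (h : nat).
Hypothesis rs : rsys Phi.
Hypothesis sp : spanning Phi.
Hypothesis irr : irreducible_rs Phi.
Hypothesis l0 : (0 < l)%N.
Hypothesis szP : size Phi = (h * l)%N.
Let T : 'M[R]_l := \sum_(b <- Phi) (dotp b b)^-1 *: (b^T *m b).
Let mulT x : x *m T = \sum_(b <- Phi) (dotp x b / dotp b b) *: b.
Proof.
rewrite /T mulmx_sumr; apply: eq_bigr => b _; rewrite -scalemxAr mul_outer scalerA mulrC //.
Qed.
Let TT : T^T = T.
Proof. by rewrite /T linear_sum; apply: eq_bigr => b _; rewrite /= linearZ /= trmx_mul trmxK. Qed.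
Lemma refl_perm a : a \in Phi -> perm_eq [seq b *m refl a | b <- Phi] Phi.
Proof.
move=> ha; have a0 := root_neq0 rs ha; case: (rs) => uP _ _ _ _.
have uq : uniq [seq b *m refl a | b <- Phi].
  rewrite map_inj_uniq // => x y E; by rewrite -[x]mulmx1 -[y]mulmx1 -(dotp_reflK a0) !mulmxA E.
have sub : {subset [seq b *m refl a | b <- Phi] <= Phi} by move=> x /mapP[b hb ->]; apply: root_refl.
have [_ E] := uniq_min_size uq sub (ltac:(by rewrite size_map)).
exact: uniq_perm.
Qed.
Lemma schur (x : V) : \sum_(b <- Phi) dotp x b ^+ 2 / dotp b b = h%:R * dotp x x.
Proof.
have [mu [y [y0 Ey _]]] := sym_top l0 TT.
have comm a (z : V) : a \in Phi -> (z *m refl a) *m T = (z *m T) *m refl a.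
  move=> ha; have a0 := root_neq0 rs ha; rewrite !mulT mulmx_suml -[LHS](perm_big _ (refl_perm ha)) big_map /=.
  by apply: eq_bigr => b _; rewrite !dotp_refl // -scalemxAl.
have key (z : V) a : a \in Phi -> z *m T = mu *: z -> dotp z a != 0 -> a *m T = mu *: a.
  move=> ha Ez nz; have := comm a z ha; rewrite Ez -scalemxAl mul_refl mulmxBl Ez scalerBr => /addrI/oppr_inj.
  set c := 2 * _ / _; have c0 : c != 0; last first.
    by move=> E; apply: (scalerI c0); rewrite scalemxAl E !scalerA mulrC.
  by rewrite !mulf_neq0 ?invr_eq0 ?pnatr_eq0 ?dotp_eq0 ?(root_neq0 rs ha).
have all1 a : a \in Phi -> a *m T = mu *: a.
  case: irr => _ /(_ (fun a => a *m T == mu *: a)) [].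
  - move=> b c hb hc /eqP Eb /eqP nc; apply/eqP; apply: contraPT isT => nz.
    by move=> _; apply: nc; apply: (key b).
  - by move=> /allP H /H/eqP.
  - move=> /allP H; exfalso; move/eqP: y0; apply; apply: sp => c hc; apply/eqP; apply: contraPT isT => nz _.
    by have /negP := H c hc; apply; apply/eqP; apply: (key y).
have Tm : T = mu%:M.
  apply/row_matrixP => i; rewrite !rowE mul_mx_scalar; set e := delta_mx _ _.
  apply/eqP; rewrite -subr_eq0; apply/eqP/sp => a ha.
  by rewrite dotpBl dotp_mulmx TT all1 // dotpZr dotpZl subrr.
have mh : mu = h%:R.
  have := congr1 mxtrace Tm; rewrite mxtrace_scalar /T raddf_sum /=.
  rewrite big_seq (eq_bigr (fun=> 1)); last first.
    move=> b hb; rewrite mxtraceZ mxtrace_mulC trace_mx11 -/(dotp b b) mulVf // dotp_eq0; exact: root_neq0 hb.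
  rewrite -big_seq big_const_seq count_predT iter_addr_0 szP => /esym.
  rewrite natrM -[mu *+ l]mulr_natr => /mulIf; apply.
  by rewrite pnatr_eq0 -lt0n.
have : dotp (x *m T) x = h%:R * dotp x x by rewrite Tm mul_mx_scalar dotpZl mh.
move=> <-; rewrite mulT dotp_suml; apply: eq_bigr => b _.
by rewrite dotpZl [dotp b x]dotpC expr2 mulrAC.
Qed.
End Schur.

Section Planes.
Variables (R : realType) (n : nat).
Local Notation V := 'rV[R]_n.
Variables (Phi : seq V) (v : V) (s : seq V) (dual : V -> V).
Hypothesis rs : rsys Phi.
Hypothesis reg : regular_vec Phi v.
Hypothesis sd : simple_dual Phi v s dual.
Local Notation Pos := (pos_system Phi v).
Definition span2 (a b c : V) := `[< exists x y, c = x *: a + y *: b >].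
Definition plane (a b : V) := [seq c <- Pos | span2 a b c].
Let Psi (a b : V) := [seq c <- Phi | span2 a b c].
Let posPsi a b : pos_system (Psi a b) v = plane a b.
Proof. by rewrite /plane /pos_system -!filter_predI; apply: eq_filter => c /=; rewrite andbC. Qed.
Let rsPsi a b : rsys (Psi a b).
Proof.
apply: sub_rsys => // c d hc hd /asboolP[x [y ->]] /asboolP[x' [y' ->]]; rewrite mul_refl; set t := _ / _.
apply/asboolP; exists (x' - t * x), (y' - t * y).
by rewrite !scalerDr !scalerA !scalerBl opprD addrACA.
Qed.
Let regPsi a b : regular_vec (Psi a b) v. Proof. exact: sub_reg. Qed.
Lemma span2_l a b : span2 a b a. Proof. by apply/asboolP; exists 1, 0; rewrite scale1r scale0r addr0. Qed.
Lemma span2_r a b : span2 a b b. Proof. by apply/asboolP; exists 0, 1; rewrite scale1r scale0r add0r. Qed.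
Lemma plane_same a b c : c \in plane a b -> (forall t, c <> t *: a) -> plane a c = plane a b.
Proof.
rewrite mem_filter => /andP[/asboolP[x [y E]] hc] nc.
have y0 : y != 0 by apply/eqP => y0; apply: (nc x); rewrite E y0 scale0r addr0.
apply: eq_filter => d; apply/asboolP/asboolP => [[x' [y' ->]]|[x' [y' ->]]].
  by exists (x' + y' * x), (y' * y); rewrite E scalerDr !scalerA addrA scalerDl.
exists (x' - y' * x / y), (y' / y); rewrite E scalerDr !scalerA addrA -scalerDl; congr (_ *: _ + _ *: _); by field.
Qed.

(** Two simple roots span the plane; their Cartan integers are nonpositive with product below 4,
    which leaves the four types up to exchange of the roots. *)
Lemma plane_type a b : a \in Pos -> b \in Pos -> a != b ->
  exists e1 e2 dl p q G, [/\ simple_dual (Psi a b) v [:: e1; e2] dl, ((p, q), G) \in cartan_types,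
    2 * dotp e1 e2 / dotp e2 e2 = - p%:R & 2 * dotp e1 e2 / dotp e1 e1 = - q%:R].
Proof.
move=> ha hb ab.
have [t [dl sdt]] := simple_exists (rsPsi a b) (regPsi (a := a) (b := b)).
have [ut tP gen D] := sdt; rewrite posPsi in tP gen.
have a' : a \in plane a b by rewrite mem_filter span2_l.
have b' : b \in plane a b by rewrite mem_filter span2_r.
have st : size t = 2%N.
  apply/eqP; rewrite eqn_leq; apply/andP; split.
    have fr : row_free (rowsmx t).
      apply: (obtuse_free (v := v)) ut _ _; first by move=> x /tP; rewrite mem_filter mem_pos => /andP[_ /andP[]].
      by move=> x c hx hc xc; apply: (simple_obtuse (rsPsi a b) (regPsi (a := a) (b := b)) sdt).
    rewrite -(eqP (fr : \rank _ == _)); apply: leq_trans (rank_leq_row (rowsmx [:: a; b])); apply: mxrankS.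
    apply/row_subP => j; rewrite rowK; have := tP _ (mem_nth 0 (ltn_ord j)).
    rewrite mem_filter => /andP[/asboolP[x [y ->]] _]; apply: addmx_sub; apply: scalemx_sub.
      have -> : (a <= rowsmx [:: a; b])%MS = (row (Ordinal (isT : (0 < 2)%N)) (rowsmx [:: a; b]) <= rowsmx [:: a; b])%MS by rewrite rowK.
      exact: row_sub.
    have -> : (b <= rowsmx [:: a; b])%MS = (row (Ordinal (isT : (1 < 2)%N)) (rowsmx [:: a; b]) <= rowsmx [:: a; b])%MS by rewrite rowK.
    exact: row_sub.
  have [ma Ea] := gen a a'; have [mb Eb] := gen b b'.
  case: (t) Ea Eb => [|d [|d' t']] //; first by rewrite big_nil => E; have := pos_neq0 rs ha; rewrite E eqxx.
  rewrite !big_seq1 => Ea Eb; exfalso.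
  have n0 : (ma d)%:R != 0 :> R by apply: contraTneq (pos_neq0 rs ha) => E0; rewrite Ea E0 scale0r eqxx.
  apply: (pos_nprop rs ha hb ab (t := (mb d)%:R / (ma d)%:R)); by rewrite Ea Eb scalerA divfK.
case: t st ut tP gen D sdt => [|d1 [|d2 [|]]] // _ ut tP gen D sdt.
have d12 : d1 != d2 by move: ut; rewrite /= inE andbT.
have m1 : d1 \in [:: d1; d2] by rewrite mem_head.
have m2 : d2 \in [:: d1; d2] by rewrite !inE eqxx orbT.
have h1 : d1 \in Phi by have := tP _ m1; rewrite mem_filter => /andP[_ /pos_root].
have h2 : d2 \in Phi by have := tP _ m2; rewrite mem_filter => /andP[_ /pos_root].
have n1 : 0 < dotp d1 d1 by rewrite dotp_gt0 (root_neq0 rs h1).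
have n2 : 0 < dotp d2 d2 by rewrite dotp_gt0 (root_neq0 rs h2).
have ob : dotp d1 d2 <= 0 by apply: (simple_obtuse (rsPsi a b) (regPsi (a := a) (b := b)) sdt).
case: (rs) => _ _ _ _ Hz; have [z1 E1] := Hz _ _ h2 h1; have [z2 E2] := Hz _ _ h1 h2; rewrite dotpC in E2.
have cs : dotp d1 d2 ^+ 2 < dotp d1 d1 * dotp d2 d2.
  pose x := d2 - (dotp d1 d2 / dotp d1 d1) *: d1.
  have x0 : x != 0.
    apply/negP => /eqP /(congr1 (dotp (dl d2))); rewrite /x dotpBr dotpZr (D _ _ m2 m2) (D _ _ m2 m1) eqxx [d2 == d1]eq_sym (negbTE d12).
    by rewrite mulr0 subr0 dotp0r => /eqP; rewrite oner_eq0.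
  have : 0 < dotp x x by rewrite dotp_gt0.
  have -> : dotp x x = dotp d2 d2 - dotp d1 d2 ^+ 2 / dotp d1 d1.
    rewrite /x !dotpBl !dotpBr !dotpZl !dotpZr [dotp d2 d1]dotpC; field; exact: lt0r_neq0.
  by rewrite subr_gt0 ltr_pdivrMr // mulrC.
have Ez : (z1 * z2)%:~R = 4 * (dotp d1 d2 ^+ 2 / (dotp d1 d1 * dotp d2 d2)) :> R.
  by rewrite intrM -E1 -E2 invfM; ring.
have z4 : (z1 * z2 < 4)%R.
  rewrite -(ltr_int R) Ez -[4%:~R]/(4%:R) gtr_pMr ?ltr0n // ltr_pdivrMr ?mulr_gt0 // mul1r //.
have z1n : (z1 <= 0)%R by rewrite -(ler_int R) -E1 pmulr_lle0 ?invr_gt0 //; lra.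
have z2n : (z2 <= 0)%R by rewrite -(ler_int R) -E2 pmulr_lle0 ?invr_gt0 //; lra.
have zz : (z1 == 0) = (z2 == 0).
  rewrite -!(intr_eq0 R) -E1 -E2 !mulf_eq0 !invr_eq0 !(gt_eqF n1) !(gt_eqF n2) //.
have nE (z : int) : (z <= 0)%R -> z%:~R = - (absz z)%:R :> R.
  by move=> zn; rewrite -[in LHS](opprK z) -(ler0_norm zn) -abszE rmorphN.
have cases : [\/ z1 = 0 /\ z2 = 0, z1 = -1 /\ z2 = -1, (z1 = -2 \/ z1 = -3) /\ z2 = -1 | (z2 = -2 \/ z2 = -3) /\ z1 = -1].
  have [z10|z10] := eqVneq z1 0; first by apply: Or41; split=> //; apply/eqP; rewrite -zz z10.
  have z20 : z2 != 0 by rewrite -zz.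
  have : (z1 = -1 /\ z2 = -1) \/ ((z1 = -2 \/ z1 = -3) /\ z2 = -1) \/ ((z2 = -2 \/ z2 = -3) /\ z1 = -1).
    by move: z10 z20 z1n z2n z4; clear; nia.
  by case=> [h|[h|h]]; [apply: Or42 | apply: Or43 | apply: Or44].
have [G [ty|ty]] : exists G, ((absz z1, absz z2), G) \in cartan_types \/ ((absz z2, absz z1), G) \in cartan_types.
  case: cases => [[-> ->]|[-> ->]|[[->|->] ->]|[[->|->] ->]].
  - by exists G_A1A1; left.
  - by exists G_A2; left.
  - by exists G_B2; left.
  - by exists G_G2; left.
  - by exists G_B2; right.
  - by exists G_G2; right.
- by exists d1, d2, dl, (absz z1), (absz z2), G; split=> //; rewrite ?E1 ?E2 nE.
- exists d2, d1, dl, (absz z2), (absz z1), G; split=> //; rewrite ?[dotp d2 d1]dotpC ?E1 ?E2 ?nE //.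
  split.
  + by rewrite /= inE eq_sym d12.
  + move=> x; rewrite !inE orbC => hx; apply: (proj1 (let: And4 _ h _ _ := sdt in conj h I)); by rewrite !inE.
  + move=> x hx; rewrite posPsi in hx; have [m Em] := gen x hx; exists m; rewrite Em !big_cons big_nil !addr0 addrC //.
  + by move=> x y hx hy; apply: D; [move: hx | move: hy]; rewrite !inE orbC.
Qed.

Variables (a : V) (K : V -> seq int) (k0 : int) (m : nat).
Hypothesis ha : a \in Pos.
Local Notation ht := (ht s dual).
(** Twice the squared cosine. Like [r1] it is attached to a single root, so the bounds for the
    planes add up to sums over all positive roots. *)
Definition c2 (g : V) : R := 2 * dotp a g ^+ 2 / (dotp a a * dotp g g).
Definition r1 (g : V) : R := dotp a g / dotp g g.
Definition ptsl (P : seq V) := undup [seq pt a k0%:~R b k%:~R | b <- rem a P, k <- K b].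
Definition kind1 := k0 = - m%:Z /\ forall b, b \in Pos ->
  K b = zrange (if ht b < ht a then - m%:Z else 1 - m%:Z) m%:Z.
Definition kind2 := k0 = m.+1%:Z /\ forall b, b \in Pos ->
  K b = zrange (- m%:Z) (if ht a < ht b then m.+1%:Z else m%:Z).
(** The table bound restated through sums over roots: inside the plane [c2] sums to the number of
    positive roots less two, and [r1] to the local height of [a] less one. *)
Lemma plane_bound b : b \in Pos -> a != b ->
  (kind1 -> (size (ptsl (plane a b)))%:R + \sum_(g <- rem a (plane a b)) (m%:R * c2 g + r1 g) <=
     (\sum_(g <- rem a (plane a b)) size (K g))%N%:R :> R) /\
  (kind2 -> (size (ptsl (plane a b)))%:R + \sum_(g <- rem a (plane a b)) (m.+1%:R * c2 g - r1 g) <=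
     (\sum_(g <- rem a (plane a b)) size (K g))%N%:R :> R).
Proof.
move=> hb ab; have [e1 [e2 [dl [p [q [G [sdG ty Ep Eq]]]]]]] := plane_type ha hb ab.
have pm := pos_coord (rsPsi a b) (regPsi (a := a) (b := b)) sdG Ep Eq ty; rewrite posPsi in pm.
have inj := r2_inj sdG.
have Gty : G \in types2 by move: ty; rewrite !inE => /or4P[] /eqP[_ _ ->]; rewrite ?eqxx ?orbT.
have [ug sP _ D] := sdG; rewrite posPsi in sP.
have D12 x y x' y' : x *: e1 + y *: e2 = x' *: e1 + y' *: e2 -> x = x' /\ y = y'.
  have m1 : e1 \in [:: e1; e2] by rewrite mem_head.
  have m2 : e2 \in [:: e1; e2] by rewrite !inE eqxx orbT.
  have ne : (e1 == e2) = false by move: ug => /=; rewrite inE andbT => /negbTE.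
  move=> E; have E1 := congr1 (dotp (dl e1)) E; have E2 := congr1 (dotp (dl e2)) E.
  by move: E1 E2; rewrite !dotpDr !dotpZr !D // !eqxx ne [e2 == e1]eq_sym ne !mulr0 !mulr1 !addr0 !add0r.
have ap : a \in plane a b by rewrite mem_filter span2_l.
have [ga hga Ea] : exists2 ga, ga \in G & a = r2 e1 e2 ga by move: ap; rewrite (perm_mem pm) => /mapP[g hg ->]; exists g.
have prem : perm_eq (rem a (plane a b)) (map (r2 e1 e2) (rem ga G)).
  rewrite -(perm_cons a) -(permPl (perm_to_rem ap)); apply: (perm_trans pm).
  by have := perm_map (r2 e1 e2) (perm_to_rem hga); rewrite /= -Ea.
have e1P : e1 \in Pos by have := sP e1 (mem_head _ _); rewrite mem_filter => /andP[].
have e2P : e2 \in Pos by have := sP e2 (ltac:(by rewrite !inE eqxx orbT)); rewrite mem_filter => /andP[].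
have [h1 [h10 Eh1]] := ht_pos rs sd e1P; have [h2 [h20 Eh2]] := ht_pos rs sd e2P.
have htE g : ht (r2 e1 e2 g) = (wt h1 h2 g)%:R.
  by rewrite /r2 htD !htZ Eh1 Eh2 /wt natrD !natrM.
have rp g : g \in G -> r2 e1 e2 g \in Pos.
  move=> hg; have : r2 e1 e2 g \in plane a b by rewrite (perm_mem pm) map_f.
  by rewrite mem_filter => /andP[].
have sumc : \sum_(g <- rem a (plane a b)) c2 g = (size G)%:R - 2.
  rewrite (perm_big _ prem) /= big_map /c2 Ea.
  exact: (cos_sum (rsPsi a b) sdG Ep Eq ty hga).
have sumr : \sum_(g <- rem a (plane a b)) r1 g = (ga.1 + ga.2)%N%:R - 1.
  have := ht_rho (rsPsi a b) (regPsi (a := a) (b := b)) sdG; rewrite posPsi => /(_ a ap).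
  rewrite (big_rem a) //= divff ?dotp_eq0 ?(pos_neq0 rs ha) // => E.
  have -> : (ga.1 + ga.2)%N%:R = RootSystemBasics.ht [:: e1; e2] dl a.
    have m1 : e1 \in [:: e1; e2] by rewrite mem_head.
    have m2 : e2 \in [:: e1; e2] by rewrite !inE eqxx orbT.
    rewrite /RootSystemBasics.ht big_cons big_seq1 [a in dotp _ a]Ea; rewrite [X in dotp (dl e2) X]Ea /r2.
    rewrite !dotpDr !dotpZr !(D _ _ m1 m1, D _ _ m1 m2, D _ _ m2 m1, D _ _ m2 m2) !eqxx.
    have ne : (e1 == e2) = false by move: ug => /=; rewrite inE andbT => /negbTE.
    by rewrite ne [e2 == e1]eq_sym ne !mulr0 !mulr1 addr0 add0r natrD.
  rewrite E addrC addrK; apply: eq_bigr => g _; by rewrite /r1 dotpC.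
have [c [cf [gc c1 c2']]] := rank2_table Gty hga.
have szcf : size cf = (size G).-1.
  by case/and4P: gc => _ _ /eqP E _; rewrite -(size_map fst) E size_rem.
have szG : (1 < size G)%N by move: Gty; rewrite !inE => /or4P[] /eqP ->.
have wa : (0 < ga.1 + ga.2 <= (size G).-1)%N.
  have : all (fun g : nat * nat => (0 < g.1 + g.2 <= (size G).-1)%N) G by move: Gty; rewrite !inE => /or4P[] /eqP ->.
  by move/allP; apply.
split=> -[k0E KE].
- have KE' g : g \in G -> K (r2 e1 e2 g) = rng1 ga m h1 h2 g.
    by move=> hg; rewrite KE ?rp // /rng1 Ea !htE ltr_nat.
  have [le eq] := count_via D12 Gty pm k0 hga KE' gc; rewrite -Ea in le eq.
  have := c1 m h1 h2 h10 h20; rewrite -k0E => cc.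
  have : (size (ptsl (plane a b)) + m * (size cf - 1) + (ga.1 + ga.2 - 1) <= \sum_(g <- rem a (plane a b)) size (K g))%N.
    by rewrite eq; apply: leq_trans cc; rewrite !leq_add2r.
  rewrite -(ler_nat R) !natrD natrM !natrB ?szcf; try by move: szG wa; clear; case: (size G) => //; lia.
  rewrite big_split /= -mulr_sumr sumc sumr -[(size G).-1%:R]/((size G).-1%:R).
  have -> : (size G).-1%:R = (size G)%:R - 1 :> R by rewrite -subn1 natrB // ltnW.
  by move=> H; apply: le_trans H; rewrite le_eqVlt; apply/orP; left; apply/eqP; ring.
- have KE' g : g \in G -> K (r2 e1 e2 g) = rng2 ga m h1 h2 g.
    by move=> hg; rewrite KE ?rp // /rng2 Ea !htE ltr_nat.
  have [le eq] := count_via D12 Gty pm k0 hga KE' gc; rewrite -Ea in le eq.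
  have := c2' m h1 h2 h10 h20; rewrite -k0E => cc.
  have : (size (ptsl (plane a b)) + m * (size cf - 1) + (size cf - (ga.1 + ga.2)) <= \sum_(g <- rem a (plane a b)) size (K g))%N.
    by rewrite eq; apply: leq_trans cc; rewrite !leq_add2r.
  rewrite -(ler_nat R) !natrD natrM !natrB ?szcf; try by move: szG wa; clear; case: (size G) => //; lia.
  rewrite sumrB -mulr_sumr sumc sumr.
  have -> : (size G).-1%:R = (size G)%:R - 1 :> R by rewrite -subn1 natrB // ltnW.
  by move=> H; apply: le_trans H; rewrite le_eqVlt; apply/orP; left; apply/eqP; rewrite -natr1 natrD; ring.
Qed.
End Planes.

End RankTwoCounting.

(** * Traces on a new hyperplane of the cone *)

Module ConeCounting.
Import LinearFormDivisibility RootSystemBasics SimpleSystems CoxeterOrbits MultipleAddition EqualHeightRoots RankTwoTables RankTwoGeometry RankTwoCounting.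

Section ConeForms.
Variables (R : realType) (l : nat).
Local Notation V := 'rV[R]_l.
Local Notation W := 'rV[R]_l.+1.
(** Real levels are allowed, unlike in [cone_form], so that linear combinations of forms stay of
    this shape. *)
Definition lform (b : V) (t : R) : W := \row_(i < l.+1) (if unlift ord0 i is Some j then b 0 j else - t).
Lemma cone_formE (b : V) k : cone_form b k = lform b k%:~R. Proof. by []. Qed.
Definition low (w : W) : V := \row_j w 0 (lift ord0 j).
Definition top (w : W) : R := - w 0 ord0.
Lemma low_lform b t : low (lform b t) = b.
Proof. by apply/rowP => j; rewrite !mxE liftK. Qed.
Lemma top_lform b t : top (lform b t) = t.
Proof. by rewrite /top mxE unlift_none opprK. Qed.
Lemma lform_inj b t b' t' : lform b t = lform b' t' -> b = b' /\ t = t'.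
Proof. by move=> E; rewrite -(low_lform b t) -{2}(top_lform b t) E low_lform top_lform. Qed.
Lemma lform_comb c e b t b' t' : lform (c *: b + e *: b') (c * t + e * t') = c *: lform b t + e *: lform b' t'.
Proof. by apply/rowP => i; rewrite !mxE; case: unliftP => [j _|_]; rewrite ?mxE //; ring. Qed.
Lemma lformZ c b t : lform (c *: b) (c * t) = c *: lform b t.
Proof. by have := lform_comb c 0 b t b t; rewrite !scale0r mul0r !addr0. Qed.
Lemma lform_sum (I : Type) (r : seq I) (F : I -> V) (t : I -> R) :
  \sum_(i <- r) lform (F i) (t i) = lform (\sum_(i <- r) F i) (\sum_(i <- r) t i).
Proof.
elim: r => [|i r IH]; first by rewrite !big_nil; apply/rowP => j; rewrite !mxE; case: unlift => [?|]; rewrite ?mxE ?oppr0.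
by rewrite !big_cons IH; have := lform_comb 1 1 (F i) (t i) (\sum_(i <- r) F i) (\sum_(i <- r) t i); rewrite !scale1r !mul1r.
Qed.
Lemma H_inftyE : H_infty R l = lform 0 (-1).
Proof.
apply/rowP => i; rewrite !mxE; case: unliftP => [j ->|->]; rewrite ?mxE ?eqxx ?opprK //.
Qed.
Lemma dotp_lform b t b' t' : dotp (lform b t) (lform b' t') = t * t' + dotp b b'.
Proof.
rewrite !dotpE big_ord_recl !mxE unlift_none mulrNN; congr (_ + _).
by apply: eq_bigr => i _; rewrite !mxE liftK.
Qed.
Lemma lform_neq0 b t : b != 0 -> lform b t != 0.
Proof. by apply: contraNneq => E; rewrite -(low_lform b t) E; apply/eqP/rowP => j; rewrite !mxE. Qed.
Lemma proj_comb (n : nat) (al w w' : 'rV[R]_n) c e : al != 0 -> w' = c *: w + e *: al ->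
  w' *m projm al = c *: (w *m projm al).
Proof.
move=> a0 ->; rewrite mulmxDl -!scalemxAl [al *m _]mul_projm divff ?dotp_eq0 // scale1r subrr scaler0 addr0 //.
Qed.

Definition arr (Pos : seq V) (K : V -> seq int) : seq W := H_infty R l :: [seq cone_form b k | b <- Pos, k <- K b].
Lemma mem_arr Pos K w : reflect (w = H_infty R l \/ exists b k, [/\ b \in Pos, k \in K b & w = cone_form b k]) (w \in arr Pos K).
Proof.
rewrite inE; apply: (iffP orP) => [[/eqP|]|[/eqP|]]; [by left| |by left|].
  by move=> /allpairsPdep[b [k [hb hk ->]]]; right; exists b, k.
by move=> [b [k [hb hk ->]]]; right; apply/allpairsPdep; exists b, k.
Qed.
Lemma size_arr Pos K : size (arr Pos K) = (1 + \sum_(b <- Pos) size (K b))%N.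
Proof. by rewrite /arr /= size_allpairs_dep sumnE big_map. Qed.
Lemma cone_inj b k b' k' : cone_form b k = cone_form b' k' :> W -> b = b' /\ k = k'.
Proof. by rewrite !cone_formE => /lform_inj[-> /intr_inj ->]. Qed.
Lemma cone_ninf (b : V) k t : b != 0 -> cone_form b k <> t *: H_infty R l.
Proof.
move=> b0; rewrite cone_formE H_inftyE -lformZ scaler0 => /lform_inj[E _]; by rewrite E eqxx in b0.
Qed.
End ConeForms.

Section Keys.
Variables (R : realType) (l : nat).
Local Notation V := 'rV[R]_l.
Local Notation W := 'rV[R]_l.+1.
Variables (Phi : seq V) (v : V) (s : seq V) (dual : V -> V) (h : nat).
Hypothesis rs : rsys Phi.
Hypothesis reg : regular_vec Phi v.
Hypothesis sd : simple_dual Phi v s dual.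
Hypothesis sp : spanning Phi.
Hypothesis irr : irreducible_rs Phi.
Hypothesis l0 : (0 < l)%N.
Hypothesis szP : ((size (pos_system Phi v)).*2 = h * l)%N.
Local Notation Pos := (pos_system Phi v).
Local Notation ht := (ht s dual).

Lemma cone_np b k b' k' t : b \in Pos -> b' \in Pos -> cone_form b' k' = t *: cone_form b k -> b = b' /\ k = k'.
Proof.
move=> hb hb'; rewrite !cone_formE -lformZ => /lform_inj[E1 E2].
have bb : b = b'.
  by apply/eqP; apply: contraT => ne; case: (pos_nprop rs hb hb' ne E1).
split=> //; have : t = 1.
  have b0 := pos_neq0 rs hb; move/eqP: E1; rewrite -bb -subr_eq0 -{1}[b]scale1r -scalerBl scaler_eq0 (negbTE b0) orbF.
  by rewrite subr_eq0 => /eqP.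
by move=> t1; move: E2; rewrite t1 mul1r => /intr_inj.
Qed.
Lemma arr_simple (K : V -> seq int) : (forall b, b \in Pos -> uniq (K b)) -> simple_arr (arr Pos K).
Proof.
move=> uK; have i0 : H_infty R l != 0.
  by apply/eqP => /rowP/(_ ord0) /eqP; rewrite !mxE eqxx oner_eq0.
have nz b k : b \in Pos -> cone_form b k != 0 by move=> hb; apply/lform_neq0/(pos_neq0 rs hb).
split.
- rewrite /arr /=; apply/andP; split.
    apply/negP => /allpairsPdep[b [k [hb hk E]]].
    by apply: (@cone_ninf R l b k 1 (pos_neq0 rs hb)); rewrite scale1r.
  apply: allpairs_uniq_dep => //; first exact: pos_uniq.
  move=> [b k] [b' k'] _ _ /= /cone_inj[-> ->] //.
- by move=> w /mem_arr[->//|[b [k [hb _ ->]]]]; exact: nz.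
- move=> w w' /mem_arr[->|[b [k [hb hk ->]]]] /mem_arr[->|[b' [k' [hb' hk' ->]]]].
  + by rewrite eqxx.
  + by move=> _ t; apply: cone_ninf; apply: pos_neq0 hb'.
  + move=> _ t E; have [E0|t0] := eqVneq t 0; first by move: i0; rewrite E E0 scale0r eqxx.
    apply: (@cone_ninf R l b k t^-1 (pos_neq0 rs hb)); by rewrite E scalerA mulVf // scale1r.
  + by move=> ne t E; have [Eb Ek] := cone_np hb hb' E; rewrite Eb Ek eqxx in ne.
Qed.
Lemma Phi_split (F : V -> R) : (forall x, F (- x) = F x) -> \sum_(b <- Phi) F b = 2 * \sum_(b <- Pos) F b.
Proof.
move=> FN; have pm : perm_eq Phi (Pos ++ map -%R Pos).
  case: (rs) => uP _ _ _ _; apply: uniq_perm => //.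
    rewrite cat_uniq (pos_uniq v rs) /= map_inj_uniq ?(pos_uniq v rs) ?andbT; last exact: oppr_inj.
    by apply/hasPn => x /mapP[y hy ->]; apply: pos_notN.
  move=> x; rewrite mem_cat; apply/idP/orP => [hx|[/pos_root //|/mapP[y hy ->]]].
    case/orP: (pos_or rs reg hx) => hh; [by left | right; apply/mapP; exists (- x) => //; by rewrite opprK].
  by move/pos_root: hy => /(RootSystemBasics.rootN rs).
rewrite (perm_big _ pm) big_cat big_map /=; under [X in _ + X]eq_bigr do rewrite FN.
by rewrite mulrDl !mul1r.
Qed.

Variables (a : V) (K : V -> seq int) (k0 : int) (m : nat).
Hypothesis ha : a \in Pos.
Let a0 : a != 0. Proof. exact: pos_neq0 ha. Qed.
Let ur : uniq (rem a Pos). Proof. exact/rem_uniq/pos_uniq. Qed.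
Let remP b : (b \in rem a Pos) = (b != a) && (b \in Pos).
Proof. by rewrite mem_rem_uniq ?pos_uniq. Qed.
Lemma sum_c2 : \sum_(g <- rem a Pos) c2 a g = h%:R - 2.
Proof.
have szPhi : size Phi = (h * l)%N.
  have := Phi_split (F := fun=> 1) (fun=> erefl); rewrite !big_const_seq !count_predT !iter_addr_0 => /eqP.
  by rewrite -natrM eqr_nat mul2n szP => /eqP.
have := schur rs sp irr l0 szPhi a; rewrite Phi_split; last first.
  by move=> x; rewrite dotpNr dotpNl dotpNr sqrrN opprK.
have aa : dotp a a != 0 by rewrite dotp_eq0.
rewrite (big_rem a) //= => E.
have -> : \sum_(g <- rem a Pos) c2 a g = (2 / dotp a a) * \sum_(g <- rem a Pos) dotp a g ^+ 2 / dotp g g.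
  by rewrite mulr_sumr; apply: eq_bigr => g _; rewrite /c2 invfM; ring.
move: E; set X := \sum_(_ <- _) _ => E.
apply: (mulfI aa); have -> : dotp a a * (2 / dotp a a * X) = 2 * X by field.
by move: E; rewrite expr2 mulfK // mulrDr => E; rewrite mulrBr [dotp a a * h%:R]mulrC -E; ring.
Qed.
Lemma sum_r1 : \sum_(g <- rem a Pos) r1 a g = ht a - 1.
Proof.
rewrite (ht_rho rs reg sd ha) [X in _ = X - _](big_rem a) //= divff ?dotp_eq0 // addrC addrK.
by apply: eq_bigr => g _; rewrite /r1 dotpC.
Qed.
Local Notation plane := (plane Phi v).
Let planes := undup [seq plane a b | b <- rem a Pos].
Lemma plane_fibre b : b \in rem a Pos -> [seq c <- rem a Pos | plane a c == plane a b] = rem a (plane a b).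
Proof.
rewrite remP => /andP[ba hb].
have uP := pos_uniq v rs; rewrite (rem_filter _ uP) (rem_filter _ (filter_uniq _ uP)).
rewrite -[LHS]filter_predI -[RHS]filter_predI; apply: eq_in_filter => c hc /=.
rewrite andbC; have [//|ca] := eqVneq c a; rewrite !andTb.
apply/eqP/idP => [E|sc].
  have : c \in plane a c by rewrite mem_filter span2_r.
  by rewrite E mem_filter => /andP[].
apply: plane_same; first by rewrite mem_filter sc.
by move=> t E; apply: (pos_nprop rs ha hc (ltac:(by rewrite eq_sym)) E).
Qed.
Lemma sum_planes (T : nmodType) (F : V -> T) : \sum_(b <- rem a Pos) F b = \sum_(P <- planes) \sum_(b <- rem a P) F b.
Proof.
transitivity (\sum_(P <- planes) \sum_(b <- rem a Pos | plane a b == P) F b).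
  under [RHS]eq_bigr do rewrite big_mkcond; rewrite exchange_big /= big_seq [RHS]big_seq.
  apply: eq_bigr => b hb; rewrite (big_rem (plane a b)) /= ?mem_undup ?map_f // eqxx big_seq big1 ?addr0 // => P.
  by rewrite mem_rem_uniq ?undup_uniq // inE eq_sym => /andP[/negbTE ->].
rewrite big_seq [RHS]big_seq; apply: eq_bigr => P; rewrite mem_undup => /mapP[b hb ->].
by rewrite -big_filter plane_fibre.
Qed.
(** The hyperplanes parallel to [a] and the one at infinity share a single trace, labelled [None];
    every other trace is given by a plane through [a] and a point of it. *)
Definition key (w : W) : option (seq V * V) :=
  if (low w == 0) || (low w == a) then None else Some (plane a (low w), pt a k0%:~R (low w) (top w)).
Lemma key_prop w w' : k0 \notin K a -> w \in arr Pos K -> w' \in arr Pos K -> key w = key w' ->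
  exists c, w' *m projm (cone_form a k0) = c *: (w *m projm (cone_form a k0)).
Proof.
move=> nk hw hw'; set al := cone_form a k0; have al0 : al != 0 by apply: lform_neq0.
suff: key w = key w' -> exists c e, w' = c *: w + e *: al.
  by move=> H /H[c [e E]]; exists c; exact: proj_comb E.
have nullP u : u \in arr Pos K -> (low u == 0) || (low u == a) ->
    exists x y, u = x *: al + y *: H_infty R l /\ y != 0.
  move=> /mem_arr[-> _|[b [k [hb hk ->]]]].
    by exists 0, 1; rewrite scale0r add0r scale1r oner_eq0.
  rewrite cone_formE low_lform (negbTE (pos_neq0 rs hb)) /= => /eqP E; rewrite E in hk *.
  exists 1, (k0%:~R - k%:~R); rewrite H_inftyE -lform_comb scaler0 scale1r addr0; split.
    by congr lform; ring.
  by rewrite subr_eq0 eqr_int; apply: contraNneq nk => ->.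
have someP u : u \in arr Pos K -> (low u == 0) || (low u == a) = false ->
    exists b k, [/\ b \in Pos, b != a & u = cone_form b k].
  move=> /mem_arr[->|[b [k [hb hk ->]]]]; first by rewrite H_inftyE low_lform eqxx.
  by rewrite cone_formE low_lform => /norP[_ ba]; exists b, k.
rewrite /key; case: ifP => n1; case: ifP => n2 //.
  have [x [y [-> y0]]] := nullP _ hw n1; have [x' [y' [-> y0']]] := nullP _ hw' n2.
  move=> _; exists (y' / y), (x' - y' / y * x).
  by rewrite scalerDr !scalerA divfK // addrAC -scalerDl addrC [_ + (x' - _)]addrC subrK addrC.
have [b [k [hb ba Ew]]] := someP _ hw n1; have [b' [k' [hb' ba' Ew']]] := someP _ hw' n2.
rewrite Ew Ew' !cone_formE !low_lform !top_lform => -[Epl Ept].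
have nb c : c \in Pos -> c != a -> forall t, c <> t *: a.
  by move=> hc ca t E; apply: (pos_nprop rs ha hc (ltac:(by rewrite eq_sym)) E).
have : b' \in plane a b by rewrite Epl mem_filter span2_r.
rewrite mem_filter => /andP[/asboolP[x [y Eb]] _].
have : dotp (pt a k0%:~R b k%:~R) b' = k'%:~R by rewrite Ept pt_b //; exact: nb.
rewrite Eb dotpDr !dotpZr pt_a // pt_b //; last exact: nb.
move=> Ek; exists y, x; rewrite -Ek /al cone_formE -lform_comb; congr lform; first by rewrite addrC.
by rewrite addrC.
Qed.
Lemma key_count : (size (undup (map key (arr Pos K))) <= 1 + \sum_(P <- planes) size (ptsl a K k0 P))%N.
Proof.
pose L := None :: [seq Some (P, x) | P <- planes, x <- ptsl a K k0 P].
have -> : (1 + \sum_(P <- planes) size (ptsl a K k0 P) = size L)%N.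
  by rewrite /L /= size_allpairs_dep sumnE big_map.
apply: uniq_leq_size; first exact: undup_uniq.
move=> x; rewrite mem_undup => /mapP[w /mem_arr[->|[b [k [hb hk ->]]]] ->]; rewrite /key.
  by rewrite H_inftyE low_lform eqxx mem_head.
rewrite cone_formE low_lform top_lform; case: ifP => [_|/norP[_ ba]]; first by rewrite mem_head.
rewrite inE /=; apply/allpairsPdep; exists (plane a b), (pt a k0%:~R b k%:~R); split=> //.
  by rewrite mem_undup map_f // remP ba.
rewrite mem_undup; apply/allpairsPdep; exists b, k; split=> //.
by rewrite (mem_rem_uniq _ (filter_uniq _ (pos_uniq v rs))) inE ba mem_filter span2_r.
Qed.
(** The common trace at infinity gives the excess 2m, respectively 2m + 1. The planes add m (h - 2)
    + ht a - 1, respectively (m + 1) (h - 2) - ht a + 1; the totals are the two values of [d]. *)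
Lemma key_cnt d :
  (kind1 Phi v s dual a K k0 m -> d%:R = (m * h)%N%:R + ht a - 1 ->
     (d + size (undup (map key (arr Pos K))) <= size (arr Pos K))%N /\ k0 \notin K a) /\
  (kind2 Phi v s dual a K k0 m -> d%:R = (m * h + h)%N%:R - ht a ->
     (d + size (undup (map key (arr Pos K))) <= size (arr Pos K))%N /\ k0 \notin K a).
Proof.
have red N : (d + \sum_(P <- planes) size (ptsl a K k0 P) <= size (K a) + \sum_(g <- rem a Pos) size (K g))%N ->
    N = size (arr Pos K) -> (d + size (undup (map key (arr Pos K))) <= N)%N.
  move=> le ->; rewrite size_arr (big_rem a) //=; apply: leq_trans (leq_add (leqnn d) key_count) _.
  by rewrite addnCA leq_add2l.
have inP P : P \in planes -> exists2 b, b \in Pos /\ a != b & P = plane a b.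
  by rewrite mem_undup => /mapP[b]; rewrite remP eq_sym => /andP[ba hb] ->; exists b.
split=> kd dE; split.
- apply: (red _ _ erefl).
  have bnd : \sum_(P <- planes) ((size (ptsl a K k0 P))%:R + \sum_(g <- rem a P) (m%:R * c2 a g + r1 a g)) <=
     \sum_(P <- planes) (\sum_(g <- rem a P) size (K g))%N%:R :> R.
    rewrite big_seq [leRHS]big_seq; apply: ler_sum => P /inP[b [hb ab] ->].
    by case: (plane_bound rs reg sd K k0 m ha hb ab) => /(_ kd).
  move: bnd; rewrite big_split /= -sum_planes -!natr_sum -(sum_planes (fun g => size (K g))).
  rewrite big_split /= -mulr_sumr sum_c2 sum_r1 => bnd.
  have sK : size (K a) = (2 * m)%N.
    by case: kd => _ /(_ a ha) ->; rewrite ltxx size_zrange; lia.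
  by rewrite -(ler_nat R) !natrD sK dE !natrM; lra.
- by case: kd => -> /(_ a ha) ->; rewrite ltxx mem_zrange; lia.
- apply: (red _ _ erefl).
  have bnd : \sum_(P <- planes) ((size (ptsl a K k0 P))%:R + \sum_(g <- rem a P) (m.+1%:R * c2 a g - r1 a g)) <=
     \sum_(P <- planes) (\sum_(g <- rem a P) size (K g))%N%:R :> R.
    rewrite big_seq [leRHS]big_seq; apply: ler_sum => P /inP[b [hb ab] ->].
    by case: (plane_bound rs reg sd K k0 m ha hb ab) => _ /(_ kd).
  move: bnd; rewrite big_split /= -sum_planes -!natr_sum -(sum_planes (fun g => size (K g))).
  rewrite sumrB -mulr_sumr sum_c2 sum_r1 => bnd.
  have sK : size (K a) = (2 * m + 1)%N.
    by case: kd => _ /(_ a ha) ->; rewrite ltxx size_zrange; lia.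
  by rewrite -(ler_nat R) !natrD sK dE !natrD !natrM; move: bnd; rewrite -natr1; lra.
- by case: kd => -> /(_ a ha) ->; rewrite ltxx mem_zrange; lia.
Qed.
End Keys.

End ConeCounting.

(** * Degrees of bases, the pairing argument and restriction to infinity *)

Module FreeModuleBases.
Import LinearFormDivisibility HomogeneousPolynomials SaitoCriterion RootSystemBasics CoxeterEigenvalues MultipleAddition ConeCounting.

Section FreeBases.
Variables (R : realType) (n : nat).
Local Notation V := 'rV[R]_n.
Local Notation S := {mpoly R[n]}.
Local Notation lf := (@linform R n).

Lemma freeb_perm (A B : seq V) M dg : perm_eq A B -> freeb A M dg -> freeb B M dg.
Proof.
move=> pm [h1 h2 [c c0 E]]; split=> // [a j ha|]; first by apply: h2; rewrite (perm_mem pm).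
by exists c => //; rewrite E (perm_big _ pm).
Qed.
Lemma prod_lf_neq0 (A : seq V) : (forall a, a \in A -> a != 0) -> \prod_(a <- A) lf a != 0.
Proof.
move=> nz; rewrite big_seq prodf_seq_neq0; apply/allP => a ha; apply/implyP => _; by rewrite linform_eq0 nz.
Qed.
Lemma freeb_det (A : seq V) M dg : simple_arr A -> freeb A M dg -> \det M != 0.
Proof.
move=> [_ nz _] [_ _ [c c0 ->]]; rewrite -mul_mpolyC mulf_neq0 ?mpolyC_eq0 ?prod_lf_neq0 //.
Qed.
Lemma mx_inj0 (M : 'M[S]_n) k (u : 'M[S]_(n, k)) : \det M != 0 -> M *m u = 0 -> u = 0.
Proof.
move=> d0 E; have : \det M *: u = 0 by rewrite -mul_scalar_mx -mul_adj_mx -mulmxA E mulmx0.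
by move=> Eu; apply/matrixP => i j; have /matrixP/(_ i j) := Eu; rewrite !mxE => /eqP; rewrite mulf_eq0 (negbTE d0) => /eqP.
Qed.
Lemma freeb_gen (A : seq V) M dg (th : 'cV[S]_n) : simple_arr A -> freeb A M dg ->
  (forall a, a \in A -> mdvd (lf a) ((cmx n a *m th) 0 0)) -> exists f : 'cV[S]_n, th = M *m f.
Proof.
move=> [uA nz np] [_ dv [c c0 dM]] hth.
apply: (@saito R n _ A id (fun=> 1%N) uA nz np M c c0).
- by rewrite dM; congr (_ *: _); apply: eq_bigr => a _; rewrite expr1.
- move=> j a ha; rewrite expr1; have := dv a j ha; congr mdvd; rewrite /app !mxE.
  by apply: eq_bigr => i _; rewrite !mxE.
- by move=> a ha; rewrite expr1; apply: hth.
Qed.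
Lemma freeb_exponents (A : seq V) M dg (d : seq nat) : simple_arr A -> freeb A M dg ->
  perm_eq d [seq dg j | j <- enum 'I_n] -> free_with_exponents A d.
Proof.
move=> sA fr pm; have [hom dv _] := fr; have d0 := freeb_det sA fr.
split; first by rewrite (perm_size pm) size_map size_enum_ord.
have [p Ep] : exists p : 'S_n, d = [tuple tnth [tuple dg j | j < n] (p i) | i < n].
  by apply/tuple_permP; exact: pm.
have dE (k : 'I_n) : nth 0%N d k = dg (p k) by rewrite Ep -tnth_nth !tnth_mktuple.
exists (fun k i => M i (p k)); split.
- by move=> k a ha; have [q E] := dv a (p k) ha; exists q; rewrite -E appE.
- by move=> k i; rewrite dE; exact: hom.
- move=> th hth; have [|f Ef] := @freeb_gen A M dg (\col_i th i) sA fr.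
    move=> a ha; have [q E] := hth a ha; exists q; rewrite -E mxE; apply: eq_bigr => i _.
    by rewrite !mxE mul_mpolyC.
  exists (fun k => f (p k) 0) => i; have /matrixP/(_ i 0) := Ef; rewrite !mxE => ->.
  rewrite (reindex_inj (@perm_inj _ p)) /=; apply: eq_bigr => k _; exact: mulrC.
- move=> f g E k; pose u : 'cV[S]_n := \col_j (f (p^-1 j)%g - g (p^-1 j)%g).
  have : u = 0.
    apply: (mx_inj0 d0); apply/matrixP => i j; rewrite !mxE (reindex_inj (@perm_inj _ p)) /=.
    rewrite (eq_bigr (fun k => f k * M i (p k) - g k * M i (p k))); last first.
      by move=> x _; rewrite !mxE permK mulrC mulrBl.
    by rewrite sumrB E subrr.
  by move=> /matrixP/(_ (p k) 0); rewrite !mxE permK => /eqP; rewrite subr_eq0 => /eqP.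
Qed.
Lemma sum_deg (A : seq V) M dg : simple_arr A -> freeb A M dg -> (\sum_j dg j = size A)%N.
Proof.
move=> sA fr; have [hom _ [c c0 E]] := fr; have d0 := freeb_det sA fr; have [_ nz _] := sA.
have h1 := det_homog hom.
have h2 : \det M \is (size A).-homog.
  rewrite E rpredZ // -sum1_size; apply: (@homog_prod_seq _ _ _ _ _ (fun=> 1%N)) => a; exact: linform_homog.
exact: dhomog_uniq d0 h1 h2.
Qed.
(** A nonzero entry of the transition matrix can only raise the degree. Its determinant has a
    nonzero term, which gives a permutation with dg i at most dg' (p i); the degree sums agree, so
    equality holds throughout. *)
Lemma free_degrees (A : seq V) M M' dg dg' : simple_arr A -> freeb A M dg -> freeb A M' dg' ->
  perm_eq [seq dg j | j <- enum 'I_n] [seq dg' j | j <- enum 'I_n].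
Proof.
move=> sA fr fr'; have [hom dv _] := fr; have [hom' dv' _] := fr'.
have d0 := freeb_det sA fr; have d0' := freeb_det sA fr'.
have : forall j, exists f : 'cV[S]_n, col j M' = M *m f.
  move=> j; apply: freeb_gen sA fr _ => a ha; have := dv' a j ha; congr mdvd.
  by rewrite /app !mxE; apply: eq_bigr => i _; rewrite !mxE.
move=> /choice[f Hf]; pose T : 'M[S]_n := \matrix_(i, j) f j i 0.
have MT : M' = M *m T.
  apply/matrixP => i j; have /matrixP/(_ i 0) := Hf j; rewrite !mxE => ->.
  by apply: eq_bigr => k _; rewrite mxE.
have le k j : T k j != 0 -> (dg k <= dg' j)%N.
  pose D : 'M[S]_n := \matrix_(k, j) (2 ^+ dg k *: act 2%:M (T k j) - 2 ^+ dg' j *: T k j).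
  have D0 : D = 0.
    apply: (mx_inj0 d0); apply/matrixP => i x; rewrite !mxE.
    have : act 2%:M (M' i x) = 2 ^+ dg' x *: M' i x by apply: scal_homog.
    rewrite MT !mxE rmorph_sum scaler_sumr /= => /eqP; rewrite -subr_eq0 -sumrB => /eqP E0.
    apply: etrans E0; apply: eq_bigr => y _; rewrite rmorphM /= (scal_homog (hom i y)) mxE mulrBr.
    by rewrite -!scalerAr -scalerAl.
  move=> nz; have [mu hmu] : exists mu, (T k j)@_mu != 0.
    apply: contrapT => /forallNP N; move/eqP: nz; apply; apply/mpolyP => mu; rewrite mcoeff0.
    by apply/eqP; have /negP := N mu; rewrite negbK.
  have TE : T k j = f j k 0 by rewrite mxE.
  rewrite TE in hmu; have /matrixP/(_ k j) := D0; rewrite !mxE => /(congr1 (fun p : S => p@_mu)).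
  rewrite mcoeffB !mcoeffZ act_scal mcoeff0 => /eqP; rewrite subr_eq0 mulrA => /eqP E; have := mulIf hmu E.
  rewrite -exprD => E'; have : 2 ^+ (dg k + mdeg mu) <= 2 ^+ dg' j :> R by rewrite E'.
  by rewrite ler_eXn2l ?ltr1n //; apply: leq_trans (leq_addr _ _).
have dT : \det T != 0 by apply: contraNneq d0' => E; rewrite MT det_mulmx E mulr0.
have [p Hp] : exists p : 'S_n, forall i, T i (p i) != 0.
  apply: contrapT => /forallNP N; move/eqP: dT; apply; rewrite /determinant big1 // => p _.
  have /existsNP[i /negP] := N p; rewrite negbK => /eqP E.
  by rewrite (bigD1 i) //= E mul0r mulr0.
have eqd i : dg i = dg' (p i).
  have tot : (\sum_i dg' (p i) = \sum_i dg i)%N.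
    by rewrite (sum_deg sA fr) -(sum_deg sA fr') [RHS](reindex_inj (@perm_inj _ p)).
  have : (\sum_i (dg' (p i) - dg i) = 0)%N.
    rewrite sumnB ?tot ?subnn // => x _; exact: le.
  move/eqP; rewrite sum_nat_eq0 => /forallP/(_ i) /=; rewrite subn_eq0 => h1.
  by apply/eqP; rewrite eqn_leq h1 le.
have -> : map dg (enum 'I_n) = map dg' (map p (enum 'I_n)).
  by rewrite -(map_comp dg' p); apply: eq_map => i; exact: eqd.
apply: perm_map; apply: uniq_perm; [by rewrite (map_inj_uniq (@perm_inj _ p)) enum_uniq | exact: enum_uniq |].
by move=> i; rewrite mem_enum inE; apply/mapP; exists ((p^-1)%g i); rewrite ?mem_enum ?permKV.
Qed.
End FreeBases.

Section Pairing.
Variables (R : realType) (n : nat).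
Local Notation V := 'rV[R]_n.
Local Notation S := {mpoly R[n]}.
Local Notation lf := (@linform R n).
Definition mdm (u : S) a b (M : 'M[S]_(a, b)) := forall i j, mdvd u (M i j).
Lemma mdmD u a b (M N : 'M[S]_(a, b)) : mdm u M -> mdm u N -> mdm u (M + N).
Proof. by move=> h1 h2 i j; rewrite mxE; apply: mdvdD. Qed.
Lemma mdmB u a b (M N : 'M[S]_(a, b)) : mdm u M -> mdm u N -> mdm u (M - N).
Proof. by move=> h1 h2 i j; rewrite !mxE; apply: mdvdB. Qed.
Lemma mdmZ u a b c (M : 'M[S]_(a, b)) : mdm u M -> mdm u (c *: M).
Proof. by move=> h1 i j; rewrite mxE; apply: mdvd_mull. Qed.
Lemma mdmMl u a b c (M : 'M[S]_(a, b)) (N : 'M[S]_(b, c)) : mdm u N -> mdm u (M *m N).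
Proof. by move=> h1 i j; rewrite mxE; apply: mdvd_sum => k _; apply: mdvd_mull. Qed.
Lemma mdmMr u a b c (M : 'M[S]_(a, b)) (N : 'M[S]_(b, c)) : mdm u M -> mdm u (M *m N).
Proof. by move=> h1 i j; rewrite mxE; apply: mdvd_sum => k _; apply: mdvd_mulr. Qed.
Lemma mdm_anti (a : V) k m (M : 'M[S]_(k, m)) : a != 0 -> map_mx (act (refl a)) M = - M -> mdm (lf a) M.
Proof. by move=> a0 E i j; apply: anti_dvd => //; have /matrixP/(_ i j) := E; rewrite !mxE. Qed.

Lemma adj_dvd (P : 'M[S]_n) (th : 'cV[S]_n) (a : V) u : a != 0 -> mdm u (cmx n a *m P) -> mdm u (cmx n a *m th) ->
  mdm u (\adj P *m th).
Proof.
move=> a0 h1 h2 j z; rewrite (ord1 z) adj_repl; apply: (@row_dvd_det _ _ _ _ a) => // y.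
have [->|yj] := eqVneq y j.
  have := h2 0 0; congr mdvd; rewrite !mxE; apply: eq_bigr => i _; by rewrite !mxE eqxx.
have := h1 0 y; congr mdvd; rewrite !mxE; apply: eq_bigr => i _; by rewrite !mxE (negbTE yj).
Qed.

(* Modulo the form a, equivariance makes P block diagonal for the splitting into the line a and its
   orthogonal complement, so the a-singular part of P^-1 th is parallel to a. *)
Lemma local_pairing (a : V) (q1 : nat) (P : 'M[S]_n) (D : S) (th vt : 'cV[S]_n) :
  a != 0 -> odd q1 -> mdm (lf a ^+ q1.+1) (cmx n a *m P) ->
  map_mx (act (refl a)) P = cmx n (refl a) *m P *m cmx n (refl a) ->
  \det P = lf a ^+ q1.+1 * D -> ~ mdvd (lf a) D ->
  mdm (lf a ^+ q1) (cmx n a *m th) -> mdm (lf a) (cmx n a *m vt) ->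
  mdm (lf a ^+ q1.+1) (vt^T *m (\adj P *m th)).
Proof.
move=> a0 qo hP eqv dP nD hth hvt; have aa : dotp a a != 0 by rewrite dotp_eq0.
have la0 : lf a != 0 by rewrite linform_eq0.
set s := cmx n (refl a) in eqv; pose pi := cmx n (projm a); pose aT := cmx n a^T; pose al := cmx n a.
pose c : S := ((dotp a a)^-1)%:MP.
have E1 : al *m aT = ((dotp a a)%:MP)%:M.
  rewrite -cmxM [a *m _]mx11_scalar -/(dotp a a); apply/matrixP => i j; rewrite !mxE !ord1 eqxx !mulr1n //.
have cd : c * (dotp a a)%:MP = 1 by rewrite -mpolyCM mulVf.
have paT : projm a *m a^T = 0.
  by apply: trmx_inj; rewrite trmx_mul trmxK projmT trmx0 mul_projm divff // scale1r subrr.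
have E2 : pi *m aT = 0 by rewrite -cmxM paT /cmx map_mx0.
have E3 : al *m pi = 0 by rewrite -cmxM mul_projm divff // scale1r subrr /cmx map_mx0.
have E4 : 1%:M = pi + c *: (aT *m al).
  rewrite /aT /al -cmxM -cmx1; apply/matrixP => i j; rewrite !mxE -mpolyCM -mpolyCD; congr (_%:MP).
  by rewrite subrK.
have E5 : pi *m pi = pi by rewrite -[RHS]mulmx1 E4 mulmxDr -scalemxAr [pi *m (aT *m _)]mulmxA E2 mul0mx scaler0 addr0.
have sp : s *m pi = pi.
  rewrite -cmxM; congr cmx; by apply: trmx_inj; rewrite trmx_mul projmT reflT proj_refl.
have ps : pi *m s = pi by rewrite -cmxM proj_refl.
have saT : s *m aT = - aT.
  rewrite -cmxM -(reflT a) -trmx_mul refl_self //; apply/matrixP => i j; by rewrite !mxE mpolyCN.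
have als : al *m s = - al by rewrite -cmxM refl_self //; apply/matrixP => i j; rewrite !mxE mpolyCN.
have [z Ez] : exists z : 'cV[S]_n, \adj P *m th = lf a ^+ q1 *: z.
  have := @adj_dvd P th a (lf a ^+ q1) a0 _ hth.
  have H : mdm (lf a ^+ q1) (cmx n a *m P) by move=> i j; apply: mdvd_trans (hP i j); apply: mdvd_exp.
  move=> /(_ H) H'; have [f Hf] := choice (fun j => H' j 0); exists (\col_j f j).
  by apply/matrixP => i j; rewrite (ord1 j) Hf !mxE.
have api : map_mx (act (refl a)) pi = pi by exact: act_cmx.
have aaT : map_mx (act (refl a)) aT = aT by exact: act_cmx.
have aal : map_mx (act (refl a)) al = al by exact: act_cmx.
have aTE : aT = al^T by rewrite /al /aT /cmx map_trmx.
rewrite -/al in hP hth hvt; clearbody s pi aT al.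
have [r Er] : exists r : 'rV[S]_n, al *m P = lf a ^+ q1.+1 *: r.
  have [r Hr] := choice (hP 0); exists (\row_j r j); apply/matrixP => i j; rewrite (ord1 i) Hr mxE mxE //.
have lq0 : lf a ^+ q1.+1 != 0 by rewrite expf_neq0.
have canq x y (M N : 'M[S]_(x, y)) : lf a ^+ q1.+1 *: M = lf a ^+ q1.+1 *: N -> M = N.
  by move=> E; apply/matrixP => i j; apply: (mulfI lq0); have /matrixP/(_ i j) := E; rewrite !mxE.
have actq : act (refl a) (lf a ^+ q1.+1) = lf a ^+ q1.+1.
  by rewrite rmorphXn /= act_refl_lin refl_self // linformN -mulN1r exprMn -signr_odd /= qo /= expr0 mul1r.
have ra : map_mx (act (refl a)) r = - (r *m s).
  apply: canq; rewrite -{1}actq -map_mxZ -Er map_mxM aal eqv !mulmxA als !mulNmx Er -scalemxAl scalerN //.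
have D1 : mdm (lf a) (r *m pi).
  by apply: mdm_anti => //; rewrite map_mxM api ra mulNmx -mulmxA sp.
have D2 : mdm (lf a) (pi *m P *m aT).
  by apply: mdm_anti => //; rewrite !map_mxM api aaT eqv !mulmxA ps -mulmxA saT mulmxN.
(* [W] is [P] with the power of [a] removed from its component along [a]. Its determinant is prime
   to the form, so divisibility by the form can be pulled back through [W]. *)
pose W := pi *m P + c *: (aT *m r).
have PW : P = (1%:M - aT *m ((c - c * lf a ^+ q1.+1) *: al)) *m W.
  have pW : pi *m W = pi *m P.
    by rewrite /W mulmxDr mulmxA E5 -scalemxAr mulmxA E2 mul0mx scaler0 addr0.
  have aW : al *m W = r.
    rewrite /W mulmxDr mulmxA E3 mul0mx add0r -scalemxAr mulmxA E1 mul_scalar_mx scalerA cd scale1r //.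
  have -> : 1%:M - aT *m ((c - c * lf a ^+ q1.+1) *: al) = pi + (c * lf a ^+ q1.+1) *: (aT *m al).
    by rewrite E4 -scalemxAr scalerBl opprB addrACA subrr addr0.
  rewrite mulmxDl pW -scalemxAl -mulmxA aW.
  by rewrite -{1}[P]mul1mx E4 mulmxDl -scalemxAl -mulmxA Er -scalemxAr scalerA.
have dW : \det W = D.
  apply: (mulfI lq0); rewrite -dP {1}PW det_mulmx det1B -scalemxAl E1 !mxE eqxx mulr1n; congr (_ * _).
  by rewrite mulrBl mulrAC cd mul1r opprB addrC subrK.
have Pz : P *m z = (lf a * D) *: th.
  have : lf a ^+ q1 *: (P *m z) = lf a ^+ q1 *: ((lf a * D) *: th).
    by rewrite scalemxAr -Ez mulmxA mul_mx_adj mul_scalar_mx dP exprSr scalerA mulrA.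
  move=> E; apply/matrixP => i j; apply: (@mulfI _ (lf a ^+ q1)); first by rewrite expf_neq0.
  by have /matrixP/(_ i j) := E; rewrite [LHS]mxE [RHS]mxE.
have piz : mdm (lf a) (pi *m z).
  have WZ : mdm (lf a) (W *m (pi *m z)).
    rewrite /W mulmxDl; apply: mdmD; last first.
      by rewrite -scalemxAl -mulmxA; apply/mdmZ/mdmMl; rewrite mulmxA; apply: mdmMr.
    have -> : pi *m z = z - c *: (aT *m (al *m z)).
      by rewrite -{2}[z]mul1mx E4 mulmxDl -scalemxAl -mulmxA addrK.
    rewrite mulmxBr; apply: mdmB; last by rewrite -scalemxAr [pi *m P *m (aT *m _)]mulmxA; apply/mdmZ/mdmMr; exact: D2.
    rewrite -mulmxA Pz; apply: mdmMl => i j; rewrite mxE -mulrA; exact: mdvd_mulr (mdvd_refl _).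
  move=> i j; have := mdmMl (\adj W) WZ i j; rewrite mulmxA mul_adj_mx mul_scalar_mx dW mxE.
  by case/(lin_prime a0).
rewrite Ez -scalemxAr exprSr => i j; rewrite mxE; apply: mdvdM; first exact: mdvd_refl.
move: i j; have -> : vt^T *m z = vt^T *m (pi *m z) + c *: ((al *m vt)^T *m (al *m z)).
  rewrite -{1}[z]mul1mx E4 mulmxDl mulmxDr -scalemxAl -scalemxAr; congr (_ + _ *: _).
  by rewrite trmx_mul -aTE !mulmxA.
apply: mdmD; first exact: mdmMl.
by apply/mdmZ/mdmMr => i j; rewrite mxE; exact: hvt.
Qed.

(** Entries of B^T adj(P) th contain the full power of every root: outside [X] because [th] has it,
    inside [X] because the column of [B] supplies the missing factor through [local_pairing]. Their
    degree is below that of [\det P], and both [B] and [\adj P] cancel. *)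
Lemma pairing_zero (Pos X : seq V) (q1 d kh : nat) (P B : 'M[S]_n) (dg : 'I_n -> nat) (t : R) (th : 'cV[S]_n) :
  simple_arr Pos -> odd q1 -> simple_arr X -> freeb X B dg ->
  (forall i j, P i j \is kh.-homog) -> t != 0 -> \det P = t *: \prod_(a <- Pos) lf a ^+ q1.+1 ->
  (forall a, a \in Pos -> mdm (lf a ^+ q1.+1) (cmx n a *m P)) ->
  (forall a, a \in Pos -> map_mx (act (refl a)) P = cmx n (refl a) *m P *m cmx n (refl a)) ->
  (forall i, th i 0 \is d.-homog) ->
  (forall a, a \in Pos -> mdm (lf a ^+ q1) (cmx n a *m th)) ->
  (forall a, a \in Pos -> a \notin X -> mdm (lf a ^+ q1.+1) (cmx n a *m th)) ->
  (forall j, (dg j + d < kh)%N) -> th = 0.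
Proof.
move=> sP qo sX fB hP t0 dP rP eqv hth th1 th2 small; have [uP nz np] := sP; have [homB dvB _] := fB.
have dB := freeb_det sX fB.
set Q := \prod_(a <- Pos) _ in dP.
have Q0 : Q != 0.
  rewrite /Q big_seq prodf_seq_neq0; apply/allP => a ha; apply/implyP => _.
  by rewrite expf_neq0 // linform_eq0 nz.
have QE : Q = t^-1 *: \det P by rewrite dP scalerA mulVf // scale1r.
have hQ : Q \is (\sum_(j < n) kh).-homog by rewrite QE rpredZ // (@det_homog _ _ _ _ (fun=> kh)).
have d0 : \det P != 0 by rewrite dP -mul_mpolyC mulf_neq0 ?mpolyC_eq0.
have nd a : a \in Pos -> ~ mdvd (lf a) (t *: \prod_(b <- rem a Pos) lf b ^+ q1.+1).
  move=> ha; rewrite -mul_mpolyC => /(lin_prime (nz _ ha))[[u]|].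
    move=> /(congr1 (fun p : S => t^-1 *: (p * 1))); rewrite mulr1 -mul_mpolyC -mpolyCM mulVf // => E.
    have : mdvd (lf a) 1 by exists (t^-1 *: u); rewrite -mpolyC1 E mulr1 scalerAr.
    move=> /(mdvd_lin 1 (nz _ ha)); rewrite rmorph1 => /eqP; by rewrite oner_eq0.
  rewrite big_seq; apply: (lin_dvd_prod (nz _ ha)) => b; rewrite mem_rem_uniq // inE => /andP[ba hb].
  move=> /(lin_dvdX (nz _ ha)); apply: lin_ndvd; [exact: nz | by apply: np => //; rewrite eq_sym].
have y0 : B^T *m (\adj P *m th) = 0.
  apply/matrixP => j z; rewrite (ord1 z) [RHS]mxE.
  have hom : (B^T *m (\adj P *m th)) j 0 \is (dg j + (d + \sum_(i < n.-1) kh)).-homog.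
    rewrite mxE; apply: homog_sum => i _; rewrite mxE; apply: dhomogM; first exact: homB.
    rewrite adj_repl; set N := \matrix_(_, _) _.
    have -> : (d + \sum_(i < n.-1) kh = \sum_(y < n) (if y == i then d else kh))%N.
      rewrite (bigD1 i) //= eqxx; congr (_ + _)%N; rewrite sum_nat_const card_ord.
      rewrite (eq_bigr (fun=> kh)); last by move=> y /negbTE ->.
      by rewrite sum_nat_const cardC1 card_ord.
    by apply: det_homog => x y; rewrite mxE; case: eqP.
  apply: (mdvd_small Q0 hQ hom); last first.
    rewrite !sum_nat_const !card_ord.
    have n0 : (0 < n)%N := leq_ltn_trans (leq0n j) (ltn_ord j).
    have -> : (n * kh = kh + n.-1 * kh)%N by rewrite -mulSn prednK.
    by have := small j; lia.
  apply: (@lin_coprime_prod R n _ Pos id (fun=> q1.+1)) => // a ha.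
  have [aX|aX] := boolP (a \in X); last first.
    have := @adj_dvd P th a (lf a ^+ q1.+1) (nz _ ha) (rP _ ha) (th2 _ ha aX) => H.
    exact: (mdmMl _ H).
  have := @local_pairing a q1 P (t *: \prod_(b <- rem a Pos) lf b ^+ q1.+1) th (col j B) (nz _ ha) qo (rP _ ha) (eqv _ ha).
  move=> H; have {H} := H _ (nd _ ha) (th1 _ ha) _.
  rewrite dP /Q (big_rem a) //= => H.
  have -> : (B^T *m (\adj P *m th)) j 0 = ((col j B)^T *m (\adj P *m th)) 0 0.
    by rewrite !mxE; apply: eq_bigr => i _; rewrite !mxE.
  apply: H; first by rewrite scalerAr.
  move=> i x; rewrite !ord1; have := dvB a j aX; congr mdvd; rewrite /app !mxE.
  by apply: eq_bigr => y _; rewrite !mxE.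
have dBT : \det B^T != 0 by rewrite det_tr.
have := mx_inj0 dBT y0 => z0.
have : \det P *: th = 0 by rewrite -mul_scalar_mx -mul_mx_adj -mulmxA z0 mulmx0.
move=> E; apply/matrixP => i j; have /matrixP/(_ i j) := E; rewrite !mxE => /eqP.
by rewrite mulf_eq0 (negbTE d0) => /eqP.
Qed.
End Pairing.

Section Restriction.
Variables (R : realType) (l : nat).
Local Notation V := 'rV[R]_l.
Local Notation W := 'rV[R]_l.+1.
Local Notation S1 := {mpoly R[l.+1]}.
Local Notation S := {mpoly R[l]}.
(** Restriction to the hyperplane at infinity: the coordinate x_0 is set to zero. *)
Definition rho : S1 -> S := msub (fun i : 'I_l.+1 => if unlift ord0 i is Some j then 'X_j else 0).
HB.instance Definition _ := GRing.RMorphism.on rho.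
Lemma rhoZ c p : rho (c *: p) = c *: rho p. Proof. exact: msubZ. Qed.
Lemma rho_lform (b : V) t : rho (linform (lform b t)) = linform b.
Proof.
rewrite /rho msub_lin /dera big_ord_recl unlift_none scaler0 add0r; apply: eq_bigr => i _.
by rewrite liftK mxE liftK.
Qed.
Lemma rho_homog p d : p \is d.-homog -> rho p \is d.-homog.
Proof.
by apply: msub_homog => i; case: unlift => [j|]; rewrite ?rpred0 // -linform_delta; exact: linform_homog.
Qed.
(** The parallel hyperplanes b = k x_0 all restrict to b = 0, so each level raises the multiplicity
    at infinity by one, as in Ziegler's restriction. *)
Lemma restr_dvd (b : V) (K : seq int) (ph : 'I_l -> S1) : b != 0 -> uniq K ->
  (forall k, k \in K -> mdvd (linform (cone_form b k)) (\sum_i b 0 i *: ph i)) ->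
  mdvd (linform b ^+ size K) (\sum_i b 0 i *: rho (ph i)).
Proof.
move=> b0 uK h.
have [q Eq] : mdvd (\prod_(k <- K) linform (cone_form b k) ^+ 1) (\sum_i b 0 i *: ph i).
  apply: (@lin_coprime_prod R l.+1 _ K (fun k => cone_form b k) (fun=> 1%N)) => //.
  - by move=> k _; apply: lform_neq0.
  - move=> k k' _ _ kk c; rewrite !cone_formE -lformZ => /lform_inj[/eqP].
    rewrite -subr_eq0 -{1}[b]scale1r -scalerBl scaler_eq0 (negbTE b0) orbF subr_eq0 => /eqP <-.
    by rewrite mul1r => /intr_inj E; rewrite E eqxx in kk.
exists (rho q).
have -> : \sum_i b 0 i *: rho (ph i) = rho (\sum_i b 0 i *: ph i).
  by rewrite raddf_sum; apply: eq_bigr => i _; rewrite /= rhoZ.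
rewrite Eq rmorphM rmorph_prod; congr (_ * _).
rewrite (eq_bigr (fun=> linform b)); first by rewrite big_const_seq count_predT; elim: (size K) => // m IH; rewrite exprS /= IH.
by move=> k _; rewrite /= expr1 cone_formE rho_lform.
Qed.
(** The column [ord0] is the Euler derivation and the others have no component along x_0, so
    deleting that row and column leaves the matrix to be restricted. *)
Definition eul (M : 'M[S1]_l.+1) := (forall i, M i ord0 = 'X_i) /\ (forall j, j != ord0 -> M ord0 j = 0).
Definition restr (M : 'M[S1]_l.+1) : 'M[S]_l := \matrix_(i, j) rho (M (lift ord0 i) (lift ord0 j)).
Lemma eul_app M w : eul M -> app M w ord0 = linform w.
Proof. by move=> [h _]; rewrite appE; apply: eq_bigr => i _; rewrite h. Qed.
Lemma app_lift M (b : V) t j : eul M -> app M (lform b t) (lift ord0 j) = \sum_i b 0 i *: M (lift ord0 i) (lift ord0 j).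
Proof.
move=> [_ h]; rewrite appE big_ord_recl h ?scaler0 ?add0r; last by rewrite eq_sym neq_lift.
by apply: eq_bigr => i _; rewrite mxE liftK.
Qed.
Lemma restr_free (Pos : seq V) (K : V -> seq int) M dg : (forall b, b \in Pos -> b != 0 /\ uniq (K b)) ->
  freeb (arr Pos K) M dg -> eul M ->
  [/\ forall i j, restr M i j \is (dg (lift ord0 j)).-homog,
      forall b j, b \in Pos -> mdvd (linform b ^+ size (K b)) (app (restr M) b j) &
      exists2 c : R, c != 0 & \det (restr M) = c *: \prod_(b <- Pos) linform b ^+ size (K b)].
Proof.
move=> hP [hom dv [c c0 dM]] eM; split.
- by move=> i j; rewrite mxE; apply: rho_homog.
- move=> b j hb; have [b0 uK] := hP b hb; rewrite appE; under eq_bigr do rewrite mxE.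
  apply: restr_dvd => // k hk; rewrite -(app_lift b k%:~R j eM); apply: dv.
  by apply/mem_arr; right; exists b, k.
- exists c => //; pose Mt : 'M[S1]_l := \matrix_(i, j) M (lift ord0 i) (lift ord0 j).
  have E : 'X_ord0 * \det Mt = 'X_ord0 * (c *: \prod_(w <- [seq cone_form b k | b <- Pos, k <- K b]) linform w).
    have -> : 'X_ord0 * \det Mt = \det M.
      case: (eM) => h1 h2; rewrite (expand_det_row M ord0) big_ord_recl h1 big1 ?addr0; last first.
        by move=> i _; rewrite h2 ?mul0r // eq_sym neq_lift.
      congr (_ * _); rewrite /cofactor addn0 expr0 mul1r; congr (\det _).
      by apply/matrixP => i j; rewrite !mxE.
    rewrite dM big_cons -scalerAr; congr (_ *: (_ * _)).
    rewrite H_inftyE /linform big_ord_recl mxE unlift_none opprK scale1r big1 ?addr0 // => i _.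
    by rewrite mxE liftK mxE scale0r.
  have X0 : 'X_ord0 != 0 :> S1 by rewrite -linform_delta linform_eq0; apply/eqP => /rowP/(_ ord0)/eqP; rewrite !mxE !eqxx oner_eq0.
  have -> : restr M = map_mx rho Mt by apply/matrixP => i j; rewrite !mxE.
  rewrite det_map_mx (mulfI X0 E) /= rhoZ rmorph_prod /=; congr (_ *: _).
  rewrite big_allpairs_dep /=; apply: eq_bigr => b _.
  rewrite (eq_bigr (fun=> linform b)); first by rewrite big_const_seq count_predT; elim: (size (K b)) => // m IH; rewrite exprS /= IH.
  by move=> k _; rewrite cone_formE rho_lform.
Qed.
Lemma freeb_start (Pos : seq V) (K : V -> seq int) : (forall b, b \in Pos -> K b = [::]) ->
  exists M, freeb (arr Pos K) M (fun j => nat_of_bool (j == ord0)) /\ eul M.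
Proof.
move=> K0; pose M : 'M[S1]_l.+1 := \matrix_(i, j) (if j == ord0 then 'X_i else (i == j)%:R).
have eM : eul M by split=> [i|j j0]; rewrite mxE ?eqxx // (negbTE j0) eq_sym (negbTE j0).
have A1 : arr Pos K = [:: H_infty R l].
  by rewrite /arr; congr cons; elim: Pos K0 => //= b P IH K0; rewrite K0 ?mem_head //= IH // => x hx; apply: K0; rewrite inE hx orbT.
have lI : linform (H_infty R l) = 'X_ord0.
  rewrite H_inftyE /linform big_ord_recl mxE unlift_none opprK scale1r big1 ?addr0 // => i _.
  by rewrite mxE liftK mxE scale0r.
exists M; split=> //; rewrite A1; split.
- move=> i j; rewrite mxE; case: eqP => _; first by rewrite -linform_delta; exact: linform_homog.
  by case: (i == j); rewrite ?rpred0 // dhomog1.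
- move=> a j; rewrite inE => /eqP ->; have [->|j0] := eqVneq j ord0; first by rewrite eul_app //; exact: mdvd_refl.
  rewrite appE big_ord_recl (proj2 eM) // scaler0 add0r big1; first exact: mdvd0.
  by move=> i _; rewrite mxE eq_sym (negbTE (neq_lift _ _)) scale0r.
- exists 1; first exact: oner_neq0.
  rewrite scale1r big_seq1 lI (expand_det_row M ord0) big_ord_recl big1 ?addr0; last first.
    by move=> i _; rewrite (proj2 eM) ?mul0r // eq_sym neq_lift.
  rewrite (proj1 eM) /cofactor addn0 expr0 mul1r -[RHS]mulr1; congr (_ * _).
  have -> : row' ord0 (col' ord0 M) = 1%:M; last exact: det1.
  by apply/matrixP => i j; rewrite !mxE eq_sym (negbTE (neq_lift _ _)) (inj_eq lift_inj).
Qed.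
End Restriction.

End FreeModuleBases.

(** * From the Shi to the Catalan arrangement, by increasing height *)

Module HeightFiltration.
Import LinearFormDivisibility HomogeneousPolynomials SaitoCriterion RootSystemBasics SimpleSystems CoxeterOrbits CoxeterEigenvalues MultipleAddition EqualHeightRoots RankTwoTables RankTwoCounting ConeCounting FreeModuleBases.

Section Chain.
Variables (R : realType) (l : nat).
Local Notation V := 'rV[R]_l.
Local Notation W := 'rV[R]_l.+1.
Local Notation S1 := {mpoly R[l.+1]}.
Local Notation lf := (@linform R l.+1).
Variables (Phi : seq V) (v : V) (s : seq V) (dual : V -> V) (h : nat).
Hypothesis rs : rsys Phi.
Hypothesis reg : regular_vec Phi v.
Hypothesis sd : simple_dual Phi v s dual.
Hypothesis sp : spanning Phi.
Hypothesis irr : irreducible_rs Phi.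
Hypothesis l0 : (0 < l)%N.
Hypothesis szP : ((size (pos_system Phi v)).*2 = h * l)%N.
Local Notation Pos := (pos_system Phi v).
Local Notation ht := (ht s dual).
Local Notation level := (level Phi v s dual).

Definition xdg (dg : 'I_l -> nat) (j : 'I_l.+1) : nat := if unlift ord0 j is Some j' then dg j' else 1%N.
Definition state (K : V -> seq int) dg := exists2 M, freeb (arr Pos K) M (xdg dg) & eul M.
(** Roots of height below [i] have received the level [-m]: [i = 1] is the Shi arrangement, and once
    [i] exceeds all heights the Catalan arrangement is reached. *)
Definition K1 m i b := zrange (if ht b < i%:R then - m%:Z else 1 - m%:Z) m%:Z.
(** Roots of height above [h - t] have received the level [m + 1]. With all heights below [h],
    [t = 1] is the Catalan arrangement and [t = h] the next Shi arrangement. *)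
Definition K2 m t b := zrange (- m%:Z) (if (h - t)%N%:R < ht b then m.+1%:Z else m%:Z).
Lemma xdg0 dg : xdg dg ord0 = 1%N. Proof. by rewrite /xdg unlift_none. Qed.
Lemma xdg_lift dg j : xdg dg (lift ord0 j) = dg j. Proof. by rewrite /xdg liftK. Qed.
Lemma arr_ext (K K' : V -> seq int) : {in Pos, K =1 K'} -> arr Pos K = arr Pos K'.
Proof. by move=> E; rewrite /arr; congr (_ :: flatten _); apply/eq_in_map => b hb; rewrite E. Qed.
Lemma levelP i a : a \in level i -> a \in Pos /\ ht a = i%:R.
Proof. by rewrite mem_filter => /andP[/eqP]. Qed.

(** The part common to both kinds of step: trace counts supply the factorisations and [mult_add] the
    new basis. Independence of the constants is left as a hypothesis. *)
Lemma stage (K K' : V -> seq int) (Hl : seq V) (k0 : int) d dg M :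
  let H := [seq cone_form a k0 | a <- Hl] in
  freeb (arr Pos K) M (xdg dg) -> eul M -> {subset Hl <= Pos} -> uniq Hl ->
  (forall b, b \in Pos -> uniq (K b) /\ uniq (K' b)) ->
  (forall b k, b \in Pos -> (k \in K' b) = (k \in K b) || ((b \in Hl) && (k == k0))) ->
  (forall a, a \in Hl -> (d + size (undup (map (key Phi v a k0) (arr Pos K))) <= size (arr Pos K))%N /\ k0 \notin K a) ->
  (forall (L : W -> seq W) (C : W -> 'I_l.+1 -> R), (forall w, w \in H -> {subset L w <= arr Pos K} /\
      forall j, exists f, [/\ mdvd (lf w) (app M w j - f * \prod_(b <- L w) lf (b *m projm w)),
         (xdg dg j < d)%N -> f = 0, xdg dg j = d -> f = (C w j)%:MP & j = ord0 -> f = 0]) ->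
    forall y : W -> R, (forall j, xdg dg j = d -> \sum_(w <- H) y w * C w j = 0) -> forall w, w \in H -> y w = 0) ->
  exists2 P : {set 'I_l}, #|P| = size Hl /\ (forall j, j \in P -> dg j = d) & state K' (fun j => dg j + (j \in P))%N.
Proof.
move=> H fr eM HP uH uK KK' cnt indep.
have cinj : injective (fun a : V => cone_form a k0) by move=> a b /cone_inj[].
have uHW : uniq H by rewrite map_inj_uniq.
have sA : simple_arr (arr Pos K) by apply: arr_simple => // b /uK[].
have sA' : simple_arr (arr Pos K') by apply: arr_simple => // b /uK[].
have [|L [f Hf]] := @terao_family R l.+1 (option (seq V * V) : eqType) d H (arr Pos K) M (xdg dg) fr sA.
  move=> w /mapP[a ha ->]; have [c1 nk] := cnt a ha; have aP := HP a ha; have a0 := pos_neq0 rs aP.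
  split; first exact: lform_neq0.
    move=> b /mem_arr[->|[b' [k' [hb hk ->]]]] t E.
      have [E0|t0] := eqVneq t 0.
        by move: E; rewrite E0 scale0r => /rowP/(_ ord0) /eqP; rewrite !mxE eqxx oner_eq0.
      by apply: (@cone_ninf R l a k0 t^-1 a0); rewrite E scalerA mulVf // scale1r.
    by have [Ea Ek] := cone_np rs aP hb E; move: nk; rewrite Ek Ea hk.
  exists (key Phi v a k0) => // b b' hb hb'; exact: (key_prop rs aP nk hb hb').
(* A form takes itself as value on the Euler derivation, so that column needs no correction and its
   coefficient may be taken as zero. *)
pose f' w j := if j == ord0 then 0 else f w j.
pose C w j := (f' w j)@_0%MM.
have Hf' w j : w \in H -> [/\ mdvd (lf w) (app M w j - f' w j * \prod_(b <- L w) lf (b *m projm w)),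
     (d <= xdg dg j)%N -> f' w j \is (xdg dg j - d).-homog, (xdg dg j < d)%N -> f' w j = 0 & xdg dg j = d -> f' w j = (C w j)%:MP].
  move=> hw; have [_ /(_ j) [h1 h2 h3]] := Hf w hw; rewrite /C /f'; have [->|j0] := eqVneq j ord0.
    split=> //; [by rewrite mul0r subr0 eul_app //; exact: mdvd_refl | by move=> _; exact: rpred0 | by rewrite mcoeff0].
  split=> // E; have := h2 (ltac:(by rewrite E)); rewrite E subnn => /homog0C[c ->].
  by rewrite mcoeffC eqxx mulr1.
have [|||M' [P' [cP hP fP [eP ce] zP]]] := @mult_add R l.+1 d ord0 ord0 H (arr Pos K) M (xdg dg)
    (fun w => \prod_(b <- L w) lf (b *m projm w)) C uHW fr.
- by case: eM.
- by move=> w hw; exists (f' w); [rewrite /f' eqxx | move=> j; apply: Hf'].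
- apply: (indep L) => w hw; split; first by case: (Hf w hw).
  by move=> j; exists (f' w j); have [h1 h2 h3 h4] := Hf' w j hw; split=> // ->; rewrite /f' eqxx.
have EP : P' = [set lift ord0 j | j in [set j | lift ord0 j \in P']].
  apply/setP => x; apply/idP/imsetP => [hx|[j]]; last by rewrite inE => hj ->.
  by case: (unliftP ord0 x) hx => [j -> hj|-> hx]; [exists j; rewrite ?inE | rewrite hx in eP].
exists [set j | lift ord0 j \in P'].
  split; first by rewrite -(card_imset _ (@lift_inj _ ord0)) -EP cP size_map.
  by move=> j; rewrite inE => /hP; rewrite xdg_lift.
exists M'; last by split=> // i; rewrite ce; case: eM.
have -> : xdg (fun j => dg j + (j \in [set j | lift ord0 j \in P']))%N = (fun j => xdg dg j + (j \in P'))%N.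
  apply: funext => j; rewrite /xdg; case: unliftP => [j' ->|->]; first by rewrite inE.
  by rewrite (negbTE eP).
apply: freeb_perm fP; apply: uniq_perm.
- rewrite cat_uniq uHW; apply/andP; split=> //; apply/andP; split; last by case: sA.
  apply/hasPn => w /mem_arr[->|[b [k [hb hk ->]]]]; apply/mapP => -[a ha E].
    by apply: (@cone_ninf R l a k0 1 (pos_neq0 rs (HP _ ha))); rewrite scale1r.
  by have [Eb Ek] := cone_inj E; have [_] := cnt a ha; rewrite -Ek -Eb hk.
- by case: sA'.
move=> w; rewrite mem_cat; apply/orP/mem_arr => [[/mapP[a ha ->]|/mem_arr[->|[b [k [hb hk ->]]]]]|[->|[b [k [hb hk ->]]]]].
- by right; exists a, k0; rewrite KK' ?HP // ha eqxx orbT.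
- by left.
- by right; exists b, k; rewrite KK' // hk.
- by right; rewrite mem_head.
- move: hk; rewrite KK' // => /orP[hk|/andP[hb' /eqP ->]]; last by left; apply/mapP; exists b.
  by right; apply/mem_arr; right; exists b, k.
Qed.

Lemma uniqK1 m i b : uniq (K1 m i b). Proof. exact: zrange_uniq. Qed.
Lemma uniqK2 m t b : uniq (K2 m t b). Proof. exact: zrange_uniq. Qed.

(** Were a present hyperplane in the span of the new ones with coefficients of sum c, then its root
    has height i c and its level is -m c. [level_span_ht] gives c at least 1, so the level is at
    most -m, which a root of height at least [i] does not yet have. The form at infinity is not in
    the span either, since the new roots are independent. *)
Lemma generic_point m i : (0 < i)%N -> exists x : W,
  (forall w, w \in [seq cone_form a (- m%:Z) | a <- level i] -> dotp x w = 0) /\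
  (forall w, w \in arr Pos (K1 m i) -> dotp x w != 0).
Proof.
move=> i0; have [dl Hdl] := level_dual rs reg sd i; set H := [seq _ | _ <- _].
have uH : uniq (level i) by exact: level_uniq.
pose pr (w : W) : W := w - \sum_(a <- level i) dotp (lform (dl a) 0) w *: cone_form a (- m%:Z).
have nz w : w \in arr Pos (K1 m i) -> pr w != 0.
  move=> hw; rewrite subr_eq0; apply/eqP => E.
  pose c a := dotp (lform (dl a) 0) w.
  have {}E : w = lform (\sum_(a <- level i) c a *: a) (\sum_(a <- level i) c a * (- m%:R)).
    rewrite {1}E -lform_sum; apply: eq_bigr => a _; rewrite -/(c a) cone_formE lformZ rmorphN //.
  case/mem_arr: hw E => [->|[b [k [hb hk ->]]]].
    rewrite H_inftyE => /lform_inj[E1 E2].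
    have c0 a : a \in level i -> c a = 0.
      move=> ha; have := congr1 (dotp (dl a)) E1; rewrite dotp0r dotp_sumr (big_rem a) //= dotpZr Hdl // eqxx mulr1.
      rewrite big_seq big1 ?addr0 // => x; rewrite mem_rem_uniq // inE => /andP[xa hx].
      by rewrite dotpZr Hdl // eq_sym (negbTE xa) mulr0.
    move: E2; rewrite big_seq big1 => [/eqP|a ha]; first by rewrite oppr_eq0 oner_eq0.
    by rewrite c0 // mul0r.
  rewrite cone_formE => /lform_inj[E1 E2].
  have ib : inspan Phi v s dual i b by apply/asboolP; exists c.
  have hle := level_span_ht rs reg sd i0 hb ib.
  have Eh : ht b = i%:R * \sum_(a <- level i) c a.
    rewrite E1 ht_sum mulr_sumr big_seq [RHS]big_seq; apply: eq_bigr => a /levelP[_ Ea]; by rewrite htZ Ea mulrC.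
  have i0R : 0 < i%:R :> R by rewrite ltr0n.
  have c1 : 1 <= \sum_(a <- level i) c a by rewrite -(ler_pM2l i0R) mulr1 -Eh.
  move: hk; rewrite /K1 ltNge hle /= mem_zrange; last by lia.
  case/andP=> hk _; have : (1 - m%:Z)%:~R <= k%:~R :> R by rewrite ler_int.
  rewrite E2 -mulr_suml rmorphB /= => h1.
  have : (\sum_(a <- level i) c a) * m%:R >= 1 * m%:R by rewrite ler_wpM2r ?ler0n.
  by move: h1; rewrite mulrN -[m%:Z%:~R]/(m%:R); lra.
have [|y Hy] := @avoid_hyperplanes R l.+1 (map pr (arr Pos (K1 m i))).
  by move=> w /mapP[u hu ->]; exact: nz.
exists (y - \sum_(a <- level i) dotp y (cone_form a (- m%:Z)) *: lform (dl a) 0); split.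
- move=> w /mapP[a ha ->]; rewrite dotpBl dotp_suml (big_rem a) //= dotpZl cone_formE dotp_lform mul0r add0r Hdl // eqxx mulr1.
  rewrite big_seq big1 ?addr0 ?subrr // => x; rewrite mem_rem_uniq // inE => /andP[xa hx].
  by rewrite dotpZl dotp_lform mul0r add0r Hdl // (negbTE xa) mulr0.
- move=> w hw; have := Hy (pr w) (map_f _ hw); congr (_ != 0).
  rewrite /pr dotpBr dotpBl dotp_sumr dotp_suml; congr (_ - _); apply: eq_bigr => a _.
  by rewrite dotpZr dotpZl mulrC.
Qed.

(** The bound on the degrees makes [d] maximal apart from the Euler column, so every column of
    another degree has coefficient zero and [generic_rank] applies. *)
Lemma stage1 m i dg : (0 < i)%N -> state (K1 m i) dg -> (forall j, dg j <= (m * h + i).-1)%N ->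
  exists2 P : {set 'I_l}, #|P| = size (level i) /\ (forall j, j \in P -> dg j = (m * h + i).-1) &
    state (K1 m i.+1) (fun j => dg j + (j \in P))%N.
Proof.
move=> i0 [M fr eM] le; have [x [xH xA]] := generic_point m i0.
have [dl Hdl] := level_dual rs reg sd i.
apply: (stage (k0 := - m%:Z) fr eM) => //.
- by move=> a /levelP[].
- exact: level_uniq.
- by move=> b hb; split; exact: uniqK1.
- move=> b k hb; have [hn [hn0 Eh]] := ht_pos rs sd hb; rewrite /K1 mem_filter Eh !ltr_nat eqr_nat hb andbT ltnS leq_eqVlt.
  by case: ltngtP => //= hc; rewrite !mem_zrange; lia.
- move=> a /levelP[aP Ea].
  have kd : kind1 Phi v s dual a (K1 m i) (- m%:Z) m by split=> // b hb; rewrite /K1 Ea.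
  have [H1 _] := key_cnt rs reg sd sp irr l0 szP (K1 m i) (- m%:Z) m aP (m * h + i).-1.
  apply: H1 => //; rewrite Ea -subn1 natrB ?natrD //; by rewrite addn_gt0 i0 orbT.
- move=> L C HL; apply: (@generic_rank R l.+1 (m * h + i).-1 _ (arr Pos (K1 m i)) M (xdg dg) L C x
     (fun w => lform (dl (low w)) 0) fr) => //.
  + by rewrite map_inj_uniq ?level_uniq // => a b /cone_inj[].
  + move=> w w' /mapP[a ha ->] /mapP[b hb ->]; rewrite !cone_formE low_lform dotp_lform mul0r add0r Hdl //.
    by congr (nat_of_bool _)%:R; apply/eqP/eqP => [->//|/lform_inj[]].
  + move=> w hw; split; last by case: (HL w hw).
    by case/mapP: hw => a /levelP[aP _] ->; apply/lform_neq0/(pos_neq0 rs aP).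
  + move=> w hw j; have [_ /(_ j) [f [h1 h2 h3 h4]]] := HL w hw; exists f; split=> // ne.
    case: (unliftP ord0 j) => [j' Ej|]; last exact: h4.
    by apply: h2; rewrite ltn_neqAle ne Ej xdg_lift le.
Qed.

Lemma chain1 m : state (K1 m 1) (fun=> (m * h)%N) -> forall i, (0 < i)%N -> exists2 dg, state (K1 m i) dg &
  (forall j, m * h <= dg j <= (m * h + i).-1)%N /\
  (forall x, (0 < x < i)%N -> #|[set j | (m * h + x <= dg j)%N]| = size (level x)).
Proof.
move=> st0; elim=> // -[|i] IH _.
  by exists (fun=> (m * h)%N) => //; split=> [j|x]; [rewrite addn1 /= leqnn | case: x => // -[]].
have [//|dg st [bd ct]] := IH.
have [|P [cP hP] st'] := stage1 (isT : (0 < i.+1)%N) st; first by move=> j; case/andP: (bd j).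
exists (fun j => dg j + (j \in P))%N => //; split.
- move=> j; have := bd j; rewrite !addnS /= => /andP[b1 b2]; rewrite (leq_trans b1 (leq_addr _ _)) /=.
  by case: (j \in P); rewrite ?addn1 ?ltnS ?addn0 // (leq_trans b2).
- move=> x /andP[x0]; rewrite ltnS leq_eqVlt => /orP[/eqP ->|lt].
    rewrite -cP; apply: eq_card => j; rewrite inE; have := bd j; have := hP j; rewrite !addnS /=.
    by case: (j \in P) => [->//|_]; rewrite ?addn1 ?leqnn // addn0 => /andP[_ h1]; rewrite ltnNge h1.
  rewrite -(ct x) ?x0 //; apply: eq_card => j; rewrite !inE; have := hP j; rewrite addnS /=.
  case: (j \in P) => [/(_ isT) ->|_]; last by rewrite addn0.
  by rewrite addn1 -addnS !leq_add2l; rewrite ltnS in lt; rewrite lt leqW.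
Qed.
End Chain.

End HeightFiltration.

(** * From the Catalan to the next Shi arrangement, by decreasing height *)

Module ShiCatalanTower.
Import LinearFormDivisibility HomogeneousPolynomials SaitoCriterion RootSystemBasics SimpleSystems CoxeterOrbits CoxeterEigenvalues MultipleAddition EqualHeightRoots RankTwoTables RankTwoCounting ConeCounting FreeModuleBases HeightFiltration.

Lemma card_count l (F : 'I_l -> nat) (p : pred nat) : #|[set j | p (F j)]| = count p [seq F j | j <- enum 'I_l].
Proof.
by rewrite -sum1_count big_map big_enum_cond -sum1_card; apply: eq_bigl => j; rewrite !inE.
Qed.
Lemma perm_of_counts l (F G : 'I_l -> nat) : (forall x, #|[set j | (x <= F j)%N]| = #|[set j | (x <= G j)%N]|) ->
  perm_eq [seq F j | j <- enum 'I_l] [seq G j | j <- enum 'I_l].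
Proof.
move=> H; have key (A : 'I_l -> nat) y : (#|[set j | A j == y]| + #|[set j | (y.+1 <= A j)%N]| = #|[set j | (y <= A j)%N]|)%N.
  rewrite -cardsUI [X in (_ + X)%N](_ : _ = 0%N) ?addn0.
    by apply: eq_card => j; rewrite !inE [in RHS]leq_eqVlt [in RHS]eq_sym.
  by apply: eq_card0 => j; rewrite !inE; case: eqP => // ->; rewrite ltnn.
apply/allP => y _ /=; apply/eqP; rewrite -!(card_count _ (pred1 y)).
by have := key F y; have := key G y; rewrite -!H => <- /addIn.
Qed.

Section Chain2.
Variables (R : realType) (l : nat).
Local Notation V := 'rV[R]_l.
Local Notation W := 'rV[R]_l.+1.
Local Notation S1 := {mpoly R[l.+1]}.
Local Notation S := {mpoly R[l]}.
Local Notation lf := (@linform R l.+1).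
Variables (Phi : seq V) (v : V) (s : seq V) (dual : V -> V) (h : nat).
Hypothesis rs : rsys Phi.
Hypothesis reg : regular_vec Phi v.
Hypothesis sd : simple_dual Phi v s dual.
Hypothesis sp : spanning Phi.
Hypothesis irr : irreducible_rs Phi.
Hypothesis l0 : (0 < l)%N.
Hypothesis szP : ((size (pos_system Phi v)).*2 = h * l)%N.
Local Notation Pos := (pos_system Phi v).
Local Notation ht := (ht s dual).
Local Notation level := (level Phi v s dual).
Local Notation state := (state Phi v).
Local Notation K1 := (K1 s dual).
Local Notation K2 := (K2 s dual h).

Lemma pos_simple : simple_arr Pos.
Proof. split; first exact: pos_uniq.
  by move=> a ha; exact: pos_neq0 ha.
by move=> a b ha hb ab t; exact: (pos_nprop rs ha hb ab). Qed.
Lemma start0 : state (K1 0 1) (fun=> (0 * h)%N).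
Proof.
have [|M [fr eM]] := @freeb_start R l Pos (K1 0 1).
  move=> b hb; have [k [k0 E]] := ht_pos rs sd hb; rewrite /HeightFiltration.K1 E ltr_nat ltnNge k0 //.
exists M => //; have -> // : xdg (fun=> (0 * h)%N) = (fun j : 'I_l.+1 => nat_of_bool (j == ord0)).
by apply: funext => j; rewrite /xdg; case: unliftP => [j' ->|->]; rewrite ?eqxx // eq_sym (negbTE (neq_lift _ _)).
Qed.
(** For m = 0 a root has the single level 0 or none, so restriction to infinity gives an ordinary
    basis for the roots of height below [i]. *)
Lemma restr_start i dg : state (K1 0 i) dg -> exists B, freeb [seq a <- Pos | ht a < i%:R] B dg.
Proof.
move=> [M fr eM]; have sz b : size (K1 0 i b) = (ht b < i%:R).
  by rewrite /HeightFiltration.K1 size_zrange; case: (ht b < i%:R).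
have [|h1 h2 [c c0 E]] := restr_free _ fr eM.
  by move=> b hb; split; [exact: pos_neq0 hb | exact: uniqK1].
exists (restr M); split.
- by move=> x j; have := h1 x j; rewrite xdg_lift.
- by move=> a j; rewrite mem_filter => /andP[ha hp]; have := h2 a j hp; rewrite sz ha expr1.
- exists c => //; rewrite E big_filter [in RHS]big_mkcond /=; congr (_ *: _); apply: eq_bigr => b _.
  by rewrite sz; case: (ht b < i%:R); rewrite ?expr1 ?expr0.
Qed.
Lemma basisX i : (0 < i)%N -> exists B dg, freeb [seq a <- Pos | ht a < i%:R] B dg /\ (forall j, dg j <= i.-1)%N.
Proof.
move=> i0; have [dg st [bd _]] := chain1 rs reg sd sp irr l0 szP start0 i0.
have [B fB] := restr_start st; exists B, dg; split=> // j; by have := bd j; rewrite mul0n add0n => /andP[].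
Qed.
(** The chain for m = 0, run beyond the highest root, restricts to a basis for all positive roots,
    and uniqueness of degrees compares it with [B0]. *)
Lemma level_count (B0 : 'M[S]_l) (mm : 'I_l -> nat) : freeb Pos B0 mm ->
  forall x, (0 < x)%N -> size (level x) = #|[set j | (x <= mm j)%N]|.
Proof.
move=> f0 x x0.
have [N HN] : exists N : nat, forall b, b \in Pos -> ht b < N%:R.
  have : {subset Pos <= Pos} by []; elim: {1 3}Pos => [|b L IH] sub; first by exists 0%N.
  have [|N HN] := IH; first by move=> y hy; apply: sub; rewrite inE hy orbT.
  have [k [_ Ek]] := ht_pos rs sd (sub b (mem_head _ _)); exists (N + k.+1)%N => y.
  rewrite inE => /orP[/eqP ->|/HN lt]; first by rewrite Ek ltr_nat; lia.
  by apply: lt_le_trans lt _; rewrite ler_nat leq_addr.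
have [dg st [bd ct]] := chain1 rs reg sd sp irr l0 szP start0 (i := (N + x.+1)%N) (ltac:(by rewrite addnS)).
have [B fB] := restr_start st.
have EX : [seq a <- Pos | ht a < (N + x.+1)%N%:R] = Pos.
  apply/all_filterP/allP => b /HN lt; apply: lt_le_trans lt _; by rewrite ler_nat leq_addr.
rewrite EX in fB.
rewrite -(ct x); last by rewrite x0 addnS ltnS leq_addl.
rewrite !(card_count _ (leq _)) mul0n; exact: (seq.permP (free_degrees pos_simple fB f0)).
Qed.

(** The degrees of the pairing leave a margin of exactly one: mh + t for the derivation and at most
    h - t - 1 for the roots of height below h - t add up to less than (m + 1) h. *)
Lemma stage2 m t dg (P : 'M[S]_l) (tt : R) :
  (0 < t < h)%N -> state (K2 m t) dg ->
  #|[set j | dg j == (m * h + t)%N]| = size (level (h - t)) ->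
  (forall i j, P i j \is (m.+1 * h).-homog) -> tt != 0 ->
  \det P = tt *: \prod_(a <- Pos) linform a ^+ (m.+1).*2 ->
  (forall a j, a \in Pos -> mdvd (linform a ^+ (m.+1).*2) ((cmx l a *m P) 0 j)) ->
  (forall a, a \in Pos -> map_mx (act (refl a)) P = cmx l (refl a) *m P *m cmx l (refl a)) ->
  exists2 Ps : {set 'I_l}, #|Ps| = size (level (h - t)) /\ (forall j, j \in Ps -> dg j = (m * h + t)%N) &
    state (K2 m t.+1) (fun j => dg j + (j \in Ps))%N.
Proof.
move=> /andP[t0 th] [M fr eM] cJ hP tt0 dP rP eqv.
set d := (m * h + t)%N in cJ *; pose k0 : int := m.+1%:Z.
have memK b k : b \in Pos -> (k \in K2 m t.+1 b) = (k \in K2 m t b) || ((b \in level (h - t)) && (k == k0)).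
  move=> hb; have [hn [hn0 Eh]] := ht_pos rs sd hb; rewrite /HeightFiltration.K2 /k0 mem_filter Eh !ltr_nat eqr_nat hb andbT.
  have -> : (h - t.+1 < hn)%N = (h - t <= hn)%N by lia.
  rewrite leq_eqVlt [in RHS]eq_sym; case: ltngtP => //= hc; rewrite !mem_zrange; lia.
apply: (stage rs (k0 := k0) fr eM) => //.
- by move=> a /levelP[].
- exact: level_uniq.
- by move=> b hb; split; exact: uniqK2.
- move=> a /levelP[aP Ea].
  have kd : kind2 Phi v s dual a (K2 m t) k0 m by split=> // b hb; rewrite /HeightFiltration.K2 Ea.
  have [_ H1] := key_cnt rs reg sd sp irr l0 szP (K2 m t) k0 m aP d.
  by apply: H1 => //; rewrite Ea /d natrB ?(ltnW th) // !natrD; ring.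
move=> L C HL y Hy; set H := [seq _ | _ <- _] in HL Hy *.
have szH : size H = size (level (h - t)) by rewrite size_map.
set J := [set j | _] in cJ.
pose jn (k : 'I_(size H)) : 'I_l := nth (Ordinal l0) (enum J) k.
have szJ : size (enum J) = size H by rewrite -cardE cJ szH.
have jnJ k : dg (jn k) = d.
  have : jn k \in enum J by rewrite mem_nth // szJ.
  by rewrite mem_enum inE => /eqP.
have jnI k k' : (jn k == jn k') = (k == k') by rewrite nth_uniq ?szJ ?enum_uniq.
(* Square by the hypothesis on the number of columns of degree [d], so independence of rows may be
   proved as injectivity on columns. *)
pose Mx : 'M[R]_(size H) := \matrix_(k, a) C H`_a (lift ord0 (jn k)).
have [hN dN [c c0 dtN]] : [/\ forall i j, restr M i j \is (xdg dg (lift ord0 j)).-homog,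
      forall b j, b \in Pos -> mdvd (linform b ^+ size (K2 m t b)) (app (restr M) b j) &
      exists2 c : R, c != 0 & \det (restr M) = c *: \prod_(b <- Pos) linform b ^+ size (K2 m t b)].
  by apply: restr_free fr eM => b hb; split; [exact: pos_neq0 hb | exact: uniqK2].
have dN0 : \det (restr M) != 0.
  rewrite dtN -mul_mpolyC mulf_neq0 ?mpolyC_eq0 // big_seq prodf_seq_neq0; apply/allP => a ha; apply/implyP => _.
  by rewrite expf_neq0 // linform_eq0 (pos_neq0 rs ha).
have [_ dv _] := fr.
have uMx : Mx \in unitmx.
  rewrite -row_free_unit; apply: inj_row_free => u Hu.
  pose z : 'cV[R]_l := \sum_k u 0 k *: delta_mx (jn k) 0.
  have zE j : z j 0 = \sum_k u 0 k * (j == jn k)%:R.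
    by rewrite summxE; apply: eq_bigr => k _; rewrite !mxE eqxx andbT.
  have zu k : z (jn k) 0 = u 0 k.
    rewrite zE (bigD1 k) //= eqxx mulr1 big1 ?addr0 // => k' kk; by rewrite jnI eq_sym (negbTE kk) mulr0.
  have z0 j : dg j != d -> z j 0 = 0.
    move=> jd; rewrite zE big1 // => k _; case: eqP => [E|]; last by rewrite mulr0.
    by rewrite E jnJ eqxx in jd.
  have zC w : w \in H -> \sum_j z j 0 * C w (lift ord0 j) = 0.
    move=> hw; have /matrixP/(_ 0 (Ordinal (ltac:(by rewrite index_mem) : (index w H < size H)%N))) := Hu.
    rewrite !mxE => E; rewrite -[RHS]E; under eq_bigr do rewrite zE mulr_suml.
    rewrite exchange_big /=; apply: eq_bigr => k _; rewrite (bigD1 (jn k)) //= eqxx mulr1 mxE nth_index // big1 ?addr0 //.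
    by move=> j jk; rewrite (negbTE jk) mulr0 mul0r.
  (* The relation cancels the constants on every new hyperplane, so this combination of columns of
     degree [d] is divisible by the new forms too. Its restriction has multiplicity 2m + 2 on the
     roots of height at least h - t and 2m + 1 below. *)
  pose th' : 'cV[S]_l := restr M *m cmx l z.
  pose ph i : S1 := \sum_j z j 0 *: M (lift ord0 i) (lift ord0 j).
  have rph i : rho (ph i) = th' i 0.
    rewrite /ph raddf_sum mxE; apply: eq_bigr => j _; by rewrite /= rhoZ !mxE mulrC mul_mpolyC.
  have mult a : a \in Pos -> mdvd (linform a ^+ size (K2 m t.+1 a)) ((cmx l a *m th') 0 0).
    move=> ha; have -> : (cmx l a *m th') 0 0 = \sum_i a 0 i *: rho (ph i).
      by rewrite mxE; apply: eq_bigr => i _; rewrite mxE mul_mpolyC rph.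
    apply: restr_dvd; [exact: pos_neq0 ha | exact: uniqK2 | move=> k hk].
    have -> : \sum_i a 0 i *: ph i = \sum_j z j 0 *: app M (cone_form a k) (lift ord0 j).
      under [RHS]eq_bigr do rewrite cone_formE app_lift // scaler_sumr.
      rewrite exchange_big /=; apply: eq_bigr => i _; rewrite /ph scaler_sumr; apply: eq_bigr => j _.
      by rewrite !scalerA mulrC.
    move: hk; rewrite memK // => /orP[hk|/andP[hl /eqP ->]].
      apply: mdvd_sum => j _; rewrite -mul_mpolyC; apply/mdvd_mull/dv.
      by apply/mem_arr; right; exists a, k.
    have hw : cone_form a k0 \in H by apply: map_f.
    have [_ HLj] := HL _ hw; set w := cone_form a k0 in hw HLj *; set Pi := \prod_(b <- L w) _ in HLj.
    have -> : \sum_j z j 0 *: app M w (lift ord0 j) =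
       \sum_j z j 0 *: (app M w (lift ord0 j) - (C w (lift ord0 j))%:MP * Pi).
      under [RHS]eq_bigr do rewrite scalerBr; rewrite sumrB -[LHS]subr0; congr (_ - _).
      under eq_bigr do rewrite -mul_mpolyC mulrA -mpolyCM; rewrite -mulr_suml -raddf_sum /= zC //.
      by rewrite mpolyC0 mul0r.
    apply: mdvd_sum => j _; have [jd|jd] := eqVneq (dg j) d; last by rewrite z0 // scale0r; exact: mdvd0.
    have [f [h1 _ h3 _]] := HLj (lift ord0 j); rewrite -mul_mpolyC; apply: mdvd_mull.
    by rewrite -h3 // xdg_lift.
  have szK a : a \in Pos -> size (K2 m t.+1 a) = ((m.*2).+1 + ~~ (ht a < (h - t)%N%:R)%R)%N.
    move=> ha; have [hn [hn0 Eh]] := ht_pos rs sd ha; rewrite /HeightFiltration.K2 size_zrange Eh !ltr_nat.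
    have -> : (h - t.+1 < hn)%N = ~~ (hn < h - t)%N by lia.
    by case: (hn < h - t)%N => /=; lia.
  have i0 : (0 < h - t)%N by rewrite subn_gt0.
  have [B [dgX [fB bB]]] := basisX i0.
  have th0 : th' = 0.
    have sX : simple_arr [seq a <- Pos | ht a < (h - t)%N%:R].
      apply: simple_sub pos_simple; first exact/filter_uniq/pos_uniq.
      by move=> a; rewrite mem_filter => /andP[].
    apply: (@pairing_zero R l Pos _ (m.*2).+1 d (m.+1 * h) P B dgX tt th' pos_simple _ sX fB hP tt0) => //.
    - by rewrite /= odd_double.
    - by move=> a ha i j; rewrite (ord1 i); exact: rP.
    - move=> i; rewrite mxE; apply: homog_sum => j _; have [jd|jd] := eqVneq (dg j) d.
        by rewrite [cmx l z j 0]mxE mulrC mul_mpolyC rpredZ // -jd -(xdg_lift dg j); exact: hN.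
      by rewrite [cmx l z j 0]mxE z0 // mpolyC0 mulr0 rpred0.
    - move=> a ha i j; rewrite !ord1; apply: mdvd_trans (mult a ha); apply: mdvd_exp; by rewrite szK // leq_addr.
    - move=> a ha aX i j; rewrite !ord1; apply: mdvd_trans (mult a ha); apply: mdvd_exp.
      by move: aX; rewrite mem_filter ha andbT szK // => ->; rewrite addn1.
    - by move=> j; have := bB j; rewrite /d mulSn; lia.
  have cz := mx_inj0 dN0 th0; apply/rowP => k; rewrite mxE -zu.
  by have /matrixP/(_ (jn k) 0) := cz; rewrite !mxE => /eqP; rewrite mpolyC_eq0 => /eqP.
pose yv : 'cV[R]_(size H) := \col_a y H`_a.
have y0 : yv = 0.
  rewrite -[yv](mulKmx uMx); have -> : Mx *m yv = 0; last by rewrite mulmx0.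
  apply/matrixP => k i; rewrite !mxE -[RHS](Hy (lift ord0 (jn k))) ?xdg_lift ?jnJ //.
  by rewrite (big_nth 0) big_mkord; apply: eq_bigr => a _; rewrite !mxE mulrC.
move=> w hw; have /matrixP/(_ (Ordinal (ltac:(by rewrite index_mem) : (index w H < size H)%N)) 0) := y0.
by rewrite !mxE nth_index.
Qed.

Variables (mm : 'I_l -> nat) (B0 : 'M[S]_l).
Hypothesis f0 : freeb Pos B0 mm.
Hypothesis mmb : forall j, (0 < mm j < h)%N.
Hypothesis mms : perm_eq [seq mm j | j <- enum 'I_l] [seq (h - mm j)%N | j <- enum 'I_l].
Hypothesis h1 : (1 < h)%N.
Hypothesis even : forall m, exists P : 'M[S]_l, [/\ forall i j, P i j \is (m.+1 * h).-homog,
  exists2 tt : R, tt != 0 & \det P = tt *: \prod_(a <- Pos) linform a ^+ (m.+1).*2,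
  forall a j, a \in Pos -> mdvd (linform a ^+ (m.+1).*2) ((cmx l a *m P) 0 j) &
  forall a, a \in Pos -> map_mx (act (refl a)) P = cmx l (refl a) *m P *m cmx l (refl a)].
Lemma level_big x : (h <= x)%N -> size (level x) = 0%N.
Proof.
move=> hx; rewrite (level_count f0) ?(leq_trans _ hx) ?(ltnW h1) //; apply: eq_card0 => j; rewrite !inE.
by apply/negbTE; rewrite -ltnNge; have := mmb j; lia.
Qed.
Lemma ht_lt_h b : b \in Pos -> ht b < h%:R.
Proof.
move=> hb; have [k [k0 E]] := ht_pos rs sd hb; rewrite E ltr_nat ltnNge; apply/negP => /level_big/size0nil H.
have : b \in level k by rewrite mem_filter E eqxx.
by rewrite H.
Qed.
Lemma cat_state m : state (K1 m 1) (fun=> (m * h)%N) -> exists2 dg, state (K1 m h) dg &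
  (forall j, m * h <= dg j)%N /\ (forall x, (0 < x)%N -> #|[set j | (m * h + x <= dg j)%N]| = size (level x)).
Proof.
move=> st; have [dg st' [bd ct]] := chain1 rs reg sd sp irr l0 szP st (ltnW h1).
exists dg => //; split; first by move=> j; case/andP: (bd j).
move=> x x0; have [lt|ge] := ltnP x h; first by apply: ct; rewrite x0.
rewrite level_big //; apply: eq_card0 => j; rewrite !inE; have /andP[_] := bd j.
by move=> le; apply/negbTE; rewrite -ltnNge; move: le h1 ge; clear; lia.
Qed.
(** Beginning with the Catalan arrangement, step t raises every column of the minimal degree mh + t;
    after t = h - 1 all degrees equal (m + 1) h. *)
Lemma shi_step m : state (K1 m 1) (fun=> (m * h)%N) -> state (K1 m.+1 1) (fun=> (m.+1 * h)%N).
Proof.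
move=> st; have [dg st' [bd ct]] := cat_state st.
have [P [hP [tt tt0 dP] rP eqv]] := even m.
have inv t : (0 < t <= h)%N -> exists2 dg, state (K2 m t) dg & (forall j, m * h + t <= dg j)%N /\
    (forall x, (t < x)%N -> #|[set j | (m * h + x <= dg j)%N]| = size (level x)).
  elim: t => // -[|t] IH /andP[_ th].
    exists dg; last split.
    - case: st' => M fr eM; exists M => //.
      rewrite (@arr_ext _ _ _ _ _ (K1 m h)) // => b hb; have := ht_lt_h hb.
      have [k [k0 E]] := ht_pos rs sd hb; rewrite /HeightFiltration.K2 /HeightFiltration.K1 E !ltr_nat => lt.
      by rewrite lt ltnNge; have -> : (k <= h - 1)%N by lia.
    - move=> j; have : #|[set j | (m * h + 1 <= dg j)%N]| = #|[set: 'I_l]|.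
        rewrite ct // (level_count f0) //; apply: eq_card => x; rewrite !inE.
        by have /andP[] := mmb x.
      move=> E; have /eqP : [set j | (m * h + 1 <= dg j)%N] = setT.
        by apply/eqP; rewrite eqEcard subsetT E leqnn.
      by move=> /eqP/setP/(_ j); rewrite !inE.
    - by move=> x x1; apply: ct; apply: leq_trans x1.
  have [|dg1 st1 [bd1 ct1]] := IH; first by rewrite (ltnW th).
  (* The columns not yet above the minimal degree correspond to exponents at most t + 1. By the
     symmetry of the exponents these are as many as the exponents at least h - t - 1, hence as the
     roots of that height. *)
  have cJ : #|[set j | dg1 j == (m * h + t.+1)%N]| = size (level (h - t.+1)).
    have e1 : #|[set j | dg1 j == (m * h + t.+1)%N]| = #|~: [set j | (m * h + t.+2 <= dg1 j)%N]|.
      by apply: eq_card => j; rewrite !inE; have := bd1 j; lia.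
    have e2 : #|~: [set j | (m * h + t.+2 <= dg1 j)%N]| = #|~: [set j | (t.+2 <= mm j)%N]|.
      by have := cardsC [set j | (m * h + t.+2 <= dg1 j)%N]; have := cardsC [set j | (t.+2 <= mm j)%N]; rewrite ct1 // (level_count f0) //; lia.
    have e3 : #|~: [set j | (t.+2 <= mm j)%N]| = #|[set j | (mm j <= t.+1)%N]|.
      by apply: eq_card => j; rewrite !inE -ltnNge.
    rewrite e1 e2 e3 (card_count mm (fun x => x <= t.+1)%N) (seq.permP mms) -card_count (level_count f0) ?subn_gt0 //.
    by apply: eq_card => j; rewrite !inE; have := mmb j; lia.
  have [Ps [cPs hPs] st2] := stage2 (ltac:(by rewrite th) : (0 < t.+1 < h)%N) st1 cJ hP tt0 dP rP eqv.
  have PJ : Ps = [set j | dg1 j == (m * h + t.+1)%N].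
    by apply/eqP; rewrite eqEcard cJ cPs leqnn andbT; apply/subsetP => j /hPs E; rewrite inE E.
  exists (fun j => dg1 j + (j \in Ps))%N => //; split.
  - by move=> j; rewrite PJ inE; have := bd1 j; case: eqP => /=; lia.
  - move=> x tx; rewrite -ct1; last exact: ltnW.
    by apply: eq_card => j; rewrite PJ !inE; case: eqP => /=; lia.
have [|dg2 [M fr eM] [bd2 ct2]] := inv h; first by rewrite (ltnW h1) leqnn.
exists M => //; have <- : arr Pos (K2 m h) = arr Pos (K1 m.+1 1).
  apply: arr_ext => b hb; have [k [k0 E]] := ht_pos rs sd hb; rewrite /HeightFiltration.K2 /HeightFiltration.K1 E subnn !ltr_nat k0 ltnNge k0 /=.
  by congr zrange; lia.
have <- // : xdg dg2 = xdg (fun=> (m.+1 * h)%N).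
apply: funext => j; rewrite /xdg; case: unlift => // j'.
have := ct2 h.+1 (ltnSn _); rewrite level_big // => /eqP; rewrite cards_eq0 => /eqP/setP/(_ j'); rewrite !inE.
by have := bd2 j'; rewrite mulSn; lia.
Qed.
Lemma shi_state m : state (K1 m 1) (fun=> (m * h)%N).
Proof. by elim: m => [|m IH]; [exact: start0 | exact: shi_step]. Qed.

Lemma state_exponents (K : V -> seq int) dg d : (forall b, b \in Pos -> uniq (K b)) -> state K dg ->
  perm_eq d [seq dg j | j <- enum 'I_l] -> free_with_exponents (arr Pos K) (1%N :: d).
Proof.
move=> uK [M fr eM] pm; apply: freeb_exponents fr _; first exact: arr_simple.
by rewrite enum_ordSl map_cons xdg0 perm_cons -map_comp (@eq_map _ _ (xdg dg \o lift ord0) dg (xdg_lift dg)).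
Qed.
Theorem shi_cone_free m : free_with_exponents (cone_arr Pos (1 - m%:Z) m%:Z) (1%N :: nseq l (m * h)%N).
Proof.
have -> : cone_arr Pos (1 - m%:Z) m%:Z = arr Pos (K1 m 1).
  rewrite -[LHS]/(arr Pos (fun=> zrange (1 - m%:Z) m%:Z)); apply: arr_ext => b hb.
  by have [k [k0 E]] := ht_pos rs sd hb; rewrite /HeightFiltration.K1 E ltr_nat ltnNge k0.
apply: state_exponents (shi_state m) _; first by move=> b _; exact: uniqK1.
have -> : [seq (m * h)%N | _ <- enum 'I_l] = nseq (size (enum 'I_l)) (m * h)%N by elim: (enum _) => //= x r ->.
by rewrite size_enum_ord.
Qed.
Theorem catalan_cone_free m e : perm_eq [seq mm j | j <- enum 'I_l] [seq e j | j <- enum 'I_l] ->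
  free_with_exponents (cone_arr Pos (- m%:Z) m%:Z) (1%N :: [seq (e j + m * h)%N | j <- enum 'I_l]).
Proof.
move=> pe; have [dg st [bd ct]] := cat_state (shi_state m).
have -> : cone_arr Pos (- m%:Z) m%:Z = arr Pos (K1 m h).
  rewrite -[LHS]/(arr Pos (fun=> zrange (- m%:Z) m%:Z)); apply: arr_ext => b hb.
  by rewrite /HeightFiltration.K1 ht_lt_h.
apply: state_exponents st _; first by move=> b _; exact: uniqK1.
apply: (@perm_trans _ [seq (mm j + m * h)%N | j <- enum 'I_l]).
  have := perm_map (addn^~ (m * h)%N) pe; rewrite -!map_comp perm_sym; exact.
apply: perm_of_counts => x; have [le|lt] := leqP x (m * h).
  by apply: eq_card => j; rewrite !inE (leq_trans le (bd j)) (leq_trans le (leq_addl _ _)).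
have Ex : x = (m * h + (x - m * h))%N by rewrite subnKC // ltnW.
rewrite [in RHS]Ex ct ?subn_gt0 // (level_count f0) ?subn_gt0 //; apply: eq_card => j; rewrite !inE.
by rewrite leq_subLR addnC.
Qed.
End Chain2.

End ShiCatalanTower.

(** * Assembly of the two statements *)

Module ShiCatalanFreeness.
Import LinearFormDivisibility HomogeneousPolynomials SaitoCriterion RootSystemBasics SimpleSystems CoxeterOrbits CoxeterEigenvalues MultiarrangementBases MultipleAddition EqualHeightRoots RankTwoTables RankTwoCounting ConeCounting FreeModuleBases HeightFiltration ShiCatalanTower.

Theorem shi_catalan_free (R : realType) (l : nat) (Phi : seq 'rV[R]_l)
    (v : 'rV[R]_l) (s : seq 'rV[R]_l) (h : nat) (e : 'I_l -> nat) :
  is_root_system Phi ->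
  irreducible_rs Phi ->
  regular_vec Phi v ->
  simple_system_of (pos_system Phi v) s ->
  is_order (coxeter_elt s) h ->
  are_exponents (coxeter_elt s) h e ->
  (forall m : nat,
     free_with_exponents
       (cone_arr (pos_system Phi v) (- (m%:Z)) (m%:Z))
       (1%N :: [seq (e j + m * h)%N | j <- enum 'I_l])) /\
  (forall m : nat,
     free_with_exponents
       (cone_arr (pos_system Phi v) (1 - m%:Z) (m%:Z))
       (1%N :: nseq l (m * h)%N)).
Proof.
move=> hrs irr reg hs ho he; have rs := root_rsys hrs.
have [mm [Ro [Re [pe mb ms [sz h1] bs]]]] := terao_bases hrs irr reg hs ho he.
have [dual sd] := given_dual hrs reg hs.
have sp := root_spanning hrs.
have l0 : (0 < l)%N.
  rewrite lt0n; apply/eqP => l0; case: irr => /eqP nz _; apply: nz.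
  case: rs => _ n0 _ _ _; case: (Phi) n0 => // a L; rewrite inE negb_or => /andP[/eqP a0 _]; case: a0.
  by apply/rowP => i; case: i => i hi; exfalso; move: hi; rewrite l0.
have f0 : freeb (pos_system Phi v) (Ro 0%N) mm.
  have [h1' [[t t0 E] hom] _ _ _] := bs 0%N; split.
  - by move=> i j; have := hom i j; rewrite mul0n addn0.
  - by move=> a j ha; have := h1' a j ha; rewrite expr1.
  - by exists t => //; rewrite E; congr (_ *: _); apply: eq_bigr => a _; rewrite expr1.
have ev m : exists P : 'M[{mpoly R[l]}]_l, [/\ forall i j, P i j \is (m.+1 * h).-homog,
  exists2 tt : R, tt != 0 & \det P = tt *: \prod_(a <- pos_system Phi v) linform a ^+ (m.+1).*2,
  forall a j, a \in pos_system Phi v -> mdvd (linform a ^+ (m.+1).*2) ((cmx l a *m P) 0 j) &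
  forall a, a \in pos_system Phi v -> map_mx (act (refl a)) P = cmx l (refl a) *m P *m cmx l (refl a)].
  by have [_ _ h3 [h4 h5] h6] := bs m.+1; exists (Re m.+1); split.
split=> m.
- exact: (catalan_cone_free rs reg sd sp irr l0 sz f0 mb ms h1 ev m pe).
- exact: (shi_cone_free rs reg sd sp irr l0 sz f0 mb ms h1 ev).
Qed.

End ShiCatalanFreeness.

End ShiCatalan.

From mathcomp Require Import all_boot all_algebra.
From mathcomp Require Import all_classical all_reals all_analysis.
From mathcomp Require Import complex.
Local Open Scope ring_scope.

Theorem mainTheorem9 (R : realType) (l : nat) (Phi : seq 'rV[R]_l)
    (v : 'rV[R]_l) (s : seq 'rV[R]_l) (h : nat) (e : 'I_l -> nat) :
  is_root_system Phi ->
  irreducible_rs Phi ->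
  regular_vec Phi v ->
  simple_system_of (pos_system Phi v) s ->
  is_order (coxeter_elt s) h ->
  are_exponents (coxeter_elt s) h e ->
  (forall m : nat,
     free_with_exponents
       (cone_arr (pos_system Phi v) (- (m%:Z)) (m%:Z))
       (1%N :: [seq (e j + m * h)%N | j <- enum 'I_l])) /\
  (forall m : nat, (1 <= m)%N ->
     free_with_exponents
       (cone_arr (pos_system Phi v) (1 - m%:Z) (m%:Z))
       (1%N :: nseq l (m * h)%N)).
Proof. by move=> rs irr reg ss ho he; have [cat shi] := ShiCatalan.ShiCatalanFreeness.shi_catalan_free rs irr reg ss ho he. Qed.
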